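(* Let $\mathcal W:\mathbb R^{dr}\to[0,1]$ be measurable with $\mathrm{supp}(\mathcal W)\subset[0,1]^{dr}$. Assume: (a) (sub-Gaussian noise) there is $C_\varepsilon>0$ with $\mathbb E[|\varepsilon_{1j}|^k]^{1/k}\le C_\varepsilon\sqrt k$ for all $k\in\mathbb N$ and $j\in\{1,\dots,d\}$; (b) (encoder-decoder structure and smoothness) $f_0=f_{dec}\circ g_{enc,1}\circ g_{enc,0}$ satisfies the encoder-decoder assumption and the smoothness assumption of the context, with parameters $\tilde d, D, t_{dec},t_{enc,0},t_{enc,1}$, $\beta_{dec},\beta_{enc,0},\beta_{enc,1}\ge 1$, $K\ge1$; (c) (mixing) $(X_i)$ and a function $\phi$ satisfy the compatibility assumption of the context, and $\Lambda^{mix}$ is the associated function. For each $n$, let $N\in\{1,\dots,n\}$ and let the network parameters $L,L_1,p,s,F$ (with $N,L,L_1,p,s$ possibly depending on $n$) satisfy: (i) $K\le F$; (ii) $\{\log_2(4(t_{enc,0}\vee\beta_{enc,0}))+\log_2(4(t_{enc,1}\vee\beta_{enc,1}))\}\log_2(n)\le L_1$ and $L_1+\log_2(4(t_{dec}\vee\beta_{dec}))\log_2(n)\le L\lesssim\log_2(n)$; (iii) $N\lesssim\min_{i\in\{1,\dots,L\}\setminus\{L_1\}}p_i$; (iv) $s\asymp N\log_2(n)$. Then $$\mathbb E D(\hat f^{net})\lesssim \Lambda^{mix}\Big(\frac{N\log(n)^3}{n}\Big)+N^{-2A},\qquad A:=\min\Big\{\frac{\beta_{dec}}{t_{dec}}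,\frac{\beta_{enc,0}}{t_{enc,0}},\frac{\beta_{enc,1}}{t_{enc,1}}\Big\}.$$
   Context: Notation: $x_n\lesssim y_n$ means $x_n\le Cy_n$ for all $n$ with a constant $C>0$ independent of $n$; $x_n\asymp y_n$ means $x_n\lesssim y_n$ and $y_n\lesssim x_n$. $|\cdot|_2$ is the Euclidean norm, $|\cdot|_\infty$ the maximum norm of the entries of a vector or matrix, $|\cdot|_0$ the number of nonzero entries. For $f:\mathbb R^{t}\to\mathbb R^d$, $\|f\|_\infty:=\sup_x|f(x)|_\infty$. $a\vee b=\max\{a,b\}$. Model: $d,r\in\mathbb N$ are fixed. $(X_i)_{i\in\mathbb Z}$ is a stationary $\mathbb R^d$-valued process with $X_i=f_0(\mathbb X_{i-1})+\varepsilon_i$, where $\mathbb X_{i-1}:=(X_{i-1},\dots,X_{i-r})\in\mathbb R^{dr}$, $f_0:\mathbb R^{dr}\to\mathbb R^d$ is measurable, and $\varepsilon_i=(\varepsilon_{i1},\dots,\varepsilon_{id})$ are i.i.d. with $\mathbb E\varepsilon_i=0$, $\varepsilon_i$ independent of $(X_j)_{j<i}$. One observes $X_1,\dots,X_n$, $n>r$. Prediction error: for deterministic measurable $f:\mathbb R^{dr}\to\mathbb R^d$, $D(f):=\frac1d\mathbb E[|f(\mathbb X_r)-f_0(\mathbb X_r)|_2^2\,\mathcal W(\mathbb X_r)]$; for a random (data-dependent) $\hat f$, $D(\hat f)$ is $D(f)$ evaluated at $f=\hat f$. Empirical counterpart: $\hat R_n(f):=\frac1n\sum_{i=r+1}^n\frac1d|X_i-f(\mathbb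 X_{i-1})|_2^2\,\mathcal W(\mathbb X_{i-1})$. Encoder-decoder assumption: $f_0=f_{dec}\circ f_{enc}$, $f_{enc}=g_{enc,1}\circ g_{enc,0}$, with $\tilde d\in\{1,\dots,d\}$, $D\in\mathbb N$ (the integer $D$ is not to be confused with $D(f)$), $g_{enc,0}:\mathbb R^{dr}\to\mathbb R^D$, $g_{enc,1}:\mathbb R^D\to\mathbb R^{\tilde d}$, $f_{dec}:\mathbb R^{\tilde d}\to\mathbb R^d$; each component of $g_{enc,0}$, $g_{enc,1}$, $f_{dec}$ depends on at most $t_{enc,0}\in\{1,\dots,dr\}$, $t_{enc,1}\in\{1,\dots,D\}$, $t_{dec}\in\{1,\dots,\tilde d\}$ arguments respectively. Hölder balls: with $\lfloor\beta\rfloor:=\max\{k\in\mathbb N_0:k<\beta\}$, $C^\beta(P,K)$ is the set of $f:P\to\mathbb R$ whose partial derivatives up to order $\lfloor\beta\rfloor$ exist with $\sum_{|\alpha|<\beta}\|\partial^\alpha f\|_\infty+\sum_{|\alpha|=\lfloor\beta\rfloor}\sup_{x\ne y\in P}\frac{|\partial^\alpha f(x)-\partial^\alpha f(y)|}{|x-y|_\infty^{\beta-\lfloor\beta\rfloor}}\le K$. Vector-valued functions belong to it componentwise. Smoothness assumption: $g_{enc,0}\in C^{\beta_{enc,0}}([0,1]^{dr},K)$ with $g_{enc,0}([0,1]^{dr})\subset[0,1]^D$; $g_{enc,1}\in C^{\beta_{enc,1}}([0,1]^D,K)$ with $g_{enc,1}([0,1]^D)\subset[0,1]^{\tilde d}$;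 $f_{dec}\in C^{\beta_{dec}}([0,1]^{\tilde d},K)$. Networks: $\sigma(x)=\max\{x,0\}$, and $\sigma_v(x)=(\sigma(x_1-v_1),\dots,\sigma(x_m-v_m))'$ for $v\in\mathbb R^m$. For $L\in\mathbb N_0$ (number of hidden layers) and $p=(p_0,\dots,p_{L+1})\in\mathbb N^{L+2}$ (widths), a network with architecture $(L,p)$ is $f(x)=W^{(L)}\sigma_{v^{(L)}}W^{(L-1)}\sigma_{v^{(L-1)}}\cdots W^{(1)}\sigma_{v^{(1)}}W^{(0)}x$ with $W^{(i)}\in\mathbb R^{p_{i+1}\times p_i}$, $v^{(i)}\in\mathbb R^{p_i}$ (and $v^{(0)}:=0$). Here $p_0=dr$, $p_{L+1}=d$. For $L_1\in\{1,\dots,L\}$, $s\in\mathbb N$, $F>0$, $\mathcal F(L,L_1,p,s,F)$ is the set of such $f$ with all $|W^{(j)}|_\infty\vee|v^{(j)}|_\infty\le1$, $p_{L_1}=\tilde d$, $\sum_{j=0}^L(|W^{(j)}|_0+|v^{(j)}|_0)\le s$, and $\|f\|_\infty\le F$. The estimator is any (measurable) minimizer $\hat f^{net}\in\arg\min_{f\in\mathcal F(L,L_1,p,s,F)}\hat R_n(f)$. Mixing: for $\sigma$-fields $\mathcal U,\mathcal V$, $2\beta^{mix}(\mathcal U,\mathcal V):=\sup\sum_{(i,j)}|\mathbb P(U_i\cap V_j)-\mathbb P(U_i)\mathbb P(V_j)|$ over all finite partitions $(U_i)\subset\mathcal U$, $(V_j)\subset\mathcal V$ of the probability space; $\beta^{mix}(k):=\beta^{mix}(\sigma(X_i:i\le0),\sigma(X_i:i\ge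 k))$, $k\in\mathbb N_0$. Compatibility assumption: there is $C_{\beta,sub}>0$ with $\beta^{mix}(q_1q_2)\le C_{\beta,sub}\beta^{mix}(q_1)\beta^{mix}(q_2)$ for all $q_1,q_2\in\mathbb N$; and $\phi:[0,\infty)\to[0,\infty)$ satisfies: $\phi(0)=0$, $\phi$ is convex and differentiable with $c_0:=\sup_{y>0}\frac{\phi'(y)y}{\phi(y)}<\infty$; $y\mapsto y/\phi(y)$ maps $(0,\infty)$ to $(0,\infty)$ and is convex and decreasing; $\sum_{k=0}^\infty(\phi^*(k+1)-\phi^*(k))\beta^{mix}(k)<\infty$, where $\phi^*(x):=\sup_{y>0}\{xy-\phi(y)\}$. Then $\psi(x):=\phi^*(x)x$ and $\Lambda^{mix}(x):=\lceil\psi^{-1}(x^{-1})\rceil x$ for $x>0$. *)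

(* Defs.v *)
From HB Require Import structures.
From mathcomp Require Import all_boot all_order all_algebra.
From mathcomp Require Import all_classical all_reals all_analysis.

Set Implicit Arguments.
Unset Strict Implicit.
Unset Printing Implicit Defensive.

Import Order.TTheory GRing.Theory Num.Theory.
Import numFieldNormedType.Exports.

Local Open Scope classical_set_scope.
Local Open Scope ring_scope.

(** Vectors of R^m are column vectors ['cV[R]_m]; the library norm [`|x|] on
    matrices is the maximum norm of the entries. *)

(* R^m with its Borel sigma-algebra. *)
Definition borel (R : realType) (m : nat) := g_sigma_algebraType (@open 'cV[R]_m).

Definition enorm2 (R : realType) m (x : 'cV[R]_m) : R :=
  Num.sqrt (\sum_(j < m) x j ord0 ^+ 2).

Definition nnz (R : realType) m k (A : 'M[R]_(m, k)) : nat :=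
  #|[set ij : 'I_m * 'I_k | A ij.1 ij.2 != 0]|.

Definition cube (R : realType) m : set 'cV[R]_m :=
  [set x | forall j, 0 <= x j ord0 <= 1].

Definition log2 (R : realType) (x : R) : R := ln x / ln 2.

(* Sequences are indexed by the sample sizes n > r. *)
Definition lesssim (R : realType) (r : nat) (x y : nat -> \bar R) : Prop :=
  exists2 C : R, 0 < C & forall n, (r < n)%N -> (x n <= C%:E * y n)%E.

Definition asymp (R : realType) (r : nat) (x y : nat -> \bar R) : Prop :=
  lesssim r x y /\ lesssim r y x.

Section Probability.
Context {dT : measure_display} {T : measurableType dT} {R : realType}.
Variable P : probability T R.

Definition random_vector m (X : T -> 'cV[R]_m) : Prop :=
  measurable_fun [set: T] (X : T -> borel R m).

(* sigma(X_i : i in J) *)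
Definition sigma_of m (X : int -> T -> 'cV[R]_m) (J : set int) : set (set T) :=
  <<s \bigcup_(i in J)
        preimage_set_system [set: T] (X i : T -> borel R m) measurable >>.

Definition independent_systems (U V : set (set T)) : Prop :=
  forall A B, U A -> V B -> P (A `&` B) = (P A * P B)%E.

Definition mutually_independent m (Y : int -> T -> 'cV[R]_m) : Prop :=
  forall (I : seq int) (B : int -> set (borel R m)), uniq I ->
    (forall i, measurable (B i)) ->
    P (\bigcap_(i in [set` I]) Y i @^-1` B i) = (\prod_(i <- I) P (Y i @^-1` B i))%E.

Definition identically_distributed m (Y : int -> T -> 'cV[R]_m) : Prop :=
  forall i j (B : set (borel R m)), measurable B ->
    P (Y i @^-1` B) = P (Y j @^-1` B).

Definition stationary m (X : int -> T -> 'cV[R]_m) : Prop :=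
  forall (k : nat) (t : 'I_k -> int) (h : int)
         (B : set (k.-tuple (borel R m))), measurable B ->
    P [set w | B [tuple (X (t l) w : borel R m) | l < k]] =
    P [set w | B [tuple (X (t l + h) w : borel R m) | l < k]].

Definition beta_mix_systems (U V : set (set T)) : R :=
  2^-1 * sup [set z | exists (k l : nat) (A : 'I_k -> set T) (B : 'I_l -> set T),
    [/\ partition [set: 'I_k] A [set: T] /\ (forall i, U (A i)),
        partition [set: 'I_l] B [set: T] /\ (forall j, V (B j)) &
        z = \sum_(i < k) \sum_(j < l)
              `|fine (P (A i `&` B j)) - fine (P (A i)) * fine (P (B j))|]].

Definition beta_mix m (X : int -> T -> 'cV[R]_m) (k : nat) : R :=
  beta_mix_systems (sigma_of X [set i | i <= 0]) (sigma_of X [set i | k%:Z <= i]).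

End Probability.

Section Model.
Context {R : realType} {d : nat}.

(* (x_j, x_(j-1), ..., x_(j-r+1)), concatenated into one vector of R^(dr). *)
Definition lags (r : nat) (x : int -> 'cV[R]_d) (j : int) : 'cV[R]_(r * d) :=
  (mxvec (\matrix_(k < r, l < d) x (j - k%:Z) l ord0))^T.

Definition autoregressive {dT : measure_display} {T : measurableType dT}
    (P : probability T R) (r : nat) (f0 : 'cV[R]_(r * d) -> 'cV[R]_d)
    (X eps : int -> T -> 'cV[R]_d) : Prop :=
  (forall i, random_vector (X i)) /\ stationary P X /\
  measurable_fun [set: borel R (r * d)] (f0 : borel R (r * d) -> borel R d) /\
  (forall i w, X i w = f0 (lags r (X^~ w) (i - 1)) + eps i w) /\
  (forall i, random_vector (eps i)) /\
  mutually_independent P eps /\ identically_distributed P eps /\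
  (forall i j, ('E_P[fun w => (eps i w j ord0)%R] = 0)%E) /\
  (forall i, independent_systems P (sigma_of eps [set i])
                                   (sigma_of X [set j | j < i])).

Definition pred_error {dT : measure_display} {T : measurableType dT}
    (P : probability T R) (r : nat) (Wt : 'cV[R]_(r * d) -> R)
    (f0 : 'cV[R]_(r * d) -> 'cV[R]_d) (X : int -> T -> 'cV[R]_d)
    (f : 'cV[R]_(r * d) -> 'cV[R]_d) : \bar R :=
  ((d%:R^-1)%:E *
   'E_P[fun w => (let x := lags r (X^~ w) r%:Z in
                  enorm2 (f x - f0 x) ^+ 2 * Wt x)%R])%E.

(* [x] is the observed path; only x 1, ..., x n enter. *)
Definition emp_risk (r : nat) (Wt : 'cV[R]_(r * d) -> R) (n : nat)
    (x : int -> 'cV[R]_d) (f : 'cV[R]_(r * d) -> 'cV[R]_d) : R :=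
  n%:R^-1 * \sum_(r.+1 <= i < n.+1)
    d%:R^-1 * enorm2 (x i%:Z - f (lags r x (i%:Z - 1))) ^+ 2
    * Wt (lags r x (i%:Z - 1)).

End Model.

Section Hoelder.
Context {R : realType} {m : nat}.
Variable D : set 'cV[R]_m.

(* Difference quotients only use points of D, so that derivatives at boundary
   points of D are one-sided. *)
Definition diff_quot (f : 'cV[R]_m -> R) (j : 'I_m) (x : 'cV[R]_m) (h : R) : R :=
  h^-1 * (f (x + h *: delta_mx j ord0) - f x).

Definition step_filter (j : 'I_m) (x : 'cV[R]_m) : set_system R :=
  within [set h : R | D (x + h *: delta_mx j ord0)] 0^'.

Definition has_pderiv (f : 'cV[R]_m -> R) (j : 'I_m) (x : 'cV[R]_m) : Prop :=
  cvg (diff_quot f j x @ step_filter j x).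

Definition pderiv (j : 'I_m) (f : 'cV[R]_m -> R) (x : 'cV[R]_m) : R :=
  lim (diff_quot f j x @ step_filter j x).

Definition pderivs (s : seq 'I_m) (f : 'cV[R]_m -> R) : 'cV[R]_m -> R :=
  foldr pderiv f s.

Definition mdeg k (a : {ffun 'I_m -> 'I_k}) : nat := (\sum_j a j)%N.

(* The order of differentiation is fixed by [enum 'I_m]; in a Hoelder ball the
   mixed derivatives are continuous, so that it is immaterial. *)
Definition pderiv_multi k (a : {ffun 'I_m -> 'I_k}) :
    ('cV[R]_m -> R) -> 'cV[R]_m -> R :=
  pderivs (flatten [seq nseq (a j) j | j <- enum 'I_m]).

(* max {k : nat | k < beta}; it differs from the usual floor at integers. *)
Definition sfloor (beta : R) : nat :=
  (\max_(k < (Num.truncn beta).+1 | (k%:R < beta)%R) k)%N.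

Definition hoelder_ball (beta K : R) (f : 'cV[R]_m -> R) : Prop :=
  let k := sfloor beta in
  (forall (s : seq 'I_m) (j : 'I_m), (size s < k)%N ->
     forall x, D x -> has_pderiv (pderivs s f) j x) /\
  (\sum_(a : {ffun 'I_m -> 'I_k.+1} | ((mdeg a)%:R < beta)%R)
     ereal_sup [set `|pderiv_multi a f x|%:E | x in D] +
   \sum_(a : {ffun 'I_m -> 'I_k.+1} | mdeg a == k)
     ereal_sup [set (`|pderiv_multi a f z.1 - pderiv_multi a f z.2|
                     / `|z.1 - z.2| `^ (beta - k%:R))%:E
               | z in [set z | [/\ D z.1, D z.2 & z.1 != z.2]]]
   <= K%:E)%E.

End Hoelder.

Section EncoderDecoder.
Context {R : realType}.

(* Each component of g depends on at most t arguments. *)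
Definition sparse_args m k (t : nat) (g : 'cV[R]_m -> 'cV[R]_k) : Prop :=
  forall i, exists2 S : {set 'I_m}, (#|S| <= t)%N &
    forall x y : 'cV[R]_m, (forall j, j \in S -> x j ord0 = y j ord0) ->
      g x i ord0 = g y i ord0.

Definition encoder_decoder (r d dt D tdec tenc0 tenc1 : nat)
    (f0 : 'cV[R]_(r * d) -> 'cV[R]_d)
    (genc0 : 'cV[R]_(r * d) -> 'cV[R]_D) (genc1 : 'cV[R]_D -> 'cV[R]_dt)
    (fdec : 'cV[R]_dt -> 'cV[R]_d) : Prop :=
  (1 <= dt <= d)%N /\ (1 <= D)%N /\
  (1 <= tenc0 <= r * d)%N /\ (1 <= tenc1 <= D)%N /\ (1 <= tdec <= dt)%N /\
  f0 = fdec \o (genc1 \o genc0) /\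
  sparse_args tenc0 genc0 /\ sparse_args tenc1 genc1 /\ sparse_args tdec fdec.

Definition hoelder_vec m k (beta K : R) (g : 'cV[R]_m -> 'cV[R]_k) : Prop :=
  forall i, hoelder_ball (@cube R m) beta K (fun x => g x i ord0).

Definition encdec_smooth (r d dt D : nat) (bdec benc0 benc1 K : R)
    (genc0 : 'cV[R]_(r * d) -> 'cV[R]_D) (genc1 : 'cV[R]_D -> 'cV[R]_dt)
    (fdec : 'cV[R]_dt -> 'cV[R]_d) : Prop :=
  [/\ hoelder_vec benc0 K genc0 /\ genc0 @` (@cube R _) `<=` @cube R _,
      hoelder_vec benc1 K genc1 /\ genc1 @` (@cube R _) `<=` @cube R _ &
      hoelder_vec bdec K fdec].

End EncoderDecoder.

Section Networks.
Context {R : realType}.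

Definition shifted_relu m (v x : 'cV[R]_m) : 'cV[R]_m :=
  \col_i Num.max (x i ord0 - v i ord0) 0.

(* W^(l) sigma_(v^(l)) W^(l-1) ... W^(1) sigma_(v^(1)) W^(0) x *)
Fixpoint network (p : nat -> nat) (W : forall i, 'M[R]_(p i.+1, p i))
    (v : forall i, 'cV[R]_(p i)) (x : 'cV[R]_(p 0%N)) (l : nat) : 'cV[R]_(p l.+1) :=
  match l with
  | 0%N => W 0%N *m x
  | l'.+1 => W l'.+1 *m shifted_relu (v l'.+1) (network W v x l')
  end.

(* Of [p], [W] and [v] only p 0, ..., p (L + 1), W 0, ..., W L and
   v 0, ..., v L are relevant. *)
Definition net_class (din dout dt L L1 : nat) (p : nat -> nat) (s : nat) (F : R) :
    set ('cV[R]_din -> 'cV[R]_dout) :=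
  [set f | exists (e0 : p 0%N = din) (eL : p L.+1 = dout)
                  (W : forall i, 'M[R]_(p i.+1, p i)) (v : forall i, 'cV[R]_(p i)),
    (forall x, f x = castmx (eL, erefl)
                       (network W v (castmx (esym e0, erefl) x) L)) /\
    v 0%N = 0 /\
    (forall j, (j <= L)%N -> `|W j| <= 1 /\ `|v j| <= 1) /\
    p L1 = dt /\
    (\sum_(0 <= j < L.+1) (nnz (W j) + nnz (v j)) <= s)%N /\
    (forall x, `|f x| <= F)].

End Networks.

Arguments net_class R din dout : clear implicits.

Definition is_argmin {R : realType} (A : Type) (S : set A) (g : A -> R) (a : A) : Prop :=
  S a /\ forall b, S b -> g a <= g b.

Section Mixing.
Context {R : realType}.

Definition conjugate (phi : R -> R) (x : R) : \bar R :=
  ereal_sup [set (x * y - phi y)%:E | y in [set y | 0 < y]].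

(* [bmix] is the sequence of mixing coefficients. Finiteness of the conjugate is
   what gives a meaning to the differences in the series and to Lambda. *)
Definition compatible (bmix : nat -> R) (phi : R -> R) : Prop :=
  (exists2 C : R, 0 < C & forall q1 q2 : nat, (0 < q1)%N -> (0 < q2)%N ->
     bmix (q1 * q2)%N <= C * bmix q1 * bmix q2) /\
  (forall y, 0 <= y -> 0 <= phi y) /\
  phi 0 = 0 /\
  convex_function (`[0, +oo[%classic : set R^o) phi /\
  ((forall y, 0 < y -> derivable phi y 1) /\
   cvg ((h^-1 * (phi h - phi 0)) @[h --> (0 : R)^'+])) /\
  (ereal_sup [set (derive1 phi y * y / phi y)%:E | y in [set y : R | (0 < y)%R]]
     < +oo)%E /\
  (forall y, 0 < y -> 0 < y / phi y) /\
  convex_function (`]0, +oo[%classic : set R^o) (fun y : R => y / phi y) /\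
  (forall x y, 0 < x -> x <= y -> y / phi y <= x / phi x) /\
  (forall x, 0 <= x -> conjugate phi x \is a fin_num) /\
  (\sum_(0 <= k <oo)
     (conjugate phi k.+1%:R - conjugate phi k%:R) * (bmix k)%:E < +oo)%E.

Definition psi (phi : R -> R) (x : R) : R := fine (conjugate phi x) * x.

Definition psi_inv (phi : R -> R) (y : R) : R :=
  xget 0 [set x | 0 <= x /\ psi phi x = y].

Definition Lambda_mix (phi : R -> R) (x : R) : R :=
  (Num.ceil (psi_inv phi x^-1))%:~R * x.

End Mixing.

(* Main.v *)
(** Statistical part. Let [G] be a finite [1/n]-net of the network class. The potential
    ln (sum_g exp S_g) of the accumulated increments S_g grows, when an increment s_g is added, by at most
    sum_g pi_g (exp s_g - 1) with weights pi_g proportional to exp S_g. For the increments of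
    "expected loss minus twice the empirical loss" these weights are functions of the past; beta-mixing
    over a gap of length q makes the sum nonpositive in expectation up to a multiple of beta(q), and for the
    sub-Gaussian noise independence does the same. Both maximal inequalities cost ln #|G|, which is of order
    N log(n)^3, and give an oracle inequality; the choice of q as the ceiling of psi^-1(1/x) turns
    q x + beta(q) into Lambda(x), because phi^*(q) beta(q) is bounded by the convergent series.

    Approximation part. Hoelder functions of t variables are approximated on a grid of mesh 1/M by products of
    hat functions and Taylor monomials; products are computed by ReLU layers through the polarization identity
    and the sawtooth expansion t - t^2 = T(t)/4 + (T(t) - T(t)^2)/4 of the square. Weights are bounded by a
    constant first, and by 1 after every node has been copied a constant number of times, except at layer L1
    where the encoder output must have exactly the prescribed width. *)

Require Import Defs.
From HB Require Import structures.
From mathcomp Require Import all_boot all_order all_algebra.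
From mathcomp Require Import all_classical all_reals all_analysis.
From mathcomp Require Import measurable_realfun.
From mathcomp Require Import ring lra zify.
Set Implicit Arguments.
Unset Strict Implicit.
Unset Printing Implicit Defensive.
Import Order.TTheory GRing.Theory Num.Theory.
Import numFieldNormedType.Exports.
Local Open Scope classical_set_scope.
Local Open Scope ring_scope.

(** * Expectations and path space *)

(** The estimator and its nearest net element depend on the whole sample, so the mixing bound cannot
    be applied to one fixed function. Log-sum-exp dominates all net elements at once, and its
    softmax weights sum to one: the covariance bound for a weighted sum over the net costs a single
    mixing coefficient, with no factor [#|G|] and no coupling with independent blocks. Lag vectors
    have length [r], so a gap [q] between past and future needs time steps of q + r - 1, and the
    residue classes modulo that number are treated separately. The net lies inside the class, so
    that its elements are measurable and bounded by [F]; its size does not involve the widths,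
    because dead nodes are discarded and at most [s] remain per hidden layer. In the approximation
    the factor log2(4 max(t, beta)) in the depth is the height of a binary tree of multiplications.
    Three quarters of log2(n) go into squaring steps, which makes the squared multiplication error
    of order N / n; the rest pays for the slopes of the hat functions. Small [N] are served by the
    zero network and a large constant. *)

Section Expectation.
Context {dT : measure_display} {T : measurableType dT} {R : realType}.
Variable P : probability T R.
Implicit Types f g : T -> R.

Definition Ex f : R := Rintegral P [set: T] f.
Definition itg f : Prop := P.-integrable [set: T] (EFin \o f).

Lemma itg_meas f : itg f -> measurable_fun [set: T] f.
Proof. by move=> /measurable_int /measurable_EFinP. Qed.

Lemma itgD f g : itg f -> itg g -> itg (fun w => f w + g w).
Proof. exact: integrableD. Qed.

Lemma itgB f g : itg f -> itg g -> itg (fun w => f w - g w).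
Proof. exact: integrableB. Qed.

Lemma itgZ c f : itg f -> itg (fun w => c * f w).
Proof. exact: integrableZl. Qed.

Lemma itg_cst c : itg (fun=> c).
Proof. by apply: finite_measure_integrable_cst. Qed.

Lemma itg_sum (I : Type) (s : seq I) (p : pred I) (h : I -> T -> R) :
  (forall i, p i -> itg (h i)) -> itg (fun w => \sum_(i <- s | p i) h i w).
Proof.
move=> H; apply: (@eq_integrable _ _ _ _ _ _
  (fun w => \sum_(i <- s | p i) (EFin \o h i) w)%E) => //.
  by move=> w _; rewrite /= sumEFin.
exact: integrable_sum.
Qed.

Lemma itg_le f g : measurable_fun [set: T] f -> itg g ->
  (forall w, `|f w| <= `|g w|) -> itg f.
Proof.
move=> mf ig H; apply: (@le_integrable _ _ _ _ _ _ _ (EFin \o g)) => //.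
  exact/measurable_EFinP.
by move=> w _; rewrite /= lee_fin.
Qed.

Lemma itg_bounded f c : measurable_fun [set: T] f ->
  (forall w, `|f w| <= c) -> itg f.
Proof.
move=> mf H; apply: (itg_le mf (itg_cst c)) => w.
by apply: (le_trans (H w)); exact: ler_norm.
Qed.

Lemma itgM f g c : measurable_fun [set: T] f -> (forall w, `|f w| <= c) ->
  itg g -> itg (fun w => f w * g w).
Proof.
move=> mf H ig; apply: (@itg_le _ (fun w => c * g w)).
- exact: measurable_funM mf (itg_meas ig).
- exact: itgZ.
- move=> w; rewrite !normrM ler_wpM2r//.
  by apply: (le_trans (H w)); exact: ler_norm.
Qed.

Lemma Ex_cst c : Ex (fun=> c) = c.
Proof.
rewrite /Ex Rintegral_cst//; transitivity (c * fine (P [set: T])) => //.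
by rewrite probability_setT mulr1.
Qed.

Lemma ExD f g : itg f -> itg g -> Ex (fun w => f w + g w) = Ex f + Ex g.
Proof. by move=> ? ?; rewrite /Ex RintegralD. Qed.

Lemma ExB f g : itg f -> itg g -> Ex (fun w => f w - g w) = Ex f - Ex g.
Proof. by move=> ? ?; rewrite /Ex RintegralB. Qed.

Lemma ExZ c f : itg f -> Ex (fun w => c * f w) = c * Ex f.
Proof. by move=> ?; rewrite /Ex RintegralZl. Qed.

Lemma Ex_ge0 f : (forall w, 0 <= f w) -> 0 <= Ex f.
Proof. by move=> ?; apply: Rintegral_ge0. Qed.

Lemma le_Ex f g : itg f -> itg g -> (forall w, f w <= g w) -> Ex f <= Ex g.
Proof. by move=> ? ? ?; apply: le_Rintegral. Qed.

Lemma eq_Ex f g : (forall w, f w = g w) -> Ex f = Ex g.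
Proof. by move=> H; congr Ex; apply/funext. Qed.

Lemma Ex_sum (I : eqType) (s : seq I) (h : I -> T -> R) :
  (forall i, i \in s -> itg (h i)) ->
  Ex (fun w => \sum_(i <- s) h i w) = \sum_(i <- s) Ex (h i).
Proof.
elim: s => [|i s IH] H.
  rewrite big_nil -[RHS](Ex_cst 0); apply: eq_Ex => w; by rewrite big_nil.
rewrite big_cons -IH; last by move=> j js; apply: H; rewrite inE js orbT.
rewrite -ExD.
- by apply: eq_Ex => w; rewrite big_cons.
- by apply: H; rewrite mem_head.
- rewrite (_ : (fun w => _) = (fun w => \sum_(i <- s | i \in s) h i w)).
    by apply: itg_sum => j js; apply: H; rewrite inE js orbT.
  by apply/funext => w; rewrite big_seq.
Qed.

Lemma Ex_sumf (I : finType) (h : I -> T -> R) :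
  (forall i, itg (h i)) ->
  Ex (fun w => \sum_i h i w) = \sum_i Ex (h i).
Proof. by move=> H; rewrite Ex_sum. Qed.

Lemma Ex_indic (A : set T) : measurable A -> Ex (\1_A) = fine (P A).
Proof. by move=> mA; rewrite /Ex /Rintegral integral_indic// setIT. Qed.

Lemma itg_indic (A : set T) : measurable A -> itg (\1_A).
Proof. by move=> mA; exact: integrable_indic. Qed.

Lemma Ex_EFin f : itg f -> (\int[P]_w (f w)%:E)%E = (Ex f)%:E.
Proof. by move=> fi; rewrite /Ex /Rintegral fineK//; exact: integrable_fin_num. Qed.

(** The integral of a nonnegative function is a supremum over the nonnegative simple functions below
    it, hence monotone. It serves to dominate the random prediction error by an explicit integrable
    bound. *)
Lemma le_nonneg_integral (f g : T -> \bar R) :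
  (forall w, 0 <= f w)%E -> (forall w, f w <= g w)%E ->
  (\int[P]_w f w <= \int[P]_w g w)%E.
Proof.
move=> f0 fg; have g0 w : (0 <= g w)%E by exact: le_trans (f0 w) (fg w).
rewrite !ge0_integralTE//; apply: ub_ereal_sup => _ [h /= hf <-].
apply: ereal_sup_ubound; exists h => //= w; exact: le_trans (hf w) (fg w).
Qed.

End Expectation.

Lemma borel_coord_measurable (R : realType) m (j : 'I_m) :
  measurable_fun [set: borel R m] (fun x : borel R m => (x : 'cV[R]_m) j ord0 : R).
Proof.
apply: (measurability _ (RGenOpens.measurableE R)) => _ [_ [a [b ->] <-]].
rewrite setTI; apply: sub_sigma_algebra.
have /continuousP := @coord_continuous R m 1%N j ord0; apply.
exact: interval_open.
Qed.

(** Cubes with rational centre and radius 1/(N + 1) form a countable family; those not contained in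
    [U] are replaced by the empty set, so that the index runs over a whole countable type. This
    reduces measurability into [borel R m] to the coordinates. *)
Lemma borel_open_bigcup (R : realType) m (U : set 'cV[R]_m) : open U ->
  U = \bigcup_(qe : 'cV[rat]_m * nat)
    if asbool ([set x : 'cV[R]_m | forall j, `|x j ord0 - ratr (qe.1 j ord0)| < qe.2.+1%:R^-1] `<=` U)
    then [set x : 'cV[R]_m | forall j, `|x j ord0 - ratr (qe.1 j ord0)| < qe.2.+1%:R^-1] else set0.
Proof.
move=> oU; apply/seteqP; split => [x Ux|x [qe _]]; last first.
  by case: asboolP => // H /H.
have /nbhs_ballP [e /= e0 eU] := open_nbhs_nbhs (conj oU Ux).
have [N Ne] : exists N : nat, N.+1%:R^-1 < e / 2.
  exists (Num.truncn (e / 2)^-1); rewrite invf_plt ?posrE ?divr_gt0//.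
  by rewrite truncnS_gt.
have H j : exists q : rat, `|x j ord0 - ratr q| < N.+1%:R^-1.
  have [q] := @rat_in_itvoo R (x j ord0 - N.+1%:R^-1) (x j ord0 + N.+1%:R^-1)
    (ltac:(by rewrite ltrD2l gt0_cp)).
  rewrite in_itv/= => /andP[q1 q2]; exists q; rewrite distrC ltr_distl.
  by rewrite q1 q2.
have [q Hq] := choice H.
exists (\col_j q j, N) => //=; case: asboolP => [_ j|]; first by rewrite mxE.
case=> y /= Hy; apply: eU; split => // i k; rewrite (ord1 k) /ball /=.
have := Hq i; have := Hy i; rewrite mxE => h1 h2.
rewrite (le_lt_trans (ler_distD (ratr (q i)) _ _))// (splitr e).
by rewrite ltrD// ?(lt_trans _ Ne)// distrC.
Qed.

Lemma measurable_borelP (R : realType) m d (S : measurableType d) (f : S -> 'cV[R]_m) :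
  (forall j, measurable_fun [set: S] (fun s => f s j ord0)) ->
  measurable_fun [set: S] (f : S -> borel R m).
Proof.
move=> H; apply: (@measurability _ _ _ (borel R m) _ _ (@open 'cV[R]_m)) => //.
move=> _ [U oU <-]; rewrite setTI (borel_open_bigcup oU) preimage_bigcup.
apply: countable_bigcupT_measurable; first exact: countableP.
move=> qe; case: asboolP => _; last by rewrite preimage_set0; exact: measurable0.
rewrite (_ : _ @^-1` _ = \bigcap_(j in [set: 'I_m])
  ((fun s => `|f s j ord0 - ratr (qe.1 j ord0)|) @^-1` [set y | y < qe.2.+1%:R^-1])).
  apply: fin_bigcap_measurable; first exact: finite_finset.
  move=> j _; rewrite -[X in measurable X]setTI.
  have mg : measurable_fun [set: S] (fun s => `|f s j ord0 - ratr (qe.1 j ord0)|).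
    by apply: measurableT_comp => //; apply: measurable_funB.
  apply: mg => //.
  rewrite (_ : [set y | y < _] = `]-oo, qe.2.+1%:R^-1[%classic) //.
by apply/seteqP; split=> s Hs j; [move=> _; exact: (Hs j)|exact: (Hs j I)].
Qed.

Section PathSpace.
Context {R : realType} {d : nat}.
Implicit Types J : set int.

Definition cyl J : set (set (int -> 'cV[R]_d)) :=
  \bigcup_(i in J) preimage_set_system [set: int -> 'cV[R]_d]
    (fun x : int -> 'cV[R]_d => x i : borel R d) measurable.

(** The index set [J] records which times a path functional looks at; past and future are then
    separated by the choice of [J]. *)
Definition pathT J := g_sigma_algebraType (cyl J).

Lemma path_coord_measurable J i : J i ->
  measurable_fun [set: pathT J] (fun x : pathT J => (x i : borel R d)).
Proof.
move=> Ji _ B mB; apply: sub_sigma_algebra; exists i => //; by exists B.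
Qed.

Lemma path_sub J J' (A : set (int -> 'cV[R]_d)) : J `<=` J' ->
  measurable (A : set (pathT J)) -> measurable (A : set (pathT J')).
Proof.
move=> JJ'; apply: sub_smallest2r; first exact: smallest_sigma_algebra.
by move=> B [i Ji HB]; exists i => //; exact: JJ'.
Qed.

Lemma path_fun_sub J J' d' (S : measurableType d') (F : (int -> 'cV[R]_d) -> S) :
  J `<=` J' -> measurable_fun [set: pathT J] (F : pathT J -> S) ->
  measurable_fun [set: pathT J'] (F : pathT J' -> S).
Proof.
move=> JJ' mF _ B mB; rewrite setTI; apply: (path_sub JJ').
by rewrite -[X in measurable X]setTI; apply: mF.
Qed.

Lemma lags_measurable J r j : (forall k : nat, (k < r)%N -> J (j - k%:Z)) ->
  measurable_fun [set: pathT J]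
    (fun x : pathT J => (lags r x j : borel R (r * d))).
Proof.
move=> HJ; apply: measurable_borelP => l.
case: (mxvec_indexP l) => a b.
apply: (eq_measurable_fun
   (fun x : pathT J => (x (j - a%:Z) : 'cV[R]_d) b ord0)).
  by move=> x _; rewrite /lags mxE mxvecE mxE.
apply: (measurableT_comp (@borel_coord_measurable R d b)).
by apply: path_coord_measurable; apply: HJ; exact: ltn_ord.
Qed.

Context {dT : measure_display} {T : measurableType dT}.
Variables (P : probability T R) (X : int -> T -> 'cV[R]_d).
Hypothesis mX : forall i, random_vector (X i).

(** The shift moves the boundary between past and future to time 0, where [beta_mix] is defined. *)
Definition spath (h : int) (w : T) : int -> 'cV[R]_d := fun i => X (i + h) w.

Lemma spath_sigma J J' h (A : set (int -> 'cV[R]_d)) :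
  (forall i, J i -> J' (i + h)) -> measurable (A : set (pathT J)) ->
  sigma_of X J' (spath h @^-1` A).
Proof.
move=> JJ' mA.
suff H : @measurable _ (pathT J) `<=`
   image_set_system setT (spath h) (sigma_of X J').
  by have := H A mA; rewrite /image_set_system /= setTI.
apply: smallest_sub.
  exact/sigma_algebra_image/smallest_sigma_algebra.
move=> _ [i Ji [B mB <-]]; rewrite /image_set_system /= !setTI.
apply: sub_sigma_algebra; exists (i + h); first exact: JJ'.
by exists B => //; rewrite setTI.
Qed.

Lemma sigma_of_measurable J : sigma_of X J `<=` @measurable _ T.
Proof.
apply: smallest_sub; first exact: sigma_algebra_measurable.
by move=> _ [i _ [B mB <-]]; exact: mX.
Qed.

Lemma spath_measurable J h :
  measurable_fun [set: T] (spath h : T -> pathT J).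
Proof.
move=> _ A mA; rewrite setTI; apply: (@sigma_of_measurable setT).
exact: (@spath_sigma J).
Qed.

Definition window (n : nat) : set int := [set i | 1 <= i <= n%:Z].

Hypothesis stX : stationary P X.

(** Stationarity is stated for finite tuples. Every event of [pathT (window n)] is the preimage of
    an event of n-tuples under the coordinates 1, ..., n, because such preimages form a
    sigma-algebra containing the generators. *)
Lemma spath_stationary n h (A : set (int -> 'cV[R]_d)) :
  measurable (A : set (pathT (window n))) ->
  P (spath 0 @^-1` A) = P (spath h @^-1` A).
Proof.
move=> mA.
pose tup (x : int -> 'cV[R]_d) : n.-tuple (borel R d) :=
  [tuple (x k.+1%:Z : borel R d) | k < n].
have H : @measurable _ (pathT (window n)) `<=`
   preimage_set_system setT tup (@measurable _ (n.-tuple (borel R d))).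
  apply: smallest_sub.
    exact/sigma_algebra_preimage/sigma_algebra_measurable.
  move=> _ [i /andP[i1 i2] [B mB <-]].
  have [k [kn ik]] : exists k : nat, (k < n)%N /\ i = k.+1%:Z.
    exists (`|i|%N.-1); split; lia.
  exists ((@tnth n _ ^~ (Ordinal kn)) @^-1` B).
    rewrite -[X in measurable X]setTI; exact: measurable_tnth.
  by rewrite !setTI; apply/seteqP; split => x /=; rewrite tnth_mktuple ik.
have [B mB <-] := H A mA.
have := stX (fun l : 'I_n => l.+1%:Z) h mB.
rewrite !setTI => E; rewrite -[RHS]E; congr (P _).
apply/seteqP; split => w /=.
  by congr B; apply: eq_mktuple => k; rewrite /spath addr0.
by congr B; apply: eq_mktuple => k; rewrite /spath addr0.
Qed.

End PathSpace.

Section Transfer.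
Context {dT : measure_display} {T : measurableType dT} {R : realType}.
Variable P : probability T R.

Lemma Ex_transfer d' (S : measurableType d') (f1 f2 : T -> S) (F : S -> R) :
  measurable_fun [set: T] f1 -> measurable_fun [set: T] f2 ->
  measurable_fun [set: S] F ->
  (forall A, measurable A -> P (f1 @^-1` A) = P (f2 @^-1` A)) ->
  itg P (F \o f1) -> itg P (F \o f2) -> Ex P (F \o f1) = Ex P (F \o f2).
Proof.
move=> m1 m2 mF E i1 i2; rewrite /Ex /Rintegral; congr fine.
have mF' : measurable_fun [set: S] (EFin \o F) by exact/measurable_EFinP.
have := integral_pushforward m1 (mu := P) (D := setT) mF' i1 measurableT.
have := integral_pushforward m2 (mu := P) (D := setT) mF' i2 measurableT.
rewrite !preimage_setT => /= <- <-.
apply: eq_measure_integral => A mA _; exact: E.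
Qed.

End Transfer.

(** * Beta-mixing and finite partitions *)

Section BetaMixing.
Context {dT : measure_display} {T : measurableType dT} {R : realType}.
Variable P : probability T R.
Implicit Types U V : set (set T).

Lemma partition_sum_indic k (A : 'I_k -> set T) w :
  partition [set: 'I_k] A [set: T] -> \sum_(i < k) \1_(A i) w = 1 :> R.
Proof.
case=> cA tA _.
have [i _ Ai] : (\bigcup_(i in setT) A i) w by rewrite -/(cover _ _) cA.
rewrite (bigD1 i)//= big1 ?addr0 => [|j ji]; first by rewrite indicE mem_set.
rewrite indicE memNset// => Aj.
have /trivIsetP/(_ j i I I ji) := tA => E.
by have : (A j `&` A i) w by []; rewrite E.
Qed.

Lemma partition_sum_prob k l (A : 'I_k -> set T) (B : 'I_l -> set T) :
  partition [set: 'I_k] A [set: T] -> partition [set: 'I_l] B [set: T] ->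
  (forall i, measurable (A i)) -> (forall i, measurable (B i)) ->
  \sum_(i < k) \sum_(j < l) fine (P (A i `&` B j)) = 1.
Proof.
move=> pA pB mA mB.
have iAB i j : itg P (\1_(A i `&` B j)) by apply/itg_indic/measurableI.
rewrite (eq_bigr (fun i => Ex P (fun w => \sum_j \1_(A i `&` B j) w))); last first.
  move=> i _; rewrite Ex_sumf//; apply: eq_bigr => j _.
  by rewrite Ex_indic//; exact: measurableI.
rewrite -Ex_sumf => [|i]; last exact: itg_sum.
rewrite -[RHS](Ex_cst P 1); apply: eq_Ex => w.
under eq_bigr => i _.
  under eq_bigr => j _ do rewrite indicI /=.
  rewrite -mulr_sumr (partition_sum_indic _ pB) mulr1; over.
exact: partition_sum_indic.
Qed.

Lemma fine_prob_ge0 (A : set T) : 0 <= fine (P A).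
Proof. exact: fine_ge0. Qed.

Definition beta_sums U V : set R :=
  [set z | exists (k l : nat) (A : 'I_k -> set T) (B : 'I_l -> set T),
    [/\ partition [set: 'I_k] A [set: T] /\ (forall i, U (A i)),
        partition [set: 'I_l] B [set: T] /\ (forall j, V (B j)) &
        z = \sum_(i < k) \sum_(j < l)
              `|fine (P (A i `&` B j)) - fine (P (A i)) * fine (P (B j))|]].

(** [sup] of an unbounded set is a default value, so an upper bound is needed before any sum can be
    compared with [beta_mix_systems]. The crude 2 comes from splitting the absolute value: both
    double sums of probabilities equal 1. *)
Lemma beta_sums_bounded U V : U `<=` measurable -> V `<=` measurable ->
  forall z, beta_sums U V z -> z <= 2.
Proof.
move=> mU mV _ [k [l [A [B [[pA UA] [pB VB] ->]]]]].
have mA i : measurable (A i) by exact/mU.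
have mB i : measurable (B i) by exact/mV.
apply: (@le_trans _ _ (\sum_(i < k) \sum_(j < l)
  (fine (P (A i `&` B j)) + fine (P (A i)) * fine (P (B j))))).
  apply: ler_sum => i _; apply: ler_sum => j _.
  rewrite (le_trans (ler_normB _ _))// !ger0_norm ?mulr_ge0//;
  exact: fine_prob_ge0.
under eq_bigr do rewrite big_split /=.
rewrite big_split /= partition_sum_prob//.
suff pE n (C : 'I_n -> set T) : partition [set: 'I_n] C [set: T] ->
    (forall i, measurable (C i)) -> \sum_i fine (P (C i)) = 1.
  rewrite (eq_bigr (fun i => fine (P (A i)))); first by rewrite pE.
  by move=> i _; rewrite -mulr_sumr (pE _ B)// mulr1.
move=> pC mC.
rewrite (eq_bigr (fun i => Ex P (\1_(C i)))); last by move=> i _; rewrite Ex_indic.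
rewrite -Ex_sumf; last by move=> i; exact: itg_indic.
rewrite -[RHS](Ex_cst P 1); apply: eq_Ex => w; exact: partition_sum_indic.
Qed.

Lemma beta_sums_le U V z : U `<=` measurable -> V `<=` measurable ->
  beta_sums U V z -> z <= 2 * beta_mix_systems P U V.
Proof.
move=> mU mV Hz; rewrite /beta_mix_systems mulrA divff// mul1r.
apply: ub_le_sup => //; exists 2 => y; exact: beta_sums_bounded.
Qed.

Lemma beta_mix_systems_ge0 U V : U `<=` measurable -> V `<=` measurable ->
  0 <= beta_mix_systems P U V.
Proof.
move=> mU mV; have [[z Uz]|E] := pselect (exists z, beta_sums U V z).
  have := beta_sums_le mU mV Uz; suff : 0 <= z by move=> z0 /(le_trans z0); lra.
  case: Uz => k [l [A [B [_ _ ->]]]].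
  by apply: sumr_ge0 => i _; apply: sumr_ge0.
rewrite /beta_mix_systems (_ : [set z | _] = set0) ?sup0 ?mulr0//.
by apply/seteqP; split => // z Hz; apply: E; exists z.
Qed.

Lemma beta_mix_systems_le U V V' : U `<=` measurable -> V' `<=` measurable ->
  V `<=` V' -> sigma_algebra setT V -> sigma_algebra setT U ->
  beta_mix_systems P U V <= beta_mix_systems P U V'.
Proof.
move=> mU mV' VV' [V0 VC VU] [U0 UC UU]; rewrite ler_wpM2l ?invr_ge0//.
have setTS (W : set (set T)) : W set0 -> (forall A, W A -> W (setT `\` A)) -> W setT.
  by move=> W0 /(_ _ W0); rewrite setD0.
have pT : partition [set: 'I_1] (fun=> [set: T]) [set: T].
  split; first by apply/seteqP; split => // w _; exists ord0.
    by apply/trivIsetP => i j _ _; rewrite !ord1 eqxx.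
  by move=> _ _; exists point.
apply: sup_le.
- move=> z [k [l [A [B [hA [pB VB] zE]]]]]; apply/downP; exists z => //.
  exists k, l, A, B; split => //; split => // j; exact: VV'.
(* The partition into the single cell [[set: T]] shows that the set of sums is nonempty. *)
- exists (\sum_(i < 1) \sum_(j < 1) `|fine (P (setT `&` setT)) - fine (P setT) * fine (P setT)|).
  exists 1%N, 1%N, (fun=> setT), (fun=> setT).
  split => //; split => // _; first exact: (setTS U U0 UC).
  exact: (setTS V V0 VC).
- split; last by exists 2 => y; apply: beta_sums_bounded.
  exists (\sum_(i < 1) \sum_(j < 1) `|fine (P (setT `&` setT)) - fine (P setT) * fine (P setT)|).
  exists 1%N, 1%N, (fun=> setT), (fun=> setT).
  split => //; split => // _; first exact: (setTS U U0 UC).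
  by apply: VV'; exact: (setTS V V0 VC).
Qed.

Lemma preim_partition k (I : finType) (a : T -> I) (e : 'I_k -> I) :
  injective e -> (forall i, exists w, a w = e i) -> (forall w, exists i, a w = e i) ->
  partition [set: 'I_k] (fun i => a @^-1` [set e i]) [set: T].
Proof.
move=> ie He1 He2; split.
- by apply/seteqP; split => // w _; have [i ?] := He2 w; exists i.
- apply/trivIsetP => i j _ _ ij; apply/seteqP; split => // w [/= -> /ie E].
  by rewrite E eqxx in ij.
- by move=> i _; have [w ?] := He1 i; exists w.
Qed.

(** [partition] demands nonempty cells, so the values not attained by [a] or [b] are dropped first;
    they contribute zero to the sum. *)
Lemma beta_fintype_le U V (I J : finType) (a : T -> I) (b : T -> J) :
  U `<=` measurable -> V `<=` measurable ->
  (forall i, U (a @^-1` [set i])) -> (forall j, V (b @^-1` [set j])) ->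
  \sum_i \sum_j `|fine (P (a @^-1` [set i] `&` b @^-1` [set j]))
     - fine (P (a @^-1` [set i])) * fine (P (b @^-1` [set j]))|
  <= 2 * beta_mix_systems P U V.
Proof.
move=> mU mV Ua Vb.
have emp (K : finType) (c : T -> K) i : i \notin [set i | `[< exists w, c w = i >]]%SET ->
    c @^-1` [set i] = set0.
  rewrite inE => /asboolPn H; apply/seteqP; split => // w /= E; apply: H.
  by exists w.
set SI := [set i | `[< exists w, a w = i >]]%SET.
set SJ := [set i | `[< exists w, b w = i >]]%SET.
rewrite (bigID (mem SI)) /= [X in _ + X]big1 ?addr0; last first.
  move=> i /emp ->; apply: big1 => j _.
  by rewrite set0I measure0 /= mul0r subr0 normr0.
under eq_bigr => i _.
  rewrite (bigID (mem SJ)) /= [X in _ + X]big1 ?addr0; last first.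
    by move=> j /emp ->; rewrite setI0 measure0 /= mulr0 subr0 normr0.
  rewrite big_enum_val /=; over.
rewrite big_enum_val /=.
apply: beta_sums_le => //.
exists #|SI|, #|SJ|, (fun i => a @^-1` [set enum_val i]),
  (fun i => b @^-1` [set enum_val i]).
split=> //; split=> //; apply: preim_partition; try exact: enum_val_inj.
- by move=> i; have := enum_valP i; rewrite inE => /asboolP.
- move=> w; have H : a w \in SI by rewrite inE; apply/asboolP; exists w.
  by exists (enum_rank_in H (a w)); rewrite enum_rankK_in.
- by move=> i; have := enum_valP i; rewrite inE => /asboolP.
- move=> w; have H : b w \in SJ by rewrite inE; apply/asboolP; exists w.
  by exists (enum_rank_in H (b w)); rewrite enum_rankK_in.
Qed.

Lemma sum_preim (I : finType) (a : T -> I) (f : I -> R) w :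
  f (a w) = \sum_i f i * \1_(a @^-1` [set i]) w.
Proof.
rewrite (bigD1 (a w))//= big1 ?addr0 => [|j ji].
  by rewrite indicE mem_set// mulr1.
by rewrite indicE memNset ?mulr0// => /= E; rewrite E eqxx in ji.
Qed.

(** Expanding over the values of [a] and [b] gives the sum over i, j of the inner sum over g of the
    products [f g i * h g j], times P(A_i B_j) - P(A_i) P(B_j). Absolute values are taken after
    summing over g, so only the bound [C] enters and the cardinality of [G] does not. *)
Lemma beta_cov_fintype U V (I J G : finType) (a : T -> I) (b : T -> J)
    (f : G -> I -> R) (h : G -> J -> R) (C : R) :
  U `<=` measurable -> V `<=` measurable ->
  (forall i, U (a @^-1` [set i])) -> (forall j, V (b @^-1` [set j])) ->
  (forall w w', `|\sum_g f g (a w) * h g (b w')| <= C) ->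
  Ex P (fun w => \sum_g f g (a w) * h g (b w))
    - \sum_g Ex P (f g \o a) * Ex P (h g \o b)
  <= C * (2 * beta_mix_systems P U V).
Proof.
move=> mU mV Ua Vb HC.
have mA i : measurable (a @^-1` [set i]) by exact/mU.
have mB i : measurable (b @^-1` [set i]) by exact/mV.
have E1 (K : finType) (c : T -> K) (k : K -> R) :
    (forall i, measurable (c @^-1` [set i])) ->
    Ex P (k \o c) = \sum_i k i * fine (P (c @^-1` [set i])).
  move=> mc; rewrite (eq_Ex P (sum_preim c k)) Ex_sumf; last first.
    by move=> i; apply: itgZ; exact: itg_indic.
  apply: eq_bigr => i _; rewrite ExZ; last exact: itg_indic.
  by rewrite Ex_indic.
have E2 : Ex P (fun w => \sum_g f g (a w) * h g (b w)) =
    \sum_i \sum_j (\sum_g f g i * h g j) *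
       fine (P (a @^-1` [set i] `&` b @^-1` [set j])).
  rewrite (@eq_Ex _ _ _ P _ (fun w => \sum_i \sum_j (\sum_g f g i * h g j) *
       \1_(a @^-1` [set i] `&` b @^-1` [set j]) w)); last first.
    move=> w; rewrite (sum_preim a (fun i => \sum_g f g i * h g (b w))).
    apply: eq_bigr => i _.
    rewrite (sum_preim b (fun j => \sum_g f g i * h g j)) mulr_suml.
    by apply: eq_bigr => j _; rewrite indicI /= -mulrA [X in _ * X]mulrC.
  have I1 i j : itg P (fun w => (\sum_g f g i * h g j) *
       \1_(a @^-1` [set i] `&` b @^-1` [set j]) w).
    by apply: itgZ; apply: itg_indic; exact: measurableI.
  rewrite Ex_sumf => [|i]; last by apply: itg_sum => j _; exact: I1.
  apply: eq_bigr => i _; rewrite Ex_sumf => [|j]; last exact: I1.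
  apply: eq_bigr => j _; rewrite ExZ; last by apply: itg_indic; exact: measurableI.
  by rewrite Ex_indic//; exact: measurableI.
have E3 : \sum_g Ex P (f g \o a) * Ex P (h g \o b) =
    \sum_i \sum_j (\sum_g f g i * h g j) *
       (fine (P (a @^-1` [set i])) * fine (P (b @^-1` [set j]))).
  under eq_bigr => g _ do rewrite !E1// big_distrlr /=.
  rewrite exchange_big /=; apply: eq_bigr => i _.
  rewrite exchange_big /=; apply: eq_bigr => j _.
  by rewrite mulr_suml; apply: eq_bigr => g _; rewrite mulrACA.
rewrite E2 E3 -sumrB.
have := ler_wpM2l (le_trans (normr_ge0 _) (HC point point))
  (beta_fintype_le mU mV Ua Vb).
apply: le_trans; rewrite mulr_sumr; apply: ler_sum => i _.
rewrite -sumrB mulr_sumr; apply: ler_sum => j _.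
rewrite -mulrBr.
(* [HC] speaks of attained values; an unattained value has an empty preimage, so its term
   vanishes. *)
have [[[w Ew] [w' Ew']]|] :=
    pselect ((exists w, a w = i) /\ (exists w', b w' = j)).
  rewrite (le_trans (ler_norm _))// normrM ler_wpM2r//.
  by have := HC w w'; rewrite Ew Ew'.
move=> /not_andP[] N.
  rewrite (_ : a @^-1` [set i] = set0) ?set0I ?measure0 /= ?mul0r ?subrr ?normr0 ?mulr0//.
  by apply/seteqP; split => // w /= E; apply: N; exists w.
rewrite (_ : b @^-1` [set j] = set0) ?setI0 ?measure0 /= ?mulr0 ?subrr ?normr0 ?mulr0//.
by apply/seteqP; split => // w /= E; apply: N; exists w.
Qed.

End BetaMixing.

(** * Rounding, and covariances under mixing *)

Section Quantize.
Context {R : realType}.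

Definition quant (B M : nat) (x : R) : 'I_(B * M).+1 := inord (Num.truncn (M%:R * x)).

Lemma quantP (B M : nat) (x : R) : (0 < M)%N -> 0 <= x <= B%:R ->
  0 <= x - (quant B M x)%:R / M%:R <= M%:R^-1.
Proof.
move=> M0 /andP[x0 xB]; rewrite /quant inordK; last first.
  rewrite ltnS -[leqRHS](@natrK R); apply: le_truncn.
  by rewrite natrM mulrC ler_wpM2r.
have M0' : 0 < M%:R :> R by rewrite ltr0n.
have /andP[h1 h2] := truncn_itv (mulr_ge0 (ltW M0') x0).
rewrite subr_ge0 ler_pdivrMr// [x * _]mulrC h1/= lerBlDl.
by rewrite -[X in _ + X]mul1r -mulrDl ler_pdivlMr// mulrC (le_trans (ltW h2))// mulrSr.
Qed.

Lemma quant_measurable (B M : nat) d (S : measurableType d) (f : S -> R) i :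
  (0 < M)%N -> (forall s, 0 <= f s <= B%:R) ->
  measurable_fun [set: S] f -> measurable [set s | quant B M (f s) = i].
Proof.
move=> M0 fB mf.
rewrite (_ : [set s | _] = [set: S] `&` (fun s => M%:R * f s) @^-1` `[(i%:R : R), i.+1%:R[%classic).
  have : measurable_fun [set: S] (fun s => M%:R * f s) by exact: measurable_funM.
  by apply.
rewrite setTI; apply/seteqP; split => s /=; rewrite in_itv /=.
  move=> <-; rewrite /quant inordK.
    by apply: truncn_itv; rewrite mulr_ge0//; have /andP[] := fB s.
  rewrite ltnS -[leqRHS](@natrK R); apply: le_truncn.
  by rewrite natrM mulrC ler_wpM2r//; have /andP[] := fB s.
by move=> H; rewrite /quant (truncn_def H); exact: inord_val.
Qed.

End Quantize.

Section Covariance.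
Context {dT : measure_display} {T : measurableType dT} {R : realType}.
Variable P : probability T R.

(** Rounding [p] and [Z] to multiples of 1/M gives finitely valued functions, for which the finite
    bound holds with constant [c] because the weights sum to at most 1. The rounding error carries
    the factor [#|G|] but vanishes as M grows, so the limit is free of it. *)
Lemma beta_cov (U0 V0 : set (set T)) (G : finType) (p Z : G -> T -> R) (c : R) :
  <<s U0 >> `<=` measurable -> <<s V0 >> `<=` measurable ->
  (forall g, measurable_fun [set: g_sigma_algebraType U0] (p g : g_sigma_algebraType U0 -> R)) ->
  (forall g, measurable_fun [set: g_sigma_algebraType V0] (Z g : g_sigma_algebraType V0 -> R)) ->
  (forall g w, 0 <= p g w) -> (forall w, \sum_g p g w <= 1) ->
  0 <= c -> (forall g w, `|Z g w| <= c) ->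
  Ex P (fun w => \sum_g p g w * Z g w) - \sum_g Ex P (p g) * Ex P (Z g)
    <= c * (2 * beta_mix_systems P <<s U0 >> <<s V0 >>).
Proof.
move=> mU mV mp mZ p0 p1 c0 Zc.
set beta := beta_mix_systems _ _ _.
have mp' g : measurable_fun [set: T] (p g).
  by move=> _ B mB; apply: mU; exact: mp.
have mZ' g : measurable_fun [set: T] (Z g).
  by move=> _ B mB; apply: mV; exact: mZ.
have p1' g w : 0 <= p g w <= 1%:R.
  rewrite p0 /= (le_trans _ (p1 w))// (bigD1 g)//= lerDl.
  by apply: sumr_ge0 => ? _.
have [B cB] : exists B : nat, c + c <= B%:R.
  exists (Num.truncn (c + c)).+1; exact/ltW/truncnS_gt.
have ZB g w : 0 <= Z g w + c <= B%:R.
  by have := Zc g w; rewrite ler_norml => /andP[? ?]; lra.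
have ip g : itg P (p g).
  by apply: (@itg_bounded _ _ _ _ _ 1) => // w; rewrite ger0_norm//; have /andP[] := p1' g w.
have iZ g : itg P (Z g) by exact: (itg_bounded P (mZ' g) (Zc g)).
have ipZ g : itg P (fun w => p g w * Z g w).
  apply: (itgM (c := 1)) => // w; rewrite ger0_norm//; by have /andP[] := p1' g w.
suff main M : (0 < M)%N -> Ex P (fun w => \sum_g p g w * Z g w) - \sum_g Ex P (p g) * Ex P (Z g)
    <= c * (2 * beta) + #|G|%:R * (2 * c + 2) * M%:R^-1.
  apply/ler_addgt0Pr => e e0.
  set K := #|G|%:R * (2 * c + 2).
  have K0 : 0 <= K by rewrite mulr_ge0// addr_ge0// mulr_ge0.
  pose M := (Num.truncn (K / e)).+1.
  apply: (le_trans (main M isT)); rewrite lerD2l -/K ler_pdivrMr ?ltr0n//.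
  by rewrite mulrC -ler_pdivrMr// ltW// truncnS_gt.
move=> M0.
have M0' : 0 < M%:R :> R by rewrite ltr0n.
pose a w : {ffun G -> 'I_(1 * M).+1} := [ffun g => quant 1 M (p g w)].
pose b w : {ffun G -> 'I_(B * M).+1} := [ffun g => quant B M (Z g w + c)].
pose f g (i : {ffun G -> 'I_(1 * M).+1}) : R := (i g)%:R / M%:R.
(* [quant] rounds nonnegative numbers, so [Z] is shifted by [c] before rounding and shifted back
   afterwards. *)
pose h g (j : {ffun G -> 'I_(B * M).+1}) : R := (j g)%:R / M%:R - c.
have ffun_preim (k : nat) (q : T -> {ffun G -> 'I_k}) i :
    q @^-1` [set i] = \bigcap_(g in [set: G]) [set w | q w g = i g].
  apply/seteqP; split => w; first by move=> E g _; rewrite /= E.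
  by move=> H; apply/ffunP => g; exact: (H g I).
have Ua i : <<s U0 >> (a @^-1` [set i]).
  have : measurable (a @^-1` [set i] : set (g_sigma_algebraType U0)).
    rewrite ffun_preim; apply: fin_bigcap_measurable; first exact: finite_finset.
    move=> g _; rewrite (_ : [set w | _] = [set w | quant 1 M (p g w) = i g]).
      exact: quant_measurable.
    by apply/seteqP; split => w /=; rewrite ffunE.
  by [].
have Vb i : <<s V0 >> (b @^-1` [set i]).
  have : measurable (b @^-1` [set i] : set (g_sigma_algebraType V0)).
    rewrite ffun_preim; apply: fin_bigcap_measurable; first exact: finite_finset.
    move=> g _; rewrite (_ : [set w | _] = [set w | quant B M (Z g w + c) = i g]).
      by apply: quant_measurable => //; exact: measurable_funD.
    by apply/seteqP; split => w /=; rewrite ffunE.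
  by [].
have fa g w : 0 <= p g w - f g (a w) <= M%:R^-1.
  by rewrite /f ffunE; exact: quantP.
have hb g w : 0 <= Z g w - h g (b w) <= M%:R^-1.
  by have := quantP M0 (ZB g w); rewrite /h ffunE => /andP[? ?]; lra.
have f0 g i : 0 <= f g i by rewrite /f divr_ge0.
have hc g w : `|h g (b w)| <= c.
  have /andP[h1 h2] := hb g w; have := Zc g w; rewrite !ler_norml => /andP[h3 h4].
  rewrite (_ : h g (b w) <= c = true); last by apply/idP; lra.
  by rewrite andbT /h lerBDl subrr divr_ge0.
have sfh w w' : `|\sum_g f g (a w) * h g (b w')| <= c.
  rewrite (le_trans (ler_norm_sum _ _ _))//.
  apply: (@le_trans _ _ (\sum_g p g w * c)).
    apply: ler_sum => g _; rewrite normrM ler_pM// ger0_norm//.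
    by have /andP[] := fa g w; rewrite subr_ge0.
  by rewrite -mulr_suml ler_piMl.
have := @beta_cov_fintype _ _ _ P _ _ _ _ _ _ _ _ _ _ mU mV Ua Vb sfh; rewrite -/beta => D.
have mfa g : measurable_fun [set: T] (f g \o a).
  rewrite /comp (_ : (fun _ => _) = (fun w => \sum_i f g i * \1_(a @^-1` [set i]) w)).
    apply: measurable_sum => i; apply: measurable_funM => //.
    by apply/measurable_indicP; exact: mU.
  by apply/funext => w; exact: sum_preim.
have mhb g : measurable_fun [set: T] (h g \o b).
  rewrite /comp (_ : (fun _ => _) = (fun w => \sum_i h g i * \1_(b @^-1` [set i]) w)).
    apply: measurable_sum => i; apply: measurable_funM => //.
    by apply/measurable_indicP; exact: mV.
  by apply/funext => w; exact: sum_preim.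
have f1 g w : f g (a w) <= 1.
  by have /andP[? ?] := fa g w; have /andP[? ?] := p1' g w; lra.
have ifa g : itg P (f g \o a).
  by apply: (@itg_bounded _ _ _ _ _ 1) => // w; rewrite /= ger0_norm.
have ihb g : itg P (h g \o b) by apply: (@itg_bounded _ _ _ _ _ c) => // w; exact: hc.
have ifh g : itg P (fun w => f g (a w) * h g (b w)).
  apply: (@itgM _ _ _ P (f g \o a) (h g \o b) 1 (mfa g) _ (ihb g)) => w.
  by rewrite /= ger0_norm.
have S1 : Ex P (fun w => \sum_g p g w * Z g w) <=
    Ex P (fun w => \sum_g f g (a w) * h g (b w)) + #|G|%:R * (c + 1) * M%:R^-1.
  rewrite -[X in _ + X](Ex_cst P) -ExD; [|by apply: itg_sum|exact: itg_cst].
  apply: le_Ex; first exact: itg_sum.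
    by apply: itgD; [apply: itg_sum|exact: itg_cst].
  move=> w; rewrite -lerBlDl -sumrB.
  apply: (@le_trans _ _ (\sum_(g : G) (c + 1) * M%:R^-1)); last first.
    by rewrite sumr_const -[leLHS]mulr_natl mulrA.
  apply: ler_sum => g _.
  have -> : p g w * Z g w - f g (a w) * h g (b w) =
    (p g w - f g (a w)) * Z g w + f g (a w) * (Z g w - h g (b w)) by ring.
  rewrite [leRHS]mulrDl; apply: lerD.
    rewrite (le_trans (ler_norm _))// normrM mulrC ler_pM//.
    by have /andP[? ?] := fa g w; rewrite ger0_norm.
  by have /andP[? ?] := hb g w; apply: ler_pM.
have S2 : \sum_g Ex P (f g \o a) * Ex P (h g \o b) - #|G|%:R * (c + 1) * M%:R^-1 <=
    \sum_g Ex P (p g) * Ex P (Z g).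
  rewrite lerBlDr -lerBlDl -sumrB.
  apply: (@le_trans _ _ (\sum_(g : G) (c + 1) * M%:R^-1)); last first.
    by rewrite sumr_const -[leLHS]mulr_natl mulrA.
  apply: ler_sum => g _.
  have e1 : 0 <= Ex P (p g) - Ex P (f g \o a) <= M%:R^-1.
    rewrite -ExB//; apply/andP; split.
      by apply: Ex_ge0 => w; have /andP[] := fa g w.
    rewrite -(Ex_cst P M%:R^-1); apply: le_Ex; [exact: itgB|exact: itg_cst|].
    by move=> w; have /andP[] := fa g w.
  have e2 : 0 <= Ex P (Z g) - Ex P (h g \o b) <= M%:R^-1.
    rewrite -ExB//; apply/andP; split.
      by apply: Ex_ge0 => w; have /andP[] := hb g w.
    rewrite -(Ex_cst P M%:R^-1); apply: le_Ex; [exact: itgB|exact: itg_cst|].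
    by move=> w; have /andP[] := hb g w.
  have e3 : 0 <= Ex P (f g \o a) by apply: Ex_ge0 => w; exact: f0.
  have e5 : - c <= Ex P (Z g).
    rewrite -(Ex_cst P (- c)); apply: le_Ex; [exact: itg_cst|exact: iZ|].
    by move=> w; have := Zc g w; rewrite ler_norml => /andP[].
  have -> : Ex P (f g \o a) * Ex P (h g \o b) - Ex P (p g) * Ex P (Z g) =
    (Ex P (p g) - Ex P (f g \o a)) * (- Ex P (Z g)) + Ex P (f g \o a) * (- (Ex P (Z g) - Ex P (h g \o b))) by ring.
  move: e1 e2 => /andP[e1 e1'] /andP[e2 e2'].
  have : Ex P (f g \o a) * - (Ex P (Z g) - Ex P (h g \o b)) <= 0.
    by rewrite mulr_ge0_le0// oppr_le0.
  have : (Ex P (p g) - Ex P (f g \o a)) * - Ex P (Z g) <= (Ex P (p g) - Ex P (f g \o a)) * c.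
    by rewrite ler_wpM2l// lerNl.
  have : (Ex P (p g) - Ex P (f g \o a)) * c <= M%:R^-1 * c by rewrite ler_wpM2r.
  have := invr_ge0 (M%:R : R); rewrite ler0n; lra.
lra.
Qed.

End Covariance.

(** * Maximal inequalities *)

Section Independence.
Context {dT : measure_display} {T : measurableType dT} {R : realType}.
Variable P : probability T R.

Lemma Ex_truncation (Z : T -> R) (e : R) : itg P Z -> 0 < e ->
  exists M : nat,
    Ex P (fun w => `|Num.max (- M%:R) (Num.min M%:R (Z w)) - Z w|) <= e.
Proof.
move=> iZ e0; pose trunc (M : nat) w := Num.max (- M%:R) (Num.min M%:R (Z w)).
have mZ := itg_meas iZ.
have mt M : measurable_fun [set: T] (trunc M).
  by apply: measurable_maxr => //; apply: measurable_minr.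
have tZ M w : `|trunc M w| <= `|Z w|.
  have M0 : 0 <= M%:R :> R by [].
  have Z0 := normr_ge0 (Z w).
  rewrite /trunc ler_norml le_max le_min ge_max ge_min ler_norm orbT andbT.
  have -> : - `|Z w| <= Z w by rewrite lerNl -normrN ler_norm.
  rewrite andbT.
  by apply/andP; split; [apply/orP; right; lra|lra].
have H1 : {ae P, forall x : T, [set: T] x ->
    (fun M : nat => (EFin \o trunc M) x) @ \oo --> (EFin \o Z) x}.
  apply: aeW => w _; apply: cvg_near_cst; near=> M.
  have hM : `|Z w| <= M%:R by near: M; exact: nbhs_infty_ger.
  move: hM; rewrite ler_norml => /andP[h1 h2].
  by rewrite /= /trunc min_r// max_r.
have H2 : {ae P, forall (x : T) (n : nat), [set: T] x ->
    (`|(EFin \o trunc n) x| <= (EFin \o (fun w => `|Z w|%R)) x)%E}.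
  by apply: aeW => w M _; rewrite /= lee_fin.
have [_ H _] := @dominated_convergence _ _ _ P setT measurableT
  (fun M => EFin \o trunc M) (EFin \o Z) (EFin \o (fun w => `|Z w|))
  (fun M => (measurable_EFinP _ _).2 (mt M)) ((measurable_EFinP _ _).2 mZ) H1
  (integrable_norm iZ) H2.
have id M : itg P (fun w => `|trunc M w - Z w|).
  apply/integrable_norm/itgB => //.
  by apply: (itg_le (mt M) iZ) => w; exact: tZ.
have H' : (fun M => (Ex P (fun w => `|trunc M w - Z w|))%:E) @ \oo --> 0%E.
  apply: cvg_trans H; apply: near_eq_cvg; near=> M => /=.
  by rewrite -Ex_EFin//.
move/fine_cvgP: H' => [_ /cvgrPdist_le /(_ _ e0)[M _ /(_ M (leqnn _))]] /=.
rewrite sub0r normrN => h; exists M; exact: le_trans (ler_norm _) h.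
Unshelve. all: by end_near. Qed.

Lemma beta_mix_indep (U V : set (set T)) : independent_systems P U V ->
  U `<=` measurable -> V `<=` measurable -> beta_mix_systems P U V <= 0.
Proof.
move=> iUV mU mV; rewrite pmulr_rle0 ?invr_gt0//.
set S := [set z | _].
have SE z : S z -> z = 0.
  move=> [k [l [A [B [[_ UA] [_ VB] ->]]]]].
  apply: big1 => i _; apply: big1 => j _.
  have fU : P (A i) \is a fin_num by apply: fin_num_measure; exact: mU.
  have fV : P (B j) \is a fin_num by apply: fin_num_measure; exact: mV.
  by rewrite iUV// fineM// subrr normr0.
have [[z Sz]|NS] := pselect (S !=set0).
  by apply: ge_sup => [|y /SE ->//]; exists z.
rewrite (_ : S = set0) ?sup0//.
by apply/seteqP; split => // z Sz; apply: NS; exists z.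
Qed.

(** Independence makes the mixing coefficient nonpositive, so [beta_cov] with a one-element family
    gives one inequality for weights in [0, 1]. The substitution (p + 1) / 2 covers weights of
    modulus at most 1, passing from W to -W gives equality, and truncation extends it from bounded
    to integrable [Z]. *)
Lemma Ex_indep (U0 V0 : set (set T)) (Y Z : T -> R) :
  <<s U0 >> `<=` measurable -> <<s V0 >> `<=` measurable ->
  independent_systems P <<s U0 >> <<s V0 >> ->
  measurable_fun [set: g_sigma_algebraType U0] (Y : g_sigma_algebraType U0 -> R) ->
  measurable_fun [set: g_sigma_algebraType V0] (Z : g_sigma_algebraType V0 -> R) ->
  (forall w, `|Y w| <= 1) -> itg P Z ->
  Ex P (fun w => Y w * Z w) = Ex P Y * Ex P Z.
Proof.
move=> mU mV iUV mY mZ Y1 iZ.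
have beta0 := beta_mix_indep iUV mU mV.
have mY' : measurable_fun [set: T] Y by move=> _ B mB; apply: mU; exact: mY.
have iY : itg P Y by exact: (itg_bounded P mY' Y1).
have bdd01 (p W : T -> R) (c : R) :
    measurable_fun [set: g_sigma_algebraType U0] (p : g_sigma_algebraType U0 -> R) ->
    measurable_fun [set: g_sigma_algebraType V0] (W : g_sigma_algebraType V0 -> R) ->
    (forall w, 0 <= p w <= 1) -> 0 <= c -> (forall w, `|W w| <= c) ->
    Ex P (fun w => p w * W w) <= Ex P p * Ex P W.
  move=> mp mW p01 c0 Wc.
  have := @beta_cov _ _ _ P U0 V0 unit (fun=> p) (fun=> W) c mU mV (fun=> mp) (fun=> mW)
    (fun=> fun w => proj1 (andP (p01 w))) _ c0 (fun=> Wc).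
  have E (f : T -> R) : (fun w => \sum_(g : unit) f w) = f.
    by apply/funext => w; rewrite big_const card_unit /= addr0.
  rewrite (E (fun w => p w * W w)) big_const card_unit /= addr0 => H.
  rewrite -subr_le0 (le_trans (H _))//.
    by move=> w; rewrite big_const card_unit /= addr0; have /andP[] := p01 w.
  by rewrite mulr_ge0_le0// mulr_ge0_le0.
have bdd (p W : T -> R) (c : R) :
    measurable_fun [set: g_sigma_algebraType U0] (p : g_sigma_algebraType U0 -> R) ->
    measurable_fun [set: g_sigma_algebraType V0] (W : g_sigma_algebraType V0 -> R) ->
    (forall w, `|p w| <= 1) -> 0 <= c -> (forall w, `|W w| <= c) ->
    Ex P (fun w => p w * W w) <= Ex P p * Ex P W.
  move=> mp mW p01 c0 Wc.
  have mp' : measurable_fun [set: T] p by move=> _ B mB; apply: mU; exact: mp.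
  have mW' : measurable_fun [set: T] W by move=> _ B mB; apply: mV; exact: mW.
  have ip : itg P p by exact: (itg_bounded P mp' p01).
  have iW : itg P W by exact: (itg_bounded P mW' Wc).
  have ipW : itg P (fun w => p w * W w) by exact: (itgM mp' p01).
  pose p2 w := 2^-1 * (p w + 1).
  have := bdd01 p2 W c _ mW _ c0 Wc.
  rewrite (_ : (fun w => p2 w * W w) = (fun w => 2^-1 * (p w * W w + W w))); last first.
    by apply/funext => w; rewrite /p2; ring.
  rewrite ExZ ?ExD//; last exact: itgD.
  rewrite [Ex P p2]ExZ ?ExD//; try exact: itg_cst; last by apply: itgD => //; exact: itg_cst.
  rewrite Ex_cst -mulrA ler_pM2l ?invr_gt0// mulrDl mul1r lerD2r; apply.
    by apply: measurable_funM => //; exact: measurable_funD.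
  move=> w; have := p01 w; rewrite ler_norml /p2 => /andP[? ?].
  by apply/andP; split; lra.
have bddE (W : T -> R) (c : R) :
    measurable_fun [set: g_sigma_algebraType V0] (W : g_sigma_algebraType V0 -> R) ->
    0 <= c -> (forall w, `|W w| <= c) ->
    Ex P (fun w => Y w * W w) = Ex P Y * Ex P W.
  move=> mW c0 Wc; apply/eqP; rewrite eq_le (bdd _ _ c)//=.
  have mW' : measurable_fun [set: T] W by move=> _ B mB; apply: mV; exact: mW.
  have iW : itg P W by exact: (itg_bounded P mW' Wc).
  have := bdd Y (fun w => - 1 * W w) c mY _ Y1 c0 _.
  rewrite (_ : (fun w => Y w * (- 1 * W w)) = (fun w => -1 * (Y w * W w))); last first.
    by apply/funext => w; ring.
  rewrite !ExZ//; last exact: (itgM mY' Y1).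
  rewrite mulrCA !mulN1r lerN2; apply; first exact: measurable_funM.
  by move=> w; rewrite mulN1r normrN.
apply/eqP; rewrite -subr_eq0 -normr_le0; apply/ler_addgt0Pr => e e0; rewrite add0r.
have [M HM] := Ex_truncation iZ (divr_gt0 e0 (ltr0Sn R 1)).
pose W w := Num.max (- M%:R) (Num.min M%:R (Z w)).
have mW : measurable_fun [set: g_sigma_algebraType V0] (W : g_sigma_algebraType V0 -> R).
  by apply: measurable_maxr => //; apply: measurable_minr.
have mW' : measurable_fun [set: T] W by move=> _ B mB; apply: mV; exact: mW.
have WM w : `|W w| <= M%:R.
  rewrite ler_norml /W le_max lexx/= ge_max ge_min lexx/= andbT.
  by have := ler0n R M; lra.
have iW : itg P W by exact: (itg_bounded P mW' WM).
have iYZ := itgM mY' Y1 iZ; have iYW := itgM mY' Y1 iW.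
have iD : itg P (fun w => `|W w - Z w|) by apply/integrable_norm/itgB.
have := bddE W M%:R mW (ler0n _ _) WM => EW.
have -> : Ex P (fun w => Y w * Z w) - Ex P Y * Ex P Z =
  - (Ex P (fun w => Y w * W w) - Ex P (fun w => Y w * Z w)) + Ex P Y * (Ex P W - Ex P Z).
  by rewrite EW; ring.
have absEx (f : T -> R) : itg P f -> `|Ex P f| <= Ex P (fun w => `|f w|).
  by move=> fi; exact: le_normr_Rintegral.
rewrite -!ExB// (le_trans (ler_normD _ _))// normrN normrM (splitr e); apply: lerD.
  rewrite (le_trans (absEx _ _))//; first exact: itgB.
  apply: le_trans HM; apply: le_Ex => //; first exact/integrable_norm/itgB.
  by move=> w; rewrite -mulrBr normrM ler_piMl.
apply: (@le_trans _ _ (1 * (e / 2))); last by rewrite mul1r.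
apply: ler_pM => //.
  rewrite (le_trans (absEx _ _))// -[leRHS](Ex_cst P); apply: le_Ex => //.
    exact: integrable_norm.
  exact: itg_cst.
by apply: le_trans HM; apply: absEx; exact: itgB.
Qed.

End Independence.

(** * The log-sum-exp potential *)

Section LogSumExp.
Context {R : realType} {G : finType}.
Hypothesis G0 : (0 < #|G|)%N.
Implicit Types S s : G -> R.

Definition lse S : R := ln (\sum_g expR (S g)).
Definition softmax S (g : G) : R := expR (S g) / \sum_h expR (S h).

Lemma sum_expR_gt0 S : 0 < \sum_g expR (S g).
Proof.
have /card_gt0P[g _] := G0; rewrite (bigD1 g)//= ltr_wpDr ?expR_gt0//.
by apply: sumr_ge0 => h _; exact: expR_ge0.
Qed.

Lemma lse_ge S g : S g <= lse S.
Proof.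
rewrite /lse -[leLHS]expRK ler_ln ?posrE ?expR_gt0 ?sum_expR_gt0//.
by rewrite (bigD1 g)//= lerDl; apply: sumr_ge0 => h _; exact: expR_ge0.
Qed.

Lemma lse0 : lse (fun=> 0) = ln #|G|%:R.
Proof. by rewrite /lse expR0 sumr_const. Qed.

Lemma softmax_ge0 S g : 0 <= softmax S g.
Proof. by rewrite divr_ge0 ?expR_ge0// ltW// sum_expR_gt0. Qed.

Lemma softmax_sum S : \sum_g softmax S g = 1.
Proof. by rewrite -mulr_suml divff// gt_eqF// sum_expR_gt0. Qed.

Lemma softmax_le1 S g : softmax S g <= 1.
Proof.
rewrite -(softmax_sum S) (bigD1 g)//= lerDl.
by apply: sumr_ge0 => h _; exact: softmax_ge0.
Qed.

(** The ratio of the two sums of exponentials is 1 plus the softmax average of e^s - 1, and ln(1 +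
    x) <= x. *)
Lemma lseD S s :
  lse (fun g => S g + s g) <= lse S + \sum_g softmax S g * (expR (s g) - 1).
Proof.
rewrite -lerBlDl /lse -ln_div ?posrE ?sum_expR_gt0//.
set x := \sum_g softmax _ _ * _.
have E : (\sum_g expR (S g + s g)) / (\sum_g expR (S g)) = 1 + x.
  rewrite /x; under [in RHS]eq_bigr do rewrite mulrBr mulr1.
  rewrite sumrB softmax_sum addrC subrK mulr_suml; apply: eq_bigr => g _.
  by rewrite expRD /softmax mulrAC.
rewrite E; apply: le_ln1Dx.
have : 0 < 1 + x by rewrite -E divr_gt0 ?sum_expR_gt0.
by move=> H; lra.
Qed.

(** A crude bound whose purpose is the integrability of the potential. *)
Lemma lse_abs S : `|lse S| <= ln #|G|%:R + \sum_g `|S g|.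
Proof.
have SB g : `|S g| <= \sum_h `|S h|.
  by rewrite (bigD1 g)//= lerDl; apply: sumr_ge0.
have /card_gt0P[g _] := G0.
have G1 : 0 < #|G|%:R :> R by rewrite ltr0n.
have lnG : 0 <= ln (#|G|%:R : R) by rewrite ln_ge0// ler1n.
rewrite ler_norml; apply/andP; split.
  apply: le_trans (lse_ge S g).
  have := SB g; have := ler_norm (- S g); rewrite normrN => h1 h2.
  by rewrite lerNl; lra.
rewrite /lse -[X in _ + X]expRK -lnM ?posrE ?expR_gt0//.
rewrite ler_ln ?posrE ?sum_expR_gt0 ?mulr_gt0 ?expR_gt0//.
rewrite mulr_natl -sumr_const; apply: ler_sum => h _; rewrite ler_expR.
exact: le_trans (ler_norm _) (SB h).
Qed.

End LogSumExp.

Section LseMeasurable.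
Context {R : realType} {G : finType}.
Hypothesis G0 : (0 < #|G|)%N.

Lemma eq_le1 (x : R) : x = 1 -> x <= 1.
Proof. by move=> ->. Qed.

Lemma measurable_lse d (S : measurableType d) (f : G -> S -> R) :
  (forall g, measurable_fun [set: S] (f g)) ->
  measurable_fun [set: S] (fun x => lse (f^~ x)).
Proof.
move=> mf; apply: (measurableT_comp (@measurable_ln R)).
apply: measurable_sum => g; exact: measurableT_comp.
Qed.

Lemma softmaxE (S : G -> R) g : softmax S g = expR (S g - lse S).
Proof. by rewrite expRB /lse lnK// posrE sum_expR_gt0. Qed.

Lemma measurable_softmax d (S : measurableType d) (f : G -> S -> R) g :
  (forall g, measurable_fun [set: S] (f g)) ->
  measurable_fun [set: S] (fun x => softmax (f^~ x) g).
Proof.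
move=> mf; under eq_fun do rewrite softmaxE.
apply: (measurableT_comp (@measurable_expR R)); apply: measurable_funB => //.
exact: measurable_lse.
Qed.

Context {dT : measure_display} {T : measurableType dT}.
Variable P : probability T R.

(** The potential starts at ln #|G|, its value for empty sums, and [lseD] bounds each expected
    increase. *)
Lemma lse_chain (s : nat -> G -> T -> R) (e : nat -> R) n :
  (forall k g, (k < n)%N -> itg P (s k g)) ->
  (forall k g, (k < n)%N -> itg P (fun w => expR (s k g w))) ->
  (forall k, (k < n)%N -> Ex P (fun w => \sum_g
     softmax (fun h => \sum_(i < k) s i h w) g * (expR (s k g w) - 1)) <= e k) ->
  itg P (fun w => lse (fun g => \sum_(i < n) s i g w)) /\
  Ex P (fun w => lse (fun g => \sum_(i < n) s i g w)) <= ln #|G|%:R + \sum_(k < n) e k.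
Proof.
move=> is_ ie He.
have iS k g : (k <= n)%N -> itg P (fun w => \sum_(i < k) s i g w).
  by move=> kn; apply: itg_sum => i _; apply: is_; apply: leq_trans kn.
have il k : (k <= n)%N -> itg P (fun w => lse (fun g => \sum_(i < k) s i g w)).
  move=> kn; apply: (@itg_le _ _ _ _ _ (fun w => ln #|G|%:R + \sum_g `|\sum_(i < k) s i g w|)).
  - by apply: measurable_lse => g; apply: itg_meas; exact: iS.
  - apply: itgD; first exact: itg_cst.
    by apply: itg_sum => g _; apply: integrable_norm; exact: iS.
  - move=> w; rewrite (le_trans (lse_abs G0 _))//; exact: ler_norm.
split; first exact: il.
suff H k : (k <= n)%N -> Ex P (fun w => lse (fun g => \sum_(i < k) s i g w))
    <= ln #|G|%:R + \sum_(i < k) e i by exact: H.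
elim: k => [_|k IH kn].
  rewrite big_ord0 addr0 -[leRHS](Ex_cst P); apply: le_Ex; [exact: il|exact: itg_cst|].
  move=> w; rewrite -lse0 (_ : (fun g => _) = (fun=> 0))//.
  by apply/funext => g; rewrite big_ord0.
rewrite big_ord_recr /= addrA; apply: le_trans (lerD (IH (ltnW kn)) (He k kn)).
have im g : itg P (fun w => softmax (fun h => \sum_(i < k) s i h w) g * (expR (s k g w) - 1)).
  apply: (itgM (c := 1)).
  - by apply: measurable_softmax => h; apply: itg_meas; apply: iS; exact: ltnW.
  - by move=> w; rewrite ger0_norm ?softmax_ge0 ?softmax_le1.
  - by apply: itgB; [exact: ie|exact: itg_cst].
rewrite -ExD; [|exact/il/ltnW|by apply: itg_sum].
apply: le_Ex; first exact: il.
  by apply: itgD; [exact/il/ltnW|apply: itg_sum].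
move=> w; apply: le_trans (lseD G0 _ _).
rewrite (_ : (fun g => \sum_(i < k.+1) _) = (fun g => \sum_(i < k) s i g w + s k g w))//.
by apply/funext => g; rewrite big_ord_recr.
Qed.

End LseMeasurable.

(** * Maximal inequality for losses under mixing *)

Section MixingMaximal.
Context {dT : measure_display} {T : measurableType dT} {R : realType}.
Variable P : probability T R.
Variables (d r : nat) (X : int -> T -> 'cV[R]_d).
Hypothesis r0 : (0 < r)%N.
Hypothesis mX : forall i, random_vector (X i).
Hypothesis stX : stationary P X.

Lemma spath0 w : spath X 0 w = X^~ w.
Proof. by apply/funext => i; rewrite /spath addr0. Qed.

(** The base point [r] is the least time whose lag vector uses positive times alone, so it fits into
    [window r]. *)
Lemma lags_spath h w j : lags r (spath X h w) j = lags r (spath X (h + j - r%:Z) w) r%:Z.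
Proof.
rewrite /lags; congr (_^T); congr mxvec; apply/matrixP => k l; rewrite !mxE /spath.
by congr (X _ w l ord0); lia.
Qed.

Lemma Ex_spath n h (F : (int -> 'cV[R]_d) -> R) (c : R) :
  measurable_fun [set: pathT (window n)] (F : pathT (window n) -> R) ->
  (forall x, `|F x| <= c) ->
  Ex P (fun w => F (spath X 0 w)) = Ex P (fun w => F (spath X h w)).
Proof.
move=> mF Fc.
have i0 h' : itg P (fun w => F (spath X h' w)).
  apply: (itg_bounded P (c := c)) => [|w]; last exact: Fc.
  exact: (measurableT_comp mF (spath_measurable mX h')).
apply: (@Ex_transfer _ _ _ P _ (pathT (window n)) (spath X 0) (spath X h) F) => //;
  try exact: spath_measurable; try exact: i0.
by move=> A mA; exact: (spath_stationary stX h mA).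
Qed.

Lemma Ex_lags (f : 'cV[R]_(r * d) -> R) (c : R) h j :
  measurable_fun [set: borel R (r * d)] (f : borel R (r * d) -> R) ->
  (forall x, `|f x| <= c) ->
  Ex P (fun w => f (lags r (spath X h w) j)) = Ex P (fun w => f (lags r (X^~ w) r%:Z)).
Proof.
move=> mf fc.
under eq_Ex do rewrite lags_spath.
under [RHS]eq_Ex do rewrite -spath0.
apply/esym; apply: (@Ex_spath r _ (fun x => f (lags r x r%:Z)) c) => //.
apply: (measurableT_comp mf); apply: lags_measurable => k kr.
by rewrite /window /=; lia.
Qed.

Variables (G : finType) (Y : G -> 'cV[R]_(r * d) -> R) (B : R).
Hypothesis G0 : (0 < #|G|)%N.
Hypothesis B0 : 0 < B.
Hypothesis mY : forall g, measurable_fun [set: borel R (r * d)] (Y g : borel R (r * d) -> R).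
Hypothesis YB : forall g x, 0 <= Y g x <= B.

Let lam := (2 * B)^-1.
Let m g := Ex P (fun w => Y g (lags r (X^~ w) r%:Z)).

(** Time steps outside the residue class [o] contribute zero, so consecutive active steps are [Q]
    apart. The factor 1/(2 B) brings the increment into [-1, 1/2], where e^s - 1 has modulus at most
    1. *)
Definition mix_incr (Q o k : nat) (g : G) (x : int -> 'cV[R]_d) : R :=
  if (k %% Q)%N == o then (2 * B)^-1 *
     (Ex P (fun w => Y g (lags r (X^~ w) r%:Z)) - 2 * Y g (lags r x (r + k)%:Z)) else 0.

Let mYT g : measurable_fun [set: T] (fun w => Y g (lags r (X^~ w) r%:Z)).
Proof.
have mL : measurable_fun [set: T] (fun w => lags r (X^~ w) r%:Z : borel R (r * d)).
  have := measurableT_comp (@lags_measurable R d setT r r%:Z (fun _ _ => I))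
    (@spath_measurable R d dT T X mX setT 0).
  by rewrite /comp; under eq_fun do rewrite spath0.
exact: (measurableT_comp (mY g) mL).
Qed.

Let mB g : 0 <= m g <= B.
Proof.
have iY : itg P (fun w => Y g (lags r (X^~ w) r%:Z)).
  by apply: (itg_bounded P (mYT g) (c := B)) => w; rewrite ger0_norm; have /andP[] := YB g (lags r (X^~ w) r%:Z).
apply/andP; split; first by apply: Ex_ge0 => w; have /andP[] := YB g (lags r (X^~ w) r%:Z).
rewrite -(Ex_cst P B); apply: le_Ex => //; first exact: itg_cst.
by move=> w; have /andP[] := YB g (lags r (X^~ w) r%:Z).
Qed.

Lemma mix_incr_bounds Q o k g x : -1 <= mix_incr Q o k g x <= 2^-1.
Proof.
rewrite /mix_incr; case: eqP => _; last by apply/andP; split; lra.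
have /andP[m0 m1] := mB g; have /andP[y0 y1] := YB g (lags r x (r + k)%:Z).
rewrite -/(m g) mulrC ler_pdivlMr ?mulr_gt0// ler_pdivrMr ?mulr_gt0//.
by apply/andP; split; lra.
Qed.

Lemma mix_incr_measurable (J : set int) Q o k g :
  (forall l : nat, (k %% Q)%N = o -> (l < r)%N -> J (r%:Z + k%:Z - l%:Z)) ->
  measurable_fun [set: pathT J] (mix_incr Q o k g : pathT J -> R).
Proof.
move=> HJ; rewrite /mix_incr; case: eqP => ko //.
apply: measurable_funM => //; apply: measurable_funB => //; apply: measurable_funM => //.
apply: (measurableT_comp (mY g)); apply: lags_measurable => l lr.
by rewrite PoszD; exact: HJ.
Qed.

Lemma expR_half_lt2 : expR (2^-1 : R) <= 2.
Proof.
have : expR (2^-1 : R) * expR (2^-1) <= 4; last first.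
  have := expR_gt0 (2^-1 : R); set x := expR _ => x0 H.
  rewrite leNgt; apply/negP => x2.
  have : 2 * 2 < x * x by rewrite ltr_pM.
  lra.
rewrite -expRD (_ : 2^-1 + 2^-1 = 1 :> R); last by lra.
(* 1/4 = (1/2)^2 <= e^(-1/2) e^(-1/2) *)
have h : 2^-1 <= expR (- 2^-1 : R) by apply: le_trans (expR_ge1Dx _); lra.
rewrite -[leLHS]invrK -expRN -[leRHS]invrK lef_pV2 ?posrE ?expR_gt0 ?invr_gt0//.
have -> : -1 = - 2^-1 + - 2^-1 :> R by lra.
rewrite expRD; apply: le_trans (ler_pM _ _ h h) => //; lra.
Qed.

Lemma mix_incr_abs Q o k g x : `|expR (mix_incr Q o k g x) - 1| <= 1.
Proof.
have /andP[h1 h2] := mix_incr_bounds Q o k g x.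
have e0 := expR_gt0 (mix_incr Q o k g x).
have : expR (mix_incr Q o k g x) <= 2.
  by apply: le_trans expR_half_lt2; rewrite ler_expR.
by rewrite ler_norml => e2; apply/andP; split; lra.
Qed.

(* [e^(-2 lam y) <= 1 - lam y] on [0, B], since [lam = 1 / (2 B)]. *)
Lemma Ex_expR_mix_incr Q o k g h :
  Ex P (fun w => expR (mix_incr Q o k g (spath X h w)) - 1) <= 0.
Proof.
rewrite /mix_incr; case: eqP => ko; last first.
  by under eq_Ex do rewrite expR0 subrr; rewrite Ex_cst.
rewrite -/(m g).
have mF : measurable_fun [set: borel R (r * d)]
   (fun x => expR ((2 * B)^-1 * (m g - 2 * Y g x)) - 1 : R).
  apply: measurable_funB => //; apply: (measurableT_comp (@measurable_expR R)).
  by apply: measurable_funM => //; apply: measurable_funB => //; apply: measurable_funM.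
have Fc (x : 'cV[R]_(r * d)) : `|expR ((2 * B)^-1 * (m g - 2 * Y g x)) - 1| <= 1.
  have e0 := expR_gt0 ((2 * B)^-1 * (m g - 2 * Y g x)).
  have : expR ((2 * B)^-1 * (m g - 2 * Y g x)) <= 2.
    apply: le_trans expR_half_lt2; rewrite ler_expR mulrC ler_pdivrMr ?mulr_gt0//.
    by have /andP[m0 m1] := mB g; have /andP[y0 y1] := YB g x; lra.
  by rewrite ler_norml => e2; apply/andP; split; lra.
rewrite (@Ex_lags (fun x => expR ((2 * B)^-1 * (m g - 2 * Y g x)) - 1) 1 h _ mF Fc).
have E x : expR ((2 * B)^-1 * (m g - 2 * Y g x)) - 1 <=
    expR (lam * m g) * (1 - lam * Y g x) - 1.
  rewrite lerB// mulrBr expRD ler_wpM2l ?expR_ge0//.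
  have /andP[y0 yB] := YB g x.
  set t := lam * Y g x.
  have t0 : 0 <= t by rewrite mulr_ge0// invr_ge0 mulr_ge0// ltW.
  have t1 : t <= 2^-1.
    by rewrite /t /lam mulrC ler_pdivrMr ?mulr_gt0//; lra.
  have -> : - (lam * (2 * Y g x)) = - (2 * t) by rewrite /t mulrCA.
  (* e^(-2t) = 1 / e^(2t) <= 1 / (1 + 2t) <= 1 - t *)
  rewrite expRN; have h1 := expR_ge1Dx (2 * t).
  have : (expR (2 * t))^-1 <= (1 + 2 * t)^-1 by rewrite lef_pV2 ?posrE ?expR_gt0//; lra.
  move=> h2; apply: (le_trans h2); rewrite -[leLHS]mul1r ler_pdivrMr; last lra.
  have : 0 <= t * (2^-1 - t) by apply: mulr_ge0 => //; lra.
  lra.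
have iY : itg P (fun w => Y g (lags r (X^~ w) r%:Z)).
  by apply: (itg_bounded P (mYT g) (c := B)) => w; rewrite ger0_norm; have /andP[] := YB g (lags r (X^~ w) r%:Z).
have i2 : itg P (fun w => 1 - lam * Y g (lags r (X^~ w) r%:Z)).
  by apply: itgB; [exact: itg_cst|exact: itgZ].
apply: (@le_trans _ _ (Ex P (fun w => expR (lam * m g) * (1 - lam * Y g (lags r (X^~ w) r%:Z)) - 1))).
  apply: le_Ex.
  - apply: (itg_bounded P (c := 1)) => [|w]; last exact: Fc.
    have mL : measurable_fun [set: T] (fun w => lags r (X^~ w) r%:Z : borel R (r * d)).
      have := measurableT_comp (@lags_measurable R d setT r r%:Z (fun _ _ => I))
        (@spath_measurable R d dT T X mX setT 0).
      by rewrite /comp; under eq_fun do rewrite spath0.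
    exact: (measurableT_comp mF mL).
  - by apply: itgB; [exact: itgZ|exact: itg_cst].
  - by move=> w; exact: E.
rewrite ExB ?Ex_cst ?ExZ ?ExB ?ExZ ?Ex_cst//; try exact: itg_cst; try exact: itgZ.
rewrite -/(m g) subr_le0.
have : 1 - lam * m g <= expR (- (lam * m g)) by apply: le_trans (expR_ge1Dx _); lra.
move=> h1; apply: le_trans (ler_wpM2l (expR_ge0 _) h1) _.
by rewrite expRxMexpNx_1.
Qed.

(** An active step i before the active step k satisfies i + Q <= k, so it reads times up to r + i <=
    k + 1 - q, whereas step k reads the times k + 1, ..., k + r. Requiring this gap to be [q] fixes
    Q = q + r - 1. *)
Lemma mixing_maximal_offset (q o n : nat) :
  let Q := (q + r).-1 in
  itg P (fun w => lse (fun g => \sum_(k < n) mix_incr Q o k g (X^~ w))) /\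
  Ex P (fun w => lse (fun g => \sum_(k < n) mix_incr Q o k g (X^~ w)))
    <= ln #|G|%:R + \sum_(k < n) (if (k %% Q)%N == o then 2 * beta_mix P X q else 0).
Proof.
move=> Q.
have mi J k g : (forall l : nat, (l < r)%N -> J (r%:Z + k%:Z - l%:Z)) ->
  measurable_fun [set: pathT J] (mix_incr Q o k g : pathT J -> R).
  by move=> HJ; apply: mix_incr_measurable => l _; exact: HJ.
have msT h k g : measurable_fun [set: T] (fun w => mix_incr Q o k g (spath X h w)).
  exact: (measurableT_comp (mi setT k g (fun _ _ => I)) (spath_measurable mX h)).
have E k g : (fun w => mix_incr Q o k g (X^~ w)) = (fun w => mix_incr Q o k g (spath X 0 w)).
  by apply/funext => w; rewrite spath0.
apply: (@lse_chain _ _ G0 _ _ P (fun k g w => mix_incr Q o k g (X^~ w))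
  (fun k => if (k %% Q)%N == o then 2 * beta_mix P X q else 0)).
- move=> k g kn; rewrite E; apply: (itg_bounded P (c := 1)) => [|w]; first exact: msT.
  have /andP[? ?] := mix_incr_bounds Q o k g (spath X 0 w).
  by rewrite ler_norml; apply/andP; split; lra.
- move=> k g kn; apply: (itg_bounded P (c := 2)) => [|w].
    by apply: measurableT_comp => //; rewrite E; exact: msT.
  rewrite ger0_norm ?expR_ge0//; have := mix_incr_abs Q o k g (X^~ w).
  by rewrite ler_norml => /andP[? ?]; lra.
move=> k kn; case: eqP => ko; last first.
  rewrite -[leRHS](Ex_cst P); rewrite le_eqVlt; apply/orP; left; apply/eqP/eq_Ex => w; rewrite big1// => g _.
  by rewrite /mix_incr (negbTE (introN eqP ko)) expR0 subrr mulr0.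
pose Pi g (x : int -> 'cV[R]_d) := softmax (fun h => \sum_(i < k) mix_incr Q o i h x) g.
pose Z g (x : int -> 'cV[R]_d) := expR (mix_incr Q o k g x) - 1.
pose J1 := [set i : int | 1 <= i <= k%:Z + 1 - q%:Z].
pose J2 := [set i : int | k%:Z + 1 <= i <= (r + n)%:Z].
have mPi1 g : measurable_fun [set: pathT J1] (Pi g : pathT J1 -> R).
  apply: measurable_softmax => // f; apply: measurable_sum => i.
  apply: mix_incr_measurable => l io lr; rewrite /J1 /=.
  have ik : (i + Q <= k)%N.
    have /eqP := etrans ko (esym io); rewrite eqn_mod_dvd; last exact/ltnW/ltn_ord.
    by move=> /dvdn_leq; rewrite subn_gt0 => /(_ (ltn_ord i)); lia.
  by rewrite /Q in ik; lia.
have mZ2 g : measurable_fun [set: pathT J2] (Z g : pathT J2 -> R).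
  apply: measurable_funB => //; apply: measurableT_comp => //.
  by apply: mi => l lr; rewrite /J2 /=; lia.
have J1n : J1 `<=` window (r + n) by move=> i; rewrite /J1 /window /=; lia.
have J2n : J2 `<=` window (r + n) by move=> i; rewrite /J2 /window /=; lia.
have mPi g := path_fun_sub J1n (mPi1 g).
have mZ g := path_fun_sub J2n (mZ2 g).
have Pi01 g x : 0 <= Pi g x <= 1 by rewrite softmax_ge0 ?softmax_le1.
have Z1 g x : `|Z g x| <= 1 by exact: mix_incr_abs.
(* This shift takes the last past time k + 1 - q to 0 and the first future time k + 1 to [q]. *)
pose h : int := q%:Z - k%:Z - 1.
under eq_Ex do rewrite -spath0.
rewrite -/(Pi _ _) (@Ex_spath (r + n) h (fun x => \sum_g Pi g x * Z g x) 1); last first.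
- move=> x; rewrite (le_trans (ler_norm_sum _ _ _))//.
  rewrite -(softmax_sum G0 (fun h => \sum_(i < k) mix_incr Q o i h x)); apply: ler_sum => g _.
  rewrite normrM ger0_norm; last by have /andP[] := Pi01 g x.
  by rewrite ler_piMr//; have /andP[] := Pi01 g x.
- by apply: measurable_sum => g; apply: measurable_funM.
have sub J J' h' : (forall i, J i -> J' (i + h')) ->
   measurable_fun [set: g_sigma_algebraType (\bigcup_(i in J')
        preimage_set_system [set: T] (X i : T -> borel R d) measurable)]
     (spath X h' : _ -> pathT J).
  move=> HJ _ A mA; rewrite setTI; exact: (@spath_sigma _ _ _ _ X J J' h' A HJ mA).
have HJ1 i : J1 i -> [set i : int | i <= 0] (i + h) by rewrite /J1 /h /=; lia.
have HJ2 i : J2 i -> [set i : int | q%:Z <= i] (i + h) by rewrite /J2 /h /=; lia.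
have := @beta_cov _ _ _ P _ _ G (fun g w => Pi g (spath X h w))
   (fun g w => Z g (spath X h w)) 1
   (@sigma_of_measurable _ _ _ _ X mX [set i | i <= 0])
   (@sigma_of_measurable _ _ _ _ X mX [set i | q%:Z <= i])
   (fun g => measurableT_comp (mPi1 g) (sub _ _ h HJ1))
   (fun g => measurableT_comp (mZ2 g) (sub _ _ h HJ2))
   (fun g w => proj1 (andP (Pi01 g _))) _ ler01 (fun g w => Z1 g _).
rewrite mul1r => H; have {}H := H (fun w => eq_le1 (softmax_sum G0 _)).
(* The weights are nonnegative and each exponential increment has expectation at most 1, so the
   decoupled sum is nonpositive and only the mixing error remains. *)
suff H0 : \sum_g Ex P (fun w => Pi g (spath X h w)) * Ex P (fun w => Z g (spath X h w)) <= 0.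
  by move: H; rewrite /beta_mix; lra.
apply: sumr_le0 => g _; apply: mulr_ge0_le0; last exact: Ex_expR_mix_incr.
by apply: Ex_ge0 => w; have /andP[] := Pi01 g (spath X h w).
Qed.

End MixingMaximal.

(** The falling factorial of 2j of length j has factors at least j, and it equals j! times the
    central binomial coefficient, which is at most 4^j. *)
Lemma expn_self_le_fact j : (j ^ j <= 4 ^ j * j`!)%N.
Proof.
apply: (@leq_trans ((j + j) ^_ j)).
  have H m : (j ^ m <= (j + m) ^_ m)%N.
    elim: m => // m IH; rewrite addnS ffactSS expnS; apply: leq_mul => //; lia.
  exact: H.
rewrite -bin_ffact leq_mul2r; apply/orP; right.
rewrite (_ : (4 ^ j = 2 ^ (j + j))%N); last by rewrite addnn -mul2n expnM.
rewrite -[2%N]/(1 + 1)%N Pascal.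
have jj : (j < (j + j).+1)%N by lia.
rewrite (bigD1 (Ordinal jj))//=; rewrite !exp1n !muln1; exact: leq_addr.
Qed.

(** * Exponential moments of sub-Gaussian variables *)

Section SubGaussian.
Context {dT : measure_display} {T : measurableType dT} {R : realType}.
Variable P : probability T R.

Lemma expR_nneseries (x : R) : 0 <= x ->
  (expR x)%:E = (\sum_(n <oo) (exp_coeff x n)%:E)%E.
Proof.
move=> x0; rewrite /expR -EFin_lim; last exact: is_cvg_series_exp_coeff.
by congr (limn _); apply/funext => n; rewrite /= /series /= sumEFin.
Qed.

Lemma measurable_EFinf (f : T -> R) : measurable_fun [set: T] f ->
  measurable_fun [set: T] (fun w => (f w)%:E).
Proof. by move=> mf; apply/measurable_EFinP. Qed.

(** An infinite integral would make the left side of the hypothesis infinite; hence the moment is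
    finite and both sides may be raised to the power k. *)
Lemma moment_powR (Z : T -> R) (k : nat) (y : R) : (0 < k)%N -> 0 <= y ->
  (('E_P[fun w => (`|Z w| ^+ k)%R] `^ (k%:R^-1)) <= y%:E)%E ->
  (\int[P]_w (`|Z w| ^+ k)%:E <= (y ^+ k)%:E)%E.
Proof.
move=> k0 y0; rewrite unlock.
have : (0 <= \int[P]_w (`|Z w| ^+ k)%:E)%E by apply: integral_ge0 => w _; rewrite lee_fin.
have k0' : k%:R != 0 :> R by rewrite pnatr_eq0 -lt0n.
case: (\int[P]_w _)%E => [x| |]//.
- rewrite poweR_EFin !lee_fin => x0 H.
  rewrite -[leLHS](powRr1 x0) -(mulVf k0') powRrM powR_mulrn ?powR_ge0//.
  by rewrite lerXn2r// nnegrE ?powR_ge0.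
- by rewrite poweRyr ?invr_eq0.
Qed.

(** The term of order j of the exponential series involves the moment of order 2j, at most (2 C^2
    j)^j. With j^j <= 4^j j! the constant 16 makes this term at most 2^(-j), and the geometric
    series sums to at most 2. *)
Lemma expR_sqr_integral (Z : T -> R) (C : R) : measurable_fun [set: T] Z -> 0 < C ->
  (forall k : nat, (0 < k)%N -> (('E_P[fun w => (`|Z w| ^+ k)%R] `^ (k%:R^-1))
        <= (C * Num.sqrt k%:R)%:E)%E) ->
  (\int[P]_w (expR ((16 * C ^+ 2)^-1 * Z w ^+ 2))%:E <= 2%:E)%E.
Proof.
move=> mZ C0 HZ.
set a := (16 * C ^+ 2)^-1.
have a0 : 0 <= a by rewrite invr_ge0 mulr_ge0// sqr_ge0.
have aZ w : 0 <= a * Z w ^+ 2 by rewrite mulr_ge0// sqr_ge0.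
under eq_integral do rewrite expR_nneseries//.
rewrite integral_nneseries//; last 2 first.
- move=> n; apply: measurable_EFinf; apply: measurable_funM => //.
  by apply: measurable_funX; apply: measurable_funM => //; exact: measurable_funX.
- by move=> n w _; rewrite lee_fin exp_coeff_ge0.
have mom j : (\int[P]_w (exp_coeff (a * Z w ^+ 2) j)%:E <= ((2^-1) ^+ j)%:E)%E.
  have E w : (exp_coeff (a * Z w ^+ 2) j)%:E =
      ((a ^+ j / j`!%:R)%:E * (`|Z w| ^+ (2 * j))%:E)%E.
    rewrite -EFinM /exp_coeff /= exprMn exprM -(real_normK (num_real (Z w))).
    by congr _%:E; ring.
  under eq_integral do rewrite E.
  rewrite ge0_integralZl//; last 2 first.
  - by apply: measurable_EFinf; apply: measurable_funX; exact: measurableT_comp.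
  - by rewrite lee_fin divr_ge0// exprn_ge0.
  case: j {E} => [|j].
    rewrite muln0 expr0; under eq_integral do rewrite expr0.
    rewrite integral_cst// fact0 divr1 !expr0 mul1e mul1e.
    exact: probability_le1.
  have y0 : 0 <= C * Num.sqrt (2 * j.+1)%:R by rewrite mulr_ge0 ?sqrtr_ge0// ltW.
  have k0 : (0 < 2 * j.+1)%N by [].
  have H := moment_powR k0 y0 (HZ _ k0).
  apply: (le_trans (lee_wpmul2l _ H)).
    by rewrite lee_fin divr_ge0// exprn_ge0.
  rewrite -EFinM lee_fin exprMn !exprM sqr_sqrtr// natrM.
  have -> : a ^+ j.+1 / j.+1`!%:R * ((C ^+ 2) ^+ j.+1 * (2 * j.+1%:R) ^+ j.+1) =
     ((a * C ^+ 2) * 2) ^+ j.+1 * j.+1%:R ^+ j.+1 / j.+1`!%:R.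
    by rewrite !exprMn; ring.
  have -> : a * C ^+ 2 * 2 = 8^-1.
    by rewrite /a; field; rewrite gt_eqF.
  rewrite ler_pdivrMr ?ltr0n ?fact_gt0//.
  have := expn_self_le_fact j.+1; rewrite -(ler_nat R) natrM !natrX => h.
  apply: (le_trans (ler_wpM2l _ h)); first by rewrite exprn_ge0.
  rewrite mulrA -exprMn ler_wpM2r// (_ : 8^-1 * 4%:R = 2^-1 :> R)//.
  by field.
apply: lime_le.
  apply: is_cvg_nneseries => n _ _; apply: integral_ge0 => w _.
  by rewrite lee_fin exp_coeff_ge0.
near=> n; apply: (@le_trans _ _ (\sum_(0 <= i < n) (2^-1 ^+ i : R)%:E)%E).
  by apply: lee_sum => i _; exact: mom.
rewrite sumEFin lee_fin.
have : \sum_(0 <= i < n) (2^-1 ^+ i : R) = 2 - 2 * 2^-1 ^+ n.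
  elim: (n : nat) => [|m IH]; first by rewrite big_nil expr0; ring.
  by rewrite big_nat_recr//= IH exprS; field.
move=> ->; rewrite gerBl mulr_ge0// exprn_ge0//.
Unshelve. all: by end_near. Qed.

End SubGaussian.

Section ExpInequalities.
Context {R : realType}.
Implicit Types x y z s u : R.

Lemma expR_tangent x y : expR y * (1 + (x - y)) <= expR x.
Proof.
rewrite (_ : expR x = expR y * expR (x - y)); last by rewrite -expRD addrC subrK.
by rewrite ler_wpM2l ?expR_ge0// expR_ge1Dx.
Qed.

(** Convexity of exp against the chord from 0 to z: the tangent at s z is compared with exp at z and
    at 0, with weights s and 1 - s. *)
Lemma expR_chord s z : 0 <= s <= 1 -> expR (s * z) <= 1 + s * (expR z - 1).
Proof.
move=> /andP[s0 s1].
have h1 := ler_wpM2l s0 (expR_tangent z (s * z)).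
have s1' : 0 <= 1 - s by lra.
have h2 := ler_wpM2l s1' (expR_tangent 0 (s * z)).
rewrite expR0 in h2.
have := lerD h1 h2.
have -> : s * (expR (s * z) * (1 + (z - s * z))) + (1 - s) * (expR (s * z) * (1 + (0 - s * z)))
  = expR (s * z) by ring.
lra.
Qed.

(** Jensen's inequality, by summing the tangent inequalities at the mean [m]. *)
Lemma expR_avg d (y : 'I_d -> R) : (0 < d)%N ->
  expR (d%:R^-1 * \sum_j y j) <= d%:R^-1 * \sum_j expR (y j).
Proof.
move=> d0; set m := d%:R^-1 * _.
have d0' : 0 < d%:R :> R by rewrite ltr0n.
have : \sum_j expR m * (1 + (y j - m)) <= \sum_j expR (y j).
  by apply: ler_sum => j _; exact: expR_tangent.
rewrite -mulr_sumr big_split /= sumrB !sumr_const card_ord.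
have -> : \sum_j y j = d%:R * m by rewrite /m mulrA divff ?gt_eqF// mul1r.
rewrite -[m *+ d]mulr_natl subrr addr0 => h.
by rewrite mulrC ler_pdivlMr.
Qed.

(* For y < 0 and y > 0 the bound follows from (1 - y/2)^2 <= e^(-y). *)
Lemma expR_le_addr_sqr y : expR y <= y + expR (4 * y ^+ 2).
Proof.
have [y1|y1] := ltP 1 y.
  have : expR y <= expR (4 * y ^+ 2).
    rewrite ler_expR expr2; have : y * 1 <= y * y by rewrite ler_wpM2l; lra.
    lra.
  lra.
have h1 := expR_ge1Dx (4 * y ^+ 2).
suff : expR y <= 1 + y + 4 * y ^+ 2 by lra.
have h2 : 1 - y / 2 <= expR (- y / 2) by apply: le_trans (expR_ge1Dx _); lra.
have h3 : (1 - y / 2) ^+ 2 <= expR (- y).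
  rewrite (_ : - y = - y / 2 + - y / 2); last by lra.
  rewrite expRD expr2; apply: ler_pM => //; lra.
have p0 : 0 < (1 - y / 2) ^+ 2 by apply: exprn_gt0; lra.
have : expR y <= ((1 - y / 2) ^+ 2)^-1.
  rewrite -[expR y]invrK -expRN lef_pV2 ?posrE ?expR_gt0//.
move=> h; apply: (le_trans h); rewrite -[leLHS]mul1r ler_pdivrMr//.
have -> : (1 + y + 4 * y ^+ 2) * (1 - y / 2) ^+ 2 =
  1 + y ^+ 2 * ((y - 1) * (y - 11 / 4) + 1 / 2) by field.
have : 0 <= y ^+ 2 * ((y - 1) * (y - 11 / 4) + 1 / 2).
  apply: mulr_ge0; first exact: sqr_ge0.
  have : 0 <= (1 - y) * (11 / 4 - y) by apply: mulr_ge0; lra.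
  lra.
lra.
Qed.

(** Here [u] will be a function of the past and [x] the current noise: each term is a power of [u]
    times a function of [x], so independence can separate them. The bound combines e^y <= y + e^(4
    y^2) with the chord inequality in u^2. *)
Lemma expR_linear_bound u x : `|u| <= 1 ->
  expR (u * x) <= 1 + u * x + u ^+ 2 * (expR (4 * x ^+ 2) - 1).
Proof.
move=> u1; apply: (le_trans (expR_le_addr_sqr _)).
have u2 : 0 <= u ^+ 2 <= 1.
  by rewrite sqr_ge0 /= -(real_normK (num_real u)) expr_le1.
have := expR_chord (4 * x ^+ 2) u2.
rewrite (_ : 4 * (u * x) ^+ 2 = u ^+ 2 * (4 * x ^+ 2)); last by ring.
lra.
Qed.

End ExpInequalities.

(** * Maximal inequality for the noise *)

Section NoiseMaximal.
Context {dT : measure_display} {T : measurableType dT} {R : realType}.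
Variable P : probability T R.
Variables (d r : nat).
Hypothesis d0 : (0 < d)%N.
Variables (f0 : 'cV[R]_(r * d) -> 'cV[R]_d) (X eps : int -> T -> 'cV[R]_d).
Hypothesis hmodel : autoregressive P f0 X eps.
Variable (C : R).
Hypothesis C0 : 0 < C.
Hypothesis hnoise : forall (k : nat) (j : 'I_d), (0 < k)%N ->
     (('E_P[fun w => (`|eps 1 w j ord0| ^+ k)%R] `^ (k%:R^-1))
        <= (C * Num.sqrt k%:R)%:E)%E.

Let mX i : random_vector (X i) := (proj1 hmodel) i.

Lemma eps_measurable i j : measurable_fun [set: T] (fun w => eps i w j ord0).
Proof.
case: hmodel => _ [_ [_ [_ [me _]]]].
exact: (measurableT_comp (@borel_coord_measurable R d j) (me i)).
Qed.

(** The scale 8 C makes 4 epsc(x)^2 equal to x^2 / (16 C^2), the exponent whose exponential moment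
    is at most 2. *)
Definition epsc (x : R) : R := (8 * C)^-1 * x.

Lemma expR_eps_integral i j :
  (\int[P]_w (expR (4 * (epsc (eps i w j ord0)) ^+ 2))%:E <= 2%:E)%E.
Proof.
case: hmodel => _ [_ [_ [_ [me [_ [hid _]]]]]].
pose F (x : borel R d) : \bar R := (expR (4 * epsc ((x : 'cV[R]_d) j ord0) ^+ 2))%:E.
have mF : measurable_fun [set: borel R d] F.
  apply: measurable_EFinf; apply: measurableT_comp => //.
  apply: measurable_funM => //; apply: measurable_funX; apply: measurable_funM => //.
  exact: borel_coord_measurable.
have F0 : {in [set: borel R d], forall y, (0 <= F y)%E}.
  by move=> y _; rewrite lee_fin expR_ge0.
have := ge0_integral_pushforward (me i) P measurableT mF F0.
have := ge0_integral_pushforward (me 1) P measurableT mF F0.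
rewrite !preimage_setT /comp => E1 Ei.
rewrite [leLHS](_ : _ = (\int[P]_w F (eps i w))%E)// -Ei.
rewrite [leLHS](_ : _ = (\int[P]_w F (eps 1 w))%E); last first.
  rewrite -E1; apply: eq_measure_integral => [||? ? A mA _]; [exact: (me 1)|exact: (me i)|exact: (hid i 1 A mA)].
rewrite /F; have := expR_sqr_integral (eps_measurable 1 j) C0 (fun k k0 => hnoise j k0).
congr (_ <= _)%E; apply: eq_integral => w _; congr (expR _)%:E.
by rewrite /epsc; field; rewrite gt_eqF.
Qed.

Lemma expR_eps_itg i j : itg P (fun w => expR (4 * epsc (eps i w j ord0) ^+ 2)).
Proof.
apply/integrableP; split.
  apply: measurable_EFinf; apply: measurableT_comp => //.
  apply: measurable_funM => //; apply: measurable_funX; apply: measurable_funM => //.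
  exact: eps_measurable.
under eq_integral do rewrite /= ger0_norm ?expR_ge0//.
exact: le_lt_trans (expR_eps_integral i j) (ltry _).
Qed.

Lemma expR_eps_Ex i j : Ex P (fun w => expR (4 * epsc (eps i w j ord0) ^+ 2)) <= 2.
Proof.
rewrite -lee_fin -Ex_EFin; first exact: expR_eps_integral.
exact: expR_eps_itg.
Qed.

Lemma eps_abs_le (x : R) : `|x| <= (8 * C) * expR (4 * epsc x ^+ 2).
Proof.
have C8 : 0 < 8 * C by rewrite mulr_gt0.
rewrite -ler_pdivrMl//.
have Ci : 0 <= (8 * C)^-1 by rewrite invr_ge0 ltW.
rewrite -[X in X * _](ger0_norm Ci) -normrM -/(epsc x).
apply: le_trans (expR_ge1Dx _).
have : 0 <= (`|epsc x| - 1) ^+ 2 by exact: sqr_ge0.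
rewrite -(real_normK (num_real (epsc x))) => h.
have : 0 <= `|epsc x| by []. have : 0 <= `|epsc x| ^+ 2 by exact: sqr_ge0.
lra.
Qed.

Lemma eps_itg i j : itg P (fun w => eps i w j ord0).
Proof.
apply: (@itg_le _ _ _ _ _ (fun w => (8 * C) * expR (4 * epsc (eps i w j ord0) ^+ 2))).
- exact: eps_measurable.
- by apply: itgZ; exact: expR_eps_itg.
- move=> w; apply: (le_trans (eps_abs_le _)); exact: ler_norm.
Qed.

Lemma eps_abs_Ex i j : Ex P (fun w => `|eps i w j ord0|) <= 16 * C.
Proof.
have iE := expR_eps_itg i j.
apply: (@le_trans _ _ (Ex P (fun w => (8 * C) * expR (4 * epsc (eps i w j ord0) ^+ 2)))).
  apply: le_Ex => [||w]; [apply: integrable_norm; exact: eps_itg|exact: itgZ|exact: eps_abs_le].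
rewrite ExZ// (_ : 16 * C = 8 * C * 2); last by ring.
by rewrite ler_wpM2l ?expR_eps_Ex// mulr_ge0// ltW.
Qed.

Lemma eps_Ex0 i j : Ex P (fun w => eps i w j ord0) = 0.
Proof.
case: hmodel => _ [_ [_ [_ [_ [_ [_ [m _]]]]]]].
by have := m i j; rewrite unlock /Ex /Rintegral => ->.
Qed.

Definition pastU i := \bigcup_(j in [set j : int | j < i])
  preimage_set_system [set: T] (X j : T -> borel R d) measurable.

Lemma past_path i :
  measurable_fun [set: g_sigma_algebraType (pastU i)]
     ((fun w => X^~ w) : _ -> pathT [set j : int | j < i]).
Proof.
have HJ l : [set j : int | j < i] l -> [set j : int | j < i] (l + 0) by rewrite addr0.
have E : (fun w => X^~ w) = spath X 0 by apply/funext => w; rewrite spath0.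
rewrite E => _ A mA; rewrite setTI; exact: (@spath_sigma _ _ _ _ X _ _ 0 A HJ mA).
Qed.

Variables (G : finType) (u : G -> 'cV[R]_(r * d) -> 'I_d -> R).
Hypothesis G0 : (0 < #|G|)%N.
Hypothesis mu : forall g j, measurable_fun [set: borel R (r * d)] (fun x : borel R (r * d) => u g x j).
Hypothesis u1 : forall g x j, `|u g x j| <= 1.

(** The subtracted mean square is the compensator: it keeps the conditional expectation of the
    exponential, given the past, at most 1. *)
Definition noise_incr (k : nat) (g : G) (w : T) : R :=
  d%:R^-1 * (\sum_j u g (lags r (X^~ w) (r + k)%:Z) j * epsc (eps ((r + k)%:Z + 1) w j ord0))
  - d%:R^-1 * \sum_j u g (lags r (X^~ w) (r + k)%:Z) j ^+ 2.

Let mu_past i k g j : (r + k)%:Z < i ->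
  measurable_fun [set: g_sigma_algebraType (pastU i)]
    (fun w : g_sigma_algebraType (pastU i) => u g (lags r (X^~ w) (r + k)%:Z) j).
Proof.
move=> ki.
have mL := @lags_measurable R d [set l : int | l < i] r (r + k)%:Z.
have {}mL := mL (fun l _ => ltac:(rewrite /=; lia)).
exact: (measurableT_comp (measurableT_comp (mu g j) mL) (@past_path i)).
Qed.

(** The model equation expresses an earlier noise variable through observations before time [i]. *)
Let eps_past i l j : l < i ->
  measurable_fun [set: g_sigma_algebraType (pastU i)]
    (fun w : g_sigma_algebraType (pastU i) => eps l w j ord0).
Proof.
case: hmodel => _ [_ [mf0 [hX _]]] li.
have E : (fun w => eps l w j ord0) =
   (fun w => X l w j ord0 - f0 (lags r (X^~ w) (l - 1)) j ord0).
  by apply/funext => w; rewrite {1}hX mxE addrAC subrr add0r.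
rewrite E; apply: measurable_funB.
  apply: (measurableT_comp (@borel_coord_measurable R d j)).
  by apply: (measurableT_comp (@path_coord_measurable R d [set j : int | j < i] l li) (@past_path i)).
apply: (measurableT_comp (@borel_coord_measurable R d j)).
have mL := @lags_measurable R d [set m : int | m < i] r (l - 1).
have {}mL := mL (fun m _ => ltac:(rewrite /=; lia)).
exact: (measurableT_comp (measurableT_comp mf0 mL) (@past_path i)).
Qed.

Lemma noise_incr_past i k g : (r + k)%:Z + 1 < i ->
  measurable_fun [set: g_sigma_algebraType (pastU i)]
    (noise_incr k g : g_sigma_algebraType (pastU i) -> R).
Proof.
move=> ki; apply: measurable_funB; apply: measurable_funM => //;
  apply: measurable_sum => j.
  apply: measurable_funM; first by apply: mu_past; lia.
  by apply: measurable_funM => //; exact: eps_past.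
by apply: measurable_funX; apply: mu_past; lia.
Qed.

Let pastT i : <<s pastU i >> `<=` measurable.
Proof. exact: sigma_of_measurable. Qed.

Let past_meas i (f : T -> R) :
  measurable_fun [set: g_sigma_algebraType (pastU i)] (f : g_sigma_algebraType (pastU i) -> R) ->
  measurable_fun [set: T] f.
Proof. by move=> mf _ B mB; apply: (@pastT i); exact: mf. Qed.

Lemma Ex_past_eps i j (Y : T -> R) (F : R -> R) :
  measurable_fun [set: g_sigma_algebraType (pastU i)] (Y : g_sigma_algebraType (pastU i) -> R) ->
  measurable_fun [set: R] F -> (forall w, `|Y w| <= 1) ->
  itg P (fun w => F (eps i w j ord0)) ->
  Ex P (fun w => Y w * F (eps i w j ord0)) = Ex P Y * Ex P (fun w => F (eps i w j ord0)).
Proof.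
case: hmodel => _ [_ [_ [_ [me [_ [_ [_ hind]]]]]]] mY mF Y1 iF.
pose V0 := \bigcup_(l in [set i]) preimage_set_system [set: T] (eps l : T -> borel R d) measurable.
apply: (@Ex_indep _ _ _ P (pastU i) V0) => //.
- apply: smallest_sub; first exact: sigma_algebra_measurable.
  by move=> _ [l _ [B mB <-]]; exact: me.
- by move=> A B UA VB; rewrite setIC [RHS]muleC; apply: (hind i B A VB UA).
- apply: (measurableT_comp mF); apply: (measurableT_comp (@borel_coord_measurable R d j)).
  move=> _ B mB; apply: sub_sigma_algebra; exists i => //.
  by exists B.
Qed.

(** Jensen's inequality over the coordinates and [expR_linear_bound] bound the exponential by past
    quantities times functions of the current noise. Independence removes the linear term, since the
    noise is centred, and bounds E Psi - 1 by 1; what is left is e^(-v) (1 + v) <= 1, with v the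
    subtracted mean square. *)
Lemma noise_maximal n :
  itg P (fun w => lse (fun g => \sum_(k < n) noise_incr k g w)) /\
  Ex P (fun w => lse (fun g => \sum_(k < n) noise_incr k g w)) <= ln #|G|%:R.
Proof.
have d0' : 0 < d%:R :> R by rewrite ltr0n.
have di0 : 0 <= d%:R^-1 :> R by rewrite invr_ge0 ltW.
pose U k g w j := u g (lags r (X^~ w) (r + k)%:Z) j.
pose e k w j := eps ((r + k)%:Z + 1) w j ord0.
pose Psi (x : R) := expR (4 * epsc x ^+ 2).
have mPsi : measurable_fun [set: R] Psi.
  apply: measurableT_comp => //; apply: measurable_funM => //.
  by apply: measurable_funX; apply: measurable_funM.
have mU k g j : measurable_fun [set: g_sigma_algebraType (pastU ((r + k)%:Z + 1))]
    ((fun w => U k g w j) : g_sigma_algebraType (pastU ((r + k)%:Z + 1)) -> R).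
  by apply: mu_past; lia.
have U2 k g w j : `|U k g w j ^+ 2| <= 1 by rewrite normrX expr_le1 ?normr_ge0 ?u1.
have iPsi k j : itg P (fun w => Psi (e k w j)) by exact: expR_eps_itg.
have ie k j : itg P (fun w => e k w j) by exact: eps_itg.
have iec k j : itg P (fun w => epsc (e k w j)) by exact: itgZ.
have U1 k g w j : `|U k g w j| <= 1 by exact: u1.
have iUe k g j : itg P (fun w => U k g w j * epsc (e k w j)).
  by apply: (@itgM _ _ _ P _ _ 1) => //; exact: (past_meas (mU k g j)).
have iU2 k g j : itg P (fun w => U k g w j ^+ 2).
  apply: (@itg_bounded _ _ _ P _ 1) => //; apply: measurable_funX.
  exact: (past_meas (mU k g j)).
have ebnd k g w : expR (noise_incr k g w) <=
    expR (- (d%:R^-1 * \sum_j U k g w j ^+ 2)) * (d%:R^-1 *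
     \sum_j (1 + U k g w j * epsc (e k w j) + U k g w j ^+ 2 * (Psi (e k w j) - 1))).
  rewrite /noise_incr addrC expRD ler_wpM2l ?expR_ge0//.
  apply: le_trans (expR_avg _ d0) _; rewrite ler_wpM2l//.
  by apply: ler_sum => j _; exact: expR_linear_bound.
have iPs k g : itg P (fun w => d%:R^-1 *
     \sum_j (1 + U k g w j * epsc (e k w j) + U k g w j ^+ 2 * (Psi (e k w j) - 1))).
  apply: itgZ; apply: itg_sum => j _; apply: itgD.
    by apply: itgD; [exact: itg_cst|exact: iUe].
  apply: (@itgM _ _ _ P _ _ 1) => //; first by apply: measurable_funX; exact: (past_meas (mU k g j)).
  by apply: itgB => //; exact: itg_cst.
have mincr k g : measurable_fun [set: T] (noise_incr k g).
  by apply: (@past_meas ((r + k)%:Z + 2)); apply: noise_incr_past; lia.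
have is_ k g : itg P (noise_incr k g).
  apply: itgB; apply: itgZ; apply: itg_sum => j _; [exact: iUe|exact: iU2].
have q0 k g w : 0 <= d%:R^-1 * \sum_j U k g w j ^+ 2.
  by rewrite mulr_ge0//; apply: sumr_ge0 => j _; exact: sqr_ge0.
have ies k g : itg P (fun w => expR (noise_incr k g w)).
  apply: (itg_le _ (iPs k g)); first exact: measurableT_comp.
  move=> w; rewrite ger0_norm ?expR_ge0//; apply: (le_trans (ebnd k g w)).
  set z := (X in _ * X); apply: (le_trans _ (ler_norm z)).
  have z0 : 0 <= z.
    rewrite mulr_ge0//; apply: sumr_ge0 => j _.
    by apply: le_trans (expR_linear_bound _ (u1 g _ j)); rewrite expR_ge0.
  by rewrite ler_piMl// expR_le1 oppr_le0.
have := @lse_chain _ _ G0 _ _ P noise_incr (fun=> 0) n (fun k g _ => is_ k g) (fun k g _ => ies k g).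
rewrite big1// addr0; apply => k kn.
pose pi_ g w := softmax (fun h => \sum_(i < k) noise_incr i h w) g.
have mpi g : measurable_fun [set: g_sigma_algebraType (pastU ((r + k)%:Z + 1))]
    (pi_ g : g_sigma_algebraType (pastU ((r + k)%:Z + 1)) -> R).
  apply: measurable_softmax => // h; apply: measurable_sum => i.
  by apply: noise_incr_past; have := ltn_ord i; lia.
have pi01 g w : 0 <= pi_ g w <= 1 by rewrite softmax_ge0 ?softmax_le1.
(* [rho] collects the softmax weight and the compensator, both known before the current noise. *)
pose rho g w := pi_ g w * expR (- (d%:R^-1 * \sum_j U k g w j ^+ 2)).
have mrho g : measurable_fun [set: g_sigma_algebraType (pastU ((r + k)%:Z + 1))]
    (rho g : g_sigma_algebraType (pastU ((r + k)%:Z + 1)) -> R).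
  apply: measurable_funM => //; apply: measurableT_comp => //; apply: measurable_funN.
  apply: measurable_funM => //; apply: measurable_sum => j; exact: measurable_funX.
have rho01 g w : 0 <= rho g w <= 1.
  have /andP[p0 p1] := pi01 g w; rewrite mulr_ge0 ?expR_ge0//=.
  by rewrite mulr_ile1 ?expR_ge0// expR_le1 oppr_le0.
have rho1 g w : `|rho g w| <= 1.
  by have /andP[p0 p1] := rho01 g w; rewrite ger0_norm.
have irho g : itg P (rho g).
  by apply: (@itg_bounded _ _ _ P _ 1) => //; exact: (past_meas (mrho g)).
have ipi g : itg P (pi_ g).
  apply: (@itg_bounded _ _ _ P _ 1); first exact: (past_meas (mpi g)).
  by move=> w; have /andP[p0 p1] := pi01 g w; rewrite ger0_norm.
have ipe g : itg P (fun w => pi_ g w * (expR (noise_incr k g w) - 1)).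
  apply: (@itgM _ _ _ P _ _ 1); first exact: (past_meas (mpi g)).
    by move=> w; have /andP[p0 p1] := pi01 g w; rewrite ger0_norm.
  by apply: itgB => //; exact: itg_cst.
rewrite Ex_sumf//; apply: sumr_le0 => g _.
have mrU j : measurable_fun [set: g_sigma_algebraType (pastU ((r + k)%:Z + 1))]
    ((fun w => rho g w * U k g w j) : g_sigma_algebraType (pastU ((r + k)%:Z + 1)) -> R).
  exact: measurable_funM.
have mrU2 j : measurable_fun [set: g_sigma_algebraType (pastU ((r + k)%:Z + 1))]
    ((fun w => rho g w * U k g w j ^+ 2) : g_sigma_algebraType (pastU ((r + k)%:Z + 1)) -> R).
  by apply: measurable_funM => //; exact: measurable_funX.
have rU1 j w : `|rho g w * U k g w j| <= 1 by rewrite normrM mulr_ile1.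
have rU21 j w : `|rho g w * U k g w j ^+ 2| <= 1 by rewrite normrM mulr_ile1.
have irU2 j : itg P (fun w => rho g w * U k g w j ^+ 2).
  by apply: (@itg_bounded _ _ _ P _ 1) => //; exact: (past_meas (mrU2 j)).
have irUe j : itg P (fun w => (rho g w * U k g w j) * epsc (e k w j)).
  by apply: (@itgM _ _ _ P _ _ 1) => //; exact: (past_meas (mrU j)).
have irUP j : itg P (fun w => (rho g w * U k g w j ^+ 2) * (Psi (e k w j) - 1)).
  apply: (@itgM _ _ _ P _ _ 1) => //; first exact: (past_meas (mrU2 j)).
  by apply: itgB => //; exact: itg_cst.
apply: (@le_trans _ _ (Ex P (fun w => d%:R^-1 * (\sum_j (rho g w +
    (rho g w * U k g w j) * epsc (e k w j) +
    (rho g w * U k g w j ^+ 2) * (Psi (e k w j) - 1))) - pi_ g w))).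
  apply: le_Ex; first exact: ipe.
    apply: itgB => //; apply: itgZ; apply: itg_sum => j _; apply: itgD => //.
    exact: itgD.
  move=> w; rewrite -/(pi_ g w) mulrBr mulr1 lerD2r.
  have /andP[p0 p1] := pi01 g w.
  apply: (le_trans (ler_wpM2l p0 (ebnd k g w))).
  rewrite mulrA -/(rho g w) mulrCA mulr_sumr le_eqVlt; apply/orP; left; apply/eqP.
  by congr (_ * _); apply: eq_bigr => j _; ring.
rewrite ExB//; last first.
  by apply: itgZ; apply: itg_sum => j _; apply: itgD => //; exact: itgD.
rewrite ExZ; last by apply: itg_sum => j _; apply: itgD => //; exact: itgD.
rewrite Ex_sumf; last by move=> j; apply: itgD => //; exact: itgD.
have step j : Ex P (fun w => rho g w + (rho g w * U k g w j) * epsc (e k w j) +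
    (rho g w * U k g w j ^+ 2) * (Psi (e k w j) - 1)) <=
    Ex P (rho g) + Ex P (fun w => rho g w * U k g w j ^+ 2).
  rewrite ExD//; last exact: itgD.
  rewrite ExD//.
  have mec : measurable_fun [set: R] epsc by rewrite /epsc; exact: measurable_funM.
  have mP1 : measurable_fun [set: R] (fun x => Psi x - 1) by exact: measurable_funB.
  have iP1 : itg P (fun w => Psi (e k w j) - 1) by apply: itgB => //; exact: itg_cst.
  have -> := Ex_past_eps (mrU j) mec (rU1 j) (iec k j).
  have -> := Ex_past_eps (mrU2 j) mP1 (rU21 j) iP1.
  have -> : Ex P (fun w => epsc (e k w j)) = 0.
    by rewrite /epsc /e ExZ ?eps_Ex0 ?mulr0//; exact: eps_itg.
  rewrite mulr0 addr0 lerD2l ExB; [|exact: iPsi|exact: itg_cst].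
  rewrite Ex_cst ler_piMr//.
    apply: Ex_ge0 => w; rewrite mulr_ge0 ?sqr_ge0//; by have /andP[] := rho01 g w.
  by rewrite lerBlDr; exact: expR_eps_Ex.
rewrite subr_le0.
apply: (@le_trans _ _ (d%:R^-1 * \sum_(j < d) (Ex P (rho g) + Ex P (fun w => rho g w * U k g w j ^+ 2)))).
  by rewrite ler_wpM2l//; apply: ler_sum => j _; exact: step.
rewrite big_split /= sumr_const card_ord mulrDr.
have -> : d%:R^-1 * (Ex P (rho g) *+ d) = Ex P (rho g).
  by rewrite -(mulr_natl (Ex P (rho g)) d) mulrA mulVf ?mul1r ?gt_eqF.
rewrite -Ex_sumf// -ExZ; last by apply: itg_sum.
rewrite -ExD//; last by apply: itgZ; exact: itg_sum.
apply: le_Ex => //; first by apply: itgD => //; apply: itgZ; exact: itg_sum.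
move=> w; rewrite -mulr_sumr mulrCA -[X in X + _]mulr1 -mulrDr /rho -mulrA.
have /andP[p0 p1] := pi01 g w.
rewrite ler_piMr//; set q := _ * \sum_j _.
have := expR_ge1Dx q => h; apply: le_trans (ler_wpM2l (expR_ge0 _) h) _.
by rewrite mulrC expRxMexpNx_1.
Qed.

End NoiseMaximal.

(** * Oracle inequality *)

Section Oracle.
Context {dT : measure_display} {T : measurableType dT} {R : realType}.
Variable P : probability T R.
Variables (d r : nat).
Hypothesis d0 : (0 < d)%N.
Hypothesis r0 : (0 < r)%N.
Variables (f0 : 'cV[R]_(r * d) -> 'cV[R]_d) (X eps : int -> T -> 'cV[R]_d).
Hypothesis hmodel : autoregressive P f0 X eps.
Variable Wt : 'cV[R]_(r * d) -> R.
Hypothesis hWmeas : measurable_fun [set: borel R (r * d)] (Wt : borel R (r * d) -> R).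
Hypothesis hW01 : forall x, 0 <= Wt x <= 1.
Hypothesis hWcube : forall x, Wt x != 0 -> cube x.
Variable (C : R).
Hypothesis C0 : 0 < C.
Hypothesis hnoise : forall (k : nat) (j : 'I_d), (0 < k)%N ->
     (('E_P[fun w => (`|eps 1 w j ord0| ^+ k)%R] `^ (k%:R^-1))
        <= (C * Num.sqrt k%:R)%:E)%E.
Variable F : R.
Hypothesis F1 : 1 <= F.
Hypothesis f0F : forall x j, cube x -> `|f0 x j ord0| <= F.

Local Notation fn := ('cV[R]_(r * d) -> 'cV[R]_d).

Definition loss (f : fn) (x : 'cV[R]_(r * d)) : R :=
  d%:R^-1 * \sum_j (f x j ord0 - f0 x j ord0) ^+ 2 * Wt x.

Lemma enorm2_sqr m (x : 'cV[R]_m) : enorm2 x ^+ 2 = \sum_j x j ord0 ^+ 2.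
Proof. by rewrite sqr_sqrtr// sumr_ge0// => j _; exact: sqr_ge0. Qed.

Lemma loss_enorm2 f x : d%:R^-1 * (enorm2 (f x - f0 x) ^+ 2 * Wt x) = loss f x.
Proof.
rewrite enorm2_sqr mulr_suml; congr (_ * _); apply: eq_bigr => j _.
by rewrite !mxE.
Qed.

Let di0 : 0 <= d%:R^-1 :> R. Proof. by rewrite invr_ge0. Qed.

Lemma avg_le (a : 'I_d -> R) (B : R) : (forall j, a j <= B) -> d%:R^-1 * \sum_j a j <= B.
Proof.
move=> aB; rewrite ler_pdivrMl ?ltr0n// mulr_natl.
apply: (@le_trans _ _ (\sum_(j < d) B)); first by apply: ler_sum => j _.
by rewrite sumr_const card_ord.
Qed.

Lemma loss_ge0 f x : 0 <= loss f x.
Proof.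
rewrite mulr_ge0//; apply: sumr_ge0 => j _; rewrite mulr_ge0 ?sqr_ge0//.
by have /andP[] := hW01 x.
Qed.

Lemma loss_le (f : fn) x (A : R) : 0 <= A -> (cube x -> forall j, `|f x j ord0 - f0 x j ord0| <= A) ->
  loss f x <= A ^+ 2.
Proof.
move=> A0 H; apply: avg_le => j; have /andP[w0 w1] := hW01 x.
have [->|/hWcube/H/(_ j) h] := eqVneq (Wt x) 0; first by rewrite mulr0 sqr_ge0.
rewrite -(real_normK (num_real (f x j ord0 - _))) -[leRHS]mulr1.
by apply: ler_pM => //; rewrite ?exprn_ge0// lerXn2r// nnegrE.
Qed.

(** It trades the estimator for a net element at cost 2 e^2, by (b - c)^2 = 2 (a - c)^2 + 2 (a -
    b)^2 - (b - 2a + c)^2. Off the cube [Wt] vanishes, so closeness on the cube is enough. *)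
Lemma loss_swap (f g : fn) x (e : R) : 0 <= e -> (cube x -> forall j, `|f x j ord0 - g x j ord0| <= e) ->
  loss g x <= 2 * loss f x + 2 * e ^+ 2.
Proof.
move=> e0 H.
have -> : 2 * loss f x = d%:R^-1 * \sum_j 2 * ((f x j ord0 - f0 x j ord0) ^+ 2 * Wt x).
  by rewrite -mulr_sumr mulrCA.
rewrite -lerBlDl -mulrBr -sumrB; apply: avg_le => j; have /andP[w0 w1] := hW01 x.
have [->|/hWcube/H/(_ j) h] := eqVneq (Wt x) 0.
  by rewrite !mulr0 subrr; have := sqr_ge0 e; lra.
set a := f x j ord0; set b := g x j ord0; set c := f0 x j ord0; set w := Wt x.
have h2 : (a - b) ^+ 2 <= e ^+ 2.
  by rewrite -(real_normK (num_real (a - b))) lerXn2r// nnegrE.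
have h3 : (b - c) ^+ 2 - 2 * (a - c) ^+ 2 <= 2 * e ^+ 2.
  have : 0 <= (b - 2 * a + c) ^+ 2 by exact: sqr_ge0.
  rewrite (_ : (b - c) ^+ 2 = 2 * (a - c) ^+ 2 + 2 * (a - b) ^+ 2 - (b - 2 * a + c) ^+ 2); last by ring.
  lra.
have -> : (b - c) ^+ 2 * w - 2 * ((a - c) ^+ 2 * w) = ((b - c) ^+ 2 - 2 * (a - c) ^+ 2) * w by ring.
have [p|/ltW p] := leP 0 ((b - c) ^+ 2 - 2 * (a - c) ^+ 2).
  apply: le_trans h3; exact: ler_piMr.
by apply: (le_trans (mulr_le0_ge0 p w0)); rewrite mulr_ge0 ?sqr_ge0.
Qed.

Variables (n : nat) (Fcl : set fn) (G : finType) (net : G -> fn) (fstar : fn).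
Variables (fhat : T -> fn) (delta A : R) (q : nat).
Hypothesis rn : (r < n)%N.
Hypothesis G0 : (0 < #|G|)%N.
Hypothesis mF : forall f, Fcl f -> forall j, measurable_fun [set: borel R (r * d)]
  (fun x : borel R (r * d) => f x j ord0).
Hypothesis FF : forall f, Fcl f -> forall x j, `|f x j ord0| <= F.
Hypothesis netF : forall g, Fcl (net g).
Hypothesis delta01 : 0 <= delta <= 1.
Hypothesis net_cover : forall f, Fcl f -> exists g, forall x, cube x ->
  forall j, `|f x j ord0 - net g x j ord0| <= delta.
Hypothesis starF : Fcl fstar.
Hypothesis A0 : 0 <= A.
Hypothesis star_approx : forall x, cube x -> forall j, `|fstar x j ord0 - f0 x j ord0| <= A.
Hypothesis fhat_min : forall w, is_argmin Fcl (emp_risk Wt n (X^~ w)) (fhat w).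

Let mX i : random_vector (X i) := (proj1 hmodel) i.
Let stX : stationary P X := proj1 (proj2 hmodel).
Let F0 : 0 < F. Proof. exact: lt_le_trans ltr01 F1. Qed.
Let B : R := (2 * F) ^+ 2.
Let B0 : 0 < B. Proof. by apply: exprn_gt0; apply: mulr_gt0. Qed.

Lemma loss_bounds (f : fn) x : Fcl f -> 0 <= loss f x <= B.
Proof.
move=> Ff; rewrite loss_ge0 loss_le ?mulr_ge0 ?ltW// => cx j.
by rewrite (le_trans (ler_normB _ _))// mulrDl mul1r; apply: lerD; [exact: FF|exact: f0F].
Qed.

Lemma loss_measurable (f : fn) : Fcl f -> measurable_fun [set: borel R (r * d)] (loss f : borel R (r * d) -> R).
Proof.
case: hmodel => _ [_ [mf0 _]] Ff; apply: measurable_funM => //; apply: measurable_sum => j.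
apply: measurable_funM => //; apply: measurable_funX; apply: measurable_funB; first exact: mF.
exact: (measurableT_comp (@borel_coord_measurable R d j) mf0).
Qed.

Lemma lags_random j : measurable_fun [set: T] (fun w => lags r (X^~ w) j : borel R (r * d)).
Proof.
have := measurableT_comp (@lags_measurable R d setT r j (fun _ _ => I))
    (@spath_measurable R d dT T X mX setT 0).
by rewrite /comp; under eq_fun do rewrite spath0.
Qed.

Let kap : R := Num.max 1 (48 * C / F).
Let kap0 : 0 < kap. Proof. by rewrite lt_max ltr01. Qed.

(** The direction starts from the fixed function [fstar], which makes it deterministic for each net
    element, and it is normalised to modulus at most 1. *)
Definition noise_dir (g : G) (x : 'cV[R]_(r * d)) (j : 'I_d) : R :=
  (kap * (2 * F))^-1 * ((net g x j ord0 - fstar x j ord0) * Wt x).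

Lemma noise_dir_measurable g j :
  measurable_fun [set: borel R (r * d)] (fun x : borel R (r * d) => noise_dir g x j).
Proof.
apply: measurable_funM => //; apply: measurable_funM => //.
by apply: measurable_funB; exact: mF.
Qed.

Lemma noise_dir_le1 g x j : `|noise_dir g x j| <= 1.
Proof.
have F2 : 0 < 2 * F by rewrite mulr_gt0.
have k1 : 1 <= kap by rewrite le_max lexx.
rewrite /noise_dir normrM ger0_norm ?invr_ge0; last by rewrite mulr_ge0 ?ltW.
rewrite ler_pdivrMl ?mulr_gt0// mulr1 normrM.
have /andP[w0 w1] := hW01 x.
apply: (@le_trans _ _ (2 * F * 1)); last by rewrite mulr1 ler_peMl// ltW.
apply: ler_pM => //; last by rewrite ger0_norm.
by rewrite (le_trans (ler_normB _ _))// mulrDl mul1r; apply: lerD; exact: FF.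
Qed.

Let LN w := lse (fun g => \sum_(k < n - r) noise_incr X eps C noise_dir k g w).
Let Q := (q + r).-1.
Let LM o w := lse (fun g => \sum_(k < n - r) mix_incr P X (fun g => loss (net g)) B Q o k g (X^~ w)).

Lemma emp_risk_shift (f : fn) w : n%:R * emp_risk Wt n (X^~ w) f =
  \sum_(k < n - r) d%:R^-1 * enorm2 (X ((r + k)%:Z + 1) w - f (lags r (X^~ w) (r + k)%:Z)) ^+ 2
    * Wt (lags r (X^~ w) (r + k)%:Z).
Proof.
rewrite /emp_risk mulrA divff ?mul1r; last by rewrite pnatr_eq0 -lt0n (leq_trans _ rn).
rewrite -{1}[r.+1]add0n big_addn big_mkord.
rewrite (_ : (n.+1 - r.+1 = n - r)%N); last by rewrite subSS.
apply: eq_bigr => k _.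
have E1 : (k + r.+1)%:Z = (r + k)%:Z + 1 by rewrite addnS addnC -addn1 PoszD.
have E2 : (k + r.+1)%:Z - 1 = (r + k)%:Z by rewrite E1 addrK.
by rewrite E2 E1.
Qed.

(** The minimiser has no larger empirical risk than [fstar]; inserting X = f0 + eps and expanding
    the squares leaves the cross term with the noise, while the squares of the noise cancel. *)
Lemma basic_inequality w :
  \sum_(k < n - r) loss (fhat w) (lags r (X^~ w) (r + k)%:Z) <=
  \sum_(k < n - r) loss fstar (lags r (X^~ w) (r + k)%:Z) +
  \sum_(k < n - r) d%:R^-1 * \sum_j 2 * (eps ((r + k)%:Z + 1) w j ord0 *
     (fhat w (lags r (X^~ w) (r + k)%:Z) j ord0 - fstar (lags r (X^~ w) (r + k)%:Z) j ord0)
      * Wt (lags r (X^~ w) (r + k)%:Z)).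
Proof.
have [_ /(_ _ starF)] := fhat_min w.
rewrite -(ler_pM2l (x := n%:R)); last by rewrite ltr0n (leq_trans _ rn).
rewrite !emp_risk_shift -subr_ge0 -sumrB => H.
rewrite -big_split /= -subr_ge0 -sumrB; apply: le_trans H _; apply: ler_sum => k _.
set x := lags _ _ _; set W := Wt x.
rewrite /loss -mulrDr -mulrBr -[X in X - _]mulrA -[X in _ - X]mulrA -mulrBr ler_wpM2l//.
rewrite !enorm2_sqr !mulr_suml -sumrB -big_split /= -sumrB; apply: ler_sum => j _.
have XE : X ((r + k)%:Z + 1) w j ord0 = f0 x j ord0 + eps ((r + k)%:Z + 1) w j ord0.
  by case: hmodel => _ [_ [_ [hX _]]]; rewrite hX mxE addrK.
rewrite !mxE XE -/W le_eqVlt; apply/orP; left; apply/eqP; ring.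
Qed.

(* [kap] is chosen such that the quadratic term has coefficient at most 1/6. *)
Lemma noise_pointwise (a b g z e W : R) : 0 <= W <= 1 -> (W != 0 -> `|a - g| <= delta) ->
  2 * (e * (a - b) * W) <=
  32 * C * F * kap * ((kap * (2 * F))^-1 * ((g - b) * W) * epsc C e
    - ((kap * (2 * F))^-1 * ((g - b) * W)) ^+ 2)
  + 2^-1 * (delta ^+ 2 + (a - z) ^+ 2 * W + (b - z) ^+ 2 * W) + 2 * delta * `|e|.
Proof.
move=> /andP[w0 w1] Hag; have /andP[dl0 dl1] := delta01.
have F_0 : F != 0 by rewrite gt_eqF.
have C_0 : C != 0 by rewrite gt_eqF.
have k_0 : kap != 0 by rewrite gt_eqF.
have -> : 32 * C * F * kap * ((kap * (2 * F))^-1 * ((g - b) * W) * epsc C e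
    - ((kap * (2 * F))^-1 * ((g - b) * W)) ^+ 2) =
   2 * (e * (g - b) * W) - (8 * C / F / kap) * ((g - b) * W) ^+ 2.
  by rewrite /epsc; field; rewrite F_0 C_0 k_0.
have [->|W0] := eqVneq W 0.
  rewrite !mulr0 expr0n /= mulr0 subrr add0r !addr0.
  by rewrite addr_ge0 ?mulr_ge0 ?sqr_ge0.
have {}Hag := Hag W0.
have h1 : 2 * (e * (a - g) * W) <= 2 * delta * `|e|.
  rewrite -[leRHS]mulrA ler_wpM2l// (le_trans (ler_norm _))// !normrM (ger0_norm w0).
  rewrite -[leRHS]mulr1; apply: ler_pM => //.
  by rewrite mulrC ler_wpM2r.
have coef : 0 <= 8 * C / F / kap <= 6^-1.
  have C0' := ltW C0; have F0' := ltW F0; have kap0' := ltW kap0.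
  rewrite !divr_ge0 ?mulr_ge0//= ler_pdivrMr//.
  have : 48 * C / F <= kap by rewrite le_max lexx orbT.
  by rewrite (_ : 48 * C / F = 6 * (8 * C / F)); [lra|field].
have h2 : ((g - b) * W) ^+ 2 <= 3 * (delta ^+ 2 + (a - z) ^+ 2 * W + (b - z) ^+ 2 * W).
  have ag : (a - g) ^+ 2 <= delta ^+ 2.
    by rewrite -(real_normK (num_real (a - g))) lerXn2r// nnegrE.
  have s3 : (g - b) ^+ 2 <= 3 * ((a - g) ^+ 2 + (a - z) ^+ 2 + (b - z) ^+ 2).
    have p1 : 0 <= ((g - a) - (a - z)) ^+ 2 by exact: sqr_ge0.
    have p2 : 0 <= ((g - a) - (z - b)) ^+ 2 by exact: sqr_ge0.
    have p3 : 0 <= ((a - z) - (z - b)) ^+ 2 by exact: sqr_ge0.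
    have -> : (g - b) ^+ 2 = 3 * ((a - g) ^+ 2 + (a - z) ^+ 2 + (b - z) ^+ 2)
      - ((g - a) - (a - z)) ^+ 2 - ((g - a) - (z - b)) ^+ 2 - ((a - z) - (z - b)) ^+ 2 by ring.
    lra.
  rewrite exprMn.
  have w2 : W ^+ 2 <= W by rewrite expr2 ler_piMr.
  apply: (le_trans (ler_wpM2l (sqr_ge0 _) w2)).
  apply: (le_trans (ler_wpM2r w0 s3)).
  have : (a - g) ^+ 2 * W <= delta ^+ 2.
    by rewrite -[leRHS]mulr1; apply: ler_pM => //; exact: sqr_ge0.
  lra.
have h3 : (8 * C / F / kap) * ((g - b) * W) ^+ 2 <=
    2^-1 * (delta ^+ 2 + (a - z) ^+ 2 * W + (b - z) ^+ 2 * W).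
  have /andP[c0 c1] := coef.
  apply: (le_trans (ler_pM c0 (sqr_ge0 _) c1 h2)); lra.
lra.
Qed.

(** [LN] dominates the compensated noise sum of every net element, hence also of the one that the
    data select. The compensator reappears as half of the two empirical losses. *)
Lemma noise_bound w g :
  (forall x, cube x -> forall j, `|fhat w x j ord0 - net g x j ord0| <= delta) ->
  \sum_(k < n - r) d%:R^-1 * \sum_j 2 * (eps ((r + k)%:Z + 1) w j ord0 *
     (fhat w (lags r (X^~ w) (r + k)%:Z) j ord0 - fstar (lags r (X^~ w) (r + k)%:Z) j ord0)
      * Wt (lags r (X^~ w) (r + k)%:Z)) <=
  32 * C * F * kap * LN w + 2^-1 * (\sum_(k < n - r) (delta ^+ 2 +
     loss (fhat w) (lags r (X^~ w) (r + k)%:Z) + loss fstar (lags r (X^~ w) (r + k)%:Z)))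
  + 2 * delta * \sum_(k < n - r) d%:R^-1 * \sum_j `|eps ((r + k)%:Z + 1) w j ord0|.
Proof.
move=> Hg.
have CFk : 0 < 32 * C * F * kap by rewrite !mulr_gt0.
have := ler_wpM2l (ltW CFk) (lse_ge G0 (fun g => \sum_(k < n - r) noise_incr X eps C noise_dir k g w) g).
rewrite -/(LN w) => H; apply: le_trans (lerD (lerD H (lexx _)) (lexx _)).
rewrite !mulr_sumr -!big_split /=; apply: ler_sum => k _.
set x := lags _ _ _; set W := Wt x.
have dd : \sum_(j < d) delta ^+ 2 = d%:R * delta ^+ 2.
  by rewrite sumr_const card_ord -(mulr_natl (delta ^+ 2) d).
have d_0 : d%:R != 0 :> R by rewrite pnatr_eq0 -lt0n.
apply: (@le_trans _ _ (d%:R^-1 * \sum_j (32 * C * F * kap * (noise_dir g x j * epsc C (eps ((r + k)%:Z + 1) w j ord0)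
    - noise_dir g x j ^+ 2)
  + 2^-1 * (delta ^+ 2 + (fhat w x j ord0 - f0 x j ord0) ^+ 2 * W + (fstar x j ord0 - f0 x j ord0) ^+ 2 * W)
    + 2 * delta * `|eps ((r + k)%:Z + 1) w j ord0|))).
  rewrite ler_wpM2l//; apply: ler_sum => j _.
  apply: noise_pointwise; first exact: hW01.
  by move=> /hWcube cx; exact: Hg.
rewrite !big_split /= -!mulr_sumr sumrB !big_split /= dd /loss /noise_incr -/x -/W.
rewrite le_eqVlt; apply/orP; left; apply/eqP; by field; exact: d_0.
Qed.

(** The noise bound returns half of the empirical loss of the estimator, which is absorbed into the
    left side; this doubles the remaining constants. *)
Lemma fhat_error w g :
  (forall x, cube x -> forall j, `|fhat w x j ord0 - net g x j ord0| <= delta) ->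
  \sum_(k < n - r) loss (fhat w) (lags r (X^~ w) (r + k)%:Z) <=
  (n - r)%:R * (3 * A ^+ 2 + delta ^+ 2) + 64 * C * F * kap * LN w
  + 4 * delta * \sum_(k < n - r) d%:R^-1 * \sum_j `|eps ((r + k)%:Z + 1) w j ord0|.
Proof.
move=> Hg; have := basic_inequality w; have := noise_bound Hg.
have : \sum_(k < n - r) loss fstar (lags r (X^~ w) (r + k)%:Z) <= (n - r)%:R * A ^+ 2.
  rewrite mulr_natl -[X in _ *+ X]card_ord -sumr_const; apply: ler_sum => k _.
  by apply: loss_le => // cx j; exact: star_approx.
rewrite !big_split /= sumr_const card_ord -(mulr_natl (delta ^+ 2)).
set S1 := \sum_(i < _) loss fstar _; set S2 := \sum_(i < _) loss (fhat w) _.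
set S3 := \sum_(k < _) d%:R^-1 * \sum_j 2 * _; set S4 := \sum_(k < _) d%:R^-1 * \sum_j `| _ |.
lra.
Qed.

Let m g := Ex P (fun w => loss (net g) (lags r (X^~ w) r%:Z)).

(** Every time step lies in exactly one residue class modulo [Q], so adding the classes recovers the
    full empirical loss. *)
Lemma net_error w g : (0 < Q)%N ->
  (n - r)%:R * m g <= 2 * \sum_(k < n - r) loss (net g) (lags r (X^~ w) (r + k)%:Z)
    + 2 * B * \sum_(o < Q) LM o w.
Proof.
move=> Q0.
have B2 : 0 < 2 * B by rewrite mulr_gt0.
have H : \sum_(o < Q) \sum_(k < n - r) mix_incr P X (fun g => loss (net g)) B Q o k g (X^~ w)
    <= \sum_(o < Q) LM o w.
  by apply: ler_sum => o _; apply: (lse_ge G0 (fun g => \sum_(k < n - r) mix_incr P X (fun g => loss (net g)) B Q o k g (X^~ w)) g).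
have := ler_wpM2l (ltW B2) H => {}H; rewrite -lerBlDl; apply: le_trans H.
have -> : (n - r)%:R * m g - 2 * (\sum_(k < n - r) loss (net g) (lags r (X^~ w) (r + k)%:Z)) =
  \sum_(k < n - r) (m g - 2 * loss (net g) (lags r (X^~ w) (r + k)%:Z)).
  by rewrite mulr_natl -[X in _ *+ X](card_ord (n - r)) -sumr_const mulr_sumr -sumrB.
rewrite exchange_big /= mulr_sumr.
apply: ler_sum => k _; rewrite (bigD1 (Ordinal (ltn_pmod k Q0)))//= big1 => [|o ko].
  by rewrite /mix_incr /= eqxx addr0 mulVKf ?gt_eqF.
rewrite /mix_incr ifN//; apply: contraNneq ko => ko; apply/eqP/val_inj; exact: esym.
Qed.

Lemma Q_gt0 : (0 < q)%N -> (0 < Q)%N.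
Proof. by move=> q0; rewrite /Q -subn1 subn_gt0 -[1%N]addn0 -addnS leq_add. Qed.

(** The right side is free of [g]: the net element depends on the outcome, but both potentials
    dominate all of them. The chain runs from the prediction error to the expected loss of the net
    element, to its empirical loss, to that of the estimator; each passage costs a factor 2, which
    turns 3, 64 and 4 of [fhat_error] into 24, 512 and 32. *)
Lemma oracle_pointwise w : (0 < q)%N -> exists H : R,
  [/\ (pred_error P Wt f0 X (fhat w) <= H%:E)%E &
   (n - r)%:R * H = (n - r)%:R * (24 * A ^+ 2 + 18 * delta ^+ 2) + 512 * C * F * kap * LN w
    + 32 * delta * (\sum_(k < n - r) d%:R^-1 * \sum_j `|eps ((r + k)%:Z + 1) w j ord0|)
    + 4 * B * \sum_(o < Q) LM o w].
Proof.
move=> q0.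
have nr : (n - r)%:R != 0 :> R by rewrite pnatr_eq0 -lt0n subn_gt0.
pose RHS := (n - r)%:R * (24 * A ^+ 2 + 18 * delta ^+ 2) + 512 * C * F * kap * LN w
    + 32 * delta * (\sum_(k < n - r) d%:R^-1 * \sum_j `|eps ((r + k)%:Z + 1) w j ord0|)
    + 4 * B * \sum_(o < Q) LM o w.
rewrite -/RHS; exists ((n - r)%:R^-1 * RHS); split; last by rewrite mulrA divff// mul1r.
have [g Hg] := net_cover (proj1 (fhat_min w)).
have /andP[dl0 dl1] := delta01.
have d_0 : d%:R != 0 :> R by rewrite pnatr_eq0 -lt0n.
have iL : itg P (fun w' => loss (net g) (lags r (X^~ w') r%:Z)).
  apply: (itg_bounded P (c := B)) => [|w'].
    exact: (measurableT_comp (loss_measurable (netF g)) (lags_random r%:Z)).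
  by have /andP[l0 l1] := loss_bounds (lags r (X^~ w') r%:Z) (netF g); rewrite ger0_norm.
apply: (@le_trans _ _ (2 * m g + 2 * delta ^+ 2)%:E).
  rewrite /pred_error unlock.
  apply: (@le_trans _ _ ((d%:R^-1)%:E * \int[P]_w' (d%:R * (2 * loss (net g) (lags r (X^~ w') r%:Z) + 2 * delta ^+ 2))%:E)%E).
    apply: lee_wpmul2l; first by rewrite lee_fin.
    apply: le_nonneg_integral => w'; rewrite lee_fin.
      by rewrite mulr_ge0 ?sqr_ge0//; have /andP[] := hW01 (lags r (X^~ w') r%:Z).
    rewrite -ler_pdivrMl ?ltr0n// loss_enorm2.
    by apply: loss_swap => // cx j; rewrite distrC; exact: Hg.
  rewrite Ex_EFin; last first.
    by apply: itgZ; apply: itgD; [exact: itgZ|exact: itg_cst].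
  rewrite ExZ; last by apply: itgD; [exact: itgZ|exact: itg_cst].
  rewrite ExD; [|exact: itgZ|exact: itg_cst].
  rewrite ExZ// Ex_cst.
  by rewrite -EFinM lee_fin mulrA mulVf// mul1r.
rewrite lee_fin ler_pdivlMl; last by rewrite ltr0n subn_gt0.
have E1 := fhat_error Hg; have E2 := @net_error w g.
have E3 : \sum_(k < n - r) loss (net g) (lags r (X^~ w) (r + k)%:Z) <=
  2 * (\sum_(k < n - r) loss (fhat w) (lags r (X^~ w) (r + k)%:Z)) + 2 * ((n - r)%:R * delta ^+ 2).
  have -> : (n - r)%:R * delta ^+ 2 = \sum_(k < n - r) delta ^+ 2.
    by rewrite sumr_const card_ord mulr_natl.
  rewrite !mulr_sumr -big_split /=.
  by apply: ler_sum => k _; apply: loss_swap => // cx j; exact: Hg.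
have {}E2 := E2 (Q_gt0 q0).
rewrite /RHS; move: E1 E2 E3.
set x1 := \sum_(o < Q) _; set x2 := \sum_(k < n - r) loss (fhat w) _.
set x3 := \sum_(k < n - r) loss (net g) _; set x4 := \sum_(k < n - r) d%:R^-1 * _.
move=> E1 E2 E3.
have : 4 * x3 <= 8 * x2 + 8 * ((n - r)%:R * delta ^+ 2) by lra.
lra.
Qed.

(** The entropy ln #|G| is paid once for the noise and once per residue class, the mixing
    coefficient once per time step. The factor r + 1 replaces n - r by n, since n <= (r + 1) (n - r)
    for n > r, and delta^2 <= delta merges the discretisation terms. *)
Theorem oracle_inequality : (0 < q)%N ->
  (\int[P]_w pred_error P Wt f0 X (fhat w) <=
   (24 * A ^+ 2 + (18 + 512 * C) * delta
    + (512 * C * F * kap + 4 * B * Q%:R) * r.+1%:R * (ln #|G|%:R / n%:R)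
    + 8 * B * beta_mix P X q)%:E)%E.
Proof.
move=> q0; have Q0 := Q_gt0 q0.
have nr : 0 < (n - r)%:R :> R by rewrite ltr0n subn_gt0.
have /andP[dl0 dl1] := delta01.
pose H w := (n - r)%:R^-1 * ((n - r)%:R * (24 * A ^+ 2 + 18 * delta ^+ 2) + 512 * C * F * kap * LN w
    + 32 * delta * (\sum_(k < n - r) d%:R^-1 * \sum_j `|eps ((r + k)%:Z + 1) w j ord0|)
    + 4 * B * \sum_(o < Q) LM o w).
have [iN eN] := noise_maximal d0 hmodel C0 hnoise G0 noise_dir_measurable noise_dir_le1 (n - r).
have HM o := mixing_maximal_offset r0 mX stX G0 B0 (fun g => loss_measurable (netF g))
  (fun g x => loss_bounds x (netF g)) q o (n - r).
have iM o : itg P (LM o) := (HM o).1.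
have ieps k j : itg P (fun w => `|eps k w j ord0|) by apply: integrable_norm; exact: (eps_itg hmodel C0 hnoise).
have iS k : itg P (fun w => d%:R^-1 * \sum_j `|eps k w j ord0|).
  by apply: itgZ; apply: itg_sum.
have i1 : itg P (fun w => \sum_(k < n - r) d%:R^-1 * \sum_j `|eps ((r + k)%:Z + 1) w j ord0|).
  by apply: itg_sum.
have i2 : itg P (fun w => \sum_(o < Q) LM o w) by apply: itg_sum.
have iH : itg P H.
  by do !(apply: itgZ || apply: itgD || apply: itg_cst) => //.
apply: (@le_trans _ _ (\int[P]_w (H w)%:E)%E).
  apply: le_nonneg_integral => w.
    rewrite /pred_error unlock mule_ge0// ?lee_fin//; apply: integral_ge0 => w' _.
    by rewrite lee_fin mulr_ge0 ?sqr_ge0//; have /andP[] := hW01 (lags r (X^~ w') r%:Z).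
  have [h [h1 h2]] := oracle_pointwise w q0.
  by rewrite /H -h2 mulKf ?gt_eqF.
rewrite Ex_EFin// lee_fin /H ExZ; last first.
  by do !(apply: itgZ || apply: itgD || apply: itg_cst) => //.
rewrite !ExD ?ExZ ?Ex_cst//; do ?(apply: itgZ || apply: itgD || apply: itg_cst) => //.
have eE : Ex P (fun w => \sum_(k < n - r) d%:R^-1 * \sum_j `|eps ((r + k)%:Z + 1) w j ord0|)
    <= (n - r)%:R * (16 * C).
  rewrite Ex_sumf// (_ : _ * (16 * C) = \sum_(k < n - r) 16 * C); last by rewrite sumr_const card_ord mulr_natl.
  apply: ler_sum => k _; rewrite ExZ; last exact: itg_sum.
  rewrite Ex_sumf//; apply: avg_le => j.
  exact: (eps_abs_Ex hmodel C0 hnoise).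
have eM : Ex P (fun w => \sum_(o < Q) LM o w) <= Q%:R * ln #|G|%:R + (n - r)%:R * (2 * beta_mix P X q).
  have HM2 o : Ex P (LM o) <= ln #|G|%:R + \sum_(k < n - r) (if (k %% Q)%N == o then 2 * beta_mix P X q else 0).
    exact: (HM o).2.
  rewrite Ex_sumf//.
  apply: (le_trans (ler_sum _ (fun (o : 'I_Q) _ => HM2 o))).
  rewrite big_split /= sumr_const card_ord -(mulr_natl (ln _) Q) lerD2l exchange_big /=.
  rewrite (_ : _ * (2 * _) = \sum_(k < n - r) 2 * beta_mix P X q); last by rewrite sumr_const card_ord mulr_natl.
  apply: ler_sum => k _.
  rewrite (bigD1 (Ordinal (ltn_pmod k Q0)))//= eqxx big1 ?addr0// => o ko.
  by rewrite ifN//; apply: contraNneq ko => ko; apply/eqP/val_inj; exact: esym.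
have lnG : 0 <= ln #|G|%:R :> R by rewrite ln_ge0// ler1n.
have C0' := ltW C0; have F0' := ltW F0; have kap0' := ltW kap0; have B0' := ltW B0.
rewrite ler_pdivrMl//.
have c1_ge0 : 0 <= 512 * C * F * kap.
  by apply: mulr_ge0 kap0'; apply: mulr_ge0 F0'; apply: mulr_ge0 C0'; exact: ler0n.
have c2_ge0 : 0 <= 4 * B * Q%:R.
  by apply: mulr_ge0 (ler0n _ _); apply: mulr_ge0 B0'; exact: ler0n.
have h3 := ler_wpM2l (mulr_ge0 (ler0n R 4) B0') eM.
rewrite mulrDr in h3.
move: c1_ge0 c2_ge0 h3; set c1 := 512 * C * F * kap; set c2 := 4 * B * Q%:R => c1_ge0 c2_ge0 h3.
have h1 : c1 * Ex P LN <= c1 * ln #|G|%:R by exact: ler_wpM2l.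
have h2 := ler_wpM2l (mulr_ge0 (ler0n R 32) dl0) eE.
have h4 : delta ^+ 2 <= delta by rewrite expr2; exact: ler_piMr.
have h5 : (c1 + c2) * ln #|G|%:R <= (n - r)%:R * ((c1 + c2) * r.+1%:R * (ln #|G|%:R / n%:R)).
  have K0 : 0 <= (c1 + c2) * ln #|G|%:R by apply: mulr_ge0 => //; exact: addr_ge0.
  have n0 : 0 < n%:R :> R by rewrite ltr0n (leq_trans _ rn).
  rewrite (_ : (n - r)%:R * _ = ((c1 + c2) * ln #|G|%:R) * ((n - r)%:R * r.+1%:R / n%:R)); last first.
    by field; rewrite gt_eqF.
  apply: ler_peMr => //; rewrite ler_pdivlMr// mul1r -natrM ler_nat.
  have [a ->] : exists a, n = (r + a.+1)%N by exists (n - r.+1)%N; rewrite addnS -addSn subnKC.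
  by rewrite -[X in (_ <= (X - _) * _)%N]/(r + a.+1)%N addKn mulnS addnC leq_add2l leq_pmull.
have h6 : (n - r)%:R * (18 * delta ^+ 2) <= (n - r)%:R * (18 * delta).
  by apply: ler_wpM2l; [exact: ltW|apply: ler_wpM2l => //; exact: ler0n].
rewrite mulrDr -/c1.
have c2E : 4 * B * (Q%:R * ln #|G|%:R) = c2 * ln #|G|%:R by rewrite /c2 mulrA.
move: h1 h2 h3 h5 h6; move: (Ex P LN) (Ex P _) (Ex P _) => x1 x2 x3 h1 h2 h3 h5 h6.
lra.
Qed.

End Oracle.

(** * Covering numbers of network classes *)

Lemma mx_norm_leP (R : realType) m k (x : 'M[R]_(m, k)) (c : R) : 0 <= c ->
  `|x| <= c <-> forall i j, `|x i j| <= c.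
Proof.
move=> c0; rewrite [`|x|]/Num.norm /= mx_normrE; split.
  by move/bigmax_leP => [_ H] i j; exact: (H (i, j)).
by move=> H; apply/bigmax_leP; split => // ij _; exact: H.
Qed.

Lemma mx_norm_entry (R : realType) m k (x : 'M[R]_(m, k)) i j : `|x i j| <= `|x|.
Proof. exact: ((mx_norm_leP x (normr_ge0 x)).1 (lexx _)). Qed.

Section ParamNet.
Context {R : realType}.
Variables (m L : nat).

(* A weight ([Some]) or a bias ([None]) of a network of constant width [m]. *)
Definition pos : finType := ('I_L.+1 * 'I_m * option 'I_m)%type.

(** Constant width turns all parameters into one function on a finite type, so that a covering
    amounts to discretising this function. *)
Fixpoint pnet (t : pos -> R) (x : 'I_m -> R) (l : nat) : 'I_m -> R :=
  match l with
  | 0%N => fun a => \sum_k t (ord0, a, Some k) * x k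
  | l'.+1 => fun a => \sum_k t (inord l, a, Some k) *
      Num.max (pnet t x l' k - t (inord l, k, None)) 0
  end.

Lemma max0_lip (a b : R) : `|Num.max a 0 - Num.max b 0| <= `|a - b|.
Proof.
have h := ler_norm (a - b); have h' := ler_norm (b - a); rewrite distrC in h'.
by rewrite /Num.max ler_norml; case: ltP => h1; case: ltP => h2; apply/andP; split; lra.
Qed.

Lemma max0_abs (a : R) : `|Num.max a 0| <= `|a|.
Proof. by have := max0_lip a 0; rewrite maxxx !subr0. Qed.

Hypothesis m0 : (0 < m)%N.

Lemma sum_ord_le (a : 'I_m -> R) c : (forall k, a k <= c) -> \sum_k a k <= m%:R * c.
Proof.
move=> H; apply: (@le_trans _ _ (\sum_(k < m) c)); first by apply: ler_sum.
by rewrite sumr_const card_ord mulr_natl.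
Qed.

Lemma pnet_bound (t : pos -> R) x l a : (forall p, `|t p| <= 1) -> (forall k, `|x k| <= 1) ->
  `|pnet t x l a| <= (4 * m%:R) ^+ l.+1.
Proof.
have m1 : 1 <= m%:R :> R by rewrite ler1n.
move=> t1 x1; elim: l a => [|l IH] a /=.
  rewrite (le_trans (ler_norm_sum _ _ _))// expr1.
  apply: (@le_trans _ _ (m%:R * 1)); last by lra.
  by apply: sum_ord_le => k; rewrite normrM mulr_ile1.
rewrite (le_trans (ler_norm_sum _ _ _))// exprS.
have P1 : 1 <= (4 * m%:R) ^+ l.+1 :> R by rewrite exprn_ege1//; lra.
set E := (4 * m%:R) ^+ l.+1 in IH P1 *.
apply: (@le_trans _ _ (m%:R * (E + 1))); last first.
  rewrite (_ : 4 * m%:R * E = m%:R * (4 * E)); last by ring.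
  by rewrite ler_wpM2l//; lra.
apply: sum_ord_le => k; rewrite normrM -[leRHS]mul1r; apply: ler_pM => //.
rewrite (le_trans (max0_abs _))// (le_trans (ler_normB _ _))// lerD//.
Qed.

(** If the previous layer is bounded by E >= 1, a node is a sum of [m] products of a weight at most
    1 and a value at most E + 1. Both the size of the nodes and the effect of a perturbation
    therefore grow by a factor at most 4m per layer. *)
Lemma pnet_lip (t t' : pos -> R) x (e : R) l a :
  (forall p, `|t p| <= 1) -> (forall p, `|t' p| <= 1) -> (forall k, `|x k| <= 1) ->
  0 <= e -> (forall p, `|t p - t' p| <= e) ->
  `|pnet t x l a - pnet t' x l a| <= e * (4 * m%:R) ^+ l.+1.
Proof.
have m1 : 1 <= m%:R :> R by rewrite ler1n.
move=> t1 t1' x1 e0 tt; elim: l a => [|l IH] a /=.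
  rewrite -sumrB (le_trans (ler_norm_sum _ _ _))// expr1.
  apply: (@le_trans _ _ (m%:R * e)).
    apply: sum_ord_le => k; rewrite -mulrBl normrM -[leRHS]mulr1; exact: ler_pM.
  by rewrite mulrC ler_wpM2l//; lra.
rewrite -sumrB (le_trans (ler_norm_sum _ _ _))// [_ ^+ l.+2]exprS.
have P1 : 1 <= (4 * m%:R) ^+ l.+1 :> R by rewrite exprn_ege1//; lra.
have PB k := pnet_bound l k t1 x1.
set E := (4 * m%:R) ^+ l.+1 in IH P1 PB *.
apply: (@le_trans _ _ (m%:R * (e * (4 * E)))); last first.
  by rewrite le_eqVlt; apply/orP; left; apply/eqP; ring.
apply: sum_ord_le => k.
set y := Num.max (pnet t x l k - _) 0; set y' := Num.max (pnet t' x l k - _) 0.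
set w := t _; set w' := t' _.
rewrite (_ : w * y - w' * y' = (w - w') * y + w' * (y - y')); last by ring.
rewrite (le_trans (ler_normD _ _))// !normrM.
have h1 : `|w - w'| * `|y| <= e * (E + 1).
  apply: ler_pM => //; first exact: tt.
  rewrite /y (le_trans (max0_abs _))// (le_trans (ler_normB _ _))//.
  by rewrite lerD.
have h2 : `|w'| * `|y - y'| <= 1 * (e * E + e).
  apply: ler_pM => //; first exact: t1'.
  rewrite /y /y' (le_trans (max0_lip _ _))//.
  rewrite (_ : pnet t x l k - t (inord l.+1, k, None) - _ =
    (pnet t x l k - pnet t' x l k) + (t' (inord l.+1, k, None) - t (inord l.+1, k, None))); last by ring.
  by rewrite (le_trans (ler_normD _ _))// lerD// distrC.
have : e * 1 <= e * E by rewrite ler_wpM2l.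
lra.
Qed.

Variable (s M : nat).
Hypothesis M0 : (0 < M)%N.
Definition net_code := (s.-tuple (pos * 'I_(2 * M).+1))%type.

Definition net_decode (c : net_code) (p : pos) : R :=
  \sum_(e <- c | e.1 == p) ((e.2)%:R / M%:R - 1).

Definition round_param (x : R) : 'I_(2 * M).+1 := inord (Num.truncn (M%:R * (x + 1))).

Lemma round_paramP (x : R) : `|x| <= 1 ->
  `|(round_param x)%:R / M%:R - 1 : R| <= 1 /\ `|x - ((round_param x)%:R / M%:R - 1)| <= M%:R^-1.
Proof.
rewrite ler_norml => /andP[x1 x2].
have M0' : 0 < M%:R :> R by rewrite ltr0n.
have y0 : 0 <= M%:R * (x + 1) by rewrite mulr_ge0//; lra.
have /andP[h1 h2] := truncn_itv y0.
have rE : (round_param x : nat) = Num.truncn (M%:R * (x + 1)).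
  rewrite /round_param inordK// ltnS -[leqRHS](@natrK R); apply: le_truncn.
  by rewrite natrM mulrC ler_wpM2r//; lra.
rewrite rE; set k := Num.truncn _ in h1 h2 *.
have k1 : k%:R / M%:R <= x + 1 by rewrite ler_pdivrMr// mulrC.
have k2 : x + 1 <= k%:R / M%:R + M%:R^-1.
  rewrite (_ : k%:R / M%:R + M%:R^-1 = k.+1%:R / M%:R); last by rewrite -addn1 natrD mulrDl mul1r.
  by rewrite ler_pdivlMr// mulrC; exact: ltW.
have k0 : 0 <= k%:R / M%:R :> R by rewrite divr_ge0.
by split; rewrite ler_norml; apply/andP; split; lra.
Qed.

Lemma exists_net_code (t : pos -> R) : (0 < m)%N -> (forall p, `|t p| <= 1) ->
  (#|[set p | (t p != 0)%R]%SET| <= s)%N ->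
  exists c : net_code, forall p, `|net_decode c p| <= 1 /\ `|t p - net_decode c p| <= M%:R^-1.
Proof.
move=> m0' t1 cs; pose S := [set p | (t p != 0)%R]%SET.
pose p0 : pos := (ord0, Ordinal m0', None).
have Mle : (M < (2 * M).+1)%N by lia.
(* The padding entries carry the index M, which decodes to M / M - 1 = 0. *)
pose c : seq (pos * 'I_(2 * M).+1) := [seq (p, round_param (t p)) | p <- enum S] ++
  nseq (s - #|S|) (p0, Ordinal Mle).
have sc : size c == s.
  by rewrite size_cat size_map size_nseq -cardE subnKC.
have M0' : M%:R != 0 :> R by rewrite pnatr_eq0 -lt0n.
exists (Tuple sc) => p; rewrite /net_decode /= big_cat /= big_map /= [X in _ + X]big1_seq ?addr0.
  rewrite big_enum_cond /=.
  have [pS|pS] := boolP (p \in S).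
    rewrite (big_pred1 p); first exact: round_paramP.
    by move=> q /=; case: eqP => [->|_]; rewrite ?pS ?andbF.
  rewrite big_pred0; last by move=> q; case: eqP => [->|_]; rewrite ?(negbTE pS) ?andbF.
  move: pS; rewrite inE negbK => /eqP ->.
  by rewrite subrr normr0 invr_ge0 ler0n.
move=> e /andP[_]; rewrite mem_nseq => /andP[_ /eqP ->] /=.
by rewrite divff// subrr.
Qed.

End ParamNet.

Lemma leq_card_bigcup (I T : finType) (F : I -> {set T}) :
  (#|(\bigcup_i F i)%SET| <= \sum_i #|F i|)%N.
Proof.
elim/big_rec2: _ => [|i k A _ IH]; first by rewrite cards0.
by rewrite (leq_trans _ (leq_add (leqnn _) IH))// cardsU leq_subr.
Qed.

Lemma nnzE (R : realType) m k (A : 'M[R]_(m, k)) :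
  nnz A = #|[set ij : 'I_m * 'I_k | (A ij.1 ij.2 != 0)%R]%SET|.
Proof.
apply: eq_card => ij; rewrite inE; apply/idP/idP; first by move/set_mem.
by move=> H; apply/mem_set.
Qed.

(** * Removal of dead nodes *)

Section Pruning.
Context {R : realType}.
Variables (din dout L s m : nat) (p : nat -> nat).
Variables (W : forall i, 'M[R]_(p i.+1, p i)) (v : forall i, 'cV[R]_(p i)).
Hypotheses (v0 : v 0%N = 0).
Hypothesis W1 : forall j, (j <= L)%N -> `|W j| <= 1 /\ `|v j| <= 1.
Hypothesis Ws : (\sum_(0 <= j < L.+1) (nnz (W j) + nnz (v j)) <= s)%N.
Hypothesis sm : (s <= m)%N.
Hypothesis p0m : (p 0 <= m.+1)%N.
Hypothesis pLm : (p L.+1 <= m.+1)%N.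

Definition active (l : nat) : {set 'I_(p l)} :=
  match l return {set 'I_(p l)} with
  | 0%N => [set: 'I_(p 0)]
  | l'.+1 => if l' == L then [set: 'I_(p l'.+1)]
      else [set A : 'I_(p l'.+1) | [exists B, (W l' A B != 0)%R] || (v l'.+1 A ord0 != 0)%R]
  end%SET.

(** Input and output nodes keep their index, so the pruned network is fed and read at the same
    coordinates. *)
Definition rank (l : nat) (A : 'I_(p l)) : 'I_m.+1 :=
  if (l == 0%N) || (l == L.+1) then inord A else inord (index A (enum (active l))).

Lemma active_card l : (l < L)%N -> (#|active l.+1| <= s)%N.
Proof.
move=> lL; rewrite /= (ltn_eqF lL); apply: leq_trans Ws.
apply: (@leq_trans (nnz (W l) + nnz (v l.+1))).
  set U := [set A : 'I_(p l.+1) | [exists B, (W l A B != 0)%R]]%SET.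
  set V := [set A : 'I_(p l.+1) | (v l.+1 A ord0 != 0)%R]%SET.
  apply: (@leq_trans #|(U :|: V)%SET|).
    by apply: subset_leq_card; apply/fintype.subsetP => A; rewrite !inE.
  rewrite cardsU (leq_trans (leq_subr _ _))// leq_add//.
    rewrite nnzE (_ : U = [set ij.1 | ij in [set ij : 'I_(p l.+1) * 'I_(p l) | (W l ij.1 ij.2 != 0)%R]]%SET).
      exact: leq_imset_card.
    apply/setP => A; rewrite inE; apply/existsP/imsetP => [[B WB]|[[A' B] /=]].
      by exists (A, B); rewrite ?inE.
    by rewrite inE /= => WB ->; exists B.
  rewrite nnzE (_ : V = [set ij.1 | ij in [set ij : 'I_(p l.+1) * 'I_1 | (v l.+1 ij.1 ij.2 != 0)%R]]%SET).
    exact: leq_imset_card.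
  apply/setP => A; rewrite inE; apply/idP/imsetP => [vA|[[A' B] /=]].
    by exists (A, ord0); rewrite ?inE.
  by rewrite inE /= (ord1 B) => vA ->.
rewrite (big_cat_nat (n := l)) //=; last by lia.
rewrite [X in (_ <= _ + X)%N]big_ltn; last by lia.
rewrite [X in (_ <= _ + (_ + X))%N]big_ltn; last by lia.
lia.
Qed.

Lemma rank_inj l : (l <= L.+1)%N -> {in active l &, injective (@rank l)}.
Proof.
move=> lL A B Aa Ba; rewrite /rank.
have [l0|l0] := eqVneq l 0%N.
  subst l => /= /(congr1 val) /=; rewrite !inordK ?(leq_trans (ltn_ord _))//.
  exact: val_inj.
have [lE|lE] := eqVneq l L.+1.
  subst l => /= /(congr1 val) /=; rewrite !inordK ?(leq_trans (ltn_ord _))//.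
  exact: val_inj.
case: l l0 lE lL A B Aa Ba => // l _ lE lL A B Aa Ba /=.
have lL' : (l < L)%N by move: lE; rewrite eqSS; lia.
have idx C : C \in active l.+1 -> (index C (enum (active l.+1)) < m.+1)%N.
  move=> Ca; apply: (@leq_trans #|active l.+1|); first by rewrite cardE index_mem mem_enum.
  by rewrite (leq_trans (active_card lL'))// ltnW// ltnS.
move=> /(congr1 val) /=; rewrite !inordK; [|exact: idx|exact: idx].
move=> E; rewrite -(nth_index A (s := enum (active l.+1)) (x := A)) ?mem_enum//.
by rewrite E nth_index ?mem_enum.
Qed.

Lemma sum_rank l (F : 'I_(p l) -> R) A : (l <= L.+1)%N -> A \in active l ->
  \sum_(B in active l | rank B == rank A) F B = F A.
Proof.
move=> lL Aa; rewrite (big_pred1 A)// => B /=.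
apply/andP/eqP => [[Ba /eqP E]|->//].
exact: (rank_inj lL).
Qed.

Lemma sum_rank_dich l k (F : 'I_(p l) -> R) : (l <= L.+1)%N ->
  (exists2 A, A \in active l & (rank A = k /\ \sum_(B in active l | rank B == k) F B = F A)) \/
  (forall A, A \in active l -> rank A != k) /\ \sum_(B in active l | rank B == k) F B = 0.
Proof.
move=> lL; have [/existsP[A /andP[Aa /eqP Ak]]|H] := boolP [exists A, (A \in active l) && (rank A == k)].
  by left; exists A => //; split => //; rewrite -Ak sum_rank.
have H' A : A \in active l -> rank A != k.
  by move=> Aa; move/existsPn: H => /(_ A); rewrite Aa.
by right; split => //; apply: big_pred0 => B; apply/negP => /andP[/H']/negP.
Qed.

(** Ranks are injective on active nodes, so each sum has at most one term; written as a sum it is 0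
    at a position that is the rank of no active node. *)
Definition prune_param (q : pos m.+1 L) : R :=
  let: (l, a, o) := q in
  match o with
  | Some k => \sum_(A in active l.+1 | rank A == a) \sum_(B in active l | rank B == k) W l A B
  | None => \sum_(B in active l | rank B == a) v l B ord0
  end.

Lemma prune_param_le1 q : `|prune_param q| <= 1.
Proof.
case: q => [[l a] [k|]] /=.
  have [[A Aa [_ ->]]|[_ ->]] := sum_rank_dich a
     (fun A => \sum_(B in active l | rank B == k) W l A B) (ltn_ord l); last by rewrite normr0.
  have [[B Ba [_ ->]]|[_ ->]] := sum_rank_dich k
     (fun B => W l A B) (ltnW (ltn_ord l)); last by rewrite normr0.
  apply: le_trans (mx_norm_entry _ _ _) _; by apply: (W1 _).1; rewrite -ltnS.
have [[B Ba [_ ->]]|[_ ->]] := sum_rank_dich a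
     (fun B => v l B ord0) (ltnW (ltn_ord l)); last by rewrite normr0.
apply: le_trans (mx_norm_entry _ _ _) _; by apply: (W1 _).2; rewrite -ltnS.
Qed.

Lemma prune_param_support : (#|[set q | (prune_param q != 0)%R]%SET| <= s)%N.
Proof.
pose FW (l : 'I_L.+1) : {set pos m.+1 L} :=
  [set (l, rank ij.1, Some (rank ij.2)) | ij in [set ij : 'I_(p l.+1) * 'I_(p l) | (W l ij.1 ij.2 != 0)%R]]%SET.
pose Fv (l : 'I_L.+1) : {set pos m.+1 L} :=
  [set (l, rank ij.1, None) | ij in [set ij : 'I_(p l) * 'I_1 | (v l ij.1 ij.2 != 0)%R]]%SET.
have sub : ([set q | (prune_param q != 0)%R]%SET \subset \bigcup_l (FW l :|: Fv l))%SET.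
  apply/fintype.subsetP => -[[l a] o]; rewrite inE => H; apply/bigcupP; exists l => //.
  rewrite inE; case: o H => [k|] /= H; apply/orP; [left|right].
    move: H; have [[A Aa [<- ->]]|[_ ->]] := sum_rank_dich a
     (fun A => \sum_(B in active l | rank B == k) W l A B) (ltn_ord l); last by rewrite eqxx.
    have [[B Ba [<- ->]]|[_ ->]] := sum_rank_dich k
     (fun B => W l A B) (ltnW (ltn_ord l)); last by rewrite eqxx.
    by move=> WB; apply/imsetP; exists (A, B); rewrite ?inE.
  move: H; have [[B Ba [<- ->]]|[_ ->]] := sum_rank_dich a
     (fun B => v l B ord0) (ltnW (ltn_ord l)); last by rewrite eqxx.
  by move=> vB; apply/imsetP; exists (B, ord0); rewrite ?inE.
apply: (leq_trans (subset_leq_card sub)); apply: (leq_trans (leq_card_bigcup _)).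
apply: leq_trans Ws; rewrite big_mkord; apply: leq_sum => l _.
rewrite cardsU (leq_trans (leq_subr _ _))// leq_add// nnzE; exact: leq_imset_card.
Qed.

Variable x : 'cV[R]_(p 0).
Definition prune_input (k : 'I_m.+1) : R := if insub (k : nat) is Some i then x i ord0 else 0.

Lemma rank0E (B : 'I_(p 0)) : (rank B : nat) = B.
Proof. by rewrite /rank /= inordK// (leq_trans (ltn_ord _)). Qed.

Lemma prune_input_rank (B : 'I_(p 0)) : prune_input (rank B) = x B ord0.
Proof. by rewrite /prune_input rank0E valK. Qed.

Lemma inactive0 l A : (l < L)%N -> A \notin active l.+1 ->
  network W v x l A ord0 = 0 /\ v l.+1 A ord0 = 0.
Proof.
move=> lL; rewrite /= (ltn_eqF lL) inE negb_or => /andP[/existsPn WA vA].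
split; last by apply/eqP; rewrite negbK in vA.
have W0 B : W l A B = 0 by apply/eqP; have := WA B; rewrite negbK.
by case: l lL A vA WA W0 => [|l] lL A vA WA W0 /=; rewrite mxE big1// => B _; rewrite W0 mul0r.
Qed.

Lemma sum_by_rank l (G : 'I_(p l) -> 'I_m.+1 -> R) :
  \sum_k \sum_(B in active l | rank B == k) G B k = \sum_(B in active l) G B (rank B).
Proof.
rewrite (partition_big (@rank l) predT)//=; apply: eq_bigr => k _.
by apply: eq_bigr => B /andP[_ /eqP ->].
Qed.

Lemma prune_correct l (A : 'I_(p l.+1)) : (l <= L)%N -> A \in active l.+1 ->
  pnet prune_param prune_input l (rank A) = network W v x l A ord0.
Proof.
elim: l A => [|l IH] A lL Aa.
  rewrite /= mxE.
  under eq_bigr => k _ do rewrite (@sum_rank 1%N)// mulr_suml.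
  rewrite (sum_by_rank (fun B k => W 0 A B * prune_input k)).
  rewrite (eq_bigl predT); last by move=> B; rewrite /= inE.
  by apply: eq_bigr => B _; rewrite prune_input_rank.
rewrite [RHS]/= mxE.
have -> : pnet prune_param prune_input l.+1 (rank A) =
  \sum_k prune_param (inord l.+1, rank A, Some k) *
    Num.max (pnet prune_param prune_input l k - prune_param (inord l.+1, k, None)) 0 by [].
have El : (inord l.+1 : 'I_L.+1) = l.+1 :> nat by rewrite inordK.
have E1 k : prune_param (inord l.+1, rank A, Some k) =
    \sum_(B in active l.+1 | rank B == k) W l.+1 A B.
  by rewrite /prune_param El sum_rank.
have E2 k : prune_param (inord l.+1, k, None) =
    \sum_(B in active l.+1 | rank B == k) v l.+1 B ord0.
  by rewrite /prune_param El.
under eq_bigr => k _ do rewrite E1 E2 mulr_suml.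
rewrite (sum_by_rank (fun B k => W l.+1 A B * Num.max (pnet prune_param prune_input l k -
   \sum_(B in active l.+1 | rank B == k) v l.+1 B ord0) 0)).
rewrite [RHS](bigID (mem (active l.+1))) /= [X in _ = _ + X]big1 ?addr0.
  apply: eq_bigr => B Ba; rewrite sum_rank//; last exact: leqW.
  by rewrite mxE IH// ltnW.
move=> B Ba; have [n0 n1] := inactive0 lL Ba.
by rewrite mxE n0 n1 subrr maxxx mulr0.
Qed.

End Pruning.

Definition pad_input (R : realType) din m (x : 'cV[R]_din) (k : 'I_m.+1) : R :=
  if insub (k : nat) is Some i then x i ord0 else 0.

Section ClassCover.
Context {R : realType}.
Variables (din dout dt L L1 : nat) (p : nat -> nat) (s : nat) (F : R).
Local Notation class := (net_class R din dout dt L L1 p s F).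

Lemma net_class_measurable f j : class f ->
  measurable_fun [set: borel R din] (fun x : borel R din => f x j ord0).
Proof.
move=> [e0 [eL [W [v [fE _]]]]]; subst din.
have mN l i : measurable_fun [set: borel R (p 0)]
    (fun x : borel R (p 0) => network W v (x : 'cV[R]_(p 0)) l i ord0).
  elim: l i => [|l IH] i /=.
    rewrite (_ : (fun x : borel R (p 0) => _) = (fun x : borel R (p 0) => \sum_k W 0 i k * (x : 'cV[R]_(p 0)) k ord0)).
      apply: measurable_sum => k; apply: measurable_funM => //; exact: borel_coord_measurable.
    by apply/funext => x; rewrite mxE.
  rewrite (_ : (fun x : borel R (p 0) => _) = (fun x : borel R (p 0) =>
     \sum_k W l.+1 i k * Num.max (network W v (x : 'cV[R]_(p 0)) l k ord0 - v l.+1 k ord0) 0)).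
    apply: measurable_sum => k; apply: measurable_funM => //.
    by apply: measurable_maxr => //; apply: measurable_funB.
  by apply/funext => x; rewrite mxE; apply: eq_bigr => k _; rewrite mxE.
rewrite (_ : (fun x : borel R (p 0) => _) = (fun x : borel R (p 0) =>
  network W v (x : 'cV[R]_(p 0)) L (cast_ord (esym eL) j) ord0)); first exact: mN.
by apply/funext => x; rewrite fE castmxE /= castmx_id; congr (network _ _ _ _ _ _); exact/val_inj.
Qed.

Lemma net_class_bound f x j : class f -> `|f x j ord0| <= F.
Proof.
move=> [e0 [eL [W [v [_ [_ [_ [_ [_ fF]]]]]]]]].
exact: le_trans (mx_norm_entry _ _ _) (fF x).
Qed.

Lemma net_class_prune f m : class f -> (s <= m)%N -> (din <= m.+1)%N -> (dout <= m.+1)%N ->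
  exists t : pos m.+1 L -> R, [/\ forall q, `|t q| <= 1,
    (#|[set q | (t q != 0)%R]%SET| <= s)%N &
    forall x j, f x j ord0 = pnet t (@pad_input _ _ m x) L (inord j)].
Proof.
move=> [e0 [eL [W [v [fE [v0 [W1 [_ [Ws _]]]]]]]]] sm dm om.
subst din dout.
exists (prune_param (m := m) (L := L) W v); split.
- by move=> q; exact: (prune_param_le1 W1 Ws sm dm om).
- exact: (prune_param_support Ws sm dm om).
- move=> x j; rewrite fE !castmx_id.
  have jE : inord j = rank L m W v j.
    by apply/val_inj; rewrite /= /rank eqxx orbT.
  rewrite jE (prune_correct Ws sm dm om)//; last by rewrite /= eqxx inE.
Qed.

(** For a code whose decoded network is near some member of the class such a member is the centre,
    otherwise an arbitrary member is. The centres thus stay in the class, at the price of doubling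
    the radius. *)
Theorem net_class_cover (n m : nat) : (0 < n)%N -> (s <= m)%N -> (din <= m.+1)%N -> (dout <= m.+1)%N ->
  (exists f, class f) ->
  exists (G : finType) (net : G -> 'cV[R]_din -> 'cV[R]_dout),
  [/\ (0 < #|G|)%N,
      #|G| = ((L.+1 * m.+1 * m.+2 * (4 * n * (4 * m.+1) ^ L.+1).+1) ^ s)%N,
      forall g, class (net g) &
      forall f, class f -> exists g, forall x, cube x ->
        forall j, `|f x j ord0 - net g x j ord0| <= n%:R^-1].
Proof.
move=> n0 sm dm om [f1 Ff1].
(* With this M a member and its decoded network differ by at most 1/(2n), so twice the radius is
   1/n. *)
pose M := (2 * n * (4 * m.+1) ^ L.+1)%N.
have M0 : (0 < M)%N by rewrite !muln_gt0 n0/= expn_gt0.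
pose e : R := M%:R^-1 * (4 * m.+1%:R) ^+ L.+1.
have eE : e + e = n%:R^-1.
  have -> : e = M%:R^-1 * (4 * m.+1%:R) ^+ L.+1 by [].
  have -> : M%:R = 2 * n%:R * (4 * m.+1%:R) ^+ L.+1 :> R by rewrite !natrM natrX natrM.
  have q0 : (4 * m.+1%:R) ^+ L.+1 != 0 :> R by rewrite expf_neq0// mulf_neq0 ?pnatr_eq0.
  have n0' : n%:R != 0 :> R by rewrite pnatr_eq0 -lt0n.
  by move: q0; set q := (4 * m.+1%:R) ^+ L.+1 => q0; field; rewrite n0' q0.
pose near (f : 'cV[R]_din -> 'cV[R]_dout) (c : net_code m.+1 L s M) := forall x, cube x -> forall j,
  `|f x j ord0 - pnet (net_decode (R := R) c) (@pad_input _ _ m x) L (inord j)| <= e.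
have H c : exists f, class f /\ ((exists2 f', class f' & near f' c) -> near f c).
  have [[f Ff nf]|N] := pselect (exists2 f', class f' & near f' c).
    by exists f.
  by exists f1.
have [net netP] := choice H.
have cov f : class f -> exists g, forall x, cube x ->
        forall j, `|f x j ord0 - net g x j ord0| <= n%:R^-1.
  move=> Ff; have [t [t1 ts fE]] := net_class_prune Ff sm dm om.
  have [c cP] := @exists_net_code R m.+1 L isT s M M0 t isT t1 ts.
  have nf : near f c.
    move=> x cx j; rewrite fE; apply: pnet_lip => //.
    - by move=> q; exact: (cP q).1.
    - move=> k; rewrite /pad_input; case: insubP => [i _ _|_]; last by rewrite normr0.
      by have /andP[x0 x1] := cx i; rewrite ger0_norm.
    - by move=> q; exact: (cP q).2.
  exists c => x cx j; rewrite -eE.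
  have := (netP c).2 (ex_intro2 _ _ f Ff nf) x cx j; have := nf x cx j.
  set y := pnet _ _ _ _ => h1 h2; rewrite (le_trans (ler_distD y _ _))// lerD//.
  by rewrite distrC.
exists (net_code m.+1 L s M), net; split => //.
- by have [c _] := cov _ Ff1; apply/card_gt0P; exists c.
- rewrite card_tuple !card_prod card_option !card_ord.
  congr (_ ^ s)%N; congr (_ * _.+1)%N; rewrite /M; lia.
- by move=> g; exact: (netP g).1.
Qed.

End ClassCover.

(** * Taylor expansion in Hoelder balls *)

Section OneDim.
Context {R : realType}.
Implicit Types (u v : R -> R) (t l : R).

Definition wder u t l := forall e, 0 < e -> exists2 de, 0 < de &
  forall h, `|h| < de -> 0 <= t + h <= 1 -> `|u (t + h) - u t - l * h| <= e * `|h|.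

Lemma wder_cst c t : wder (fun=> c) t 0.
Proof. by move=> e e0; exists 1 => // h _ _; rewrite subrr sub0r mul0r oppr0 normr0 mulr_ge0// ltW. Qed.

Lemma wderD u v t l l' : wder u t l -> wder v t l' ->
  wder (fun x => u x + v x) t (l + l').
Proof.
move=> du dv e e0; have e2 : 0 < e / 2 by rewrite divr_gt0.
have [d1 d10 H1] := du _ e2; have [d2 d20 H2] := dv _ e2.
exists (Num.min d1 d2); first by rewrite lt_min d10.
move=> h; rewrite lt_min => /andP[h1 h2] th.
have := H1 h h1 th; have := H2 h h2 th => E2 E1.
rewrite (_ : u (t + h) + v (t + h) - _ - _ =
  (u (t + h) - u t - l * h) + (v (t + h) - v t - l' * h)); last by ring.
by rewrite (le_trans (ler_normD _ _))//; lra.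
Qed.

Lemma wderZ u t l c : wder u t l -> wder (fun x => c * u x) t (c * l).
Proof.
move=> du e e0; have c0 : 0 < `|c| + 1 by rewrite ltr_wpDl.
have [d1 d10 H1] := du (e / (`|c| + 1)) (divr_gt0 e0 c0).
exists d1 => // h h1 th; have := H1 h h1 th => E1.
rewrite (_ : c * u (t + h) - _ - _ = c * (u (t + h) - u t - l * h)); last by ring.
rewrite normrM (le_trans (ler_wpM2l _ E1))// mulrA ler_wpM2r//.
by rewrite mulrCA ler_piMr ?(ltW e0)// ler_pdivrMr// mul1r lerDl.
Qed.

Lemma wder_sum n (u : 'I_n -> R -> R) t (l : 'I_n -> R) : (forall i, wder (u i) t (l i)) ->
  wder (fun x => \sum_i u i x) t (\sum_i l i).
Proof.
elim: n u l => [|n IH] u l H.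
  rewrite big_ord0 (_ : (fun x => _) = (fun=> 0)); first exact: wder_cst.
  by apply/funext => x; rewrite big_ord0.
rewrite big_ord_recl (_ : (fun x => _) = (fun x => u ord0 x + \sum_i u (lift ord0 i) x)).
  by apply: wderD => //; apply: IH.
by apply/funext => x; rewrite big_ord_recl.
Qed.

Lemma wder_mul_lin u t l y : wder u t l ->
  wder (fun x => (x - y) * u x) t (u t + (t - y) * l).
Proof.
move=> du e e0.
pose A := `|t - y| + `|l| + 2.
have A0 : 0 < A by rewrite ltr_wpDl// addr_ge0.
pose e1 := Num.min 1 (e / A).
have e10 : 0 < e1 by rewrite lt_min ltr01 divr_gt0.
have [d1 d10 H1] := du _ e10.
exists (Num.min d1 e1); first by rewrite lt_min d10.
move=> h; rewrite lt_min => /andP[h1 h2] th; have := H1 h h1 th => E1.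
rewrite (_ : (t + h - y) * u (t + h) - _ - _ =
  (t - y) * (u (t + h) - u t - l * h) + h * ((u (t + h) - u t - l * h) + l * h)); last by ring.
have ee : e1 * A <= e by rewrite -ler_pdivlMr// ge_min lexx orbT.
have e11 : e1 <= 1 by rewrite ge_min lexx.
rewrite (le_trans (ler_normD _ _))// !normrM.
have b1 : `|u (t + h) - u t - l * h + l * h| <= (1 + `|l|) * e1.
  rewrite (le_trans (ler_normD _ _))// normrM mulrDl lerD//.
    rewrite (le_trans E1)//; apply: ler_pM => //; first exact: ltW.
    exact: ltW.
  by rewrite ler_wpM2l// ltW.
have b2 := ler_wpM2l (normr_ge0 (t - y)) E1.
have b3 := ler_wpM2l (normr_ge0 h) b1.
have : e1 * A * `|h| <= e * `|h| by rewrite ler_wpM2r.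
have : 0 <= e1 * `|h| by rewrite mulr_ge0// ltW.
rewrite /A; lra.
Qed.

Lemma wder_monomial y (j : nat) t :
  wder (fun x => (x - y) ^+ j.+1 / j.+1`!%:R) t ((t - y) ^+ j / j`!%:R).
Proof.
elim: j => [|j IH].
  have -> : (fun x : R => (x - y) ^+ 1 / 1`!%:R) = (fun x => (x - y) * 1).
    by apply/funext => x; rewrite expr1 (_ : 1`! = 1%N)// divr1 mulr1.
  have := wder_mul_lin y (wder_cst 1 t).
  by rewrite mulr0 addr0 expr0 fact0 divr1.
have := wderZ (j.+2%:R^-1) (wder_mul_lin y IH).
have -> : (fun x => j.+2%:R^-1 * ((x - y) * ((x - y) ^+ j.+1 / j.+1`!%:R))) =
   (fun x => (x - y) ^+ j.+2 / j.+2`!%:R).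
  apply/funext => x; rewrite [in RHS]exprS [in RHS]factS natrM invfM; ring.
have -> : j.+2%:R^-1 * ((t - y) ^+ j.+1 / j.+1`!%:R + (t - y) * ((t - y) ^+ j / j`!%:R)) =
   (t - y) ^+ j.+1 / j.+1`!%:R.
  have f0 : j`!%:R != 0 :> R by rewrite pnatr_eq0 -lt0n fact_gt0.
  rewrite factS natrM [in LHS]exprS [in RHS]exprS -[j.+2%:R]natr1 -![j.+1%:R]natr1.
  have j0 : 0 <= j%:R :> R by [].
  by field; rewrite f0 /=; apply/andP; split; rewrite gt_eqF//; lra.
by [].
Qed.

(* The supremum of the points where the bound holds is the right end point. *)
Lemma mean_value_le v (l : R -> R) a b C : 0 <= a -> a <= b -> b <= 1 ->
  (forall t, a <= t <= b -> wder v t (l t)) -> (forall t, a <= t <= b -> `|l t| <= C) ->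
  `|v b - v a| <= C * (b - a).
Proof.
move=> a0 ab b1 dv lC; apply/ler_addgt0Pr => e' e'0.
pose e := e' / (b - a + 1).
have e0 : 0 < e by rewrite divr_gt0//; lra.
pose S := [set x | a <= x <= b /\ `|v x - v a| <= (C + e) * (x - a)].
have Sa : S a by rewrite /S /= lexx ab subrr normr0 subrr mulr0.
have uS : has_sup S by split; [exists a|exists b => x [/andP[]]].
have step t h : a <= t <= b -> forall de, (forall h, `|h| < de -> 0 <= t + h <= 1 -> `|v (t + h) - v t - l t * h| <= e * `|h|) ->
    `|h| < de -> 0 <= t + h <= 1 -> `|v (t + h) - v t| <= (C + e) * `|h|.
  move=> tab de H hde th; have := H h hde th => E.
  rewrite -[v (t + h) - v t](subrK (l t * h)) (le_trans (ler_normD _ _))// normrM.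
  have : `|l t| * `|h| <= C * `|h| by rewrite ler_wpM2r// lC.
  lra.
have cb : sup S <= b by apply: ge_sup => [|x [/andP[]]//]; exists a.
have ac : a <= sup S by apply: ub_le_sup => //; exists b => x [/andP[]].
set c := sup S in cb ac *.
have cab : a <= c <= b by rewrite ac cb.
have [de de0 H] := dv c cab _ e0.
have Sc : S c.
  have [x [/andP[ax xb] Sx] xc] := sup_adherent de0 uS.
  have xc' : x <= c by apply: ub_le_sup; [exists b => z [/andP[]]|split=> //; rewrite ax].
  split; first by rewrite ac.
  have := step c (x - c) cab de H; rewrite addrCA subrr addr0 distrC [`|v x - _|]distrC ger0_norm ?subr_ge0// => h.
  have {}h : `|v c - v x| <= (C + e) * (c - x).
    by apply: h; [rewrite /c; lra|apply/andP; split; lra].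
  rewrite (le_trans (ler_distD (v x) _ _))//; lra.
have [cltb|bc] := ltP c b; last first.
  have -> : b = c by apply/eqP; rewrite eq_le bc cb.
  case: Sc => _ Sc; apply: (le_trans Sc).
  have : e * (b - a + 1) = e' by rewrite /e divfK// gt_eqF//; lra.
  have : e * (c - a) <= e * (b - a + 1) by rewrite ler_wpM2l ?(ltW e0)//; lra.
  lra.
pose h := Num.min (de / 2) (b - c).
have h0 : 0 < h by rewrite lt_min divr_gt0//= subr_gt0.
have hb : h <= b - c by rewrite ge_min lexx orbT.
have hd : h < de by rewrite gt_min; apply/orP; left; lra.
have := step c h cab de H; rewrite ger0_norm ?(ltW h0)// => /(_ hd) E.
have {}E : `|v (c + h) - v c| <= (C + e) * h by apply: E; apply/andP; split; lra.
have : S (c + h).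
  split; first by apply/andP; split; lra.
  rewrite (le_trans (ler_distD (v c) _ _))//; case: Sc => _; lra.
move=> Sch; have : c + h <= c by apply: ub_le_sup => //; exists b => z [/andP[]].
lra.
Qed.

Lemma mean_value_abs v (l : R -> R) x y C : 0 <= x <= 1 -> 0 <= y <= 1 ->
  (forall t, 0 <= t <= 1 -> wder v t (l t)) ->
  (forall t, 0 <= t <= 1 -> `|t - y| <= `|x - y| -> `|l t| <= C) ->
  `|v x - v y| <= C * `|x - y|.
Proof.
move=> /andP[x0 x1] /andP[y0 y1] dv lC.
have [xy|yx] := leP x y.
  rewrite distrC [`|x - y|]distrC [`|y - x|]ger0_norm ?subr_ge0//.
  apply: (@mean_value_le v l) => // t /andP[tx ty]; first by apply: dv; apply/andP; split; lra.
  apply: lC; first by apply/andP; split; lra.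
  by rewrite !ler0_norm; lra.
rewrite [`|x - y|]ger0_norm ?subr_ge0 ?(ltW yx)//.
apply: (@mean_value_le v l) => //; first exact: ltW.
  by move=> t /andP[tx ty]; apply: dv; apply/andP; split; lra.
move=> t /andP[tx ty]; apply: lC; first by apply/andP; split; lra.
by rewrite !ger0_norm; lra.
Qed.

(** Induction on [k]: the derivative of the remainder of [u 0] is the shorter remainder of [u 1],
    and the mean value inequality from [y], where the remainder vanishes, supplies one more power of
    |x - y|. *)
Lemma taylor1 (k : nat) (u : nat -> R -> R) (H g x y : R) : 0 <= g -> 0 <= H ->
  0 <= x <= 1 -> 0 <= y <= 1 ->
  (forall j t, (j < k)%N -> 0 <= t <= 1 -> wder (u j) t (u j.+1 t)) ->
  (forall t s, 0 <= t <= 1 -> 0 <= s <= 1 -> `|u k t - u k s| <= H * `|t - s| `^ g) ->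
  `|u 0%N x - \sum_(j < k.+1) u j y * ((x - y) ^+ j / j`!%:R)| <= H * `|x - y| `^ (g + k%:R).
Proof.
move=> g0 H0; elim: k u x => [|k IH] u x x01 y01 du Hk.
  by rewrite big_ord1 expr0 fact0 divr1 mulr1 addr0; exact: Hk.
pose v t := u 0%N t - \sum_(j < k.+2) u j y * ((t - y) ^+ j / j`!%:R).
pose dv t := u 1%N t - \sum_(j < k.+1) u j.+1 y * ((t - y) ^+ j / j`!%:R).
have vy : v y = 0.
  rewrite /v big_ord_recl subrr expr0 fact0 divr1 mulr1 big1 ?addr0 ?subrr// => j _.
  by rewrite expr0n /= mul0r mulr0.
have dvE t : 0 <= t <= 1 -> wder v t (dv t).
  move=> t01; rewrite /dv (_ : v = fun t => u 0%N t + (-1) * (u 0%N y + \sum_(j < k.+1) u j.+1 y * ((t - y) ^+ j.+1 / j.+1`!%:R))); last first.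
    apply/funext => z; rewrite /v big_ord_recl expr0 fact0 divr1 mulr1 mulN1r.
    by congr (_ - (_ + _)); apply: eq_bigr.
  rewrite -[X in wder _ _ (_ - X)]add0r -[X in wder _ _ (_ + X)]mulN1r.
  apply: wderD; first exact: du.
  apply: wderZ; apply: wderD; first exact: wder_cst.
  by apply: wder_sum => j; apply: wderZ; exact: wder_monomial.
have dvb t : 0 <= t <= 1 -> `|dv t| <= H * `|t - y| `^ (g + k%:R).
  move=> t01; apply: (IH (fun j => u j.+1)) => //.
  by move=> j s jk s01; apply: du.
have := @mean_value_abs v dv x y (H * `|x - y| `^ (g + k%:R)) x01 y01 dvE.
rewrite vy subr0 => M; apply: (le_trans (M _)).
  move=> t t01 txy; apply: (le_trans (dvb t t01)); rewrite ler_wpM2l//.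
  by apply: ge0_ler_powR => //; rewrite ?nnegrE// addr_ge0.
have gk : 0 < g + k.+1%:R by rewrite ltr_wpDl.
by rewrite -mulrA [_ * `|_|]mulrC -(@mulr_powRB1 _ _ (g + k.+1%:R))// -natr1 addrA addrK.
Qed.

End OneDim.

(** * Polynomials as lists of monomials *)

Section MonomialLists.
Context {R : realType} {m : nat}.
Implicit Types (l : seq (R * seq 'I_m)) (x y : 'cV[R]_m).

Definition mono (w : seq 'I_m) x : R := \prod_(i <- w) x i ord0.
Definition peval l x : R := \sum_(q <- l) q.1 * mono q.2 x.

(** Equal words are not collected: the list doubles, and the coefficients do not grow when |a| <=
    1. *)
Definition pmul_lin (i : 'I_m) (a : R) l :=
  [seq (q.1, i :: q.2) | q <- l] ++ [seq (- a * q.1, q.2) | q <- l].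

Lemma peval_mul_lin i a l x : peval (pmul_lin i a l) x = (x i ord0 - a) * peval l x.
Proof.
rewrite /peval /pmul_lin big_cat /= !big_map mulr_sumr -big_split /=.
by apply: eq_bigr => q _; rewrite /mono big_cons; ring.
Qed.

Definition pscale (c : R) l := [seq (c * q.1, q.2) | q <- l].

Lemma peval_scale c l x : peval (pscale c l) x = c * peval l x.
Proof.
by rewrite /peval big_map mulr_sumr; apply: eq_bigr => q _; rewrite mulrA.
Qed.

Lemma peval_flatten (ls : seq (seq (R * seq 'I_m))) x :
  peval (flatten ls) x = \sum_(l <- ls) peval l x.
Proof. by rewrite /peval big_flatten. Qed.

(** These bounds will be uniform in the expansion point, since they determine the size of the
    network blocks: number of monomials, degree and coefficients. The index [i] confines the
    variables to the first [i] coordinates. *)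
Definition pbound (n i k : nat) (c : R) l :=
  (size l <= n)%N /\ forall q, q \in l ->
    [/\ `|q.1| <= c, (size q.2 <= k)%N & forall j, j \in q.2 -> (j < i)%N].

Lemma pbound_mul_lin n i k c (j : 'I_m) a l : (j < i)%N -> `|a| <= 1 ->
  pbound n i k c l -> pbound (2 * n) i k.+1 c (pmul_lin j a l).
Proof.
move=> ji a1 [ln H]; split.
  by rewrite size_cat !size_map mul2n -addnn leq_add.
move=> q; rewrite mem_cat => /orP[] /mapP[q' q'l ->] /=; have [h1 h2 h3] := H q' q'l; split => //.
- by move=> j'; rewrite inE => /orP[/eqP ->//|/h3].
- by rewrite normrM normrN (le_trans _ h1)// ler_piMl.
- exact: leqW.
Qed.

Lemma pbound_scale n i k c (a : R) l : `|a| <= 1 ->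
  pbound n i k c l -> pbound n i k c (pscale a l).
Proof.
move=> a1 [ln H]; split; first by rewrite size_map.
move=> q /mapP[q' q'l ->] /=; have [h1 h2 h3] := H q' q'l; split => //.
by rewrite normrM (le_trans _ h1)// ler_piMl.
Qed.

Lemma pbound_le n n' i i' k k' c l : (n <= n')%N -> (i <= i')%N -> (k <= k')%N ->
  pbound n i k c l -> pbound n' i' k' c l.
Proof.
move=> nn ii kk [ln H]; split; first exact: leq_trans ln nn.
move=> q ql; have [h1 h2 h3] := H q ql; split => //; first exact: leq_trans kk.
by move=> j /h3 ji; exact: leq_trans ii.
Qed.

Lemma pbound_flatten n i k c (ls : seq (seq (R * seq 'I_m))) :
  (forall l, l \in ls -> pbound n i k c l) -> pbound (size ls * n) i k c (flatten ls).
Proof.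
elim: ls => [|l ls IH] H; first by split.
have [h1 h2] := H l (mem_head _ _).
have [h3 h4] := IH (fun l' l'ls => H l' (mem_behead (s := l :: ls) l'ls)).
split; first by rewrite size_cat mulSn leq_add.
by move=> q; rewrite mem_cat => /orP[/h2|/h4].
Qed.

Lemma mono_agree (w : seq 'I_m) x y (i : nat) : (forall j, j \in w -> (j < i)%N) ->
  (forall j : 'I_m, (j < i)%N -> x j ord0 = y j ord0) -> mono w x = mono w y.
Proof.
move=> wi xy; rewrite /mono big_seq [RHS]big_seq; apply: eq_bigr => j jw.
by apply: xy; exact: wi.
Qed.

Lemma peval_agree n i k c l x y : pbound n i k c l ->
  (forall j : 'I_m, (j < i)%N -> x j ord0 = y j ord0) -> peval l x = peval l y.
Proof.
move=> [_ H] xy; rewrite /peval big_seq [RHS]big_seq; apply: eq_bigr => q ql.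
by have [_ _ h] := H q ql; rewrite (mono_agree h xy).
Qed.

Lemma mono_cube w x : cube x -> 0 <= mono w x <= 1.
Proof.
move=> cx; rewrite /mono; elim: w => [|i w IH]; first by rewrite big_nil ler01 lexx.
rewrite big_cons; have /andP[x0 x1] := cx i; move: IH => /andP[p0 p1].
by rewrite mulr_ge0//= mulr_ile1.
Qed.

Lemma mono_lip w x y : cube x -> cube y -> `|mono w x - mono w y| <= (size w)%:R * `|x - y|.
Proof.
move=> cx cy; elim: w => [|i w IH].
  by rewrite /mono !big_nil subrr normr0 mul0r.
rewrite /mono !big_cons -!/(mono _ _).
have -> : x i ord0 * mono w x - y i ord0 * mono w y =
  (x i ord0 - y i ord0) * mono w x + y i ord0 * (mono w x - mono w y) by ring.
rewrite (le_trans (ler_normD _ _))// !normrM /= -[(size w).+1%:R]nat1r mulrDl mul1r lerD//.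
  have /andP[p0 p1] := mono_cube w cx; rewrite (ger0_norm p0).
  rewrite -[leRHS]mulr1; apply: ler_pM => //.
  by have := mx_norm_entry (x - y) i ord0; rewrite !mxE.
have /andP[p0 p1] := cy i; rewrite (ger0_norm p0).
by apply: le_trans IH; rewrite ler_piMl.
Qed.

Lemma peval_lip n i k c l x y : 0 <= c -> pbound n i k c l -> cube x -> cube y ->
  `|peval l x - peval l y| <= n%:R * (c * k%:R) * `|x - y|.
Proof.
move=> c0 [ln H] cx cy; rewrite /peval -sumrB (le_trans (ler_norm_sum _ _ _))//.
apply: (@le_trans _ _ (\sum_(q <- l) (c * k%:R) * `|x - y|)).
  rewrite big_seq [leRHS]big_seq; apply: ler_sum => q ql.
  have [h1 h2 h3] := H q ql; rewrite -mulrBr normrM -mulrA; apply: ler_pM => //.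
  by apply: (le_trans (mono_lip _ cx cy)); rewrite ler_wpM2r// ler_nat.
rewrite big_const_seq count_predT iter_addr_0 -[leLHS]mulr_natl mulrA.
by rewrite ler_wpM2r// ler_wpM2r ?mulr_ge0// ler_nat.
Qed.

End MonomialLists.

Section MultiTaylor.
Context {R : realType} {m : nat}.
Implicit Types (f g : 'cV[R]_m -> R) (x y : 'cV[R]_m) (s : seq 'I_m).
Local Notation D := (@cube R m).

Definition setc x (i : 'I_m) (t : R) : 'cV[R]_m := x + (t - x i ord0) *: delta_mx i ord0.

Lemma setcE x i t j : setc x i t j ord0 = if j == i then t else x j ord0.
Proof.
rewrite !mxE /= andbT; case: eqP => [->|_]; first by rewrite mulr1 addrC subrK.
by rewrite mulr0 addr0.
Qed.

Lemma setc_add x i t h : setc x i t + h *: delta_mx i ord0 = setc x i (t + h).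
Proof. by rewrite /setc -addrA -scalerDl; congr (_ + _ *: _); ring. Qed.

Lemma setc_cube x i t : D x -> 0 <= t <= 1 -> D (setc x i t).
Proof. by move=> Dx t01 j; rewrite setcE; case: eqP => // _; exact: Dx. Qed.

Lemma has_pderiv_wder g i x t : D x -> 0 <= t <= 1 -> has_pderiv D g i (setc x i t) ->
  wder (fun t => g (setc x i t)) t (pderiv D i g (setc x i t)).
Proof.
move=> Dx t01; rewrite /has_pderiv /pderiv; set l := lim _ => H e e0.
have {}H : diff_quot g i (setc x i t) @ step_filter D i (setc x i t) --> l by [].
have FF : Filter (step_filter D i (setc x i t)) by rewrite /step_filter; exact: within_filter.
move/cvgrPdist_le : H => /(_ _ e0); rewrite /step_filter !near_withinE.
move=> /nbhs_ballP[de /= de0 Hd]; exists de => // h hd th.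
have [->|h0] := eqVneq h 0.
  by rewrite addr0 subrr mulr0 subrr normr0 mulr0.
have := Hd h; rewrite /ball /= sub0r normrN => /(_ hd h0).
have Dh : D (setc x i t + h *: delta_mx i ord0) by rewrite setc_add; exact: setc_cube.
move=> /(_ Dh); rewrite /diff_quot setc_add => E.
have hn : 0 < `|h| by rewrite normr_gt0.
have -> : g (setc x i (t + h)) - g (setc x i t) - l * h =
  - h * (l - h^-1 * (g (setc x i (t + h)) - g (setc x i t))).
  by field.
by rewrite normrM normrN mulrC ler_wpM2r.
Qed.

Variables (f : 'cV[R]_m -> R) (k : nat) (beta K : R).
Hypothesis kb : k%:R < beta.
Hypothesis K0 : 0 <= K.
(** The quantitative bounds of the Hoelder ball concern derivatives taken in the order of
    [enum 'I_m], which correspond to sorted words. *)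
Definition ordered s := sorted (fun i j : 'I_m => (i <= j)%N) s.
Hypothesis Hd : forall s (j : 'I_m), (size s < k)%N -> forall x, D x -> has_pderiv D (pderivs D s f) j x.
Hypothesis Hb : forall s, ordered s -> (size s <= k)%N -> forall x, D x -> `|pderivs D s f x| <= K.
Hypothesis Hh : forall s, ordered s -> size s = k -> forall x y, D x -> D y ->
  `|pderivs D s f x - pderivs D s f y| <= K * `|x - y| `^ (beta - k%:R).

Definition agree_from (i : nat) x y := forall j : 'I_m, (i <= j)%N -> x j ord0 = y j ord0.

Lemma ordered_nseq a (j : 'I_m) s : ordered s -> (forall i, i \in s -> (j <= i)%N) ->
  ordered (nseq a j ++ s).
Proof.
move=> os js; have tr : transitive (fun i j : 'I_m => (i <= j)%N).
  by move=> y x z; exact: leq_trans.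
elim: a => [//|a IH].
rewrite /ordered /= path_min_sorted//; apply/allP => i; rewrite mem_cat => /orP[|/js//].
by rewrite mem_nseq => /andP[_ /eqP ->].
Qed.

(** Induction on the number [i] of free coordinates. The new one, [j], is expanded by [taylor1]; the
    coefficients are derivatives at points whose coordinate [j] is that of [y], so they fall under
    the induction hypothesis. Prepending copies of [j] to a word with larger letters keeps it
    sorted. *)
Lemma taylor_coords (i : nat) : (i <= m)%N -> exists (n : nat) (C : R), 0 <= C /\
  forall s y, ordered s -> (forall j, j \in s -> (i <= j)%N) -> (size s <= k)%N -> D y ->
  exists l, pbound n i (k - size s) K l /\ forall x, D x -> agree_from i x y ->
    `|pderivs D s f x - peval l x| <= C * `|x - y| `^ (beta - (size s)%:R).
Proof.
elim: i => [_|i IH im].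
  exists 1%N, 0; split => // s y os _ sk Dy.
  exists [:: (pderivs D s f y, [::])]; split.
    split => // q; rewrite inE => /eqP -> /=; split => //; exact: Hb.
  move=> x Dx xy; have -> : x = y.
    by apply/matrixP => a b; rewrite (ord1 b); exact: xy.
  by rewrite /peval big_seq1 /mono big_nil mulr1 /= subrr normr0 mul0r.
have [n [C [C0 {}IH]]] := IH (ltnW im).
pose j : 'I_m := Ordinal im.
exists (k.+1 * (2 ^ k * n))%N, (K + k.+1%:R * C); split.
  by rewrite addr_ge0// mulr_ge0.
move=> s y os si sk Dy.
have osa a : ordered (nseq a j ++ s) by apply: ordered_nseq => // i' /si /ltnW.
have sia a : forall j', j' \in nseq a j ++ s -> (i <= j')%N.
  move=> j'; rewrite mem_cat mem_nseq => /orP[/andP[_ /eqP ->]//|/si /ltnW//].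
have H a : exists l, (a <= k - size s)%N -> pbound n i (k - size s - a) K l /\
   forall x, D x -> agree_from i x y ->
    `|pderivs D (nseq a j ++ s) f x - peval l x| <= C * `|x - y| `^ (beta - (size s)%:R - a%:R).
  have [ak|ak] := boolP (a <= k - size s)%N; last by exists [::].
  have sa : size (nseq a j ++ s) = (a + size s)%N by rewrite size_cat size_nseq.
  have [|l [bl Hl]] := IH (nseq a j ++ s) y (osa a) (sia a) _ Dy; first by rewrite sa; lia.
  exists l => _; split; first by move: bl; rewrite sa subnDAC.
  move=> x Dx xy; have := Hl x Dx xy; rewrite sa natrD.
  by rewrite (_ : beta - (a%:R + (size s)%:R) = beta - (size s)%:R - a%:R)//; ring.
have [ls lsP] := choice H.
pose k' := (k - size s)%N.
pose term a := pscale (a`!%:R^-1) (iter a (pmul_lin j (y j ord0)) (ls a)).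
exists (flatten [seq term a | a <- iota 0 k'.+1]).
have yj1 : `|y j ord0| <= 1 by have /andP[? ?] := Dy j; rewrite ger0_norm.
have iterE a l x : peval (iter a (pmul_lin j (y j ord0)) l) x = peval l x * (x j ord0 - y j ord0) ^+ a.
  elim: a => [|a IHa]; first by rewrite expr0 mulr1.
  by rewrite iterS peval_mul_lin IHa exprS; ring.
have termE a x : peval (term a) x = peval (ls a) x * ((x j ord0 - y j ord0) ^+ a / a`!%:R).
  by rewrite peval_scale iterE; ring.
have fi a : 0 <= (a`!%:R^-1 : R) <= 1.
  by rewrite invr_ge0 ler0n /= invf_le1 ?ltr0n ?fact_gt0// ler1n fact_gt0.
have iterB a q l : pbound n i q K l -> pbound (2 ^ a * n) i.+1 (q + a) K (iter a (pmul_lin j (y j ord0)) l).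
  move=> bl; elim: a => [|a IHa]; first by rewrite addn0 mul1n; apply: pbound_le bl.
  by rewrite iterS expnS -mulnA addnS; apply: pbound_mul_lin.
split.
  have -> : (k.+1 * (2 ^ k * n) = (k - k') * (2 ^ k * n) + size [seq term a | a <- iota 0 k'.+1] * (2 ^ k * n))%N.
    by rewrite size_map size_iota -mulnDl; congr (_ * _)%N; rewrite /k'; lia.
  apply: (@pbound_le _ _ (size [seq term a | a <- iota 0 k'.+1] * (2 ^ k * n)) _ i.+1 _ k' _ K) => //.
    exact: leq_addl.
  apply: pbound_flatten => l /mapP[a]; rewrite mem_iota add0n ltnS => /andP[_ ak] ->.
  apply: pbound_scale; first by have /andP[f0 f1] := fi a; rewrite ger0_norm.
  have [bl _] := lsP a ak.
  apply: pbound_le (iterB a _ _ bl) => //; last by rewrite /k' in ak *; lia.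
  by rewrite leq_mul2r leq_exp2l// orbC (leq_trans ak) ?leq_subr.
move=> x Dx xy; set r := `|x - y|.
pose u a t := pderivs D (nseq a j ++ s) f (setc x j t).
have x01 := Dx j; have y01 := Dy j.
have bk0 : 0 <= beta - k%:R by rewrite subr_ge0 ltW.
have sk' : (k' + size s = k)%N by rewrite /k' subnK.
have setc_id : setc x j (x j ord0) = x by rewrite /setc subrr scale0r addr0.
have rj : `|x j ord0 - y j ord0| <= r by have := mx_norm_entry (x - y) j ord0; rewrite !mxE.
have r0 : 0 <= r by exact: normr_ge0.
have T := @taylor1 R k' u K (beta - k%:R) (x j ord0) (y j ord0) bk0 K0 x01 y01 _ _.
have {}T : `|u 0 (x j ord0) - \sum_(a < k'.+1) u a (y j ord0) * ((x j ord0 - y j ord0) ^+ a / a`!%:R)|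
    <= K * `|x j ord0 - y j ord0| `^ (beta - k%:R + k'%:R).
  apply: T.
    move=> a t ak t01; apply: has_pderiv_wder => //; apply: Hd; last exact: setc_cube.
    by rewrite size_cat size_nseq -sk' ltn_add2r.
  move=> t t' t01 t'01; apply: (le_trans (Hh (osa k') _ (setc_cube j Dx t01) (setc_cube j Dx t'01))).
    by rewrite size_cat size_nseq.
  rewrite ler_wpM2l//; apply: ge0_ler_powR => //; rewrite ?nnegrE//.
  apply/mx_norm_leP => // a b; rewrite (ord1 b) [X in `|X|]mxE [X in _ + X]mxE !setcE.
  by case: eqP => _ //; rewrite subrr normr0.
have E0 : u 0%N (x j ord0) = pderivs D s f x by rewrite /u setc_id.
rewrite E0 in T.
have bs : beta - k%:R + k'%:R = beta - (size s)%:R.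
  by rewrite -[in LHS]sk' natrD; ring.
rewrite bs in T.
have sb : (size s)%:R <= (k%:R : R) by rewrite ler_nat.
have pw : r `^ (beta - (size s)%:R) >= 0 by exact: powR_ge0.
have T1 : K * `|x j ord0 - y j ord0| `^ (beta - (size s)%:R) <= K * r `^ (beta - (size s)%:R).
  by rewrite ler_wpM2l//; apply: ge0_ler_powR => //; rewrite ?nnegrE//; lra.
have T2 (a : 'I_k'.+1) : `|u a (y j ord0) * ((x j ord0 - y j ord0) ^+ a / a`!%:R) - peval (term a) x|
   <= C * r `^ (beta - (size s)%:R).
  have ak : (a <= k - size s)%N by have := ltn_ord a; rewrite ltnS.
  have [bl Hl] := lsP a ak.
  rewrite termE -mulrBl normrM.
  (* The coefficient is evaluated with coordinate [j] reset to that of [y]; its polynomial does not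
     involve coordinate [j] and has the same value at [x]. *)
  set x' := setc x j (y j ord0).
  have Dx' : D x' by exact: setc_cube.
  have ag : agree_from i x' y.
    move=> b ib; rewrite setcE; case: eqP => [->//|/eqP bj]; apply: xy.
    by rewrite ltn_neqAle ib andbT; apply: contraNneq bj => E; apply/eqP/val_inj.
  have -> : peval (ls a) x = peval (ls a) x'.
    apply: (peval_agree bl) => b bi; rewrite setcE; case: eqP => // bj.
    by move: bi; rewrite bj /= ltnn.
  have := Hl x' Dx' ag; rewrite -/(u a (y j ord0)) => E.
  have xx : `|x' - y| <= r.
    apply/mx_norm_leP => // b c; rewrite (ord1 c) [X in `|X|]mxE [X in _ + X]mxE setcE.
    case: eqP => [->|_]; first by rewrite subrr normr0.
    by have := mx_norm_entry (x - y) b ord0; rewrite !mxE.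
  have aR : a%:R <= (k%:R - (size s)%:R : R) by rewrite -natrB// ler_nat.
  have E1 : `|u a (y j ord0) - peval (ls a) x'| <= C * r `^ (beta - (size s)%:R - a%:R).
    have ba : 0 <= beta - (size s)%:R - a%:R.
      rewrite -addrA -opprD subr_ge0 -natrD (le_trans _ (ltW kb))// ler_nat.
      by rewrite -leq_subRL.
    apply: (le_trans E); rewrite ler_wpM2l//; apply: ge0_ler_powR => //;
      by rewrite nnegrE ?normr_ge0 ?r0.
  have E2 : `|(x j ord0 - y j ord0) ^+ a / a`!%:R| <= r ^+ a.
    rewrite normrM normrX -[leRHS]mulr1; apply: ler_pM => //.
      by rewrite lerXn2r// nnegrE.
    by have /andP[f0 f1] := fi a; rewrite ger0_norm.
  apply: (le_trans (ler_pM (normr_ge0 _) (normr_ge0 _) E1 E2)).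
  rewrite -mulrA ler_wpM2l// -powR_mulrn// -powRD ?subrK//.
  by rewrite gt_eqF// subr_gt0 (le_lt_trans sb kb).
rewrite peval_flatten big_map (_ : iota 0 k'.+1 = index_iota 0 k'.+1); last by rewrite /index_iota subn0.
rewrite big_mkord.
rewrite (_ : _ - _ = (pderivs D s f x - \sum_(a < k'.+1) u a (y j ord0) * ((x j ord0 - y j ord0) ^+ a / a`!%:R))
   + \sum_(a < k'.+1) (u a (y j ord0) * ((x j ord0 - y j ord0) ^+ a / a`!%:R) - peval (term a) x)); last first.
  by rewrite sumrB; ring.
rewrite (le_trans (ler_normD _ _))// mulrDl; apply: lerD; first exact: le_trans T1.
rewrite (le_trans (ler_norm_sum _ _ _))//.
apply: (@le_trans _ _ (\sum_(a < k'.+1) C * r `^ (beta - (size s)%:R))); first by apply: ler_sum => a _.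
rewrite sumr_const card_ord -[leLHS]mulr_natl -mulrA ler_wpM2r ?mulr_ge0//.
by rewrite ler_nat ltnS leq_subr.
Qed.

Lemma taylor_cube : exists (n : nat) (C : R), 0 <= C /\
  forall y, D y -> exists l, pbound n m k K l /\ forall x, D x ->
    `|f x - peval l x| <= C * `|x - y| `^ beta.
Proof.
have [n [C [C0 H]]] := taylor_coords (leqnn m).
exists n, C; split => // y Dy; have [l [bl Hl]] := H [::] y isT (fun _ => ltac:(by [])) (leq0n _) Dy.
exists l; split; first by move: bl; rewrite subn0.
move=> x Dx; have := Hl x Dx _; rewrite subr0; apply.
by move=> j mj; have := ltn_ord j; rewrite ltnNge mj.
Qed.

End MultiTaylor.

Section HoelderExtract.
Context {R : realType}.

Lemma sfloor_lt (beta : R) : 0 < beta -> (sfloor beta)%:R < beta.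
Proof.
move=> b0; rewrite /sfloor.
elim/big_ind: _ => [//|x y hx hy|i //].
by rewrite /maxn; case: ifP.
Qed.

Variable m : nat.
Hypothesis m0 : (0 < m)%N.

Lemma ordered_flatten (c : 'I_m -> nat) (l : seq 'I_m) : ordered l ->
  ordered (flatten [seq nseq (c j) j | j <- l]).
Proof.
elim: l => [//|j l IH] jl /=; apply: ordered_nseq; first exact/IH/path_sorted/jl.
have tr : transitive (fun i j : 'I_m => (i <= j)%N) by move=> y x z; exact: leq_trans.
move=> i /flattenP[_ /mapP[j' j'l ->]]; rewrite mem_nseq => /andP[_ /eqP ->].
by have /allP := order_path_min tr jl; apply.
Qed.

Lemma ordered_enum : ordered (enum 'I_m).
Proof.
have := iota_sorted 0 m; rewrite -val_enum_ord sorted_map; exact.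
Qed.

Lemma ordered_word (c : 'I_m -> nat) (s : seq 'I_m) : ordered s ->
  (forall j, c j = count_mem j s) ->
  flatten [seq nseq (c j) j | j <- enum 'I_m] = s.
Proof.
move=> os cs; apply: (@sorted_eq _ (fun i j : 'I_m => (i <= j)%N)) => //.
- by move=> y x z; exact: leq_trans.
- by move=> x y H; apply/val_inj/anti_leq.
- exact/ordered_flatten/ordered_enum.
- rewrite /perm_eq; apply/allP => i _ /=; apply/eqP.
  rewrite count_flatten -map_comp sumnE big_map big_enum /= (bigD1 i)//= big1.
    by rewrite addn0 count_nseq /= eqxx mul1n cs.
  by move=> j ji; rewrite count_nseq /= (negbTE ji) mul0n.
Qed.

(** The Hoelder ball is stated with multi-indices and the expansion with words; sorted words are the
    dictionary between them. *)
Lemma word_multi (k : nat) (s : seq 'I_m) : ordered s -> (size s <= k)%N ->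
  exists a : {ffun 'I_m -> 'I_k.+1}, mdeg a = size s /\
   forall (D : set 'cV[R]_m) f, pderiv_multi D a f = pderivs D s f.
Proof.
move=> os sk; pose a : {ffun 'I_m -> 'I_k.+1} := [ffun j => inord (count_mem j s)].
have aE j : (a j : nat) = count_mem j s.
  by rewrite ffunE inordK// ltnS (leq_trans (count_size _ _)).
have E := ordered_word os aE.
exists a; split; last by move=> D f; rewrite /pderiv_multi E.
rewrite -[in RHS]E size_flatten /shape -map_comp sumnE big_map big_enum /=.
by apply: eq_bigr => j _; rewrite size_nseq.
Qed.

Local Notation D := (@cube R m).

Lemma cube_const (c : R) : 0 <= c <= 1 -> D (const_mx c).
Proof. by move=> c01 j; rewrite mxE. Qed.

Variables (f : 'cV[R]_m -> R) (beta K : R).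
Hypothesis b1 : 0 < beta.
Hypothesis hf : hoelder_ball D beta K f.

Let k := sfloor beta.

(** A bound on a sum of suprema bounds each term once all are nonnegative. The corners 0 and 1 of
    the cube make the index sets nonempty; they are distinct because m > 0. *)
Lemma hoelder_sums :
  (forall a : {ffun 'I_m -> 'I_k.+1}, (mdeg a)%:R < beta -> forall x, D x -> `|pderiv_multi D a f x| <= K) /\
  (forall a : {ffun 'I_m -> 'I_k.+1}, mdeg a = k -> forall x y, D x -> D y ->
    `|pderiv_multi D a f x - pderiv_multi D a f y| <= K * `|x - y| `^ (beta - k%:R)).
Proof.
have [_ H] := hf.
pose S1 (a : {ffun 'I_m -> 'I_k.+1}) := ereal_sup [set `|pderiv_multi D a f x|%:E | x in D].
pose S2 (a : {ffun 'I_m -> 'I_k.+1}) := ereal_sup [set (`|pderiv_multi D a f z.1 - pderiv_multi D a f z.2|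
                    / `|z.1 - z.2| `^ (beta - k%:R))%:E
               | z in [set z | [/\ D z.1, D z.2 & z.1 != z.2]]].
have D0 : D (const_mx 0) by apply: cube_const; rewrite lexx ler01.
have D1 : D (const_mx 1) by apply: cube_const; rewrite lexx ler01.
have S1ge a : (0 <= S1 a)%E.
  apply: (@le_trans _ _ (`|pderiv_multi D a f (const_mx 0)|%:E)); first by rewrite lee_fin.
  by apply: ereal_sup_ubound; exists (const_mx 0).
have S2ge a : (0 <= S2 a)%E.
  apply: (@le_trans _ _ (`|pderiv_multi D a f (const_mx 0) - pderiv_multi D a f (const_mx 1)|
      / `|const_mx 0 - const_mx 1 : 'cV[R]_m| `^ (beta - k%:R))%:E).
    by rewrite lee_fin divr_ge0// powR_ge0.
  apply: ereal_sup_ubound; exists (const_mx 0, const_mx 1) => //; split => //=.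
  apply/eqP => /matrixP/(_ (Ordinal m0) ord0); rewrite !mxE => /eqP.
  by rewrite eq_sym oner_eq0.
have {}H : (\sum_(a : {ffun 'I_m -> 'I_k.+1} | ((mdeg a)%:R < beta)%R) S1 a +
   \sum_(a : {ffun 'I_m -> 'I_k.+1} | mdeg a == k) S2 a <= K%:E)%E by exact: H.
have T1 : (0 <= \sum_(a : {ffun 'I_m -> 'I_k.+1} | ((mdeg a)%:R < beta)%R) S1 a)%E by apply: sume_ge0.
have T2 : (0 <= \sum_(a : {ffun 'I_m -> 'I_k.+1} | mdeg a == k) S2 a)%E by apply: sume_ge0.
split => [a ab x Dx|a ak x y Dx Dy].
  rewrite -lee_fin; apply: le_trans H.
  apply: (@le_trans _ _ (S1 a)); first by apply: ereal_sup_ubound; exists x.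
  rewrite -[leLHS]adde0; apply: leeD => //.
  by rewrite (bigD1 a)//= -[leLHS]adde0 leeD// sume_ge0.
have [->|xy] := eqVneq x y.
  by rewrite !subrr !normr0 powR0 ?mulr0// subr_eq0 gt_eqF// sfloor_lt.
have pxy : 0 < `|x - y| `^ (beta - k%:R) by rewrite powR_gt0// normr_gt0 subr_eq0.
rewrite -ler_pdivrMr// -lee_fin; apply: le_trans H.
apply: (@le_trans _ _ (S2 a)); first by apply: ereal_sup_ubound; exists (x, y).
rewrite -[leLHS]add0e; apply: leeD => //.
by rewrite (bigD1 a)/= ?ak ?eqxx// -[leLHS]adde0 leeD// sume_ge0.
Qed.

Lemma hoelder_taylor : 0 <= K -> exists (n : nat) (C : R), 0 <= C /\
  forall y, D y -> exists l, pbound n m k K l /\ forall x, D x ->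
    `|f x - peval l x| <= C * `|x - y| `^ beta.
Proof.
move=> K0; have [H1 H2] := hoelder_sums.
apply: (taylor_cube (sfloor_lt b1) K0) => //.
- by have [] := hf.
- move=> s os sk x Dx; have [a [ma aE]] := word_multi os sk.
  rewrite -aE; apply: H1 => //; rewrite ma (le_lt_trans _ (sfloor_lt b1))//.
  by rewrite ler_nat.
- move=> s os sk x y Dx Dy; have [|a [ma aE]] := @word_multi k s os; first by rewrite sk.
  by rewrite -aE; apply: H2 => //; rewrite ma.
Qed.

Lemma hoelder_bound x : D x -> `|f x| <= K.
Proof.
move=> Dx; have [H1 _] := hoelder_sums.
have [a [ma aE]] := @word_multi k [::] isT (leq0n _).
by have := H1 a; rewrite ma aE => /(_ b1 x Dx).
Qed.

(** The Taylor polynomial at [y] equals f y there and is Lipschitz on the cube, and the remainder |x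
    - y|^beta is at most |x - y| because the cube has diameter at most 1 and beta >= 1. *)
Lemma hoelder_lipschitz : 0 <= K -> 1 <= beta -> exists C : R, 0 <= C /\
  forall x y, D x -> D y -> `|f x - f y| <= C * `|x - y|.
Proof.
move=> K0 b1'; have [n [C [C0 H]]] := hoelder_taylor K0.
exists (C + n%:R * (K * k%:R)); split.
  by rewrite addr_ge0// !mulr_ge0.
move=> x y Dx Dy; have [l [bl Hl]] := H y Dy.
have Ey : peval l y = f y.
  have := Hl y Dy; rewrite subrr normr0 powR0 ?gt_eqF// mulr0 normr_le0 subr_eq0.
  by move/eqP.
rewrite -Ey -[f x](subrK (peval l x)) -addrA (le_trans (ler_normD _ _))// mulrDl; apply: lerD.
  apply: (le_trans (Hl x Dx)); rewrite ler_wpM2l//.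
  have [->|xy] := eqVneq x y; first by rewrite subrr normr0 powR0 ?gt_eqF.
  apply: ge1r_powR => //; rewrite normr_gt0 subr_eq0 xy /=.
  apply/mx_norm_leP => // i j; rewrite (ord1 j) !mxE.
  have /andP[? ?] := Dx i; have /andP[? ?] := Dy i.
  by rewrite ler_norml; apply/andP; split; lra.
exact: (peval_lip K0 bl Dx Dy).
Qed.

End HoelderExtract.

(** * ReLU layers *)

Section Layers.
Context {R : realType} {E : Type}.

Definition nzw (I J : finType) (W : J -> I -> R) : nat :=
  #|[pred ji : J * I | W ji.1 ji.2 != 0]|.

(** [z] counts the nonzero weights plus one per node for a possible bias, so it also bounds the
    number of nodes. Nodes form arbitrary finite types, which makes parallel composition a disjoint
    sum. *)
Definition layer (B : R) (z : nat) (I J : finType) (h : I -> E -> R) (h' : J -> E -> R) : Prop :=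
  exists (W : J -> I -> R) (b : J -> R),
  [/\ forall j i, `|W j i| <= B, forall j, `|b j| <= 1,
      forall j x, h' j x = Num.max (\sum_i W j i * h i x - b j) 0 &
      (nzw W + #|J| <= z)%N].

(* [reach B z l h h'] : [l.+1] successive layers lead from [h] to [h']. *)
Fixpoint reach (B : R) (z l : nat) (I J : finType) (h : I -> E -> R) (h' : J -> E -> R) : Prop :=
  match l with
  | 0%N => layer B z h h'
  | l'.+1 => exists (K : finType) (g : K -> E -> R), reach B z l' h g /\ layer B z g h'
  end.

Lemma layer_le B B' z z' (I J : finType) (h : I -> E -> R) (h' : J -> E -> R) :
  B <= B' -> (z <= z')%N -> layer B z h h' -> layer B' z' h h'.
Proof.
move=> BB zz [W [b [h1 h2 h3 h4]]]; exists W, b; split => //.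
  by move=> j i; exact: le_trans BB.
exact: leq_trans zz.
Qed.

Lemma reach_le B B' z z' l (I J : finType) (h : I -> E -> R) (h' : J -> E -> R) :
  B <= B' -> (z <= z')%N -> reach B z l h h' -> reach B' z' l h h'.
Proof.
move=> BB zz; elim: l J h' => [|l IH] J h' /=; first exact: layer_le.
by move=> [K [g [hg gh]]]; exists K, g; split; [exact: IH|exact: layer_le gh].
Qed.

Lemma layer_ge0 B z (I J : finType) (h : I -> E -> R) (h' : J -> E -> R) j x :
  layer B z h h' -> 0 <= h' j x.
Proof. by move=> [W [b [_ _ -> _]]]; rewrite le_max lexx orbT. Qed.

Lemma reach_ge0 B z l (I J : finType) (h : I -> E -> R) (h' : J -> E -> R) j x :
  reach B z l h h' -> 0 <= h' j x.
Proof. by case: l => [|l] /=; [exact: layer_ge0|move=> [K [g [_ /layer_ge0]]]]. Qed.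

Lemma reach_trans B z l l' (I J K : finType) (h : I -> E -> R) (g : J -> E -> R) (h' : K -> E -> R) :
  reach B z l h g -> reach B z l' g h' -> reach B z (l' + l).+1 h h'.
Proof.
move=> hg; elim: l' K h' => [|l' IH] K h' /=; first by move=> gh; exists J, g.
by move=> [K' [g' [gg' g'h']]]; exists K', g'; split => //; exact: IH.
Qed.

Lemma layer_sel B z (I J J' : finType) (h : I -> E -> R) (h' : J -> E -> R)
    (f : J' -> J) (h2 : J' -> E -> R) : injective f -> (forall j x, h2 j x = h' (f j) x) ->
  layer B z h h' -> layer B z h h2.
Proof.
move=> fI hf [W [b [h1 h3 h4 h5]]]; exists (fun j => W (f j)), (fun j => b (f j)); split => //.
  by move=> j x; rewrite hf h4.
apply: leq_trans h5; rewrite leq_add//; last exact: leq_card fI.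
pose F (ji : J' * I) := (f ji.1, ji.2).
have FI : injective F by move=> [a b'] [c d] [] /fI -> ->.
rewrite /nzw -(fintype.card_image FI); apply: subset_leq_card; apply/fintype.subsetP => ji /fintype.imageP[[j i] H ->]; move: H.
by rewrite !inE.
Qed.

Lemma reach_sel B z l (I J J' : finType) (h : I -> E -> R) (h' : J -> E -> R)
    (f : J' -> J) (h2 : J' -> E -> R) : injective f -> (forall j x, h2 j x = h' (f j) x) ->
  reach B z l h h' -> reach B z l h h2.
Proof.
move=> fI hf; case: l => [|l] /=; first exact: layer_sel hf.
by move=> [K [g [hg gh]]]; exists K, g; split => //; exact: layer_sel hf gh.
Qed.

Lemma layer_pre B z (I I' J : finType) (h : I -> E -> R) (f : I' -> I) (h' : J -> E -> R) : 0 <= B ->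
  injective f -> layer B z (fun i => h (f i)) h' -> layer B z h h'.
Proof.
move=> B0 fI [W [b [h1 h2 h3 h4]]].
exists (fun j i => \sum_(i' | f i' == i) W j i'), b.
have Wf j i : (exists2 i', f i' = i & \sum_(i' | f i' == i) W j i' = W j i') \/
   \sum_(i' | f i' == i) W j i' = 0.
  have [[i' fi]|H] := pselect (exists i', f i' = i); last first.
    by right; rewrite big_pred0// => i'; apply/negbTE/eqP => fi; apply: H; exists i'.
  left; exists i' => //; rewrite (bigD1 i')/= ?fi// big1 ?addr0// => i2 /andP[/eqP f2].
  by rewrite -fi in f2; rewrite (fI _ _ f2) eqxx.
split => //.
- by move=> j i; case: (Wf j i) => [[i' _ ->]|->] //; rewrite normr0.
- move=> j x; rewrite h3; congr (Num.max (_ - _) _).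
  under [RHS]eq_bigr do rewrite mulr_suml.
  rewrite (exchange_big_dep predT)//=; apply: eq_bigr => i' _.
  by rewrite (bigD1 (f i'))//= big1 ?addr0// => i /andP[/eqP -> /negP]; rewrite eqxx.
- apply: leq_trans h4; rewrite leq_add2r.
  pose F (ji : J * I') := (ji.1, f ji.2).
  have FI : injective F by move=> [a b'] [c d] [] -> /fI ->.
  rewrite /nzw -(fintype.card_image FI); apply: subset_leq_card; apply/fintype.subsetP => -[j i].
  rewrite inE /=; case: (Wf j i) => [[i' fi ->] H|->]; last by rewrite eqxx.
  by apply/fintype.imageP; exists (j, i'); rewrite ?inE// /F /= fi.
Qed.

Lemma nzwE (I J : finType) (W : J -> I -> R) : nzw W = (\sum_j #|[pred i | (W j i != 0)%R]|)%N.
Proof.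
rewrite /nzw -sum1_card (eq_bigl (fun ji : J * I => true && (W ji.1 ji.2 != 0)))//.
rewrite -(pair_big_dep xpredT (fun j i => W j i != 0) (fun _ _ => 1%N)) /=.
by apply: eq_bigr => j _; rewrite sum1_card.
Qed.

Definition gate (B : R) (k : nat) (I : finType) (h : I -> E -> R) (u : E -> R) : Prop :=
  exists (w : I -> R) (b : R), [/\ forall i, `|w i| <= B, `|b| <= 1,
    forall x, u x = Num.max (\sum_i w i * h i x - b) 0 & (#|[pred i | (w i != 0)%R]| <= k)%N].

Lemma gate_layer B k (I J : finType) (h : I -> E -> R) (h' : J -> E -> R) :
  (forall j, gate B k h (h' j)) -> layer B (#|J| * k.+1) h h'.
Proof.
move=> H; have [W HW] := choice H; have [b {}HW] := choice HW.
exists W, b; split; try by move=> j; have [? ? ? ?] := HW j.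
rewrite mulnS [X in (_ <= X)%N]addnC leq_add2r nzwE -sum_nat_const.
by apply: leq_sum => j _; have [] := HW j.
Qed.

(** The list may name a source repeatedly; the weights then add up, which the bound on the sum of
    moduli covers. *)
Lemma gate_list B (I : finType) (h : I -> E -> R) (s : seq (R * I)) (b : R) u :
  `|b| <= 1 -> \sum_(q <- s) `|q.1| <= B ->
  (forall x, u x = Num.max (\sum_(q <- s) q.1 * h q.2 x - b) 0) -> gate B (size s) h u.
Proof.
move=> b1 sB uE; exists (fun i => \sum_(q <- s | q.2 == i) q.1), b; split => //.
- move=> i; apply: le_trans sB; rewrite (le_trans (ler_norm_sum _ _ _))//.
  by rewrite [leRHS](bigID (fun q => q.2 == i))/= lerDl sumr_ge0.
- move=> x; rewrite uE; congr (Num.max (_ - _) _).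
  under [RHS]eq_bigr do rewrite mulr_suml.
  rewrite (exchange_big_dep predT)//=; apply: eq_bigr => q _.
  by rewrite (bigD1 q.2)//= big1 ?addr0// => i /andP[/eqP -> /negP]; rewrite eqxx.
- rewrite -(size_map snd s); apply: leq_trans (card_size _).
  apply: subset_leq_card; apply/fintype.subsetP => i; rewrite inE; apply: contraNT => iS; rewrite big1_seq// => q /andP[/eqP qi qs].
  by move: iS; rewrite -qi map_f.
Qed.

Lemma gate_le B B' k k' (I : finType) (h : I -> E -> R) u : B <= B' -> (k <= k')%N ->
  gate B k h u -> gate B' k' h u.
Proof.
move=> BB kk [w [b [h1 h2 h3 h4]]]; exists w, b; split => //.
  by move=> i; exact: le_trans BB.
exact: leq_trans kk.
Qed.

Lemma layer_id B (I : finType) (h : I -> E -> R) : 1 <= B -> (forall i x, 0 <= h i x) ->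
  layer B (#|I| * 2) h h.
Proof.
move=> B1 h0; apply: gate_layer => i.
apply: (@gate_list _ _ _ [:: (1, i)] 0); rewrite ?normr0// ?big_seq1 ?normr1// => x.
by rewrite big_seq1 mul1r subr0 (elimT max_idPl)// h0.
Qed.

Lemma reach_id B (l : nat) (I : finType) (h : I -> E -> R) : 1 <= B -> (forall i x, 0 <= h i x) ->
  reach B (#|I| * 2) l h h.
Proof.
move=> B1 h0; elim: l => [|l IH] /=; first exact: layer_id.
by exists I, h; split => //; exact: layer_id.
Qed.

Lemma reach_pad B z l l' (I J : finType) (h : I -> E -> R) (h' : J -> E -> R) : 1 <= B ->
  (l <= l')%N -> (#|J| * 2 <= z)%N -> reach B z l h h' -> reach B z l' h h'.
Proof.
move=> B1 ll Jz H; have [->//|ll'] := eqVneq l' l.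
have -> : l' = ((l' - l).-1 + l).+1 by lia.
apply: (reach_trans H); apply: (reach_le (lexx _) Jz (reach_id _ B1 _)).
by move=> j x; exact: (reach_ge0 _ _ H).
Qed.

Lemma layer_shared B z (I K : finType) (J : K -> finType) (h : I -> E -> R)
    (h' : forall k, J k -> E -> R) : (forall k, layer B z h (h' k)) ->
  layer B (#|K| * z) h (fun p : {k & J k} => h' (tag p) (tagged p)).
Proof.
move=> H; have [W HW] : exists W : forall k, J k -> I -> R, forall k, exists b : J k -> R,
  [/\ forall j i, `|W k j i| <= B, forall j, `|b j| <= 1,
      forall j x, h' k j x = Num.max (\sum_i W k j i * h i x - b j) 0 &
      (nzw (W k) + #|J k| <= z)%N].
  by exists (fun k => sval (cid (H k))) => k; exact: (svalP (cid (H k))).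
have {}HW k := cid (HW k).
exists (fun p => W (tag p) (tagged p)), (fun p => sval (HW (tag p)) (tagged p)); split.
- by case=> k j i /=; have [h1 _ _ _] := svalP (HW k).
- by case=> k j /=; have [_ h1 _ _] := svalP (HW k).
- by case=> k j x /=; have [_ _ h1 _] := svalP (HW k).
- rewrite card_tagged sumnE big_map big_enum /= nzwE.
  rewrite -(sig_big_dep xpredT (fun _ => xpredT) (fun k (j : J k) => #|[pred i | W k j i != 0]|)) /=.
  rewrite -big_split /= -sum_nat_const; apply: leq_sum => k _.
  by rewrite -nzwE; have [_ _ _] := svalP (HW k).
Qed.

(** Branches of equal depth run side by side: each intermediate layer is the disjoint sum of those
    of the branches, with no weights between different branches, so the costs add. *)
Lemma reach_shared_tag B z l (I K : finType) (J : K -> finType) (h : I -> E -> R)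
    (h' : forall k, J k -> E -> R) : 0 <= B -> (forall k, reach B z l h (h' k)) ->
  reach B (#|K| * z) l h (fun p : {k & J k} => h' (tag p) (tagged p)).
Proof.
move=> B0; elim: l J h' => [|l IH] J h' /= H; first exact: layer_shared.
have [M HM] : exists M : K -> {M : finType & M -> E -> R},
    forall k, reach B z l h (tagged (M k)) /\ layer B z (tagged (M k)) (h' k).
  have {}H k := cid (H k).
  exists (fun k => existT (fun M : finType => M -> E -> R) (sval (H k)) (sval (cid (svalP (H k))))).
  by move=> k; exact: (svalP (cid (svalP (H k)))).
exists {k & tag (M k)}, (fun p => tagged (M (tag p)) (tagged p)); split.
  by apply: (IH (fun k => tag (M k)) (fun k => tagged (M k))) => k; have [] := HM k.
apply: layer_shared => k; have [_ Hk] := HM k.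
apply: (@layer_pre _ _ _ _ _ _ (fun i => Tagged (fun k => tag (M k)) (i : tag (M k)))) => //.
  by move=> i i' /eqP; rewrite eq_Tagged => /eqP.
Qed.

Lemma reach_shared B z l (I K : finType) (h : I -> E -> R)
    (h' : K -> E -> R) : 0 <= B -> (forall k, reach B z l h (fun _ : unit => h' k)) ->
  reach B (#|K| * z) l h h'.
Proof.
move=> B0 /(reach_shared_tag (J := fun _ => unit) B0).
apply: (@reach_sel _ _ _ _ _ _ _ _ (fun k => Tagged (fun _ => unit) tt)) => [k k'|//].
by move/(congr1 tag).
Qed.

End Layers.

(** * Squaring and multiplication by ReLU layers *)

Section Gadgets.
Context {R : realType} {E : Type}.
Local Notation relu x := (Num.max x 0).
Local Notation fn := (E -> R).

Lemma relu_cases (x : R) : (0 <= x /\ relu x = x) \/ (x <= 0 /\ relu x = 0).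
Proof. by case: (leP 0 x) => [h|/ltW h]; [left|right]. Qed.

Lemma relu_ge0 (x : R) : 0 <= relu x. Proof. by rewrite le_max lexx orbT. Qed.

Lemma relu_sub (x : R) : relu x - relu (- x) = x.
Proof. have := relu_cases x; have := relu_cases (- x); lra. Qed.

Lemma half_dist (y : R) : 0 <= y <= 1 -> `|y - 2^-1| <= 2^-1.
Proof. by rewrite ler_norml; lra. Qed.

Lemma clip_relu (x : R) : 0 <= relu (1 - relu (1 - x)) <= 1.
Proof.
have := relu_cases (1 - x); have := relu_cases (1 - relu (1 - x)); lra.
Qed.

Lemma clip_id (x : R) : 0 <= x <= 1 -> relu (1 - relu (1 - x)) = x.
Proof.
have := relu_cases (1 - x); have := relu_cases (1 - relu (1 - x)); lra.
Qed.

(** Clipping makes the output of a block admissible as input of the next one without increasing the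
    distance to a target in [0, 1]. *)
Lemma clip_lip (x y : R) : 0 <= y <= 1 -> `|relu (1 - relu (1 - x)) - y| <= `|x - y|.
Proof.
move=> y01; have := relu_cases (1 - x); have := relu_cases (1 - relu (1 - x)).
by have := ler_norm (x - y); have := ler_norm (y - x); rewrite (distrC y x) ler_norml; lra.
Qed.

Definition single (u : fn) : unit -> fn := fun _ => u.

Definition pair_state (u v : fn) : bool -> fn := fun b => if b then u else v.

(* The squaring gadget carries an approximation of the square, the current iterate of the tent map t |-> 2t - 4 max(t - 1/2, 0) and the part [max(t - 1/2, 0)] of it. *)
Definition tent (t : R) : R := 2 * t - 4 * relu (t - 2^-1).

Lemma tent01 t : 0 <= t <= 1 -> 0 <= tent t <= 1.
Proof. by rewrite /tent; have := relu_cases (t - 2^-1); lra. Qed.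

Lemma tent_sqr t : 0 <= t <= 1 -> t - t ^+ 2 = tent t / 4 + (tent t - tent t ^+ 2) / 4.
Proof.
move=> t01; rewrite /tent; by have [[_ ->]|[_ ->]] := relu_cases (t - 2^-1); field.
Qed.

Definition tents k t : R := iter k tent t.

(** The k-th approximation of t^2 from above. Unrolled, it is t minus the sum of T_j / 4^j for j =
    1, ..., k, where T_j is the j-th iterate of the tent map. *)
Definition acc k t : R := t ^+ 2 + (4^-1) ^+ k * (tents k t - tents k t ^+ 2).

Lemma tents01 k t : 0 <= t <= 1 -> 0 <= tents k t <= 1.
Proof. by move=> t01; elim: k => //= k; exact: tent01. Qed.

Lemma accS k t : 0 <= t <= 1 -> acc k.+1 t = acc k t - 4^-1 ^+ k.+1 * tent (tents k t).
Proof.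
move=> t01; rewrite /acc [tents k.+1 t]/= (tent_sqr (tents01 k t01)) (exprS _ k) -/(tents k t).
by field.
Qed.

Lemma acc_bounds k t : 0 <= t <= 1 -> t ^+ 2 <= acc k t <= t ^+ 2 + 4^-1 ^+ k.
Proof.
move=> t01; have /andP[a b] := tents01 k t01.
have p : 0 <= 4^-1 ^+ k :> R by rewrite exprn_ge0.
rewrite /acc lerDl lerD2l; apply/andP; split.
  by rewrite mulr_ge0// subr_ge0 expr2 ler_piMr.
rewrite ler_piMr// lerBlDr (le_trans b)// lerDl sqr_ge0//.
Qed.

Definition sq_state k (a : fn) : 'I_3 -> fn := fun i x =>
  match val i with 0%N => acc k (a x) | 1%N => tents k (a x) | _ => relu (tents k (a x) - 2^-1) end.

(** Polarization needs two squares, which are computed in lockstep. *)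
Definition sq2_state k (a c : fn) : bool * 'I_3 -> fn := fun q => sq_state k (if q.1 then a else c) q.2.

Definition o0 : 'I_3 := Ordinal (isT : 0 < 3)%N.
Definition o1 : 'I_3 := Ordinal (isT : 1 < 3)%N.
Definition o2 : 'I_3 := Ordinal (isT : 2 < 3)%N.

Lemma half1 : `|2^-1 : R| <= 1. Proof. by rewrite ger0_norm; lra. Qed.

(** Each of the six new nodes is the ReLU of an affine function of at most three old ones; with the
    bias this gives the cost 24 = 6 * 4. *)
Lemma sq2_step k (a c : fn) : (forall x, 0 <= a x <= 1) -> (forall x, 0 <= c x <= 1) ->
  layer 8 24 (sq2_state k a c) (sq2_state k.+1 a c).
Proof.
move=> a01 c01.
have -> : 24%N = (#|{: bool * 'I_3}| * 4)%N by rewrite card_prod card_bool card_ord.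
apply: gate_layer => -[b i]; rewrite /sq2_state /=.
set u := if b then a else c.
have u01 x : 0 <= u x <= 1 by rewrite /u; case: (b).
pose e : R := 4^-1 ^+ k.+1.
have /andP[e0 e1] : 0 <= e <= 1.
  by rewrite /e exprn_ge0// exprn_ile1// invf_le1 ?ler1n.
have tE x : tents k.+1 (u x) = 2 * tents k (u x) + (-4) * relu (tents k (u x) - 2^-1).
  by rewrite /= /tent; ring.
case: i => -[|[|[|//]]] i3.
- apply: (@gate_list _ _ _ _ _ [:: (1, (b, o0)); (e * (-2), (b, o1)); (e * 4, (b, o2))] 0).
  + by rewrite normr0.
  + rewrite !big_cons big_nil /= normr1 !normrM normrN (ger0_norm e0) !normr_nat.
    by lra.
  + move=> x; rewrite !big_cons big_nil /= /sq_state /= -/u.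
    have /andP[h _] := acc_bounds k.+1 (u01 x).
    rewrite [X in Num.max X _](_ : _ = acc k.+1 (u x)); last by rewrite accS// /tent -/e; ring.
    by rewrite (elimT max_idPl)// (le_trans _ h)// sqr_ge0.
- apply: (@gate_le _ _ 8 8 2 3) => //.
  apply: (@gate_list _ _ _ _ _ [:: (2, (b, o1)); (-4, (b, o2))] 0).
  + by rewrite normr0.
  + by rewrite !big_cons big_nil /= normrN !normr_nat; lra.
  + move=> x; rewrite !big_cons big_nil /= /sq_state /= -/u -/(tents k _) addr0 subr0 -tE.
    by rewrite (elimT max_idPl)//; have /andP[] := tents01 k.+1 (u01 x).
- apply: (@gate_le _ _ 8 8 2 3) => //.
  apply: (@gate_list _ _ _ _ _ [:: (2, (b, o1)); (-4, (b, o2))] (2^-1)).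
  + exact: half1.
  + by rewrite !big_cons big_nil /= normrN !normr_nat; lra.
  + by move=> x; rewrite !big_cons big_nil /= /sq_state /= -/u -/(tents k _) addr0 -tE.
Qed.

Lemma sq2_reach k (a c : fn) : (forall x, 0 <= a x <= 1) -> (forall x, 0 <= c x <= 1) ->
  reach 8 24 k (sq2_state 0 a c) (sq2_state k.+1 a c).
Proof.
move=> a01 c01; elim: k => [|k IH] /=; first exact: sq2_step.
by exists (bool * 'I_3)%type, (sq2_state k.+1 a c); split => //; exact: sq2_step.
Qed.

(** uv is the square of (u + v) / 2 minus the square of |u - v| / 2, both arguments in [0, 1]. Of
    the k + 5 layers two form the arguments, k + 1 square them and two subtract and clip. *)
Lemma mul_reach k (u v : fn) : (forall x, 0 <= u x <= 1) -> (forall x, 0 <= v x <= 1) ->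
  exists g : fn, [/\ forall x, 0 <= g x <= 1, forall x, `|g x - u x * v x| <= 4^-1 ^+ k &
    reach 8 24 (k + 4) (pair_state u v) (single g)].
Proof.
move=> u01 v01.
pose a x := (u x + v x) / 2; pose c x := `|u x - v x| / 2.
have a01 x : 0 <= a x <= 1 by rewrite /a; have := u01 x; have := v01 x; lra.
have c01 x : 0 <= c x <= 1.
  rewrite /c; have := u01 x; have := v01 x; move: (u x) (v x) => s t h1 h2.
  rewrite divr_ge0//=.
  have : `|s - t| <= 1 by rewrite ler_norml; lra.
  lra.
have c2 x : c x <= 2^-1.
  rewrite /c; have := u01 x; have := v01 x; move: (u x) (v x) => s t h1 h2.
  have : `|s - t| <= 1 by rewrite ler_norml; lra.
  lra.
pose w x := acc k.+1 (a x) - acc k.+1 (c x).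
pose g x := relu (1 - relu (1 - w x)).
have uv x : u x * v x = a x ^+ 2 - c x ^+ 2.
  by rewrite /c /a !expr_div_n real_normK ?num_real//; field.
exists g; split => [x|x|].
- exact: clip_relu.
- apply: (le_trans (clip_lip _ _)).
    by have /andP[p q] := u01 x; have /andP[p' q'] := v01 x; rewrite mulr_ge0//= mulr_ile1.
  have /andP[h1 h2] := acc_bounds k.+1 (a01 x); have /andP[h3 h4] := acc_bounds k.+1 (c01 x).
  have e : 4^-1 ^+ k.+1 <= 4^-1 ^+ k :> R.
    by rewrite (exprS _ k) ler_piMl ?exprn_ge0//; lra.
  by rewrite uv /w ler_norml; lra.
pose s1 (i : 'I_3) : fn := fun x => match val i with 0%N => a x | 1%N => relu ((u x - v x) / 2) | _ => relu ((v x - u x) / 2) end.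
have L1 : layer 8 24 (pair_state u v) s1.
  apply: (@layer_le _ _ 8 8 (#|'I_3| * 3)) => //; first by rewrite card_ord.
  apply: gate_layer => -[[|[|[|//]]] i3].
  - apply: (@gate_list _ _ _ _ _ [:: (2^-1, true); (2^-1, false)] 0).
    + by rewrite normr0.
    + by rewrite !big_cons big_nil /=; have := half1; lra.
    + move=> x; rewrite !big_cons big_nil /= /s1 /= (elimT max_idPl); first by rewrite /a; field.
      by have := u01 x; have := v01 x; lra.
  - apply: (@gate_list _ _ _ _ _ [:: (2^-1, true); (- 2^-1, false)] 0).
    + by rewrite normr0.
    + by rewrite !big_cons big_nil /= normrN; have := half1; lra.
    + by move=> x; rewrite !big_cons big_nil /= /s1 /=; congr (Num.max _ _); field.
  - apply: (@gate_list _ _ _ _ _ [:: (- 2^-1, true); (2^-1, false)] 0).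
    + by rewrite normr0.
    + by rewrite !big_cons big_nil /= normrN; have := half1; lra.
    + by move=> x; rewrite !big_cons big_nil /= /s1 /=; congr (Num.max _ _); field.
have cE x : c x = relu ((u x - v x) / 2) + relu ((v x - u x) / 2).
  rewrite /c; have [h|h] := leP 0 (u x - v x).
    rewrite ger0_norm//.
    have := relu_cases ((u x - v x) / 2); have := relu_cases ((v x - u x) / 2); lra.
  rewrite ltr0_norm//.
  have := relu_cases ((u x - v x) / 2); have := relu_cases ((v x - u x) / 2); lra.
have L2 : layer 8 24 s1 (sq2_state 0 a c).
  have -> : 24%N = (#|{: bool * 'I_3}| * 4)%N by rewrite card_prod card_bool card_ord.
  apply: gate_layer => -[[] i]; rewrite /sq2_state /sq_state /=.
  - have [b [b1 bE]] : exists b, `|b| <= 1 /\ forall x, sq_state 0 a i x = relu (a x - b).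
      case: i => -[|[|[|//]]] i3.
      + exists 0; rewrite normr0; split => // x; rewrite /sq_state /= /acc /= expr0 mul1r subr0.
        by rewrite addrCA subrr addr0 (elimT max_idPl)//; have /andP[] := a01 x.
      + exists 0; rewrite normr0; split => // x; rewrite /sq_state /= subr0.
        by rewrite (elimT max_idPl)//; have /andP[] := a01 x.
      + by exists (2^-1); split => //; exact: half1.
    apply: (@gate_le _ _ 8 8 1 3) => //.
    apply: (@gate_list _ _ _ _ _ [:: (1, o0)] b) => //.
    + by rewrite big_seq1 normr1; lra.
    + by move=> x; rewrite big_seq1 /= mul1r; exact: bE.
  - have [b [b1 bE]] : exists b, `|b| <= 1 /\ forall x, sq_state 0 c i x = relu (c x - b).
      case: i => -[|[|[|//]]] i3.
      + exists 0; rewrite normr0; split => // x; rewrite /sq_state /= /acc /= expr0 mul1r subr0.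
        by rewrite addrCA subrr addr0 (elimT max_idPl)//; have /andP[] := c01 x.
      + exists 0; rewrite normr0; split => // x; rewrite /sq_state /= subr0.
        by rewrite (elimT max_idPl)//; have /andP[] := c01 x.
      + by exists (2^-1); split => //; exact: half1.
    apply: (@gate_le _ _ 8 8 2 3) => //.
    apply: (@gate_list _ _ _ _ _ [:: (1, o1); (1, o2)] b) => //.
    + by rewrite !big_cons big_nil normr1; lra.
    + by move=> x; rewrite !big_cons big_nil /= !mul1r addr0; rewrite -cE; exact: bE.
have L3 : layer 8 24 (sq2_state k.+1 a c) (single (fun x => relu (1 - w x))).
  apply: (@layer_le _ _ 8 8 (#|{: unit}| * 3)) => //; first by rewrite card_unit.
  apply: gate_layer => -[].
  apply: (@gate_list _ _ _ _ _ [:: (-1, (true, o0)); (1, (false, o0))] (-1)).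
  + by rewrite normrN normr1.
  + by rewrite !big_cons big_nil /= normrN normr1; lra.
  + by move=> x; rewrite !big_cons big_nil /=; congr (Num.max _ _); rewrite /w /sq2_state /sq_state /=; ring.
have L4 : layer 8 24 (single (fun x => relu (1 - w x))) (single g).
  apply: (@layer_le _ _ 8 8 (#|{: unit}| * 2)) => //; first by rewrite card_unit.
  apply: gate_layer => -[].
  apply: (@gate_list _ _ _ _ _ [:: (-1, tt)] (-1)).
  + by rewrite normrN normr1.
  + by rewrite big_seq1 /= normrN normr1; lra.
  + by move=> x; rewrite big_seq1 /=; congr (Num.max _ _); rewrite /single; ring.
rewrite (_ : (k + 4)%N = (k + 2).+2); last by lia.
exists unit, (single (fun x => relu (1 - w x))); split => //.
exists (bool * 'I_3)%type, (sq2_state k.+1 a c); split => //.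
have R1 : reach 8 24 1 (pair_state u v) (sq2_state 0 a c) by exists 'I_3, s1.
have := reach_trans R1 (sq2_reach k a01 c01).
by rewrite (_ : (k + 1).+1 = k + 2)%N; last lia.
Qed.

End Gadgets.

(** * Approximation by networks *)

Section Products.
Context {R : realType} {E : Type}.
Local Notation relu x := (Num.max x 0).
Local Notation fn := (E -> R).
Variables (B : R) (B8 : 8 <= B).

(** A binary tree of multiplications of height [kap]. As all factors lie in [0, 1], an error e on
    one level becomes 2 e + 4^(-k) on the next, which gives (2^kap - 1) 4^(-k). *)
Lemma prod_reach z l k (I : finType) (h : I -> fn) : (24 <= z)%N -> forall kap (F : nat -> fn),
  (forall i, (i < 2 ^ kap)%N -> reach B z l h (single (F i))) ->
  (forall i x, 0 <= F i x <= 1) ->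
  exists g : fn, [/\ forall x, 0 <= g x <= 1,
    forall x, `|g x - \prod_(i < 2 ^ kap) F i x| <= (2 ^+ kap - 1) * 4^-1 ^+ k &
    reach B (2 ^ kap * z) (l + kap * (k + 5)) h (single g)].
Proof.
move=> z24; have B0 : 0 <= B by have := B8; lra.
elim=> [|kap IH] F HF F01.
  exists (F 0%N); split => //; first by move=> x; rewrite big_ord1 subrr normr0 expr0 subrr mul0r.
  by rewrite mul1n mul0n addn0; exact: HF.
have k2 : (2 ^ kap.+1 = 2 ^ kap + 2 ^ kap)%N by rewrite expnS mul2n addnn.
have [|g1 [g101 g1E g1R]] := IH F _ F01.
  by move=> i ik; apply: HF; rewrite k2 (leq_trans ik)// leq_addr.
have [||g2 [g201 g2E g2R]] := IH (fun i => F (2 ^ kap + i)%N).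
- by move=> i ik; apply: HF; rewrite k2 ltn_add2l.
- by move=> i x; exact: F01.
have [g [g01 gE gR]] := mul_reach k g101 g201.
exists g; split => //.
  move=> x; rewrite k2 big_split_ord /=.
  set p1 := \prod_(i < 2 ^ kap) F i x; set p2 := \prod_(i < 2 ^ kap) F (2 ^ kap + i)%N x.
  have p01 : 0 <= p1 <= 1.
    by rewrite /p1 prodr_ge0 ?prodr_ile1//= => i _; have /andP[] := F01 i x.
  have /andP[q0 q1] := g201 x; have /andP[r0 r1] := p01.
  rewrite (_ : g x - p1 * p2 = (g x - g1 x * g2 x) + (g1 x - p1) * g2 x + p1 * (g2 x - p2)); last by ring.
  have e1 := gE x; have e2 := g1E x; have e3 := g2E x; rewrite -/p1 in e2; rewrite -/p2 in e3.
  have t2 : `|(g1 x - p1) * g2 x| <= (2 ^+ kap - 1) * 4^-1 ^+ k.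
    by rewrite normrM (ger0_norm q0) (le_trans _ e2)// ler_piMr.
  have t3 : `|p1 * (g2 x - p2)| <= (2 ^+ kap - 1) * 4^-1 ^+ k.
    by rewrite normrM (ger0_norm r0) (le_trans _ e3)// ler_piMl.
  rewrite (le_trans (ler_normD _ _))// exprS.
  have := ler_normD (g x - g1 x * g2 x) ((g1 x - p1) * g2 x).
  move: e1 t2 t3; set q := 4^-1 ^+ k; set P := 2 ^+ kap; lra.
have S : reach B (2 ^ kap.+1 * z) (l + kap * (k + 5)) h (pair_state g1 g2).
  have -> : (2 ^ kap.+1 * z = #|{: bool}| * (2 ^ kap * z))%N by rewrite card_bool expnS mulnA.
  by apply: reach_shared => // -[].
have := reach_trans S (reach_le B8 _ gR).
rewrite (_ : (k + 4 + (l + kap * (k + 5))).+1 = l + kap.+1 * (k + 5))%N; last by rewrite mulSn; lia.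
by apply; rewrite (leq_trans z24)// leq_pmull// expn_gt0.
Qed.

(** Weights are bounded by [B], so a large slope is distributed over several layers. *)
Lemma amp_reach l (M : R) (J : finType) (s : J -> fn) : (forall j x, 0 <= s j x) ->
  0 <= M <= B ^+ l.+1 -> reach B (#|J| * 2) l s (fun j x => M * s j x).
Proof.
move=> s0; elim: l M => [|l IH] M /andP[M0 MB] /=.
  apply: gate_layer => j; apply: (@gate_list _ _ _ _ _ [:: (M, j)] 0); rewrite ?normr0//.
    by rewrite big_seq1 ger0_norm.
  by move=> x; rewrite big_seq1 subr0 (elimT max_idPl)// mulr_ge0.
have Bp : 0 < B by have := B8; lra.
exists J, (fun j x => M / B * s j x); split.
  by apply: IH; rewrite divr_ge0 ?(ltW Bp)//= ler_pdivrMr// mulrC -exprS.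
apply: gate_layer => j; apply: (@gate_list _ _ _ _ _ [:: (B, j)] 0); rewrite ?normr0//.
  by rewrite big_seq1 ger0_norm//; exact: ltW.
move=> x; rewrite big_seq1 subr0 mulrA (mulrC B) divfK ?gt_eqF//.
by rewrite (elimT max_idPl)// mulr_ge0.
Qed.

Definition hat (M c y : R) : R := relu (1 - M * `|y - c|).

Lemma hat01 M c y : 0 <= M -> 0 <= hat M c y <= 1.
Proof.
move=> M0; have := relu_cases (1 - M * `|y - c|); rewrite -/(hat M c y).
have : 0 <= M * `|y - c| by rewrite mulr_ge0.
lra.
Qed.

Lemma abs_relu (y : R) : `|y| = relu y + relu (- y).
Proof.
have := relu_cases y; have := relu_cases (- y).
by case: (lerP 0 y) => y0; [rewrite ger0_norm//|rewrite ltr0_norm//]; lra.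
Qed.

(** |y - c| is the sum of two ReLUs, which are amplified separately before the final ReLU. *)
Lemma hat_reach l (M c : R) (I : finType) (h : I -> fn) i : 0 <= c <= 1 ->
  0 <= M <= B ^+ l.+1 -> reach B 24 l.+2 h (single (fun x => hat M c (h i x))).
Proof.
move=> /andP[c0 c1] M0.
pose s : bool -> fn := pair_state (fun x => relu (h i x - c)) (fun x => relu (c - h i x)).
have L1 : layer B 24 h s.
  apply: (@layer_le _ _ B B (#|{: bool}| * 2)) => //; first by rewrite card_bool.
  have B1 : 1 <= B by have := B8; lra.
  apply: gate_layer => -[].
  - apply: (@gate_list _ _ _ _ _ [:: (1, i)] c); rewrite ?ger0_norm//.
      by rewrite big_seq1 normr1.
    by move=> x; rewrite big_seq1 mul1r.
  - apply: (@gate_list _ _ _ _ _ [:: (-1, i)] (- c)); rewrite ?normrN ?ger0_norm//.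
      by rewrite big_seq1 normrN normr1.
    by move=> x; rewrite big_seq1 /=; congr (Num.max _ _); ring.
have s0 j x : 0 <= s j x by case: j; rewrite /s /= relu_ge0.
have A := reach_le (lexx B) _ (amp_reach s0 M0).
have {}A := A 24%N ltac:(by rewrite card_bool).
have := @reach_trans _ _ B 24 0 l _ _ _ h s _ L1 A; rewrite addn0 => AA.
exists bool, (fun j x => M * s j x); split => //.
apply: (@layer_le _ _ B B (#|{: unit}| * 3)) => //; first by rewrite card_unit.
apply: gate_layer => -[].
apply: (@gate_list _ _ _ _ _ [:: (-1, true); (-1, false)] (-1)).
- by rewrite normrN normr1.
- by rewrite !big_cons big_nil /= normrN normr1; have := B8; lra.
- move=> x; rewrite !big_cons big_nil /= /single /hat; congr (Num.max _ _).
  by rewrite abs_relu opprB; ring.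
Qed.

Lemma coord_reach l (I : finType) (h : I -> fn) i : (forall x, 0 <= h i x) ->
  reach B 24 l h (single (h i)).
Proof.
move=> h0; have B1 : 1 <= B by have := B8; lra.
apply: (@reach_pad _ _ _ _ 0) => //; first by rewrite card_unit.
apply: (@layer_le _ _ B B (#|{: unit}| * 2)) => //; first by rewrite card_unit.
apply: gate_layer => -[]; apply: (@gate_list _ _ _ _ _ [:: (1, i)] 0); rewrite ?normr0//.
  by rewrite big_seq1 normr1.
by move=> x; rewrite big_seq1 mul1r subr0 (elimT max_idPl).
Qed.

Lemma one_reach l (I : finType) (h : I -> fn) : reach B 24 l h (single (fun=> 1)).
Proof.
have B1 : 1 <= B by have := B8; lra.
apply: (@reach_pad _ _ _ _ 0) => //; first by rewrite card_unit.
apply: (@layer_le _ _ B B (#|{: unit}| * 1)) => //; first by rewrite card_unit.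
apply: gate_layer => -[]; apply: (@gate_list _ _ _ _ _ [::] (-1)); rewrite ?normrN ?normr1//.
  by rewrite big_nil; have := B8; lra.
by move=> x; rewrite big_nil sub0r opprK (elimT max_idPl).
Qed.

Lemma prod_nth (s : seq fn) N x : (size s <= N)%N ->
  \prod_(i < N) nth (fun=> 1) s i x = \prod_(u <- s) u x.
Proof.
move=> sN; rewrite (big_nth (fun=> 1)) -(big_mkord xpredT (fun i => nth (fun=> 1) s i x)).
rewrite (big_cat_nat _ _ (n := size s))//= [X in _ * X]big_nat_cond [X in _ * X]big1 ?mulr1//.
by move=> i /andP[/andP[si _] _]; rewrite nth_default.
Qed.

Lemma hats_sum_nat (M : nat) (y : R) : 0 <= y <= M%:R ->
  \sum_(i < M.+1) relu (1 - `|y - i%:R|) = 1.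
Proof.
elim: M => [|M IH] /andP[y0 yM].
  have -> : y = 0 by apply/eqP; rewrite eq_le y0 yM.
  by rewrite big_ord1 subrr normr0 subr0 (elimT max_idPl).
rewrite big_ord_recr /=; have [h|h] := leP y M%:R.
  rewrite IH ?y0//; have e : y - M.+1%:R <= 0 by lra.
  rewrite (ler0_norm e) opprB [Num.max _ _](elimT max_idPr) ?addr0//.
  by rewrite -natr1; lra.
rewrite big_ord_recr /= big1 ?add0r; last first.
  move=> i _; have iM : i%:R + 1 <= (M%:R : R) by rewrite natr1 ler_nat.
  rewrite (elimT max_idPr)//; have := ler_norm (y - i%:R); lra.
rewrite -natr1 in yM *; have e : y - (M%:R + 1) <= 0 by lra.
have e2 : 0 <= y - M%:R by lra.
rewrite (ler0_norm e) (ger0_norm e2).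
by rewrite !(elimT max_idPl); lra.
Qed.

Lemma hats_sum (M : nat) (y : R) : (0 < M)%N -> 0 <= y <= 1 ->
  \sum_(i < M.+1) hat M%:R (i%:R / M%:R) y = 1.
Proof.
move=> M0 /andP[y0 y1]; have Mp : 0 < M%:R :> R by rewrite ltr0n.
have y' : 0 <= M%:R * y <= M%:R by rewrite mulr_ge0 ?(ltW Mp)//= ler_piMr ?(ltW Mp).
rewrite -[RHS](hats_sum_nat y'); apply: eq_bigr => i _; rewrite /hat; congr (Num.max (1 - _) _).
by rewrite -{1}(ger0_norm (ltW Mp)) -normrM mulrBr mulrCA divff ?gt_eqF// mulr1.
Qed.

End Products.

(** * Approximation of one component *)

Section Component.
Context {R : realType} {E : Type}.
Local Notation fn := (E -> R).
Variables (B : R) (B8 : 8 <= B).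
Variables (m : nat) (f : 'cV[R]_m -> R) (S : {set 'I_m}) (n0 k0 : nat) (K C beta : R).
Hypothesis K0 : 0 <= K.
Hypothesis C0 : 0 <= C.
Hypothesis beta0 : 0 <= beta.
Hypothesis fS : forall x y : 'cV[R]_m, (forall j, j \in S -> x j ord0 = y j ord0) -> f x = f y.
Hypothesis HT : forall y, cube y -> exists l, pbound n0 m k0 K l /\ forall x, cube x ->
    `|f x - peval l x| <= C * `|x - y| `^ beta.
Variable h : 'I_m -> fn.
Hypothesis h01 : forall i e, 0 <= h i e <= 1.

Definition coords (e : E) : 'cV[R]_m := \col_i h i e.

Lemma coords_cube e : cube (coords e).
Proof. by move=> i; rewrite mxE. Qed.

Local Notation T := {i | i \in S}.

Definition grid (M : nat) (a : {ffun T -> 'I_M.+1}) : 'cV[R]_m :=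
  \col_i (if insub i is Some t then (a t)%:R / M%:R else 0).

(** Resetting the coordinates outside [S] to 0 leaves [f] unchanged and kills every monomial with a
    letter outside [S]. A grid in the coordinates of [S] then suffices, and the number of blocks
    grows with exponent [#|S|] instead of [m]. *)
Definition keep (x : 'cV[R]_m) : 'cV[R]_m := \col_i (if i \in S then x i ord0 else 0).

Lemma f_keep x : f (keep x) = f x.
Proof. by apply: fS => j jS; rewrite mxE jS. Qed.

Lemma keep_cube x : cube x -> cube (keep x).
Proof. by move=> cx j; rewrite mxE; case: ifP => // _; rewrite lexx ler01. Qed.

Lemma mono_keep (w : seq 'I_m) x :
  mono w (keep x) = if all (fun i => i \in S) w then mono w x else 0.
Proof.
rewrite /mono; elim: w => [|i w IH] /=; first by rewrite !big_nil.
rewrite !big_cons {}IH mxE; case: ifP => _ /=; last by rewrite mul0r.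
by case: ifP; rewrite ?mulr0.
Qed.

(** The products of hats are a partition of unity, so [f] is a weighted mean of its Taylor
    polynomials up to their errors; a nonzero weight forces the grid point to be within 1/M of the
    argument, hence the error C M^(-beta). The second term is the multiplication error of [#|Q|]
    products. *)
Lemma approx_component (M k la kap : nat) : (0 < M)%N -> M%:R <= B ^+ la.+1 ->
  (#|S| + k0 <= 2 ^ kap)%N ->
  exists (Q : finType) (c : Q -> R) (g : Q -> fn),
  [/\ #|Q| = (M.+1 ^ #|S| * n0)%N, forall q, `|c q| <= K, forall q e, 0 <= g q e <= 1,
    reach B (#|Q| * (2 ^ kap * 24)) (la.+2 + kap * (k + 5)) h g &
    forall e, `|\sum_q c q * g q e - f (coords e)| <=
      C * M%:R^-1 `^ beta + #|Q|%:R * (K * (2 ^+ kap * 4^-1 ^+ k))].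
Proof.
move=> M0 MB kapS; have B0 : 0 <= B by have := B8; lra.
have Mp : 0 < M%:R :> R by rewrite ltr0n.
pose G := {ffun T -> 'I_M.+1}.
have gc (a : G) : cube (grid a).
  move=> j; rewrite mxE; case: insubP => [t _ _|_]; last by rewrite lexx ler01.
  by rewrite divr_ge0//= ler_pdivrMr// mul1r ler_nat -ltnS.
have [ls lsP] := choice (fun a : G => HT (gc a)).
pose Q : finType := (G * 'I_n0)%type.
pose mon (q : Q) := nth (0, [::]) (ls q.1) q.2.
have mon_b q : `|(mon q).1| <= K /\ (size (mon q).2 <= k0)%N.
  have [[sl Hl] _] := lsP q.1; rewrite /mon.
  have [jl|jl] := ltnP q.2 (size (ls q.1)); last by rewrite nth_default //= normr0.
  by have [] := Hl _ (mem_nth (0, [::]) jl).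
pose c (q : Q) := if all (fun i => i \in S) (mon q).2 then (mon q).1 else 0.
pose hatf (a : G) (t : T) : fn := fun e => hat M%:R ((a t)%:R / M%:R) (h (val t) e).
(* One hat per coordinate in [S] and one factor per letter of the monomial, hence at most
   [#|S| + k0] leaves of the tree. *)
pose fac (q : Q) : seq fn := [seq hatf q.1 t | t <- enum {: T}] ++ [seq h i | i <- (mon q).2].
have cT : #|{: T}| = #|S| by rewrite card_sig.
have szT : size (enum {: T}) = #|S| by rewrite -cardE.
have szf q : (size (fac q) <= 2 ^ kap)%N.
  rewrite size_cat size_map szT size_map (leq_trans _ kapS)// leq_add2l.
  by have [] := mon_b q.
have at01 (a : G) t : 0 <= ((a t)%:R / M%:R : R) <= 1.
  by rewrite divr_ge0//= ler_pdivrMr// mul1r ler_nat -ltnS.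
have fac_ok q (i : nat) : reach B 24 la.+2 h (single (nth (fun=> 1) (fac q) i)) /\
    forall e, 0 <= nth (fun=> 1) (fac q) i e <= 1.
  have [il|il] := ltnP i (size (fac q)); last first.
    by rewrite nth_default//; split; [exact: one_reach|move=> e; rewrite ler01 lexx].
  rewrite /fac nth_cat; case: ifP => [i1|/negbT i1].
    rewrite size_map in i1.
    have [t0] : exists t0 : T, True by move: i1; case: (enum _) => // t0; exists t0.
    move=> _; rewrite (nth_map t0)//; split; last by move=> e; apply: hat01; exact: ltW.
    by apply: hat_reach => //; rewrite ltW.
  rewrite size_map szT -leqNgt in i1.
  move: il; rewrite size_cat size_map szT size_map => il.
  have i2 : (i - #|S| < size (mon q).2)%N by rewrite ltn_subLR.
  case E2 : (mon q).2 i2 => [//|i0 w'] i2; rewrite -E2 in i2 *.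
  rewrite (nth_map i0)//; split => //.
  by apply: coord_reach => // e; have /andP[] := h01 (nth i0 (mon q).2 (i - #|S|)) e.
have HG q : exists g : fn, [/\ forall x, 0 <= g x <= 1,
    forall x, `|g x - \prod_(u <- fac q) u x| <= (2 ^+ kap - 1) * 4^-1 ^+ k &
    reach B (2 ^ kap * 24) (la.+2 + kap * (k + 5)) h (single g)].
  have [||g [g1 g2 g3]] := @prod_reach R E B B8 24 la.+2 k _ h isT kap (fun i => nth (fun=> 1) (fac q) i).
  - by move=> i _; have [] := fac_ok q i.
  - by move=> i; have [] := fac_ok q i.
  by exists g; split => // x; rewrite -(prod_nth _ (szf q)); exact: g2.
have [g HG'] := choice HG.
exists Q, c, g; split.
- by rewrite card_prod card_ffun card_ord card_ord cT.
- by move=> q; rewrite /c; case: ifP => _; [have [] := mon_b q|rewrite normr0].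
- by move=> q e; have [h1 _ _] := HG' q.
- by apply: reach_shared => // q; have [] := HG' q.
move=> e; set x := coords e; have cx : cube x by exact: coords_cube.
pose w (a : G) := \prod_(t : T) hatf a t e.
have w0 a : 0 <= w a by apply: prodr_ge0 => t _; have /andP[] := hat01 ((a t)%:R / M%:R) (h (val t) e) (ltW Mp).
have w1 : \sum_a w a = 1.
  rewrite /w -(bigA_distr_bigA (fun t (j : 'I_M.+1) => hat M%:R (j%:R / M%:R) (h (val t) e))) /=.
  by rewrite big1// => t _; exact: hats_sum.
have facE q : \prod_(u <- fac q) u e = w q.1 * mono (mon q).2 x.
  rewrite /fac big_cat /= big_map big_enum /= big_map; congr (_ * _).
  by apply: eq_bigr => i _; rewrite mxE.
have pe (a : G) : \sum_(j < n0) c (a, j) * mono (mon (a, j)).2 x = peval (ls a) (keep x).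
  rewrite /peval (big_nth (0, [::])) big_mkord.
  have [[sl _] _] := lsP a.
  rewrite (big_ord_widen n0 (fun j => (nth (0, [::]) (ls a) j).1 * mono (nth (0, [::]) (ls a) j).2 (keep x)) sl).
  rewrite [RHS]big_mkcond /=; apply: eq_bigr => j _; rewrite mono_keep /c /mon /=.
  have [jl|jl] := ltnP j (size (ls a)); last by rewrite nth_default//= mul0r.
  by case: ifP; rewrite ?mul0r ?mulr0.
have S1 : \sum_q c q * \prod_(u <- fac q) u e = \sum_a w a * peval (ls a) (keep x).
  rewrite -(pair_bigA _ (fun a j => c (a, j) * \prod_(u <- fac (a, j)) u e)) /=.
  apply: eq_bigr => a _; rewrite -pe mulr_sumr; apply: eq_bigr => j _.
  by rewrite facE /=; ring.
have T1 : `|\sum_a w a * peval (ls a) (keep x) - f x| <= C * M%:R^-1 `^ beta.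
  have -> : f x = \sum_a w a * f (keep x) by rewrite -mulr_suml w1 mul1r f_keep.
  rewrite -sumrB (le_trans (ler_norm_sum _ _ _))//.
  have -> : C * M%:R^-1 `^ beta = \sum_a w a * (C * M%:R^-1 `^ beta) by rewrite -mulr_suml w1 mul1r.
  apply: ler_sum => a _.
  rewrite -mulrBr normrM (ger0_norm (w0 a)).
  have [->|wa] := eqVneq (w a) 0; first by rewrite !mul0r.
  rewrite ler_wpM2l//; have [_ Hl] := lsP a.
  rewrite distrC (le_trans (Hl _ (keep_cube cx)))// ler_wpM2l//.
  apply: ge0_ler_powR; rewrite ?nnegrE ?invr_ge0//.
  apply/mx_norm_leP; first by rewrite invr_ge0 ltW.
  move=> i j; rewrite (ord1 j) !mxE; case: insubP => [t iS ti|/negbTE ->]; last first.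
    by rewrite subrr normr0 invr_ge0 ltW.
  rewrite iS; have : hatf a t e != 0.
    by apply: contraNneq wa => h0; rewrite /w (bigD1 t)//= h0 mul0r.
  rewrite /hatf /hat ti; have := relu_cases (1 - M%:R * `|h i e - (a t)%:R / M%:R|).
  case=> [[h1 _] _|[_ ->]]; last by rewrite eqxx.
  by rewrite -[leRHS]mulr1 ler_pdivlMl//; lra.
rewrite (_ : _ - _ = (\sum_q c q * g q e - \sum_q c q * \prod_(u <- fac q) u e) +
   (\sum_a w a * peval (ls a) (keep x) - f x)); last by rewrite -S1; ring.
rewrite (le_trans (ler_normD _ _))// addrC lerD//.
rewrite -sumrB (le_trans (ler_norm_sum _ _ _))//.
apply: (@le_trans _ _ (\sum_(q : Q) K * (2 ^+ kap * 4^-1 ^+ k))); last first.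
  by rewrite sumr_const -[leLHS]mulr_natl.
apply: ler_sum => q _; rewrite -mulrBr normrM; apply: ler_pM => //.
  by rewrite /c; case: ifP => _; [have [] := mon_b q|rewrite normr0].
have [_ h2 _] := HG' q; rewrite (le_trans (h2 e))// ler_wpM2r ?exprn_ge0//.
by rewrite lerBlDr lerDl ler01.
Qed.

End Component.

(** * Embedding into the prescribed architecture *)

Section Embedding.
Context {R : realType}.

(* Each node is repeated so that a weight of modulus at most [n1] can be spread over [n1] copies of its source. *)
Definition rep {E : Type} (n : nat) (I : finType) (h : I -> E -> R) : 'I_n * I -> E -> R :=
  fun q => h q.2.

Lemma layer_rep {E : Type} n1 n2 (B : R) z (I J : finType) (h : I -> E -> R) (h' : J -> E -> R) :
  (0 < n1)%N -> B <= n1%:R -> layer B z h h' -> layer 1 (n1 * n2 * z) (rep (n := n1) h) (rep (n := n2) h').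
Proof.
move=> n10 Bn [W [b [h1 h2 h3 h4]]]; have n1p : 0 < n1%:R :> R by rewrite ltr0n.
exists (fun q q' => W q.2 q'.2 / n1%:R), (fun q => b q.2); split => //.
- move=> q q'; rewrite normrM normfV (ger0_norm (ltW n1p)) ler_pdivrMr// mul1r.
  exact: le_trans Bn.
- move=> q x; rewrite /rep h3; congr (Num.max (_ - _) _).
  rewrite -(pair_bigA _ (fun (a : 'I_n1) (i : I) => W q.2 i / n1%:R * h i x)) /=.
  rewrite exchange_big; apply: eq_bigr => i _ /=.
  by rewrite sumr_const card_ord -(mulr_natl (W q.2 i / n1%:R * h i x)) mulrA mulrCA divff ?gt_eqF// mulr1.
- have H : (nzw (fun (q : 'I_n2 * J) (q' : 'I_n1 * I) => (W q.2 q'.2 / n1%:R : R)) <= n1 * n2 * nzw W)%N.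
    rewrite !nzwE -(pair_bigA _ (fun (a : 'I_n2) (j : J) => #|[pred q' : 'I_n1 * I | (W j q'.2 / n1%:R != 0)%R]|)) /=.
    rewrite big_const_ord iter_addn_0 (mulnC n1) -mulnA mulnC leq_mul2l big_distrr /=.
    apply/orP; right; apply: leq_sum => j _.
    rewrite -[n1 in leqRHS](card_ord n1) -cardX; apply: subset_leq_card.
    apply/fintype.subsetP => q'; rewrite !inE /=; apply: contraNneq => ->.
    by rewrite mul0r.
  apply: (@leq_trans (n1 * n2 * (nzw W + #|J|))); last by rewrite leq_mul2l h4 orbT.
  rewrite mulnDr leq_add// card_prod card_ord leq_mul2r.
  by rewrite leq_pmull// orbT.
Qed.

Variables (din : nat) (p : nat -> nat).
Implicit Types (Wf : nat -> nat -> nat -> R) (bf : nat -> nat -> R) (x : 'cV[R]_din).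

Definition inp (a : nat) x : R := if insub a is Some i then x i ord0 else 0.

(** Weights indexed by natural numbers avoid transport along equalities of widths while the network
    is built; they are cut down to matrices at the end. *)
Fixpoint raw Wf bf (l a : nat) x : R :=
  match l with
  | 0%N => inp a x
  | l'.+1 => Num.max (\sum_(b < p l') Wf l' a b * raw Wf bf l' b x - bf l a) 0
  end.

Lemma raw_agree Wf bf Wf' bf' l a x : (forall i, (i < l)%N -> Wf i = Wf' i) ->
  (forall i, (i <= l)%N -> bf i = bf' i) -> raw Wf bf l a x = raw Wf' bf' l a x.
Proof.
elim: l a => [//|l IH] a hW hb /=; rewrite hW// hb//; congr (Num.max (_ - _) _).
apply: eq_bigr => b _; rewrite IH// => i il; first by apply: hW; exact: ltnW.
by apply: hb; exact: leqW.
Qed.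

Definition costs Wf bf (i : nat) : nat :=
  (#|[pred ab : 'I_(p i.+1) * 'I_(p i) | (Wf i ab.1 ab.2 != 0)%R]|
   + #|[pred a : 'I_(p i.+1) | (bf i.+1 a != 0)%R]|)%N.

(** The functions [h] occupy the first [#|J|] nodes of layer [l]. The cost bound [Z] is imposed on
    each layer, so that adding a layer leaves the earlier bounds untouched. *)
Definition emb (Z l : nat) (J : finType) (h : J -> 'cV[R]_din -> R) : Prop :=
  exists Wf bf, [/\ forall i a b, `|Wf i a b| <= 1, forall i a, `|bf i a| <= 1,
    forall i, (i < l)%N -> (costs Wf bf i <= Z)%N,
    forall j x, raw Wf bf l (enum_rank j) x = h j x & (#|J| <= p l)%N].

Definition inputs : 'I_din -> 'cV[R]_din -> R := fun i x => x i ord0.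

Lemma emb0 Z : p 0%N = din -> emb Z 0 inputs.
Proof.
move=> p0; exists (fun _ _ _ => 0), (fun _ _ => 0); split => //; try by move=> *; rewrite normr0.
  by move=> j x; rewrite enum_rank_ord /= /inp insubT//= => jn; congr (x _ ord0); apply/val_inj.
by rewrite card_ord p0.
Qed.

Definition mx_nat (I J : finType) (W : J -> I -> R) (a b : nat) : R :=
  match insub a : option 'I_#|J|, insub b : option 'I_#|I| with
  | Some a', Some b' => W (enum_val a') (enum_val b')
  | _, _ => 0
  end.

Definition vec_nat (J : finType) (c : J -> R) (a : nat) : R :=
  if insub a : option 'I_#|J| is Some a' then c (enum_val a') else 0.

Lemma mx_nat_rank (I J : finType) (W : J -> I -> R) j b : mx_nat W (enum_rank j) b =
  if insub b : option 'I_#|I| is Some b' then W j (enum_val b') else 0.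
Proof. by rewrite /mx_nat (valK (enum_rank j)) enum_rankK; case: insub. Qed.

Lemma vec_nat_rank (J : finType) (c : J -> R) j : vec_nat c (enum_rank j) = c j.
Proof. by rewrite /vec_nat (valK (enum_rank j)) enum_rankK. Qed.

Lemma mx_nat_sum (I J : finType) (W : J -> I -> R) j q (F : nat -> R) : (#|I| <= q)%N ->
  \sum_(b < q) mx_nat W (enum_rank j) b * F b = \sum_i W j i * F (enum_rank i).
Proof.
move=> Iq; rewrite -(big_mkord xpredT (fun b => mx_nat W (enum_rank j) b * F b)).
rewrite (big_cat_nat _ _ (n := #|I|))//= [X in _ + X]big_nat_cond [X in _ + X]big1 ?addr0; last first.
  move=> b /andP[/andP[Ib _] _]; rewrite mx_nat_rank.
  by rewrite insubF ?mul0r// ltnNge Ib.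
rewrite big_mkord (reindex_onto (@enum_rank I) enum_val)/=; last by move=> i _; rewrite enum_valK.
rewrite (eq_bigl xpredT); last by move=> i; rewrite enum_rankK eqxx.
by apply: eq_bigr => i _; rewrite mx_nat_rank (valK (enum_rank i)) enum_rankK.
Qed.

Lemma mx_nat_le (I J : finType) (W : J -> I -> R) a b : (forall j i, `|W j i| <= 1) ->
  `|mx_nat W a b| <= 1.
Proof.
move=> H; rewrite /mx_nat; case: insub => [a'|]; last by rewrite normr0.
by case: insub => [b'|]; rewrite ?normr0.
Qed.

Lemma vec_nat_le (J : finType) (c : J -> R) a : (forall j, `|c j| <= 1) -> `|vec_nat c a| <= 1.
Proof. by move=> H; rewrite /vec_nat; case: insub => [a'|]; rewrite ?normr0. Qed.

Lemma mx_nat_nz (I J : finType) (W : J -> I -> R) q q' :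
  (#|[pred ab : 'I_q * 'I_q' | (mx_nat W ab.1 ab.2 != 0)%R]| <= nzw W)%N.
Proof.
pose F (ab : 'I_q * 'I_q') : option (J * I) :=
  match insub (val ab.1) : option 'I_#|J|, insub (val ab.2) : option 'I_#|I| with
  | Some a', Some b' => Some (enum_val a', enum_val b') | _, _ => None end.
have FI : {in [pred ab : 'I_q * 'I_q' | (mx_nat W ab.1 ab.2 != 0)%R] &, injective F}.
  move=> [a b] [a' b']; rewrite !inE /= /F /mx_nat /=.
  case: insubP => [u _ ua|]; last by rewrite eqxx.
  case: insubP => [v _ vb|]; last by rewrite eqxx.
  case: insubP => [u' _ ua'|]; last by rewrite eqxx.
  case: insubP => [v' _ vb'|]; last by rewrite eqxx.
  move=> _ _ [/enum_val_inj uu /enum_val_inj vv].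
  congr (_, _); apply/val_inj.
    exact: (etrans (esym ua) (etrans (congr1 val uu) ua')).
  exact: (etrans (esym vb) (etrans (congr1 val vv) vb')).
have <- : #|[seq Some ji | ji : J * I in [pred ji : J * I | W ji.1 ji.2 != 0]]| = nzw W.
  by apply: fintype.card_image => a b [].
rewrite -(card_in_image FI).
apply: subset_leq_card; apply/fintype.subsetP => y /fintype.imageP[[a b]].
rewrite inE /= /F /mx_nat /=.
case: insubP => [u _ ua|]; last by rewrite eqxx.
case: insubP => [v _ vb|]; last by rewrite eqxx.
by move=> H ->; apply/fintype.imageP; exists (enum_val u, enum_val v); rewrite ?inE.
Qed.

Lemma emb_layer Z l z (I J : finType) (h : I -> 'cV[R]_din -> R) (h' : J -> 'cV[R]_din -> R) :
  (z <= Z)%N -> (#|J| <= p l.+1)%N -> emb Z l h -> layer 1 z h h' -> emb Z l.+1 h'.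
Proof.
move=> zZ Jp [Wf [bf [h1 h2 h3 h4 h5]]] [W [c [k1 k2 k3 k4]]].
pose Wf' i := if i == l then mx_nat W else Wf i.
pose bf' i := if i == l.+1 then vec_nat c else bf i.
exists Wf', bf'; split => //.
- by move=> i a b; rewrite /Wf'; case: eqP => // _; exact: mx_nat_le.
- by move=> i a; rewrite /bf'; case: eqP => // _; exact: vec_nat_le.
- move=> i; rewrite ltnS leq_eqVlt => /orP[/eqP ->|il].
    rewrite /costs /Wf' /bf' !eqxx (leq_trans _ zZ)// (leq_trans _ k4)// leq_add//; first exact: mx_nat_nz.
    pose F (a : 'I_(p l.+1)) : option J := omap enum_val (insub (val a) : option 'I_#|J|).
    have FI : {in [pred a : 'I_(p l.+1) | (vec_nat c a != 0)%R] &, injective F}.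
      move=> a a'; rewrite !inE /= /F /vec_nat /=.
      case: insubP => [u _ ua|]; last by rewrite eqxx.
      case: insubP => [u' _ ua'|]; last by rewrite eqxx.
      move=> _ _ [/enum_val_inj uu]; apply/val_inj.
      exact: (etrans (esym ua) (etrans (congr1 val uu) ua')).
    have <- : #|[seq Some j | j : J in J]| = #|J| by apply: fintype.card_image => a b [].
    rewrite -(card_in_image FI).
    apply: subset_leq_card; apply/fintype.subsetP => y /fintype.imageP[a].
    rewrite inE /= /F /vec_nat; case: insubP => [u _ ua|]; last by rewrite eqxx.
    by move=> H ->; apply/fintype.imageP; exists (enum_val u).
  by rewrite /costs /Wf' /bf' (ltn_eqF il) eqSS (ltn_eqF il); exact: h3.
- move=> j x; rewrite k3 /= /bf' eqxx {1}/Wf' eqxx.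
  rewrite vec_nat_rank; congr (Num.max (_ - _) _).
  have -> : \sum_i W j i * h i x = \sum_i W j i * raw Wf' bf' l (enum_rank i) x.
    apply: eq_bigr => i _; rewrite -h4; congr (_ * _); apply: raw_agree => i' il.
      by rewrite /Wf' (ltn_eqF il).
    by rewrite /bf' ltn_eqF.
  by rewrite (mx_nat_sum _ _ (fun b => raw Wf' bf' l b x)).
Qed.

Lemma layer_card B z (I J : finType) (h : I -> 'cV[R]_din -> R) (h' : J -> 'cV[R]_din -> R) :
  layer B z h h' -> (#|J| <= z)%N.
Proof. by move=> [W [c [_ _ _]]]; apply: leq_trans; rewrite leq_addl. Qed.

Lemma emb_reach Z n z l l' (I J : finType) (h : I -> 'cV[R]_din -> R) (h' : J -> 'cV[R]_din -> R) :
  (0 < n)%N -> (n * n * z <= Z)%N -> (forall i, (l < i <= (l + l').+1)%N -> (Z <= p i)%N) ->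
  emb Z l (rep (n := n) h) -> reach n%:R z l' h h' -> emb Z (l + l').+1 (rep (n := n) h').
Proof.
move=> n0 nZ; have C (K : finType) (g : K -> 'cV[R]_din -> R) : (#|K| <= z)%N -> (#|{: 'I_n * K}| <= Z)%N.
  move=> Kz; rewrite card_prod card_ord (leq_trans _ nZ)//.
  by rewrite leq_mul// leq_pmulr.
elim: l' J h' => [|l' IH] J h' Zp eh /=.
  rewrite addn0 in Zp * => Lh; apply: (emb_layer nZ _ eh); last exact: layer_rep Lh.
  by rewrite (leq_trans (C _ h' (layer_card Lh)))// Zp// !leqnn.
move=> [K [g [hg gh]]]; rewrite addnS; apply: (emb_layer nZ) (layer_rep n n0 (lexx _) gh).
  by rewrite (leq_trans (C _ h' (layer_card gh)))// Zp// addnS leqnn andbT ltnS leqW// leq_addr.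
apply: IH hg => // i /andP[li il]; apply: Zp; rewrite li addnS; exact: leqW.
Qed.

(** A layer of exactly prescribed width has room for one copy of each node. Copies serve the weights
    leaving a node, so the last layer is stored once while it still reads [n] copies of its
    predecessor. *)
Lemma emb_reach_last Z n z l l' (I J : finType) (h : I -> 'cV[R]_din -> R) (h' : J -> 'cV[R]_din -> R) :
  (0 < n)%N -> (n * n * z <= Z)%N -> (forall i, (l < i <= l + l')%N -> (Z <= p i)%N) ->
  (#|J| <= p (l + l').+1)%N ->
  emb Z l (rep (n := n) h) -> reach n%:R z l' h h' -> emb Z (l + l').+1 (rep (n := 1) h').
Proof.
move=> n0 nZ Zp Jp eh; have n1Z : (n * 1 * z <= Z)%N.
  by rewrite muln1 (leq_trans _ nZ)// leq_mul2r leq_pmulr// orbT.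
have J1 : (#|{: 'I_1 * J}| <= p (l + l').+1)%N by rewrite card_prod card_ord mul1n.
case: l' Zp Jp J1 => [|l'] Zp Jp J1 /=.
  rewrite addn0 in J1 *; move=> Lh.
  by apply: (emb_layer n1Z J1 eh); exact: layer_rep Lh.
move=> [K [g [hg gh]]]; rewrite addnS in Zp J1 *.
apply: (emb_layer n1Z J1) (layer_rep 1 n0 (lexx _) gh).
exact: emb_reach hg.
Qed.

Lemma emb_net_class Z dout dt L L1 (s : nat) (F : R) (J : finType) (h : J -> 'cV[R]_din -> R)
    (W : 'I_dout -> J -> R) (f : 'cV[R]_din -> 'cV[R]_dout) :
  p 0%N = din -> p L.+1 = dout -> p L1 = dt -> emb Z L h ->
  (forall j i, `|W j i| <= 1) -> (nzw W <= Z)%N -> (L.+1 * Z <= s)%N ->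
  (forall x j, f x j ord0 = \sum_i W j i * h i x) -> (forall x, `|f x| <= F) ->
  net_class R din dout dt L L1 p s F f.
Proof.
move=> e0 eL eL1 [Wf [bf [h1 h2 h3 h4 h5]]] W1 WZ sZ fE fF.
pose Wn (a b : nat) := if insub a is Some j then mx_nat W (enum_rank (j : 'I_dout)) b else 0.
pose Wf' i := if i == L then Wn else Wf i.
(* The class demands a zero bias at layer 0; this leaves [raw] unchanged, whose biases enter from
   layer 1 on. *)
pose bf' i := if i == 0%N then (fun=> 0) else bf i.
pose Wm i : 'M[R]_(p i.+1, p i) := \matrix_(a, b) Wf' i a b.
pose vm i : 'cV[R]_(p i) := \col_a bf' i a.
have Wn1 a b : `|Wn a b| <= 1.
  by rewrite /Wn; case: insub => [j|]; [exact: mx_nat_le|rewrite normr0].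
have W'1 i a b : `|Wf' i a b| <= 1 by rewrite /Wf'; case: eqP.
have rawE l a x : (l <= L)%N -> raw Wf' bf' l a x = raw Wf bf l a x.
  elim: l a => [//|l IH] a lL /=.
  have -> : bf' l.+1 = bf l.+1 by [].
  have -> : Wf' l = Wf l by rewrite /Wf' (ltn_eqF lL).
  rewrite (eq_bigr (fun b : 'I_(p l) => Wf l a b * raw Wf bf l b x))// => b _.
  by rewrite IH// ltnW.
have netE x l a : network Wm vm (castmx (esym e0, erefl) x) l a ord0 =
    \sum_(b < p l) Wf' l a b * raw Wf' bf' l b x.
  elim: l a => [|l IH] a /=.
    rewrite mxE; apply: eq_bigr => b _; rewrite mxE castmxE /=; congr (_ * _).
    rewrite /inp insubT ?e0 // => [|bn]; first by rewrite -e0.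
    by congr (x _ _); apply/val_inj.
  rewrite mxE; apply: eq_bigr => b _; rewrite !mxE; congr (_ * Num.max (_ - _) _).
  by rewrite IH.
exists e0, eL, Wm, vm; split; [|split; [|split; [|split; [|split]]]] => //.
- move=> x; apply/matrixP => j k; rewrite (ord1 k) castmxE /= fE.
  have -> : cast_ord (esym (erefl 1%N)) ord0 = ord0 by apply/val_inj.
  rewrite netE /Wf' eqxx.
  have -> : \sum_i W j i * h i x = \sum_i W j i * raw Wf' bf' L (enum_rank i) x.
    by apply: eq_bigr => i _; rewrite rawE// h4.
  rewrite -(@mx_nat_sum _ _ _ _ (p L) (fun b => raw Wf' bf' L b x))//.
  apply: eq_bigr => b _; congr (_ * _); rewrite /Wn /= insubT //= => jd.
  by congr (mx_nat _ (enum_rank _) _); apply/val_inj.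
- by apply/matrixP => a b; rewrite !mxE.
- move=> j _; split; apply/mx_norm_leP => // a b; rewrite mxE//.
  by rewrite /bf'; case: eqP => _ //; rewrite normr0.
- apply: leq_trans sZ; rewrite big_split /= big_nat_recr//= [X in (_ + X)%N]big_nat_recl//=.
  have -> : nnz (vm 0%N) = 0%N.
    by rewrite nnzE; apply/eqP; rewrite eq_card0// => ab; rewrite inE mxE /bf' /= eqxx.
  rewrite add0n addnAC -big_split /= mulSn addnC leq_add//.
    rewrite nnzE (leq_trans _ WZ)//.
    pose Fj (ab : 'I_(p L.+1) * 'I_(p L)) : 'I_#|{: 'I_dout}| * 'I_(p L) :=
      (enum_rank (cast_ord eL ab.1), ab.2).
    have FI : injective Fj.
      move=> [a b] [a' b'] H; have := congr1 fst H; have := congr1 snd H.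
      by rewrite /= => -> /enum_rank_inj/cast_ord_inj ->.
    rewrite (leq_trans _ (mx_nat_nz W #|{: 'I_dout}| (p L)))// -(fintype.card_image FI).
    apply: subset_leq_card; apply/fintype.subsetP => y /fintype.imageP[[a b]].
    rewrite !inE mxE /Wf' eqxx /Wn /= => H ->; rewrite /Fj /=; apply: contraNneq H => H.
    rewrite insubT /=; first by rewrite -eL.
    move=> ad; rewrite -H; apply/eqP; congr (mx_nat _ (enum_rank _) _); exact/val_inj.
  rewrite -(subn0 L) -[X in (_ <= (X - _) * _)%N](subn0 L) subn0 -sum_nat_const_nat.
  rewrite big_nat [leqRHS]big_nat; apply: leq_sum => i /andP[_ iL].
  apply: leq_trans (h3 i iL); rewrite /costs leq_add//.
    rewrite nnzE; apply: eq_leq; apply: eq_card => ab.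
    by rewrite !inE mxE /Wf' (ltn_eqF iL).
  rewrite nnzE.
  have FI : injective (fun ab : 'I_(p i.+1) * 'I_1 => ab.1).
    by move=> [a b] [a' b'] /= ->; rewrite (ord1 b) (ord1 b').
  rewrite -(fintype.card_image FI); apply: subset_leq_card.
  apply/fintype.subsetP => y /fintype.imageP[[a b]]; rewrite !inE mxE /bf' /= => H ->; exact: H.
Qed.

End Embedding.

Section ApproxVec.
Context {R : realType}.
Variables (m k : nat) (g : 'cV[R]_m -> 'cV[R]_k) (beta K : R) (t : nat).
Hypotheses (m0 : (0 < m)%N) (b0 : 0 < beta) (K0 : 0 <= K).
Hypothesis hg : hoelder_vec beta K g.
Hypothesis gt : sparse_args t g.

Lemma hoelder_vec_lipschitz : 1 <= beta -> exists C : R, 0 <= C /\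
  forall i x y, cube x -> cube y -> `|g x i ord0 - g y i ord0| <= C * `|x - y|.
Proof.
move=> b1; have [C HC] := choice (fun i => hoelder_lipschitz m0 b0 (hg i) K0 b1).
exists (\sum_i C i); split; first by apply: sumr_ge0 => i _; have [] := HC i.
move=> i x y cx cy; have [_ /(_ x y cx cy) H] := HC i; apply: (le_trans H).
rewrite ler_wpM2r// (bigD1 i)//= lerDl sumr_ge0// => j _; by have [] := HC j.
Qed.

(** The affine map c g + d brings the target into [0, 1], as the final clipping requires: it is the
    identity for the encoder parts and y / (2K) + 1/2 for the decoder. [n0] and [C] are sums over
    the components, to serve all of them. *)
Lemma approx_vec : exists (n0 : nat) (C : R), 0 <= C /\
  forall (c d : R), `|c| <= 1 -> 0 <= d <= 1 ->
  (forall x i, cube x -> 0 <= c * g x i ord0 + d <= 1) ->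
  forall (E : Type) (B : R) (h : 'I_m -> E -> R) (M q la kap : nat),
  8 <= B -> K <= B -> (forall i e, 0 <= h i e <= 1) ->
  (0 < M)%N -> M%:R <= B ^+ la.+1 -> (t + sfloor beta <= 2 ^ kap)%N ->
  exists u : 'I_k -> E -> R, [/\ forall i e, 0 <= u i e <= 1,
    reach B (k * (M.+1 ^ t * n0.+1 * (2 ^ kap * 24))) (la.+2 + kap * (q + 5)).+2 h u &
    forall i e, `|u i e - (c * g (coords h e) i ord0 + d)| <=
      C * M%:R^-1 `^ beta + (M.+1 ^ t * n0.+1)%:R * (K * (2 ^+ kap * 4^-1 ^+ q))].
Proof.
have [n1 Hn1] := choice (fun i => hoelder_taylor m0 b0 (hg i) K0).
have [C HC] := choice Hn1.
have gt' i : exists S : {set 'I_m}, (#|S| <= t)%N /\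
    forall x y : 'cV[R]_m, (forall j, j \in S -> x j ord0 = y j ord0) -> g x i ord0 = g y i ord0.
  by have [S S1 S2] := gt i; exists S.
have [S HS] := choice gt'.
pose n0 := (\sum_i n1 i)%N.
exists n0, (\sum_i C i); split; first by apply: sumr_ge0 => i _; have [] := HC i.
move=> c d c1 d01 cd01 E B h M q la kap B8 KB h01 M0 MB tk.
suff H i : exists v : E -> R, [/\ forall e, 0 <= v e <= 1,
    reach B (M.+1 ^ t * n0.+1 * (2 ^ kap * 24)) (la.+2 + kap * (q + 5)).+2 h (single v) &
    forall e, `|v e - (c * g (coords h e) i ord0 + d)| <=
      (\sum_i C i) * M%:R^-1 `^ beta + (M.+1 ^ t * n0.+1)%:R * (K * (2 ^+ kap * 4^-1 ^+ q))].
  have [u Hu] := choice H; exists u; split; try by move=> i; have [] := Hu i.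
  rewrite -[X in (X * _)%N](card_ord k); apply: reach_shared => [|i]; first by rewrite (le_trans _ B8).
  by have [] := Hu i.
have [St SE] := HS i; have [C0 Hi] := HC i.
have HT y : cube y -> exists l, pbound n0.+1 m (sfloor beta) K l /\ forall x, cube x ->
    `|g x i ord0 - peval l x| <= C i * `|x - y| `^ beta.
  move=> cy; have [l [bl Hl]] := Hi y cy; exists l; split => //.
  by apply: pbound_le bl => //; rewrite leqW// /n0 (bigD1 i)//= leq_addr.
have Sk : (#|S i| + sfloor beta <= 2 ^ kap)%N by rewrite (leq_trans _ tk)// leq_add2r.
have [Q [w [G [cQ wK G01 GR GE]]]] :=
  @approx_component R E B B8 m _ (S i) n0.+1 (sfloor beta) K (C i) beta K0 C0 (ltW b0) SE HT h h01 M q la kap M0 MB Sk.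
have Qle : (#|Q| <= M.+1 ^ t * n0.+1)%N.
  by rewrite cQ leq_mul2r leq_pexp2l// orbT.
have Q0 : (0 < #|Q|)%N by rewrite cQ muln_gt0 expn_gt0.
pose v e := \sum_q c * w q * G q e.
have vE e : v e = c * \sum_q w q * G q e.
  by rewrite /v mulr_sumr; apply: eq_bigr => j _; rewrite mulrA.
have /andP[d0 d1] := d01.
exists (fun e => Num.max (1 - Num.max (1 - (v e + d)) 0) 0); split.
- by move=> e; exact: clip_relu.
- have k24 : (2 <= 2 ^ kap * 24)%N.
    by rewrite -[2%N]/(1 * 2)%N leq_mul// expn_gt0.
  have Q2 : (#|Q| * 2 <= M.+1 ^ t * n0.+1 * (2 ^ kap * 24))%N by rewrite leq_mul.
  exists unit, (single (fun e => Num.max (1 - (v e + d)) 0)); split.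
    exists Q, G; split.
      by apply: reach_le GR => //; rewrite leq_mul2r Qle orbT.
    apply: (@layer_le _ _ B B (#|{: unit}| * #|Q|.+1)) => //.
      by rewrite card_unit mul1n (leq_trans _ Q2)// muln2 -addnn -addn1 leq_add2l.
    apply: gate_layer => -[]; exists (fun q => - (c * w q)), (d - 1); split.
    + by move=> j; rewrite normrN normrM (le_trans _ KB)// (le_trans _ (wK j))// ler_piMl.
    + by rewrite ler_norml; lra.
    + move=> e; rewrite /single; congr (Num.max _ _).
      have -> : \sum_j - (c * w j) * G j e = - v e.
        by rewrite /v -sumrN; apply: eq_bigr => j _; rewrite mulNr.
      by ring.
    + exact: max_card.
  apply: (@layer_le _ _ B B (#|{: unit}| * 2)) => //.
    by rewrite card_unit mul1n (leq_trans _ Q2)// leq_pmull.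
  apply: gate_layer => -[]; apply: (@gate_list _ _ _ _ _ [:: (-1, tt)] (-1)).
  + by rewrite normrN normr1.
  + by rewrite big_seq1 normrN normr1 (le_trans _ B8)// ler1n.
  + by move=> e; rewrite big_seq1 /=; congr (Num.max _ _); rewrite /single; ring.
move=> e; apply: (le_trans (clip_lip _ (cd01 _ i (coords_cube h01 e)))).
rewrite vE opprD addrACA subrr addr0 -mulrBr normrM (le_trans (ler_piMl _ c1))//.
apply: (le_trans (GE e)); apply: lerD.
  rewrite ler_wpM2r ?powR_ge0// (bigD1 i)//= lerDl sumr_ge0// => j _; by have [] := HC j.
by rewrite ler_wpM2r ?ler_nat// !mulr_ge0// exprn_ge0.
Qed.

End ApproxVec.

Lemma six_le (R : realType) (a b c u v w : R) :
  0 <= a -> 0 <= b -> 0 <= c -> 0 <= u -> 0 <= v -> 0 <= w -> let T := a + b + c + (u + v + w) in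
  [/\ a <= T, b <= T, c <= T & [/\ u <= T, v <= T & w <= T] /\ 0 <= T].
Proof. by move=> a0 b0 c0 u0 v0 w0 T; rewrite /T; do ![split]; lra. Qed.

Lemma sum_parts (a b c u v w : nat) : let z := (a + b + c + u + v + w)%N in
  [/\ (a <= z)%N, (b <= z)%N, (c <= z)%N & (u <= z)%N /\ (v <= z)%N /\ (w <= z)%N].
Proof. by move=> z; rewrite /z; do ![split]; lia. Qed.

Lemma size_budget (X Y W a b c u v w : nat) : (0 < X)%N ->
  (X * a + Y * b + W * c + u + v + w <= (a + b + c + u + v + w) * (X + Y + W))%N.
Proof.
move=> X0; have S0 : (0 < X + Y + W)%N by rewrite -addnA addn_gt0 X0.
have leX : (X * a <= a * (X + Y + W))%N by rewrite mulnC leq_mul2l -addnA leq_addr orbT.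
have leY : (Y * b <= b * (X + Y + W))%N by rewrite mulnC leq_mul2l addnAC leq_addl orbT.
have leW : (W * c <= c * (X + Y + W))%N by rewrite mulnC leq_mul2l leq_addl orbT.
rewrite !(mulnDl _ _ (X + Y + W)); do 5 (apply: leq_add; last by rewrite ?leq_pmulr).
exact: leX.
Qed.

(** * Approximation of encoder and decoder *)

Section NetworkApproximation.
Context {R : realType}.
Variables (din dout dt D : nat) (tdec t0 t1 : nat) (bdec b0 b1 K : R).
Variables (g0 : 'cV[R]_din -> 'cV[R]_D) (g1 : 'cV[R]_D -> 'cV[R]_dt) (fdec : 'cV[R]_dt -> 'cV[R]_dout).
Hypotheses (din_gt0 : (0 < din)%N) (D_gt0 : (0 < D)%N) (dt_gt0 : (0 < dt)%N).
Hypotheses (b0_ge1 : 1 <= b0) (b1_ge1 : 1 <= b1) (bdec_ge1 : 1 <= bdec) (K1 : 1 <= K).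
Hypotheses (st0 : sparse_args t0 g0) (st1 : sparse_args t1 g1) (stdec : sparse_args tdec fdec).
Hypotheses (h0 : hoelder_vec b0 K g0) (h1 : hoelder_vec b1 K g1) (hdec : hoelder_vec bdec K fdec).
Hypotheses (c0 : g0 @` (@cube R _) `<=` @cube R _) (c1 : g1 @` (@cube R _) `<=` @cube R _).
Variables (k0 k1 k2 : nat).
Hypotheses (tk0 : (t0 + sfloor b0 <= 2 ^ k0)%N) (tk1 : (t1 + sfloor b1 <= 2 ^ k1)%N)
  (tk2 : (tdec + sfloor bdec <= 2 ^ k2)%N).

Local Notation relu x := (Num.max x 0).

(** The error of an inner block passes through the outer maps with their Lipschitz constants, which
    exist because all smoothness exponents are at least 1. The grid sizes remain free here and are
    balanced later. *)
Theorem network_approximation : exists (c : nat) (C : R), 0 < C /\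
  forall (M0 M1 M2 q la L L1 s : nat) (p : nat -> nat) (F : R),
  let Z := (c * (M0.+1 ^ t0 + M1.+1 ^ t1 + M2.+1 ^ tdec))%N in
  (0 < M0)%N -> (0 < M1)%N -> (0 < M2)%N ->
  M0%:R <= 256 ^+ la.+1 :> R -> M1%:R <= 256 ^+ la.+1 :> R -> M2%:R <= 256 ^+ la.+1 :> R ->
  (2 * la + (k0 + k1) * (q + 5) + 12 <= L1)%N -> (L1 + la + k2 * (q + 5) + 7 <= L)%N ->
  (forall i, (1 <= i <= L)%N -> i != L1 -> (Z <= p i)%N) -> (L.+1 * Z <= s)%N ->
  p 0%N = din -> p L.+1 = dout -> p L1 = dt -> K <= F ->
  exists f, net_class R din dout dt L L1 p s F f /\
   forall x, cube x -> forall j, `|f x j ord0 - fdec (g1 (g0 x)) j ord0| <=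
     C * (M0%:R^-1 `^ b0 + M1%:R^-1 `^ b1 + M2%:R^-1 `^ bdec
       + (M0.+1 ^ t0 + M1.+1 ^ t1 + M2.+1 ^ tdec)%:R * 4^-1 ^+ q).
Proof.
have K0 : 0 <= K by exact: le_trans ler01 K1.
have b0p : 0 < b0 by exact: lt_le_trans ltr01 b0_ge1.
have b1p : 0 < b1 by exact: lt_le_trans ltr01 b1_ge1.
have bdp : 0 < bdec by exact: lt_le_trans ltr01 bdec_ge1.
have [n0 [C0 [C00 A0]]] := approx_vec din_gt0 b0p K0 h0 st0.
have [n1 [C1 [C10 A1]]] := approx_vec D_gt0 b1p K0 h1 st1.
have [n2 [C2 [C20 A2]]] := approx_vec dt_gt0 bdp K0 hdec stdec.
have [l1 [l10 Lip1]] := hoelder_vec_lipschitz D_gt0 b1p K0 h1 b1_ge1.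
have [l2 [l20 Lip2]] := hoelder_vec_lipschitz dt_gt0 bdp K0 hdec bdec_ge1.
(* [n] copies of each node absorb the output weight 2K, and n >= 256 lets la + 1 layers amplify by
   256^(la + 1). *)
pose n := (Num.truncn (2 * K) + 256)%N.
have n_gt0 : (0 < n)%N by rewrite addn_gt0 orbT.
have nK : 2 * K <= n%:R.
  rewrite /n natrD; have := truncnS_gt (2 * K); rewrite -(natr1 (Num.truncn (2 * K))) => /ltW H.
  by apply: (le_trans H); rewrite lerD2l ler1n.
have n256 : 256 <= n%:R :> R by rewrite /n natrD lerDr.
have n8 : 8 <= n%:R :> R by apply: le_trans n256; rewrite ler_nat.
have Kn : K <= n%:R by apply: le_trans nK; rewrite ler_peMl// ler1n.
pose a0 := (D * (n0.+1 * (2 ^ k0 * 24)))%N.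
pose a1 := (dt * (n1.+1 * (2 ^ k1 * 24)))%N.
pose a2 := (dout * (n2.+1 * (2 ^ k2 * 24)))%N.
pose c := (n * n * (a0 + a1 + a2 + 2 * din + 2 * dt + 4 * dout))%N.
pose e0 := C0 + n0.+1%:R * (K * 2 ^+ k0).
pose e1 := C1 + n1.+1%:R * (K * 2 ^+ k1).
pose e2 := C2 + n2.+1%:R * (K * 2 ^+ k2).
have ege (C' : R) nn kk : 0 <= C' -> 0 <= C' + nn%:R * (K * 2 ^+ kk).
  by move=> C'0; rewrite addr_ge0// !mulr_ge0// exprn_ge0.
have e00 : 0 <= e0 by exact: ege.
have e10 : 0 <= e1 by exact: ege.
have e20 : 0 <= e2 by exact: ege.
exists c, (2 * K * e2 + l2 * e1 + l2 * l1 * e0 + 1); split.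
  by rewrite ltr_wpDl// !addr_ge0// !mulr_ge0.
move=> M0 M1 M2 q la L L1 s p F Z M00 M10 M20 MB0 MB1 MB2 LL1 LL Zp Zs p0 pL pL1 KF.
have big_la (M : nat) : M%:R <= 256 ^+ la.+1 :> R -> M%:R <= n%:R ^+ la.+1 :> R.
  move=> H; apply: (le_trans H); apply: lerXn2r; rewrite ?nnegrE; [exact: ler0n|exact: ler0n|exact: n256].
(* Arguments may leave the cube, so they are clipped first; on the cube this is the identity. The
   input nodes exist in a single copy, hence the first layer must use weights of modulus at most
   1. *)
pose hin : 'I_din -> 'cV[R]_din -> R := fun i x => relu (1 - x i ord0).
pose hcl : 'I_din -> 'cV[R]_din -> R := fun i x => relu (1 - hin i x).
have hcl01 i x : 0 <= hcl i x <= 1 by exact: clip_relu.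
have [u0 [u001 R0 E0]] : exists u : 'I_D -> 'cV[R]_din -> R, _ :=
  A0 1 0 ltac:(by rewrite normr1) ltac:(by rewrite lexx ler01)
    ltac:(by move=> x i cx; rewrite mul1r addr0; apply: (c0 (imageP g0 cx)))
    _ n%:R hcl M0 q la k0 n8 Kn hcl01 M00 (big_la _ MB0) tk0.
have [u1 [u101 R1 E1]] : exists u : 'I_dt -> 'cV[R]_din -> R, _ :=
  A1 1 0 ltac:(by rewrite normr1) ltac:(by rewrite lexx ler01)
    ltac:(by move=> x i cx; rewrite mul1r addr0; apply: (c1 (imageP g1 cx)))
    _ n%:R u0 M1 q la k1 n8 Kn u001 M10 (big_la _ MB1) tk1.
have K2p : 0 < 2 * K by rewrite mulr_gt0// (lt_le_trans ltr01).
have dec01 x i : cube x -> 0 <= (2 * K)^-1 * fdec x i ord0 + 2^-1 <= 1.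
  move=> cx; have := hoelder_bound dt_gt0 bdp (hdec i) cx.
  rewrite ler_norml => /andP[l u].
  have l' : - 2^-1 <= (2 * K)^-1 * fdec x i ord0.
    rewrite ler_pdivlMl// mulrN mulrAC divff ?mul1r//.
  have u' : (2 * K)^-1 * fdec x i ord0 <= 2^-1.
    rewrite ler_pdivrMl// mulrAC divff ?mul1r//.
  by rewrite -lerBlDr sub0r l' /= -lerBrDr (_ : 1 - 2^-1 = 2^-1)//; field.
have [y [y01 R2 E2]] : exists u : 'I_dout -> 'cV[R]_din -> R, _ :=
  A2 (2 * K)^-1 2^-1
    ltac:(by rewrite normfV ger0_norm ?(ltW K2p)// invf_le1// (le_trans K1)// ler_peMl// ler1n)
    ltac:(by rewrite invr_ge0 ler0n invf_le1// ler1n) dec01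
    _ n%:R u1 M2 q la k2 n8 Kn u101 M20 (big_la _ MB2) tk2.
pose z := (D * (M0.+1 ^ t0 * n0.+1 * (2 ^ k0 * 24)) + dt * (M1.+1 ^ t1 * n1.+1 * (2 ^ k1 * 24))
  + dout * (M2.+1 ^ tdec * n2.+1 * (2 ^ k2 * 24)) + 2 * din + 2 * dt + 4 * dout)%N.
have zZ : (n * n * z <= Z)%N.
  rewrite /Z /c -(mulnA (n * n)) leq_mul2l; apply/orP; right.
  have m0 : (0 < M0.+1 ^ t0)%N by rewrite expn_gt0.
  move: m0; rewrite /z /a0 /a1 /a2; move: (M0.+1 ^ t0)%N (M1.+1 ^ t1)%N (M2.+1 ^ tdec)%N => X Y W X0.
  rewrite -!(mulnA _ (_.+1)) (mulnCA D X) (mulnCA dt Y) (mulnCA dout W).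
  exact: size_budget.
have zpart : [/\ (D * (M0.+1 ^ t0 * n0.+1 * (2 ^ k0 * 24)) <= z)%N,
   (dt * (M1.+1 ^ t1 * n1.+1 * (2 ^ k1 * 24)) <= z)%N,
   (dout * (M2.+1 ^ tdec * n2.+1 * (2 ^ k2 * 24)) <= z)%N & (2 * din <= z)%N /\ (2 * dt <= z)%N /\ (4 * dout <= z)%N].
  exact: sum_parts.
have [z0 z1 z2 [zin [zdt zdo]]] := zpart.
have n1R : 1 <= n%:R :> R by rewrite ler1n.
have S1 : layer 1 (din * 2) (@inputs R din) hin.
  apply: (@layer_le _ _ 1 1 (#|'I_din| * 2)) => //; first by rewrite card_ord.
  apply: gate_layer => i.
  apply: (@gate_list _ _ _ _ _ [:: (-1, i)] (-1)); rewrite ?normrN ?normr1//.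
    by rewrite big_seq1 normrN normr1.
  by move=> x; rewrite big_seq1 /=; congr (Num.max _ _); rewrite /inputs; ring.
have S2 : reach n%:R z 0 hin hcl.
  apply: (@layer_le _ _ n%:R n%:R (#|'I_din| * 2)) => //; first by rewrite card_ord mulnC.
  apply: gate_layer => i; apply: (@gate_list _ _ _ _ _ [:: (-1, i)] (-1)); rewrite ?normrN ?normr1//.
    by rewrite big_seq1 normrN normr1.
  by move=> x; rewrite big_seq1 /=; congr (Num.max _ _); ring.
have S3 := reach_trans (reach_trans S2 (reach_le (lexx _) z0 R0)) (reach_le (lexx _) z1 R1).
have LL1' : L1 = (1 + (L1 - 2)).+1 by clear -LL1; lia.
have {}S3 : reach n%:R z (L1 - 2) hin u1.
  apply: reach_pad S3 => //; last by rewrite card_ord mulnC.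
  by rewrite mulnDl in LL1; clear -LL1; lia.
have Em1 : emb p Z 1 (rep (n := n) hin).
  apply: (@emb_layer _ _ _ Z 0 (1 * n * (din * 2)) _ _ (@inputs R din)).
  - apply: leq_trans zZ; rewrite mul1n -mulnA leq_mul2l; apply/orP; right.
    by rewrite mulnC (leq_trans zin)// leq_pmull.
  - rewrite card_prod !card_ord; apply: (@leq_trans Z).
      by apply: leq_trans zZ; rewrite -mulnA leq_mul2l; apply/orP; right; exact: (leq_trans (leq_pmull din (isT : 0 < 2)%N) (leq_trans zin (leq_pmull z n_gt0))).
    by apply: Zp; clear -LL1 LL; lia.
  - exact: emb0.
  - apply: (@layer_pre _ _ _ _ _ _ _ _ (fun q : 'I_1 * 'I_din => q.2)) => //.
      by move=> [a i] [b j] /= ->; rewrite (ord1 a) (ord1 b).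
    exact: (layer_rep n (ltn0Sn 0) (lexx 1) S1).
have EmL1 : emb p Z L1 (rep (n := 1) u1).
  rewrite LL1'; apply: (emb_reach_last n_gt0 zZ _ _ Em1 S3).
    by move=> i /andP[i1 iL]; apply: Zp; clear -LL1 LL i1 iL; lia.
  by rewrite -LL1' pL1 card_ord.
(* Layer L1 + 1 copies each encoder output [n] times with weight 1, before the decoder starts. *)
have EmL1' : emb p Z L1.+1 (rep (n := n) u1).
  apply: (@emb_layer _ _ _ Z L1 (1 * n * (#|'I_dt| * 2)) _ _ (rep (n := 1) u1)) => //.
  - apply: leq_trans zZ; rewrite mul1n -mulnA leq_mul2l card_ord; apply/orP; right.
    by rewrite mulnC (leq_trans zdt)// leq_pmull.
  - rewrite card_prod !card_ord; apply: (@leq_trans Z).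
      by apply: leq_trans zZ; rewrite -mulnA leq_mul2l; apply/orP; right; exact: (leq_trans (leq_pmull dt (isT : 0 < 2)%N) (leq_trans zdt (leq_pmull z n_gt0))).
    by apply: Zp; clear -LL1 LL; lia.
  - apply: (layer_rep n (ltn0Sn 0) (lexx 1)); apply: layer_id => // i x.
    by have /andP[] := u101 i x.
(* The output layer has no bias, so 1/2 is subtracted before it, by splitting y - 1/2 into positive
   and negative part. Their difference times 2K is bounded by K because y lies in [0, 1]. *)
pose yy : bool * 'I_dout -> 'cV[R]_din -> R := fun b x =>
  if b.1 then relu (y b.2 x - 2^-1) else relu (2^-1 - y b.2 x).
have S4 : reach n%:R z 0 y yy.
  apply: (@layer_le _ _ n%:R n%:R (#|{: bool * 'I_dout}| * 2)) => //.
    by rewrite card_prod card_bool card_ord mulnAC (leq_trans _ zdo).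
  apply: gate_layer => -[[] i]; rewrite /yy /=.
    apply: (@gate_list _ _ _ _ _ [:: (1, i)] (2^-1)).
    - exact: half1.
    - by rewrite big_seq1 normr1.
    - by move=> x; rewrite big_seq1 mul1r.
  apply: (@gate_list _ _ _ _ _ [:: (-1, i)] (- 2^-1)).
  - by rewrite normrN; exact: half1.
  - by rewrite big_seq1 normrN normr1.
  - by move=> x; rewrite big_seq1 /=; congr (Num.max _ _); ring.
have LL' : L = (L1.+1 + (L - L1 - 2)).+1 by clear -LL; lia.
have S5 : reach n%:R z (L - L1 - 2) u1 yy.
  apply: reach_pad (reach_trans (reach_le (lexx _) z2 R2) S4) => //; first by clear -LL; lia.
  by rewrite card_prod card_bool card_ord mulnAC (leq_trans _ zdo).
have EmL : emb p Z L (rep (n := n) yy).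
  rewrite LL'; apply: (emb_reach n_gt0 zZ _ EmL1' S5).
  by move=> i /andP[i1 iL]; apply: Zp; clear -LL1 LL i1 iL; lia.
pose W (j : 'I_dout) (o : 'I_n * (bool * 'I_dout)) : R :=
  if o.2.2 == j then (if o.2.1 then 2 * K / n%:R else - (2 * K / n%:R)) else 0.
have np : 0 < n%:R :> R by rewrite ltr0n.
pose f (x : 'cV[R]_din) : 'cV[R]_dout := \col_j (2 * K * (y j x - 2^-1)).
have fE x j : f x j ord0 = \sum_o W j o * rep (n := n) yy o x.
  rewrite -(pair_bigA _ (fun (a : 'I_n) (o : bool * 'I_dout) => W j (a, o) * yy o x)) /=.
  have -> : \sum_(a < n) \sum_o W j (a, o) * yy o x = \sum_(a < n) (2 * K / n%:R * (y j x - 2^-1)).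
    apply: eq_bigr => a _.
    rewrite -(pair_bigA _ (fun (b : bool) (i : 'I_dout) => W j (a, (b, i)) * yy (b, i) x)) /=.
    rewrite big_bool /= (bigD1 j)//= [X in _ + X + _]big1; last first.
      by move=> i ij; rewrite /W /= (negbTE ij) mul0r.
    rewrite [X in _ + X](bigD1 j)//= [X in _ + (_ + X)]big1; last first.
      by move=> i ij; rewrite /W /= (negbTE ij) mul0r.
    rewrite /W /yy /= eqxx !addr0 mulNr -mulrBr; congr (_ * _).
    by rewrite -(opprB (y j x)) relu_sub.
  rewrite sumr_const card_ord -(mulr_natl (2 * K / n%:R * _)) mxE mulrA mulrCA divff ?gt_eqF// mulr1.
  by [].
exists f; split.
  apply: (emb_net_class p0 pL pL1 EmL _ _ Zs fE).
  - move=> j o; rewrite /W; case: eqP => _; last by rewrite normr0.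
    have H : `|2 * K / n%:R| <= 1.
      by rewrite ger0_norm ?divr_ge0 ?(ltW K2p)// ler_pdivrMr// mul1r.
    by case: o.2.1; rewrite ?normrN.
  - have FI : {in [pred jo : 'I_dout * ('I_n * (bool * 'I_dout)) | (W jo.1 jo.2 != 0)%R] &,
        injective (fun jo => jo.2)}.
      move=> [j o] [j' o'] /=; rewrite !inE /W /=.
      case: (o.2.2 =P j) => [<- _|_]; last by rewrite eqxx.
      case: (o'.2.2 =P j') => [<- _|_]; last by rewrite eqxx.
      by move=> ->.
    rewrite /nzw -(card_in_image FI) (leq_trans (max_card _))//.
    rewrite card_prod card_prod card_bool !card_ord (leq_trans _ zZ)// -mulnA leq_mul2l.
    apply/orP; right; apply: leq_trans (leq_trans zdo (leq_pmull z n_gt0)).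
    by rewrite leq_mul2r orbT.
  - move=> x; apply/mx_norm_leP => [|i j]; first by rewrite (le_trans K0).
    rewrite (ord1 j) mxE (le_trans _ KF)// normrM (ger0_norm (ltW K2p)).
    apply: (le_trans (ler_wpM2l (ltW K2p) (half_dist (y01 i x)))).
    by rewrite mulrAC divff ?mul1r// pnatr_eq0.
move=> x cx j.
have px : coords hcl x = x.
  by apply/matrixP => i k; rewrite (ord1 k) mxE /hcl /hin clip_id//; exact: cx.
have pu0 := coords_cube u001 x; have pu1 := coords_cube u101 x.
have cg0 : cube (g0 x) by apply: c0; exists x.
have cg1 : cube (g1 (g0 x)) by apply: c1; exists (g0 x).
pose q4 : R := 4^-1 ^+ q; have q40 : 0 <= q4 by rewrite exprn_ge0.
pose T : R := M0%:R^-1 `^ b0 + M1%:R^-1 `^ b1 + M2%:R^-1 `^ bdec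
       + (M0.+1 ^ t0 + M1.+1 ^ t1 + M2.+1 ^ tdec)%:R * q4.
rewrite -/q4 -/T.
have er (C' beta : R) (nn kk M tt : nat) : 0 <= C' -> M%:R^-1 `^ beta <= T ->
   (M.+1 ^ tt)%:R * q4 <= T -> 
   C' * M%:R^-1 `^ beta + (M.+1 ^ tt * nn.+1)%:R * (K * (2 ^+ kk * q4)) <= (C' + nn.+1%:R * (K * 2 ^+ kk)) * T.
  move=> C'0 h1' h2'; rewrite mulrDl lerD//; first by rewrite ler_wpM2l.
  rewrite natrM (_ : _ * _ * _ = nn.+1%:R * (K * 2 ^+ kk) * ((M.+1 ^ tt)%:R * q4)); last by ring.
  by rewrite ler_wpM2l// !mulr_ge0// exprn_ge0.
have P0 := powR_ge0 (M0%:R^-1) b0; have P1 := powR_ge0 (M1%:R^-1) b1; have P2 := powR_ge0 (M2%:R^-1) bdec.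
have Q0 : 0 <= (M0.+1 ^ t0)%:R * q4 by rewrite mulr_ge0.
have Q1 : 0 <= (M1.+1 ^ t1)%:R * q4 by rewrite mulr_ge0.
have Q2 : 0 <= (M2.+1 ^ tdec)%:R * q4 by rewrite mulr_ge0.
have TE : T = M0%:R^-1 `^ b0 + M1%:R^-1 `^ b1 + M2%:R^-1 `^ bdec + ((M0.+1 ^ t0)%:R * q4 + (M1.+1 ^ t1)%:R * q4 + (M2.+1 ^ tdec)%:R * q4).
  by rewrite /T !natrD !mulrDl.
have [lP0 lP1 lP2 [[lQ0 lQ1 lQ2] T0]] := six_le P0 P1 P2 Q0 Q1 Q2.
rewrite -TE in lP0 lP1 lP2 lQ0 lQ1 lQ2 T0.
have H0 i : `|u0 i x - g0 x i ord0| <= e0 * T.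
  by have := E0 i x; rewrite mul1r addr0 px => /le_trans; apply; exact: er.
have H1 i : `|u1 i x - g1 (coords u0 x) i ord0| <= e1 * T.
  by have := E1 i x; rewrite mul1r addr0 => /le_trans; apply; exact: er.
have H2 : `|y j x - ((2 * K)^-1 * fdec (coords u1 x) j ord0 + 2^-1)| <= e2 * T.
  by have := E2 j x => /le_trans; apply; exact: er.
have D0 : `|coords u0 x - g0 x| <= e0 * T.
  by apply/mx_norm_leP => [|i k]; rewrite ?mulr_ge0// (ord1 k) !mxE; exact: H0.
have D1 : `|coords u1 x - g1 (g0 x)| <= e1 * T + l1 * (e0 * T).
  apply/mx_norm_leP => [|i k]; first by rewrite addr_ge0// !mulr_ge0.
  rewrite (ord1 k) mxE [X in X + _]mxE [X in _ + X]mxE.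
  rewrite -(subrK (g1 (coords u0 x) i ord0) (u1 i x)) -addrA (le_trans (ler_normD _ _))// lerD//.
  by rewrite (le_trans (Lip1 i _ _ pu0 cg0))// ler_wpM2l.
have D2 : `|fdec (coords u1 x) j ord0 - fdec (g1 (g0 x)) j ord0| <= l2 * (e1 * T + l1 * (e0 * T)).
  by rewrite (le_trans (Lip2 j _ _ pu1 cg1))// ler_wpM2l.
have D3 : `|f x j ord0 - fdec (coords u1 x) j ord0| <= 2 * K * (e2 * T).
  rewrite mxE (_ : _ - _ = 2 * K * (y j x - ((2 * K)^-1 * fdec (coords u1 x) j ord0 + 2^-1))).
    by rewrite normrM (ger0_norm (ltW K2p)) ler_wpM2l// ltW.
  by field; rewrite gt_eqF// (lt_le_trans ltr01).
rewrite -(subrK (fdec (coords u1 x) j ord0) (f x j ord0)) -addrA (le_trans (ler_normD _ _))//.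
apply: (le_trans (lerD D3 D2)).
rewrite [leRHS](_ : _ = 2 * K * (e2 * T) + l2 * (e1 * T + l1 * (e0 * T)) + T); last by ring.
by rewrite lerDl.
Qed.

End NetworkApproximation.

(** * The mixing function Lambda *)

Section Conjugate.
Context {R : realType}.
Variable phi : R -> R.
Hypothesis phi_ge0 : forall y, 0 <= y -> 0 <= phi y.
Hypothesis phi0 : phi 0 = 0.
Hypothesis phi_cvx : convex_function (`[0, +oo[%classic : set R^o) phi.
Hypothesis conj_fin : forall x, 0 <= x -> conjugate phi x \is a fin_num.

Let c x := fine (conjugate phi x).

Lemma conj_fineE x : 0 <= x -> conjugate phi x = (c x)%:E.
Proof. by move=> x0; rewrite fineK// conj_fin. Qed.

Lemma conj_ge x y : 0 <= x -> 0 < y -> x * y - phi y <= c x.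
Proof.
move=> x0 y0; rewrite -lee_fin -conj_fineE//.
by apply: ereal_sup_ubound; exists y.
Qed.

Lemma conj_le x M : 0 <= x -> (forall y, 0 < y -> x * y - phi y <= M) -> c x <= M.
Proof.
move=> x0 H; rewrite -lee_fin -conj_fineE//.
by apply: ge_ereal_sup => _ [y y0 <-]; rewrite lee_fin; exact: H.
Qed.

Lemma conj_nondecreasing x y : 0 <= x -> x <= y -> c x <= c y.
Proof.
move=> x0 xy; apply: conj_le => // t t0.
apply: le_trans (conj_ge (le_trans x0 xy) t0).
by rewrite lerD2r ler_wpM2r// ltW.
Qed.

Lemma phi_scale (l y : R) : 0 <= l <= 1 -> 0 <= y -> phi (l * y) <= l * phi y.
Proof.
move=> /andP[l0 l1] y0.
have yD : y \in (`[0, +oo[%classic : set R^o) by rewrite inE /= in_itv /= y0.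
have zD : 0 \in (`[0, +oo[%classic : set R^o) by rewrite inE /= in_itv /= lexx.
have H : phi (l * y + (1 - l) * 0) <= l * phi y + (1 - l) * phi 0.
  exact: (phi_cvx (Itv01 l0 l1) yD zD).
by move: H; rewrite phi0 !mulr0 !addr0.
Qed.

(** The supremum of -phi(y) over y > 0 is 0, because convexity and phi(0) = 0 give phi(l) <= l
    phi(1), which is arbitrarily small. *)
Lemma conj0 : c 0 = 0.
Proof.
apply/eqP; rewrite eq_le; apply/andP; split.
  by apply: conj_le => // y y0; rewrite mul0r sub0r oppr_le0 phi_ge0// ltW.
apply/ler_addgt0Pr => e e0; rewrite -lerBlDr sub0r.
have p1 : 0 <= phi 1 by exact: phi_ge0.
pose l := e / (phi 1 + e + 1).
have q0 : 0 < phi 1 + e + 1 by lra.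
have l0 : 0 < l by rewrite divr_gt0.
have l1 : l <= 1 by rewrite ler_pdivrMr//; lra.
apply: le_trans (conj_ge (lexx 0) l0).
rewrite mul0r sub0r lerN2 -[l]mulr1.
have l01 : 0 <= l <= 1 by rewrite ltW.
apply: (le_trans (phi_scale l01 ler01)).
rewrite /l mulrAC ler_pdivrMr// ler_wpM2l//; lra.
Qed.

Lemma conj_fine_ge0 x : 0 <= x -> 0 <= c x.
Proof. by move=> x0; rewrite -conj0 conj_nondecreasing. Qed.

(** The conjugate is convex, so its slope on [x, y] is at most that of the chord from x to b + 1;
    this chord spans a length at least 1. *)
Lemma conj_lip (b x y : R) : 0 <= x -> x <= y -> y <= b -> c y - c x <= c (b + 1) * (y - x).
Proof.
move=> x0 xy yb.
have b0 : 0 <= b + 1 by lra.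
pose l := (y - x) / (b + 1 - x).
have d1 : 1 <= b + 1 - x by lra.
have d0 : 0 < b + 1 - x by lra.
have l0 : 0 <= l by rewrite divr_ge0//; lra.
have l1 : l <= 1 by rewrite ler_pdivrMr//; lra.
have lyx : l <= y - x by rewrite ler_pdivrMr// ler_peMr//; lra.
have yE : y = (1 - l) * x + l * (b + 1).
  have : l * (b + 1 - x) = y - x by rewrite divfK ?gt_eqF.
  lra.
have H : c y <= (1 - l) * c x + l * c (b + 1).
  apply: conj_le; first by lra.
  move=> t t0; have h1 := conj_ge x0 t0; have h2 := conj_ge b0 t0.
  have -> : y * t - phi t = (1 - l) * (x * t - phi t) + l * ((b + 1) * t - phi t).
    by rewrite {1}yE; ring.
  by apply: lerD; apply: ler_wpM2l => //; lra.
have cx := conj_fine_ge0 x0; have cb := conj_fine_ge0 b0.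
have h3 : l * c (b + 1) <= c (b + 1) * (y - x) by rewrite mulrC ler_wpM2l.
have h4 : 0 <= l * c x by rewrite mulr_ge0.
lra.
Qed.

Lemma psi_nondecreasing x y : 0 <= x -> x <= y -> psi phi x <= psi phi y.
Proof.
move=> x0 xy; apply: ler_pM => //; first exact: conj_fine_ge0.
exact: conj_nondecreasing.
Qed.

Lemma psi_lip (b x y : R) : 0 <= x -> x <= y -> y <= b ->
  `|psi phi x - psi phi y| <= (c (b + 1) * (b + 1)) * `|x - y|.
Proof.
move=> x0 xy yb; have h := conj_lip x0 xy yb; have p := psi_nondecreasing x0 xy.
rewrite (distrC x) (ger0_norm (_ : 0 <= y - x)) ?subr_ge0//.
rewrite distrC ger0_norm ?subr_ge0//.
have y0 : 0 <= y by exact: le_trans xy.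
have b0 : 0 <= b by exact: le_trans yb.
rewrite /psi -!/(c _) (_ : _ - _ = (c y - c x) * x + c y * (y - x)); last by ring.
rewrite [leRHS](_ : _ = c (b + 1) * (y - x) * b + c (b + 1) * (y - x)); last by ring.
apply: lerD.
  apply: ler_pM => //; [|exact: le_trans yb].
  by rewrite subr_ge0 conj_nondecreasing.
rewrite ler_wpM2r ?subr_ge0// conj_nondecreasing// (le_trans yb)// lerDl//.
Qed.

(** [psi_inv] picks a preimage, which exists by the intermediate value theorem on [0, b]. Testing
    the supremum at 1 bounds the conjugate at [b] below by b - phi(1) = 1 + y, and b >= 1, so psi(b)
    >= y. *)
Lemma psi_inv_spec y : 0 < y -> 0 < psi_inv phi y /\ psi phi (psi_inv phi y) = y.
Proof.
move=> y0; have p1 : 0 <= phi 1 by exact: phi_ge0.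
pose b := phi 1 + 1 + y.
have b0 : 0 <= b by rewrite /b; lra.
have Lb : y <= psi phi b.
  have : 1 + y <= c b by have := conj_ge b0 ltr01; rewrite mulr1 /b; lra.
  move=> h; have b1 : 1 <= b by rewrite /b; lra.
  rewrite /psi -/(c _) -[leLHS]mulr1; apply: ler_pM => //; lra.
have P0 : psi phi 0 = 0 by rewrite /psi mulr0.
pose M := c (b + 1) * (b + 1).
have M0 : 0 <= M by rewrite mulr_ge0// ?conj_fine_ge0//; lra.
have cont : {within `[0, b], continuous (psi phi)}.
  apply/subspace_continuousP => x /=; rewrite in_itv /= => /andP[x0 xb].
  apply/cvgrPdist_le => e e0; rewrite near_withinE.
  have M1 : 0 < M + 1 by lra.
  apply/nbhs_ballP; exists (e / (M + 1)) => /=; first exact: divr_gt0.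
  move=> t; rewrite /ball /= => xt; rewrite in_itv /= => /andP[t0 tb].
  apply: (@le_trans _ _ (M * `|x - t|)).
    have [xt'|/ltW tx] := leP x t; first exact: psi_lip.
    by rewrite distrC (distrC x); exact: psi_lip.
  apply: (@le_trans _ _ ((M + 1) * `|x - t|)); first by rewrite ler_wpM2r// lerDl.
  by rewrite mulrC -ler_pdivlMr// ltW.
have [|x xI xE] := IVT b0 cont (v := y).
  by rewrite P0 ge_min le_max ltW//= Lb orbT.
have ex : exists x, 0 <= x /\ psi phi x = y.
  by exists x; move: xI; rewrite in_itv /= => /andP[].
have [h1 h2] := xgetPex 0 ex; rewrite -/(psi_inv phi y) in h1 h2.
split => //; rewrite lt_neqAle h1 andbT; apply/eqP => h; move: h2; rewrite -h P0 => h2.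
by move: y0; rewrite -h2 ltxx.
Qed.

Variables (bm : nat -> R).
Hypothesis bm_ge0 : forall k, 0 <= bm k.
Hypothesis bm_mono : forall k l, (k <= l)%N -> bm l <= bm k.
Hypothesis bm_sum : (\sum_(0 <= k <oo)
     (conjugate phi k.+1%:R - conjugate phi k%:R) * (bm k)%:E < +oo)%E.

(** The conjugate at q telescopes from its value 0 at 0; replacing [bm q] by the larger [bm k] in
    each term bounds the product by a partial sum of the series. *)
Lemma conj_mixing_bounded : exists C : R, 0 < C /\ forall q : nat, c q%:R * bm q <= C.
Proof.
have tE k : ((conjugate phi k.+1%:R - conjugate phi k%:R) * (bm k)%:E = ((c k.+1%:R - c k%:R) * bm k)%:E)%E.
  by rewrite !conj_fineE// EFinM EFinB.
have t0 k : 0 <= (c k.+1%:R - c k%:R) * bm k.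
  by rewrite mulr_ge0// subr_ge0 conj_nondecreasing// ler_nat.
have Sge n : (\sum_(0 <= k < n) ((c k.+1%:R - c k%:R) * bm k)%:E <= \sum_(0 <= k <oo) ((c k.+1%:R - c k%:R) * bm k)%:E)%E.
  by apply: nneseries_lim_ge => k _ _; rewrite lee_fin.
move: bm_sum; rewrite (eq_eseriesr (fun k _ => tE k)) => Sfin.
have S0 : (0 <= \sum_(0 <= k <oo) ((c k.+1%:R - c k%:R) * bm k)%:E)%E.
  by have := Sge 0%N; rewrite big_geq.
have SE : (\sum_(0 <= k <oo) ((c k.+1%:R - c k%:R) * bm k)%:E)%E \is a fin_num.
  by rewrite ge0_fin_numE.
exists (fine (\sum_(0 <= k <oo) ((c k.+1%:R - c k%:R) * bm k)%:E)%E + 1); split.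
  by rewrite ltr_wpDl// fine_ge0.
move=> q; have := Sge q; rewrite -(fineK SE) sumEFin lee_fin => H.
rewrite (le_trans _ (le_trans H _)) ?lerDl//.
have -> : c q%:R = \sum_(0 <= k < q) (c k.+1%:R - c k%:R).
  by rewrite telescope_sumr// conj0 subr0.
rewrite mulr_suml big_nat [leRHS]big_nat; apply: ler_sum => k /andP[_ kq].
apply: ler_wpM2l; last by apply: bm_mono; exact: ltnW.
by rewrite subr_ge0; apply: conj_nondecreasing; rewrite ?ler_nat.
Qed.

(** Monotonicity of psi gives psi(q) >= 1/x for the ceiling q, that is, the conjugate at q times q x
    is at least 1; dividing the bounded product by the conjugate yields the last inequality. *)
Lemma Lambda_mix_mixing : exists C : R, 0 < C /\ forall x, 0 < x ->
  exists q : nat, [/\ (0 < q)%N, Lambda_mix phi x = q%:R * x & bm q <= C * (q%:R * x)].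
Proof.
have [C [C0 HC]] := conj_mixing_bounded; exists C; split => // x x0.
have xi : 0 < x^-1 by rewrite invr_gt0.
have [p0 pE] := psi_inv_spec xi; set t := psi_inv phi x^-1 in p0 pE *.
have ct : 0 < Num.ceil t by rewrite ceil_gt0.
exists `|Num.ceil t|%N; have qE : (`|Num.ceil t|%N%:R : R) = (Num.ceil t)%:~R.
  by rewrite natr_absz ger0_norm// ltW.
have q0 : (0 < `|Num.ceil t|)%N by rewrite absz_gt0 gt_eqF.
split => //; first by rewrite qE.
set q := `|_|%N in qE q0 *.
have tq : t <= q%:R by rewrite qE ceil_ge.
have h := psi_nondecreasing (ltW p0) tq; rewrite pE /psi -/(c _) in h.
have qp : 0 < q%:R :> R by rewrite ltr0n.
have cq : 0 < c q%:R by rewrite -(pmulr_lgt0 _ qp) (lt_le_trans xi).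
have h2 : 1 <= c q%:R * (q%:R * x).
  by rewrite mulrA -ler_pdivrMr// mul1r.
rewrite -(ler_pM2l cq) (le_trans (HC q))// mulrCA -[leLHS]mulr1 ler_wpM2l// ltW//.
Qed.

End Conjugate.

(** * Rates *)

Section SampleScales.
Context {R : realType}.

Lemma ln2_gt0 : 0 < ln 2 :> R. Proof. by rewrite ln_gt0// ltr1n. Qed.

Lemma log2_pow2 (x : R) : 0 < x -> 2 `^ (log2 x) = x.
Proof.
move=> x0; rewrite /powR gt_eqF ?ltr0n// /log2 divfK ?gt_eqF ?ln2_gt0//.
by rewrite lnK.
Qed.

Lemma ler_log2 (x y : R) : 0 < x -> x <= y -> log2 x <= log2 y.
Proof.
move=> x0 xy; rewrite /log2; apply: ler_wpM2r; first by rewrite invr_ge0 ltW// ln2_gt0.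
by rewrite ler_ln ?posrE// (lt_le_trans x0).
Qed.

Lemma log2_expn (k : nat) : log2 (2 ^+ k : R) = k%:R.
Proof. by rewrite /log2 lnXn ?ltr0n// -(mulr_natl (ln 2)) mulfK// gt_eqF// ln2_gt0. Qed.

Lemma log2_ge1 (n : nat) : (2 <= n)%N -> 1 <= log2 n%:R :> R.
Proof.
move=> n2; rewrite -[leLHS](log2_expn 1) expr1; apply: ler_log2; first by rewrite ltr0n.
by rewrite ler_nat.
Qed.

Lemma log2_le (n : nat) : (0 < n)%N -> log2 n%:R <= n%:R :> R.
Proof.
move=> n0; rewrite -[leRHS]log2_expn; apply: ler_log2; first by rewrite ltr0n.
by rewrite -natrX ler_nat ltnW// ltn_expl.
Qed.

Lemma nat_bound (c : R) : c <= (Num.truncn c).+1%:R.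
Proof. exact/ltW/truncnS_gt. Qed.

(** All factors are bounded by powers of n, so the logarithm of one code entry is of order (L + 6)
    ln n. *)
Lemma net_size_bound (a n L m : nat) : (2 <= n)%N -> (0 < a)%N -> (L.+1 <= n ^ a)%N -> (4 * m.+1 <= n ^ a)%N ->
  (4 * n <= n ^ a)%N ->
  (L.+1 * m.+1 * m.+2 * (4 * n * (4 * m.+1) ^ L.+1).+1 <= n ^ (a * (L + 6)))%N.
Proof.
move=> n2 a0 hL hm hn; have n0 : (0 < n)%N by exact: ltnW.
have m1 : (m.+1 <= n ^ a)%N by rewrite (leq_trans _ hm)// leq_pmull.
have m2 : (m.+2 <= n ^ a)%N by rewrite (leq_trans _ hm)//; lia.
have -> : (a * (L + 6) = a + a + a + (a + (a * L.+1 + a)))%N by nia.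
rewrite (expnD n (a + a + a)) !(expnD n (a + a)) (expnD n a a); apply: leq_mul.
  by apply: leq_mul => //; apply: leq_mul.
rewrite expnD; set X := (4 * n * (4 * m.+1) ^ L.+1)%N.
have XY : (X <= n ^ a * n ^ (a * L.+1))%N.
  by apply: leq_mul => //; rewrite expnM leq_exp2r.
have Y0 : (0 < n ^ a * n ^ (a * L.+1))%N by rewrite muln_gt0 !expn_gt0 n0.
rewrite expnD mulnA; apply: (@leq_trans (n ^ a * n ^ (a * L.+1) * 2)%N).
  by rewrite muln2 -addnn -addn1 leq_add.
by rewrite leq_mul2l (leq_trans n2) ?orbT// -[X in (X <= _)%N]expn1 leq_pexp2l.
Qed.

(** The three logarithms come from [s], of order N log n, from the depth L and from ln n itself. *)
Lemma entropy_bound (e : nat) (Cs CL : R) : 0 <= Cs -> 0 <= CL -> exists C : R, 0 < C /\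
  forall n N s L m : nat, m = (s + e)%N -> (2 <= n)%N -> (1 <= N <= n)%N ->
  s%:R <= Cs * (N%:R * log2 n%:R) -> L%:R <= CL * log2 n%:R ->
  ln ((L.+1 * m.+1 * m.+2 * (4 * n * (4 * m.+1) ^ L.+1).+1) ^ s)%N%:R
    <= C * (N%:R * ln n%:R ^+ 3).
Proof.
move=> Cs0 CL0.
pose cs := (Num.truncn Cs).+1; pose cL := (Num.truncn CL).+1.
pose b := (4 * cs + 4 * e + cL + 8)%N; pose a := (b + 2)%N.
have l2 := ln2_gt0; have l2i : 0 < (ln 2)^-1 :> R by rewrite invr_gt0.
exists (Cs / ln 2 * (a%:R * ((CL + 6) / ln 2)) + 1); split.
  rewrite ltr_wpDl// !mulr_ge0//; try exact: ltW.
  lra.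
move=> n N s L m mE n2 /andP[N1 Nn] sle Lle.
have n0 : (0 < n)%N by exact: ltnW.
have np : 0 < n%:R :> R by rewrite ltr0n.
have lg1 := log2_ge1 n2; have lgn := log2_le n0.
have bn : (b <= n ^ b)%N by rewrite (leq_trans (ltnW (ltn_expl b (isT : 1 < 2)%N)))// leq_exp2r.
have na2 : (n ^ a = n ^ b * (n * n))%N by rewrite expnD.
have nn1 : (0 < n * n)%N by rewrite muln_gt0 n0.
have nnn : (n <= n * n)%N by rewrite leq_pmulr.
have s_nat : (s <= cs * (n * n))%N.
  rewrite -(ler_nat R) !natrM; apply: (le_trans sle); apply: ler_pM => //.
  - by rewrite mulr_ge0// (le_trans ler01).
  - exact: nat_bound.
  - by apply: ler_pM => //; rewrite ?(le_trans ler01)// ler_nat.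
have L_nat : (L <= cL * n)%N.
  rewrite -(ler_nat R) !natrM; apply: (le_trans Lle); apply: ler_pM => //.
  - by rewrite (le_trans ler01).
  - exact: nat_bound.
have bnn : (b * (n * n) <= n ^ a)%N by rewrite na2 leq_mul2r bn orbT.
have H := @net_size_bound a n L m n2 (isT : 0 < b + 2)%N.
have {}H : (L.+1 * m.+1 * m.+2 * (4 * n * (4 * m.+1) ^ L.+1).+1 <= n ^ (a * (L + 6)))%N.
  apply: H; apply: leq_trans bnn; rewrite /b ?mE; clear -s_nat L_nat nnn nn1 n0; nia.
rewrite natrX lnXn; last by rewrite ltr0n !muln_gt0.
set arg := (_ * _)%N in H *; have argp : (0 < arg)%N by rewrite /arg !muln_gt0.
have lna : ln (arg%:R : R) <= (a * (L + 6))%:R * ln n%:R.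
  rewrite mulr_natl -lnXn// -natrX ler_ln ?posrE ?ltr0n ?expn_gt0 ?n0// ler_nat//.
have lnn : ln n%:R = ln 2 * log2 n%:R :> R by rewrite /log2 mulrC divfK// gt_eqF.
have ln0 : 0 <= ln n%:R :> R by rewrite ln_ge0// ler1n.
have L6 : (L + 6)%:R <= (CL + 6) * log2 n%:R.
  by rewrite natrD mulrDl lerD// ler_peMr.
have lg : log2 n%:R = ln n%:R / ln 2 :> R by [].
rewrite lg in sle L6.
rewrite -[leLHS]mulr_natl (le_trans (ler_pM _ _ sle lna))//.
  by rewrite ln_ge0// ler1n.
rewrite natrM; apply: (@le_trans _ _ (Cs / ln 2 * (a%:R * ((CL + 6) / ln 2)) * (N%:R * ln n%:R ^+ 3))).
  rewrite (_ : _ * _ * (N%:R * _) = Cs * (N%:R * (ln n%:R / ln 2)) * (a%:R * ((CL + 6) * (ln n%:R / ln 2)) * ln n%:R)); last first.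
    by field; rewrite gt_eqF.
  apply: ler_wpM2l; first by rewrite !mulr_ge0// ltW.
  by apply: ler_wpM2r => //; apply: ler_wpM2l.
by rewrite ler_wpM2r ?lerDl// mulr_ge0// exprn_ge0.
Qed.

(** M + 1 is the integer part of (N / Y)^(1/t). The threshold Y 2^t makes this root at least 2, so
    that M is positive and at least a third of the root. *)
Lemma grid_size (t : nat) (beta Y : R) : (0 < t)%N -> 0 <= beta -> 1 <= Y -> exists N0 C : R, 0 < C /\
  forall N : nat, N0 <= N%:R -> exists M : nat,
  [/\ (0 < M)%N, ((M.+1 ^ t)%N%:R : R) <= N%:R / Y, (M <= N)%N & M%:R^-1 `^ beta <= C * N%:R `^ (- (beta / t%:R))].
Proof.
move=> t0 be0 Y1; have Y0 : 0 < Y by exact: lt_le_trans Y1.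
have tp : 0 < t%:R :> R by rewrite ltr0n.
exists (Y * 2 ^+ t), (3 `^ beta * (Y^-1) `^ (- (beta / t%:R))); split.
  by rewrite mulr_gt0// powR_gt0// ?invr_gt0// ltr0n.
move=> N NN0; pose y : R := N%:R / Y; pose u := y `^ (t%:R^-1).
have y2 : 2 ^+ t <= y by rewrite ler_pdivlMr// mulrC.
have t21 : 1 <= 2 ^+ t :> R by rewrite exprn_ege1// ler1n.
have y1 : 1 <= y by exact: le_trans y2.
have yp : 0 < y by exact: lt_le_trans y1.
have u2 : 2 <= u.
  have E : (2 : R) = (2 ^+ t) `^ (t%:R^-1).
    by rewrite -powR_mulrn// -powRrM divff ?gt_eqF// powRr1.
  by rewrite {1}E; apply: ge0_ler_powR; rewrite ?nnegrE ?invr_ge0 ?exprn_ge0// ltW.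
have ut : u ^+ t = y by rewrite -powR_mulrn ?powR_ge0// -powRrM mulVf ?gt_eqF// powRr1// ltW.
have uy : u <= y.
  rewrite -[leRHS](powRr1 (ltW yp)); apply: ler_powR => //.
  by rewrite invf_le1// ler1n.
have yN : y <= N%:R by rewrite ler_pdivrMr// ler_peMr.
have u0 : 0 <= u by lra.
pose M := (Num.truncn u).-1.
have tr2 : (2 <= Num.truncn u)%N by rewrite truncn_ge_nat.
have ME : M.+1 = Num.truncn u by rewrite prednK// ltnW.
have tru : (Num.truncn u)%:R <= u by rewrite truncn_le.
have tru1 := truncnS_gt u.
have M0 : (0 < M)%N by rewrite -ltnS ME.
exists M; split => //.
- by rewrite ME natrX -/y -ut lerXn2r// nnegrE.
- rewrite -(ler_nat R); apply: (le_trans _ (le_trans (le_trans tru uy) yN)).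
  by rewrite ler_nat -ME leqnSn.
have M3 : u <= 3 * M%:R.
  have M1 : 1 <= M%:R :> R by rewrite ler1n.
  move: tru1; rewrite -ME -!(natr1) => tru1; lra.
have Mp : 0 < M%:R :> R by rewrite ltr0n.
have up : 0 < u by lra.
have Mu : M%:R^-1 <= 3 * y `^ (- t%:R^-1).
  by rewrite powRN -/u ler_pdivlMr// mulrC ler_pdivrMr.
have -> : 3 `^ beta * Y^-1 `^ (- (beta / t%:R)) * N%:R `^ (- (beta / t%:R)) = (3 * y `^ (- t%:R^-1)) `^ beta.
  rewrite powRM// ?powR_ge0// -powRrM (_ : - t%:R^-1 * beta = - (beta / t%:R)); last by ring.
  by rewrite /y powRM// ?invr_ge0 ?ltW// -mulrA [_ `^ _ * N%:R `^ _]mulrC.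
by apply: ge0_ler_powR => //; rewrite nnegrE ?invr_ge0// mulr_ge0// powR_ge0.
Qed.

(** The tree needs t + [sfloor beta] leaves. When its least height is positive, half of 2^kap is
    still below this number, which is at most 2 max(t, beta); this is where the 4 of the depth
    condition is used. *)
Lemma depth_factor (t : nat) (beta : R) : (0 < t)%N -> 1 <= beta -> exists kap : nat,
  [/\ (t + sfloor beta <= 2 ^ kap)%N, kap%:R <= log2 (4 * Num.max t%:R beta) &
     2 <= log2 (4 * Num.max t%:R beta)].
Proof.
move=> t0 b1; set mx := Num.max _ _.
have mx1 : 1 <= mx by rewrite le_max b1 orbT.
have l2 : 2 <= log2 (4 * mx).
  rewrite -[leLHS](log2_expn 2); apply: ler_log2; first by rewrite exprn_gt0// ltr0n.
  by rewrite (_ : 2 ^+ 2 = 4); [lra|ring].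
have bp : 0 < beta by lra.
exists (up_log 2 (t + sfloor beta)); split => //; first by rewrite up_logP.
have [k0|kp] := posnP (up_log 2 (t + sfloor beta)); first by rewrite k0; lra.
rewrite -log2_expn; apply: ler_log2; first by rewrite exprn_gt0// ltr0n.
have T1 : (1 < t + sfloor beta)%N.
  by rewrite ltnNge; apply: contraTN kp => T1; rewrite -eqn0Ngt up_log_eq0.
have /andP[h _] := up_log_bounds (isT : 1 < 2)%N T1.
rewrite -(prednK kp) exprS.
have : 2 ^+ (up_log 2 (t + sfloor beta)).-1 <= t%:R + (sfloor beta)%:R :> R.
  by rewrite -natrX -natrD ler_nat ltnW.
have := sfloor_lt bp; have tm : t%:R <= mx by rewrite le_max lexx.
have bm : beta <= mx by rewrite le_max lexx orbT.
move=> sb h2; rewrite (_ : 4 * mx = 2 * (mx + mx)); last by ring.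
by rewrite ler_pM2l// (le_trans h2)// lerD// (le_trans (ltW sb)).
Qed.

End SampleScales.

Section Rates.
Context {R : realType}.

Lemma le_pow2 (x : R) (k : nat) : 0 < x -> log2 x <= k%:R -> x <= 2 ^+ k.
Proof.
move=> x0 xk; rewrite -[leLHS](log2_pow2 x0) -[leRHS](powR_mulrn k); last by rewrite ler0n.
by apply: ler_powR => //; rewrite ler1n.
Qed.

(** The product trees use at most a (3 l / 4 + 6). The remainder a (l / 4 - 6) >= l - 24 covers the
    two amplifications, l / 4 in all, and the constant 12 because l >= 64. *)
Lemma encoder_depth (a l x q k : R) : 0 <= k <= a -> 4 <= a -> 64 <= l -> x <= l / 8 ->
  0 <= q <= 3 / 4 * l + 1 -> 2 * x + k * (q + 5) + 12 <= a * l.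
Proof.
move=> /andP[k0 ka] a4 l64 xl /andP[q0 ql].
have h1 : k * (q + 5) <= a * (3 / 4 * l + 6) by apply: ler_pM => //; lra.
have h2 : 4 * (l / 4 - 6) <= a * (l / 4 - 6) by apply: ler_wpM2r => //; lra.
lra.
Qed.

Lemma decoder_depth (a l x q k : R) : 0 <= k <= a -> 2 <= a -> 64 <= l -> x <= l / 8 ->
  0 <= q <= 3 / 4 * l + 1 -> x + k * (q + 5) + 7 <= a * l.
Proof.
move=> /andP[k0 ka] a4 l64 xl /andP[q0 ql].
have h1 : k * (q + 5) <= a * (3 / 4 * l + 6) by apply: ler_pM => //; lra.
have h2 : 2 * (l / 4 - 6) <= a * (l / 4 - 6) by apply: ler_wpM2r => //; lra.
lra.
Qed.

(** [la] is the amplification length, with 256^(la + 1) >= 2^l, and [q] the number of squaring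
    steps, with 4^(-q) <= 2^(-3 l / 2). *)
Lemma depth_parameters (l : R) : 64 <= l -> exists la q : nat,
  [/\ la%:R <= l / 8, l <= (8 * la.+1)%:R, 0 <= (q%:R : R) <= 3 / 4 * l + 1 & 3 / 4 * l <= q%:R].
Proof.
move=> l64; have h1 : 0 <= l / 8 by lra.
have h2 : 0 <= 3 / 4 * l by lra.
exists (Num.truncn (l / 8)), (Num.truncn (3 / 4 * l)).+1; split.
- by rewrite truncn_le.
- by have := truncnS_gt (l / 8); rewrite natrM; lra.
- by rewrite ler0n /= -(natr1 (Num.truncn (3 / 4 * l))) lerD2r truncn_le.
- exact/ltW/truncnS_gt.
Qed.

Lemma add3_le (x y z w : R) : x <= w -> y <= w -> z <= w -> x + y + z <= 3 * w.
Proof. lra. Qed.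

Lemma quarter_pow_sqr (n : nat) (q : nat) : (0 < n)%N -> 3 / 4 * log2 n%:R <= q%:R :> R ->
  (4^-1 ^+ q) ^+ 2 <= (n%:R ^+ 3)^-1 :> R.
Proof.
move=> n0 h; have np : 0 < n%:R :> R by rewrite ltr0n.
rewrite -exprM exprVn lef_pV2 ?posrE ?exprn_gt0//.
have -> : (4 : R) ^+ (q * 2) = 2 ^+ (4 * q).
  by rewrite (_ : 4 = 2 ^+ 2); [rewrite -exprM; congr (_ ^+ _); lia|ring].
apply: le_pow2; first by rewrite exprn_gt0.
rewrite /log2 lnXn// -(mulr_natl (ln n%:R)) -mulrA -/(log2 n%:R) natrM.
lra.
Qed.

Lemma sqr_rate (a b c d x y : R) : 0 <= a -> 0 <= b -> 0 <= c -> a <= c * x -> b ^+ 2 <= d * y ->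
  (a + b) ^+ 2 <= 2 * (c ^+ 2 * x ^+ 2) + 2 * (d * y).
Proof.
move=> a0 b0 c0 ax bd; have h : a ^+ 2 <= c ^+ 2 * x ^+ 2.
  by rewrite -exprMn lerXn2r// nnegrE// (le_trans a0).
have : 0 <= (a - b) ^+ 2 by exact: sqr_ge0.
rewrite (_ : (a + b) ^+ 2 = 2 * a ^+ 2 + 2 * b ^+ 2 - (a - b) ^+ 2); last by ring.
lra.
Qed.

Lemma network0 (p : nat -> nat) (W : forall i, 'M[R]_(p i.+1, p i)) (v : forall i, 'cV[R]_(p i)) x l :
  (forall i, W i = 0) -> network W v x l = 0.
Proof. by move=> W0; case: l => [|l] /=; rewrite W0 mul0mx. Qed.

Lemma net_class0 (din dout dt L L1 : nat) (p : nat -> nat) (s : nat) (F : R) g : 0 <= F ->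
  net_class R din dout dt L L1 p s F g -> net_class R din dout dt L L1 p s F (fun=> 0).
Proof.
move=> F0 [e0 [eL [_ [_ [_ [_ [_ [pL1 _]]]]]]]].
exists e0, eL, (fun=> 0), (fun=> 0); split; [|split; [|split; [|split; [|split]]]] => //.
- move=> x; rewrite network0//; apply/matrixP => i j.
  by rewrite castmxE !mxE.
- by move=> j _; rewrite !normr0.
- rewrite big1// => i _; apply/eqP; rewrite addn_eq0 /nnz.
  by apply/andP; split; rewrite eq_card0// => ij; apply/negbTE/negP => /set_mem /=; rewrite mxE eqxx.
- by move=> x; rewrite normr0.
Qed.

Variables (din dout dt D : nat) (tdec t0 t1 : nat) (bdec b0 b1 K : R).
Variables (g0 : 'cV[R]_din -> 'cV[R]_D) (g1 : 'cV[R]_D -> 'cV[R]_dt) (fdec : 'cV[R]_dt -> 'cV[R]_dout).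
Hypotheses (din_gt0 : (0 < din)%N) (D_gt0 : (0 < D)%N) (dt_gt0 : (0 < dt)%N).
Hypotheses (t0_gt0 : (0 < t0)%N) (t1_gt0 : (0 < t1)%N) (td_gt0 : (0 < tdec)%N).
Hypotheses (b0_ge1 : 1 <= b0) (b1_ge1 : 1 <= b1) (bdec_ge1 : 1 <= bdec) (K1 : 1 <= K).
Hypotheses (st0 : sparse_args t0 g0) (st1 : sparse_args t1 g1) (stdec : sparse_args tdec fdec).
Hypotheses (h0 : hoelder_vec b0 K g0) (h1 : hoelder_vec b1 K g1) (hdec : hoelder_vec bdec K fdec).
Hypotheses (c0 : g0 @` (@cube R _) `<=` @cube R _) (c1 : g1 @` (@cube R _) `<=` @cube R _).

Lemma decoder_bound x j : cube x -> `|fdec (g1 (g0 x)) j ord0| <= K.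
Proof.
move=> cx; have bp : 0 < bdec by exact: lt_le_trans ltr01 bdec_ge1.
apply: (hoelder_bound dt_gt0 bp (hdec j)); apply: c1; exists (g0 x) => //.
by apply: c0; exists x.
Qed.

Let A := Num.min (bdec / tdec%:R) (Num.min (b0 / t0%:R) (b1 / t1%:R)).

Lemma rate_ge0 : 0 <= A.
Proof.
have b0p : 0 <= b0 by exact: le_trans ler01 b0_ge1.
have b1p : 0 <= b1 by exact: le_trans ler01 b1_ge1.
have bdp : 0 <= bdec by exact: le_trans ler01 bdec_ge1.
by rewrite !le_min !divr_ge0.
Qed.

(** Below the threshold [Nst] the rate N^(-2A) is bounded away from 0, so the error K of the zero
    network is absorbed by a constant. *)
Lemma small_sample (N : nat) (Nst : R) : (0 < N)%N -> N%:R <= Nst ->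
  K ^+ 2 <= K ^+ 2 * Nst `^ (2 * A) * N%:R `^ (- 2 * A).
Proof.
move=> N0 NN; have A0 := rate_ge0; have Np : 0 < N%:R :> R by rewrite ltr0n.
rewrite -mulrA -{1}[K ^+ 2]mulr1; apply: ler_wpM2l; first exact: sqr_ge0.
rewrite mulNr powRN ler_pdivlMr ?powR_gt0// mul1r.
apply: ge0_ler_powR; rewrite ?mulr_ge0 ?nnegrE ?(ltW Np)//.
exact: le_trans (ltW Np) NN.
Qed.

Variables (Cw Cs CL : R).
Hypotheses (Cw0 : 0 < Cw) (Cs0 : 0 < Cs) (CL0 : 0 < CL).

(** Small [N] use the zero network. Otherwise each grid has at most N / Y points, and up to a
    constant the squared multiplication error is (N n^(-3/2))^2, at most N / n because N <= n. *)
Theorem class_approximation : exists C : R, 0 < C /\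
  forall (n N L L1 s : nat) (p : nat -> nat) (F : R), (2 <= n)%N -> (1 <= N <= n)%N ->
  (log2 (4 * Num.max t0%:R b0) + log2 (4 * Num.max t1%:R b1)) * log2 n%:R <= L1%:R ->
  L1%:R + log2 (4 * Num.max tdec%:R bdec) * log2 n%:R <= L%:R ->
  L%:R <= CL * log2 n%:R ->
  (forall i, (1 <= i <= L)%N -> i != L1 -> N%:R <= Cw * (p i)%:R) ->
  N%:R * log2 n%:R <= Cs * s%:R ->
  (exists g, net_class R din dout dt L L1 p s F g) -> K <= F ->
  exists f B, [/\ net_class R din dout dt L L1 p s F f, 0 <= B,
    forall x, cube x -> forall j, `|f x j ord0 - fdec (g1 (g0 x)) j ord0| <= B &
    B ^+ 2 <= C * (N%:R `^ (- 2 * A) + N%:R / n%:R)].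
Proof.
have [k0 [tk0 k0l l0]] := depth_factor t0_gt0 b0_ge1.
have [k1 [tk1 k1l l1]] := depth_factor t1_gt0 b1_ge1.
have [k2 [tk2 k2l l2]] := depth_factor td_gt0 bdec_ge1.
have [c [Ca [Ca0 NA]]] := network_approximation din_gt0 D_gt0 dt_gt0 b0_ge1 b1_ge1 bdec_ge1 K1
  st0 st1 stdec h0 h1 hdec c0 c1 tk0 tk1 tk2.
(* [Y] is chosen so that c V <= N / (Cw + Cs (CL + 1)): the summand Cw secures the width condition,
   the other one the sparsity budget summed over L + 1 layers. *)
pose Y := 3 * c%:R * (Cw + Cs * (CL + 1)) + 1.
have Y1 : 1 <= Y by rewrite lerDr !mulr_ge0// addr_ge0 ?mulr_ge0 ?addr_ge0// ltW.
have Yp : 0 < Y by exact: lt_le_trans ltr01 Y1.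
have b0p : 0 <= b0 by exact: le_trans ler01 b0_ge1.
have b1p : 0 <= b1 by exact: le_trans ler01 b1_ge1.
have bdp : 0 <= bdec by exact: le_trans ler01 bdec_ge1.
have [N0 [C0 [C00 G0]]] := grid_size t0_gt0 b0p Y1.
have [N1 [C1 [C10 G1]]] := grid_size t1_gt0 b1p Y1.
have [N2 [C2 [C20 G2]]] := grid_size td_gt0 bdp Y1.
(* The value 2^64 ensures log2 n >= 64, as the depth budget requires. *)
pose Nst := Num.max (Num.max N0 N1) (Num.max N2 (2 ^+ 64)).
pose S := C0 + C1 + C2.
have S0 : 0 < S by rewrite !addr_gt0.
pose C := K ^+ 2 * Nst `^ (2 * A) + Ca ^+ 2 * (2 * S ^+ 2) + Ca ^+ 2 * (2 * 9).
have ca0 : 0 <= K ^+ 2 * Nst `^ (2 * A) by rewrite mulr_ge0 ?sqr_ge0 ?powR_ge0.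
have cb0 : 0 <= Ca ^+ 2 * (2 * S ^+ 2).
  by apply: mulr_ge0; [exact: sqr_ge0|apply: mulr_ge0 => //; exact: sqr_ge0].
have cc0 : 0 < Ca ^+ 2 * (2 * 9) by apply: mulr_gt0; [exact: exprn_gt0|rewrite mulr_gt0 ?ltr0n].
exists C; split; first by rewrite /C ltr_wpDl// addr_ge0.
move=> n N L L1 s p F n2 /andP[N_1 Nn] hd1 hd2 hL hw hs [g gcl] KF.
have n0 : (0 < n)%N by exact: ltnW.
have np : 0 < n%:R :> R by rewrite ltr0n.
have Np : 0 < N%:R :> R by rewrite ltr0n.
have PA := powR_ge0 (N%:R : R) (- 2 * A).
have Nn0 : 0 <= N%:R / n%:R :> R by rewrite divr_ge0.
have F0 : 0 <= F by rewrite (le_trans _ KF)// (le_trans ler01).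
have [small|large] := ltP N%:R Nst.
  exists (fun=> 0), K; split => //.
  - exact: net_class0 gcl.
  - exact: le_trans ler01 K1.
  - by move=> x cx j; rewrite mxE sub0r normrN; exact: decoder_bound.
  - apply: (le_trans (small_sample N_1 (ltW small))).
    apply: (@le_trans _ _ (C * N%:R `^ (- 2 * A))).
      apply: ler_wpM2r => //; rewrite /C -addrA lerDl.
      by apply: addr_ge0 => //; exact: ltW.
    by rewrite ler_wpM2l ?lerDl// /C; apply: addr_ge0; [exact: addr_ge0|exact: ltW].
move: large; rewrite !ge_max => /andP[/andP[NN0 NN1] /andP[NN2 N64]].
have lN : 64 <= log2 N%:R :> R.
  by have := ler_log2 (exprn_gt0 64 (ltr0Sn R 1)) N64; rewrite log2_expn.
have lln : 64 <= log2 n%:R :> R by apply: (le_trans lN); apply: ler_log2 => //; rewrite ler_nat.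
have [M0 [M0p M0c M0N M0e]] := G0 N NN0.
have [M1 [M1p M1c M1N M1e]] := G1 N NN1.
have [M2 [M2p M2c M2N M2e]] := G2 N NN2.
set l := log2 n%:R in hd1 hd2 hL hs lln.
have [la [q [la1 la2 q1 q2]]] := depth_parameters lln.
have l1' : 1 <= l by apply: le_trans lln; rewrite ler1n.
have lp : 0 <= l by exact: le_trans l1'.
have Mn (M : nat) : (M <= N)%N -> M%:R <= 256 ^+ la.+1 :> R.
  move=> MN; apply: (@le_trans _ _ n%:R); first by rewrite ler_nat (leq_trans MN).
  rewrite (_ : 256 = 2 ^+ 8); last by ring.
  by rewrite -exprM; apply: le_pow2.
pose V := (M0.+1 ^ t0 + M1.+1 ^ t1 + M2.+1 ^ tdec)%N.
have V3 : V%:R <= 3 * (N%:R / Y) :> R.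
  by rewrite /V !natrD; exact: add3_le.
have cV : (c * V)%:R <= N%:R / (Cw + Cs * (CL + 1)) :> R.
  have X0 : 0 < Cw + Cs * (CL + 1) by rewrite addr_gt0// mulr_gt0// addr_gt0.
  rewrite natrM; apply: (le_trans (ler_wpM2l (ler0n R c) V3)).
  rewrite ler_pdivlMr// (_ : _ * _ * _ = N%:R / Y * (3 * c%:R * (Cw + Cs * (CL + 1)))); last by ring.
  rewrite mulrAC ler_pdivrMr// ler_wpM2l// /Y lerDl//.
have hZ1 : forall i, (1 <= i <= L)%N -> i != L1 -> (c * V <= p i)%N.
  move=> i iL iL1; rewrite -(ler_nat R); apply: (le_trans cV).
  have X0 : 0 < Cw + Cs * (CL + 1) by rewrite addr_gt0// mulr_gt0// addr_gt0.
  rewrite ler_pdivrMr// (le_trans (hw i iL iL1))// mulrC ler_wpM2l// lerDl.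
  by rewrite mulr_ge0 ?(ltW Cs0)// addr_ge0 ?(ltW CL0).
have hZ2 : (L.+1 * (c * V) <= s)%N.
  rewrite -(ler_nat R) natrM -(ler_pM2l Cs0); apply: le_trans hs.
  have X0 : 0 < Cw + Cs * (CL + 1) by rewrite addr_gt0// mulr_gt0// addr_gt0.
  have L1' : L.+1%:R <= (CL + 1) * l.
    by rewrite -(natr1 L) mulrDl mul1r lerD.
  apply: (@le_trans _ _ (Cs * ((CL + 1) * l * (N%:R / (Cw + Cs * (CL + 1)))))).
    by apply: ler_wpM2l; [exact: ltW|apply: ler_pM].
  rewrite (_ : Cs * _ = (N%:R * l) * (Cs * (CL + 1) / (Cw + Cs * (CL + 1)))); last by ring.
  apply: ler_piMr; first by rewrite mulr_ge0.
  by rewrite ler_pdivrMr// mul1r lerDr ltW.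
have dep1 : (2 * la + (k0 + k1) * (q + 5) + 12 <= L1)%N.
  rewrite -(ler_nat R); apply: le_trans hd1; rewrite !(natrD, natrM).
  apply: encoder_depth => //; last by rewrite [leLHS](_ : 4 = 2 + 2); [exact: lerD|ring].
  by rewrite addr_ge0 ?ler0n//= lerD.
have dep2 : (L1 + la + k2 * (q + 5) + 7 <= L)%N.
  rewrite -(ler_nat R); apply: le_trans hd2; rewrite !(natrD, natrM).
  rewrite [leLHS](_ : _ = L1%:R + (la%:R + k2%:R * (q%:R + 5) + 7)); last by ring.
  by rewrite lerD2l decoder_depth// ler0n k2l.
have [e0 [eL [_ [_ [_ [_ [_ [pL1 _]]]]]]]] := gcl.
have [f [fcl fE]] := NA M0 M1 M2 q la L L1 s p F M0p M1p M2p (Mn _ M0N) (Mn _ M1N) (Mn _ M2N)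
  dep1 dep2 hZ1 hZ2 e0 eL pL1 KF.
pose T1 := M0%:R^-1 `^ b0 + M1%:R^-1 `^ b1 + M2%:R^-1 `^ bdec.
pose w : R := V%:R * 4^-1 ^+ q.
have T10 : 0 <= T1 by rewrite !addr_ge0// powR_ge0.
have w0 : 0 <= w by rewrite mulr_ge0// exprn_ge0.
exists f, (Ca * (T1 + w)); split => //; first by rewrite mulr_ge0 ?(ltW Ca0)// addr_ge0.
have N1' : 1 <= N%:R :> R by rewrite ler1n.
have ex (b : R) : A <= b -> N%:R `^ (- b) <= N%:R `^ (- A).
  by move=> Ab; apply: ler_powR => //; rewrite lerN2.
have T1e : T1 <= S * N%:R `^ (- A).
  rewrite /S !mulrDl /T1; apply: lerD; [apply: lerD|].
  - apply: (le_trans M0e); apply: ler_wpM2l; [exact: ltW|apply: ex].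
    by rewrite /A !ge_min lexx orbT.
  - apply: (le_trans M1e); apply: ler_wpM2l; [exact: ltW|apply: ex].
    by rewrite /A !ge_min lexx !orbT.
  - apply: (le_trans M2e); apply: ler_wpM2l; [exact: ltW|apply: ex].
    by rewrite /A !ge_min lexx.
have NA2 : N%:R `^ (- A) ^+ 2 = N%:R `^ (- 2 * A).
  by rewrite -powR_mulrn ?powR_ge0// -powRrM; congr (_ `^ _); ring.
have w2 : w ^+ 2 <= 9 * (N%:R / n%:R).
  rewrite /w exprMn.
  have V9 : V%:R ^+ 2 <= 9 * N%:R ^+ 2 :> R.
    rewrite (_ : 9 * _ = (3 * N%:R) ^+ 2); last by ring.
    rewrite lerXn2r ?nnegrE ?mulr_ge0// (le_trans V3)// ler_wpM2l//.
    by rewrite ler_pdivrMr// ler_peMr.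
  have q4 := quarter_pow_sqr n0 q2.
  apply: (le_trans (ler_pM (sqr_ge0 _) (sqr_ge0 _) V9 q4)).
  rewrite -mulrA ler_wpM2l// ler_pdivrMr ?exprn_gt0//.
  rewrite (_ : N%:R / n%:R * n%:R ^+ 3 = N%:R * n%:R ^+ 2); last by field; rewrite gt_eqF.
  rewrite expr2 ler_wpM2l//.
  have Nn' : N%:R <= n%:R :> R by rewrite ler_nat.
  by rewrite (le_trans Nn')// expr2 ler_peMr// ler1n.
rewrite exprMn.
have H := sqr_rate T10 w0 (ltW S0) T1e w2; rewrite NA2 in H.
apply: (le_trans (ler_wpM2l (sqr_ge0 Ca) H)).
rewrite [leLHS](_ : _ = Ca ^+ 2 * (2 * S ^+ 2) * N%:R `^ (- 2 * A) + Ca ^+ 2 * (2 * 9) * (N%:R / n%:R)); last by ring.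
rewrite [leRHS]mulrDr; apply: lerD; apply: ler_wpM2r => //; rewrite /C.
  by rewrite addrAC lerDr addr_ge0// ltW.
by rewrite lerDr addr_ge0.
Qed.

End Rates.

(** Here P is N^(-2A), y is N / n, i is 1 / n, x is N ln(n)^3 / n, Q is q + r - 1, g is ln #|G| / n,
    bt is the mixing coefficient at q and a2 the squared approximation error. Everything is compared
    with q x + P, using x <= q x and Q <= q r. *)
Lemma risk_assembly (R : realType) (a2 Ca P y i l3 x q a b Q rr r1 g Ce bt Cm c d : R) :
  0 <= Ca -> 0 <= P -> 0 <= l3 -> 0 <= x -> 1 <= q -> 0 <= a -> 0 <= b -> 0 <= Q -> 0 <= rr -> 0 <= r1 ->
  0 <= g -> 0 <= Ce -> 0 <= c -> 0 <= d -> 0 <= Cm -> 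
  a2 <= Ca * (P + y) -> i <= y -> y <= l3 * x -> Q <= q * rr -> g <= Ce * x -> bt <= Cm * (q * x) ->
  24 * a2 + c * i + (a + b * Q) * r1 * g + d * bt <=
  (24 * (Ca * (1 + l3)) + c * l3 + (a + b * rr) * r1 * Ce + d * Cm) * (q * x + P).
Proof.
move=> Ca0 P0 l30 x0 q1 a0 b0 Q0 rr0 r10 g0 Ce0 c0 d0 Cm0 ha hi hy hQ hg hb.
have q0 : 0 <= q by exact: le_trans q1.
set X := q * x in hb *; have xX : x <= X by rewrite /X ler_peMl.
have X0 : 0 <= X by exact: le_trans xX.
have yX : y <= l3 * X by rewrite (le_trans hy)// ler_wpM2l.
rewrite !(mulrDl _ _ (X + P)); apply: lerD; [apply: lerD; [apply: lerD|]|].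
- rewrite -mulrA ler_wpM2l// (le_trans ha)// -mulrA ler_wpM2l// mulrDl mul1r.
  by apply: lerD; [rewrite lerDr|apply: (le_trans yX); rewrite ler_wpM2l ?lerDl].
- rewrite -mulrA ler_wpM2l// (le_trans hi)// (le_trans yX)// ler_wpM2l// lerDl//.
- apply: (@le_trans _ _ ((a + b * rr) * r1 * Ce * X)); last first.
    by rewrite ler_wpM2l ?lerDl// !mulr_ge0// addr_ge0// mulr_ge0.
  have h1 : (a + b * Q) <= (a + b * rr) * q.
    rewrite mulrDl; apply: lerD; first by rewrite ler_peMr.
    by rewrite -mulrA ler_wpM2l// mulrC.
  rewrite (_ : (a + b * rr) * r1 * Ce * X = ((a + b * rr) * q * r1) * (Ce * x)); last by rewrite /X; ring.
  by apply: ler_pM => //; rewrite ?mulr_ge0 ?addr_ge0 ?mulr_ge0// ler_wpM2r.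
- rewrite -mulrA ler_wpM2l// (le_trans hb)// ler_wpM2l// lerDl//.
Qed.

Lemma beta_mix_nonincreasing (R : realType) (dT : measure_display) (T : measurableType dT)
    (P : probability T R) m (X : int -> T -> 'cV[R]_m) k l : (forall i, random_vector (X i)) ->
  (k <= l)%N -> beta_mix P X l <= beta_mix P X k.
Proof.
move=> mX kl; apply: beta_mix_systems_le.
- exact: sigma_of_measurable.
- exact: sigma_of_measurable.
- apply: sub_smallest2r; first exact: smallest_sigma_algebra.
  move=> A [i /= li Ai]; exists i => //=.
  by rewrite (le_trans _ li)// lez_nat.
- exact: smallest_sigma_algebra.
- exact: smallest_sigma_algebra.
Qed.

Theorem theorem3p7
  (R : realType) (dT : measure_display) (T : measurableType dT)
  (P : probability T R)
  (* the model *)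
  (d r : nat) (hd : (0 < d)%N) (hr : (0 < r)%N)
  (f0 : 'cV[R]_(r * d) -> 'cV[R]_d) (X eps : int -> T -> 'cV[R]_d)
  (hmodel : autoregressive P f0 X eps)
  (* the weight function *)
  (Wt : 'cV[R]_(r * d) -> R)
  (hWmeas : measurable_fun [set: borel R (r * d)] (Wt : borel R (r * d) -> R))
  (hW01 : forall x, 0 <= Wt x <= 1)
  (hWsupp : closure [set x | Wt x != 0] `<=` @cube R (r * d))
  (* (a) *)
  (Ceps : R) (hCeps : 0 < Ceps)
  (hnoise : forall (k : nat) (j : 'I_d), (0 < k)%N ->
     (('E_P[fun w => (`|eps 1 w j ord0| ^+ k)%R] `^ (k%:R^-1))
        <= (Ceps * Num.sqrt k%:R)%:E)%E)
  (* (b) *)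
  (dt D tdec tenc0 tenc1 : nat) (bdec benc0 benc1 K : R)
  (hbdec : 1 <= bdec) (hbenc0 : 1 <= benc0) (hbenc1 : 1 <= benc1) (hK : 1 <= K)
  (genc0 : 'cV[R]_(r * d) -> 'cV[R]_D) (genc1 : 'cV[R]_D -> 'cV[R]_dt)
  (fdec : 'cV[R]_dt -> 'cV[R]_d)
  (hencdec : encoder_decoder tdec tenc0 tenc1 f0 genc0 genc1 fdec)
  (hsmooth : encdec_smooth bdec benc0 benc1 K genc0 genc1 fdec)
  (* (c) *)
  (phi : R -> R) (hmix : compatible (beta_mix P X) phi)
  (* the network parameters, depending on n *)
  (N L L1 s : nat -> nat) (p : nat -> nat -> nat) (F : R)
  (hN : forall n, (r < n)%N -> (1 <= N n <= n)%N)
  (hL1 : forall n, (r < n)%N -> (1 <= L1 n <= L n)%N)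
  (hs : forall n, (r < n)%N -> (0 < s n)%N)
  (hp : forall n i, (r < n)%N -> (i <= (L n).+1)%N -> (0 < p n i)%N)
  (hp0 : forall n, (r < n)%N -> p n 0%N = (r * d)%N)
  (hpL : forall n, (r < n)%N -> p n (L n).+1 = d)
  (* (i) *)
  (hF : K <= F)
  (* (ii) *)
  (hdepth1 : forall n, (r < n)%N ->
     (log2 (4 * Num.max tenc0%:R benc0) + log2 (4 * Num.max tenc1%:R benc1))
       * log2 n%:R <= (L1 n)%:R)
  (hdepth2 : forall n, (r < n)%N ->
     (L1 n)%:R + log2 (4 * Num.max tdec%:R bdec) * log2 n%:R <= (L n)%:R)
  (hdepth3 : lesssim r (fun n => (L n)%:R%:E) (fun n => (log2 (n%:R : R))%:E))
  (* (iii) *)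
  (hwidth : lesssim r (fun n => ((N n)%:R : R)%:E)
     (fun n => ereal_inf [set ((p n i)%:R : R)%:E
                         | i in [set i | (1 <= i <= L n)%N && (i != L1 n)]]))
  (* (iv) *)
  (hsparse : asymp r (fun n => (s n)%:R%:E)
                     (fun n => ((N n)%:R * log2 (n%:R : R))%:E))
  (* the estimator, a measurable function of the observations X_1, ..., X_n *)
  (fhat : forall n, n.-tuple (borel R d) -> 'cV[R]_(r * d) -> 'cV[R]_d)
  (hfhat_meas : forall n, (r < n)%N ->
     measurable_fun [set: n.-tuple (borel R d) * borel R (r * d)]
       (fun z => fhat n z.1 z.2 : borel R d))
  (hfhat_min : forall n, (r < n)%N -> forall w : T,
     is_argmin (net_class R (r * d) d dt (L n) (L1 n) (p n) (s n) F)
               (emp_risk Wt n (X^~ w))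
               (fhat n [tuple (X k.+1%:Z w : borel R d) | k < n])) :
  let A := Num.min (bdec / tdec%:R)
             (Num.min (benc0 / tenc0%:R) (benc1 / tenc1%:R)) in
  lesssim r
    (fun n => \int[P]_w
        pred_error P Wt f0 X (fhat n [tuple (X k.+1%:Z w : borel R d) | k < n]))%E
    (fun n => (Lambda_mix phi ((N n)%:R * ln n%:R ^+ 3 / n%:R)
               + (N n)%:R `^ (- 2 * A))%:E).
Proof.
move=> A.
have [mX [_ [_ [_ _]]]] := hmodel.
have [dtd [D0 [te0 [te1 [td [f0E [sp0 [sp1 spd]]]]]]]] := hencdec.
have [[hold0 cb0] [hold1 cb1] holdd] := hsmooth.
have /andP[dt0 _] := dtd; have /andP[te00 _] := te0; have /andP[te10 _] := te1; have /andP[td0 _] := td.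
have din0 : (0 < r * d)%N by rewrite muln_gt0 hr.
have [_ [phi_ge0 [phi0 [phi_cvx [_ [_ [_ [_ [_ [conj_fin bm_sum]]]]]]]]]] := hmix.
have [Cm [Cm0 HLam]] := Lambda_mix_mixing phi_ge0 phi0 phi_cvx conj_fin
  (fun k => beta_mix_systems_ge0 P (@sigma_of_measurable R d dT T X mX _) (@sigma_of_measurable R d dT T X mX _))
  (fun k l kl => beta_mix_nonincreasing P mX kl) bm_sum.
have [Cw Cw0 HCw] := hwidth.
have [[Cs1 Cs10 HCs1] [Cs2 Cs20 HCs2]] := hsparse.
have [CL CL0 HCL] := hdepth3.
have [Ca [Ca0 HCa]] := class_approximation din0 D0 dt0 te00 te10 td0 hbenc0 hbenc1 hbdec hK
  sp0 sp1 spd hold0 hold1 holdd cb0 cb1 Cw0 Cs20 CL0.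
have [Ce [Ce0 HCe]] := @entropy_bound R (r * d + d) Cs1 CL (ltW Cs10) (ltW CL0).
have F1 : 1 <= F by exact: le_trans hF.
have F0 : 0 < F by exact: lt_le_trans ltr01 F1.
have f0K x j : cube x -> `|f0 x j ord0| <= F.
  move=> cx; rewrite f0E /= (le_trans _ hF)//.
  exact: (decoder_bound dt0 hbdec holdd cb0 cb1).
have hWcube x : Wt x != 0 -> cube x by move=> Wx; apply: hWsupp; exact: subset_closure.
(* A point of the sample space is needed to exhibit a member of the network class, namely the
   estimator at that point. *)
have [w0 _] : [set: T] !=set0.
  apply/set0P/negP => /eqP E; have := probability_setT P.
  by rewrite E measure0 => /eqP; rewrite eqe eq_sym oner_eq0.
(* Since ln n >= ln 2, the quantity N / n is at most [l3] times N ln(n)^3 / n. *)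
pose l3 : R := (ln 2 ^+ 3)^-1.
have ln2p := @ln2_gt0 R.
have l30 : 0 < l3 by rewrite invr_gt0 exprn_gt0.
pose B : R := (2 * F) ^+ 2; have B0 : 0 <= B by exact: sqr_ge0.
pose a : R := 512 * Ceps * F * Num.max 1 (48 * Ceps / F).
have a0 : 0 <= a.
  have m0 : 0 <= Num.max 1 (48 * Ceps / F) by rewrite le_max ler01.
  by apply: mulr_ge0 m0; apply: mulr_ge0 (ltW F0); apply: mulr_ge0 (ltW hCeps); exact: ler0n.
pose c : R := 18 + 512 * Ceps.
have c0 : 0 <= c by apply: addr_ge0; [exact: ler0n|apply: mulr_ge0 (ltW hCeps); exact: ler0n].
pose b : R := 4 * B; have b0 : 0 <= b by apply: mulr_ge0 B0; exact: ler0n.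
pose e : R := 8 * B; have e0 : 0 <= e by apply: mulr_ge0 B0; exact: ler0n.
pose Cf := 24 * (Ca * (1 + l3)) + c * l3 + (a + b * r%:R) * r.+1%:R * Ce + e * Cm.
have Cf0 : 0 < Cf.
  apply: ltr_wpDr; first by apply: mulr_ge0 e0 (ltW Cm0).
  apply: ltr_wpDr.
    by apply: mulr_ge0 (ltW Ce0); apply: mulr_ge0 (ler0n _ _); apply: addr_ge0 => //; apply: mulr_ge0 b0 (ler0n _ _).
  apply: ltr_wpDr; first by apply: mulr_ge0 c0 (ltW l30).
  apply: mulr_gt0; first by rewrite ltr0n.
  by apply: mulr_gt0 => //; apply: addr_gt0.
exists Cf => // n rn.
have n2 : (2 <= n)%N by exact: leq_ltn_trans hr rn.
have n0 : (0 < n)%N by exact: ltnW.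
have np : 0 < n%:R :> R by rewrite ltr0n.
have /andP[N1 Nn] := hN n rn.
have Np : 0 < (N n)%:R :> R by rewrite ltr0n.
have lnn : ln 2 <= ln n%:R :> R by rewrite ler_ln ?posrE ?ltr0n// ler_nat.
have lnp : 0 < ln n%:R :> R by exact: lt_le_trans lnn.
pose x : R := (N n)%:R * ln n%:R ^+ 3 / n%:R.
have x0 : 0 < x by rewrite divr_gt0// mulr_gt0// exprn_gt0.
have [q [q0 LamE bq]] := HLam x x0.
pose class := net_class R (r * d) d dt (L n) (L1 n) (p n) (s n) F.
have gcl : exists g, class g by exists (fhat n [tuple (X k.+1%:Z w0 : borel R d) | k < n]); exact: (hfhat_min n rn w0).1.
have sle : (s n)%:R <= Cs1 * ((N n)%:R * log2 n%:R) by have := HCs1 n rn; rewrite -EFinM lee_fin.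
have sge : (N n)%:R * log2 n%:R <= Cs2 * (s n)%:R by have := HCs2 n rn; rewrite -EFinM lee_fin.
have Lle : (L n)%:R <= CL * log2 n%:R by have := HCL n rn; rewrite -EFinM lee_fin.
have wid i : (1 <= i <= L n)%N -> i != L1 n -> (N n)%:R <= Cw * (p n i)%:R.
  move=> iL iL1; rewrite -lee_fin (le_trans (HCw n rn))// EFinM lee_wpmul2l ?lee_fin ?(ltW Cw0)//.
  by apply: ereal_inf_lbound; exists i => //=; rewrite iL.
have [fs [A0 [fscl A00 fsE A0le]]] := HCa n (N n) (L n) (L1 n) (s n) (p n) F n2 (hN n rn)
  (hdepth1 n rn) (hdepth2 n rn) Lle wid sge gcl hF.
(* The pruned width m + 1 must hold [s] hidden nodes as well as the input and output layers. *)
pose m := (s n + (r * d + d))%N.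
have [G [net [G0 Gcard netF netcov]]] := @net_class_cover R (r * d) d dt (L n) (L1 n) (p n) (s n) F n m n0
  (leq_addr _ _) (leqW (leq_trans (leq_addr _ _) (leq_addl _ _)))
  (leqW (leq_trans (leq_addl _ _) (leq_addl _ _))) gcl.
have d01 : 0 <= (n%:R^-1 : R) <= 1 by rewrite invr_ge0 ler0n invf_le1// ler1n.
have star x' : cube x' -> forall j, `|fs x' j ord0 - f0 x' j ord0| <= A0.
  by move=> cx j; rewrite f0E; exact: fsE.
have := @oracle_inequality dT T R P d r hd hr f0 X eps hmodel Wt hWmeas hW01 hWcube Ceps hCeps hnoise F F1 f0K
  n class G net fs (fun w => fhat n [tuple (X k.+1%:Z w : borel R d) | k < n]) n%:R^-1 A0 q rn G0
  (fun f fcl j => net_class_measurable j fcl) (fun f fcl x j => net_class_bound x j fcl) netF d01 netcov fscl A00 star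
  (hfhat_min n rn) q0.
move/le_trans; apply; rewrite -EFinM lee_fin -/x LamE.
have lnG : ln #|G|%:R <= Ce * ((N n)%:R * ln n%:R ^+ 3).
  by rewrite Gcard; apply: (HCe n (N n) (s n) (L n) m) => //; exact: hN n rn.
apply: (@risk_assembly R (A0 ^+ 2) Ca ((N n)%:R `^ (- 2 * A)) ((N n)%:R / n%:R) n%:R^-1 l3 x q%:R a b
   (q + r).-1%:R r%:R r.+1%:R (ln #|G|%:R / n%:R) Ce (beta_mix P X q) Cm c e) => //; try exact: ltW.
- by rewrite ler1n.
- by rewrite divr_ge0// ln_ge0// ler1n.
- by rewrite ler_peMl// ler1n.
- rewrite /l3 ler_pdivlMl ?exprn_gt0// /x [leRHS]mulrAC [leRHS]mulrC ler_wpM2r ?divr_ge0//.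
  by rewrite lerXn2r// nnegrE ltW.
- rewrite -natrM ler_nat; case: (q) q0 => [//|q' _].
  by rewrite addSn /= mulSn addnC leq_add2l leq_pmulr.
- by rewrite /x mulrA ler_wpM2r// invr_ge0.
Qed.
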